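(* Let $p\ge 2$ be an integer, let $\mathbf Z_p=\mathbf Z/p\mathbf Z$, and let $\rho_4\otimes\mathbf Z_p\colon B_4\to GL_3(\mathbf Z_p[t,t^{-1}])$ be the reduced Burau representation of the 4-braid group with coefficients reduced modulo $p$. Then the kernel of $\rho_4\otimes\mathbf Z_p$ contains no non-trivial braid that is periodic or reducible. In particular, if $\rho_4\otimes\mathbf Z_p$ is not faithful, then its kernel is an all pseudo-Anosov normal subgroup of $B_4$.
   Context: The $n$-braid group $B_n$ is the group of mapping classes of the $n$-punctured disk (homeomorphisms fixing the boundary pointwise, up to isotopy). It has the presentation with generators $\sigma_1,\dots,\sigma_{n-1}$ (where $\sigma_i$ is the half twist exchanging the adjacent punctures $i$ and $i+1$) and relations $\sigma_i\sigma_j=\sigma_j\sigma_i$ for $|i-j|\ge 2$ and $\sigma_i\sigma_j\sigma_i=\sigma_j\sigma_i\sigma_j$ for $|i-j|=1$. For $n\ge 3$ its center is infinite cyclic, generated by the Dehn twist along the boundary. A braid is periodic if some nonzero power of it lies in the center of $B_n$. A braid is reducible if it is represented by a homeomorphism of the punctured disk that preserves a nonempty collection of pairwise disjoint essential simple closed curves (a simple closed curve is essential if it encloses at least two and fewer than $n$ punctures). A braid is pseudo-Anosov if it is neither periodic nor reducible (by the Nielsen–Thurston classification it is then represented by a pseudo-Anosov homeomorphism). A subgroup of $B_n$ is all pseudo-Anosov if all of its non-trivial elements are pseudo-Anosov. The reduced Burau representation $\rho_4\colon B_4\to GL_3(\mathbf Z[t,t^{-1}])$ is the homomorphism given by $$\rho_4(\sigma_1)=\begin{pmatrix}-t&0&0\\1&1&0\\0&0&1\end{pmatrix},\quad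 \rho_4(\sigma_2)=\begin{pmatrix}1&t&0\\0&-t&0\\0&1&1\end{pmatrix},\quad \rho_4(\sigma_3)=\begin{pmatrix}1&0&0\\0&1&t\\0&0&-t\end{pmatrix},$$ and $\rho_4\otimes\mathbf Z_p$ is obtained by reducing all coefficients modulo $p$. $B_4$ acts on row vectors from the right: $\mathbf v*\beta=\mathbf v\,\rho(\beta)$. *)

(* Defs.v *)
From HB Require Import structures.
From mathcomp Require Import all_boot all_order all_algebra.
From mathcomp Require Import generic_quotient ring.
From mathcomp Require Import all_classical all_reals all_analysis.

Set Implicit Arguments.
Unset Strict Implicit.
Unset Printing Implicit Defensive.

Import Order.TTheory GRing.Theory Num.Theory.
Import numFieldNormedType.Exports.

Local Open Scope classical_set_scope.
Local Open Scope ring_scope.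
Local Open Scope quotient_scope.

(* The pair (q, k) stands for q * t^-k. *)
Definition laurent_frac (A : comNzRingType) : Type := ({poly A} * nat)%type.
HB.instance Definition _ (A : comNzRingType) := Choice.on (laurent_frac A).

Section Laurent.
Variable A : comNzRingType.
Local Notation frac := (laurent_frac A).
Implicit Types x y z : frac.

Definition laurent_eq x y := x.1 * 'X^(y.2) == y.1 * 'X^(x.2).

Lemma laurent_eq_refl : reflexive laurent_eq.
Proof. by move=> x; rewrite /laurent_eq. Qed.

Lemma laurent_eq_sym : symmetric laurent_eq.
Proof. by move=> x y; rewrite /laurent_eq eq_sym. Qed.

Lemma mulXnI k : injective (fun q : {poly A} => q * 'X^k).
Proof. exact/monic_rreg/monicXn. Qed.

Lemma laurent_eq_trans : transitive laurent_eq.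
Proof.
move=> y x z /eqP xy /eqP yz; apply/eqP; apply: (@mulXnI y.2) => /=.
by rewrite mulrAC xy mulrAC yz mulrAC.
Qed.

Canonical laurent_equiv :=
  EquivRel laurent_eq laurent_eq_refl laurent_eq_sym laurent_eq_trans.

Definition laurent : Type := {eq_quot laurent_eq}.
HB.instance Definition _ : EqQuotient _ laurent_eq laurent :=
  EqQuotient.on laurent.
HB.instance Definition _ := Choice.on laurent.

Lemma laurentP x y :
  reflect (\pi_laurent x = \pi_laurent y) (x.1 * 'X^(y.2) == y.1 * 'X^(x.2)).
Proof. by apply: (iffP idP) => [xy|/eqmodP //]; apply/eqmodP. Qed.

Lemma laurent_repr x :
  (repr (\pi_laurent x)).1 * 'X^(x.2) = x.1 * 'X^((repr (\pi_laurent x)).2).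
Proof. by apply/eqP/laurentP; rewrite reprK. Qed.

Definition laurent_addf x y : frac :=
  (x.1 * 'X^(y.2) + y.1 * 'X^(x.2), (x.2 + y.2)%N).
Definition laurent_oppf x : frac := (- x.1, x.2).
Definition laurent_mulf x y : frac := (x.1 * y.1, (x.2 + y.2)%N).

Definition laurent_add (a b : laurent) : laurent :=
  \pi_laurent (laurent_addf (repr a) (repr b)).
Definition laurent_opp (a : laurent) : laurent := \pi_laurent (laurent_oppf (repr a)).
Definition laurent_mul (a b : laurent) : laurent :=
  \pi_laurent (laurent_mulf (repr a) (repr b)).
Definition laurent_monomial (q : {poly A}) (k : nat) : laurent := \pi_laurent (q, k).

Lemma pi_laurent_add x y :
  laurent_add (\pi x) (\pi y) = \pi_laurent (laurent_addf x y).
Proof.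
apply/laurentP/eqP; have := laurent_repr x; have := laurent_repr y.
case: (repr _) => [q' k'] /=; case: (repr _) => [q k] /= Hy Hx.
rewrite !exprD.
transitivity (q * 'X^(x.2) * ('X^k' * 'X^(y.2)) + q' * 'X^(y.2) * ('X^k * 'X^(x.2))).
  by ring.
by rewrite Hx Hy; ring.
Qed.

Lemma pi_laurent_opp x : laurent_opp (\pi x) = \pi_laurent (laurent_oppf x).
Proof.
by apply/laurentP/eqP; rewrite /= !mulNr laurent_repr.
Qed.

Lemma pi_laurent_mul x y :
  laurent_mul (\pi x) (\pi y) = \pi_laurent (laurent_mulf x y).
Proof.
apply/laurentP/eqP; have := laurent_repr x; have := laurent_repr y.
case: (repr _) => [q' k'] /=; case: (repr _) => [q k] /= Hy Hx.
rewrite !exprD; transitivity ((q * 'X^(x.2)) * (q' * 'X^(y.2))); first by ring.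
by rewrite Hx Hy; ring.
Qed.

Definition laurentE := (pi_laurent_add, pi_laurent_opp, pi_laurent_mul).

Local Notation l0 := (laurent_monomial 0 0).
Local Notation l1 := (laurent_monomial 1 0).

Fact laurent_addA : associative laurent_add.
Proof.
elim/quotW=> x; elim/quotW=> y; elim/quotW=> z; rewrite !laurentE.
by apply/laurentP/eqP; rewrite /= !exprD; ring.
Qed.

Fact laurent_addC : commutative laurent_add.
Proof.
elim/quotW=> x; elim/quotW=> y; rewrite !laurentE.
by apply/laurentP/eqP; rewrite /= !exprD; ring.
Qed.

Fact laurent_add0 : left_id l0 laurent_add.
Proof.
elim/quotW=> x; rewrite /laurent_monomial laurentE.
by apply/laurentP/eqP; rewrite /= !exprD; ring.
Qed.

Fact laurent_addN : left_inverse l0 laurent_opp laurent_add.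
Proof.
elim/quotW=> x; rewrite /laurent_monomial !laurentE.
by apply/laurentP/eqP; rewrite /= !exprD; ring.
Qed.

HB.instance Definition _ := GRing.isZmodule.Build laurent
  laurent_addA laurent_addC laurent_add0 laurent_addN.

Fact laurent_mulA : associative laurent_mul.
Proof.
elim/quotW=> x; elim/quotW=> y; elim/quotW=> z; rewrite !laurentE.
by apply/laurentP/eqP; rewrite /= !exprD; ring.
Qed.

Fact laurent_mulC : commutative laurent_mul.
Proof.
elim/quotW=> x; elim/quotW=> y; rewrite !laurentE.
by apply/laurentP/eqP; rewrite /= !exprD; ring.
Qed.

Fact laurent_mul1 : left_id l1 laurent_mul.
Proof.
elim/quotW=> x; rewrite /laurent_monomial laurentE.
by apply/laurentP/eqP; rewrite /= !exprD; ring.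
Qed.

Fact laurent_mulD : left_distributive laurent_mul laurent_add.
Proof.
elim/quotW=> x; elim/quotW=> y; elim/quotW=> z; rewrite !laurentE.
by apply/laurentP/eqP; rewrite /= !exprD; ring.
Qed.

Fact laurent_1neq0 : l1 != l0.
Proof.
apply/eqP => /laurentP; rewrite /= !expr0 !mulr1; exact/negP/oner_neq0.
Qed.

HB.instance Definition _ := GRing.Zmodule_isComNzRing.Build laurent
  laurent_mulA laurent_mulC laurent_mul1 laurent_mulD laurent_1neq0.

Definition laurent_t : laurent := laurent_monomial 'X 0.
Definition laurent_tV : laurent := laurent_monomial 1 1.

Lemma laurent_tK : laurent_t * laurent_tV = 1.
Proof.
rewrite /GRing.mul /= /laurent_t /laurent_tV /laurent_monomial laurentE.
by apply/laurentP/eqP; rewrite /= expr1; ring.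
Qed.

End Laurent.

Definition laurent_map (A B : comNzRingType) (f : A -> B) (a : laurent A) :
  laurent B := laurent_monomial (map_poly f (repr a).1) (repr a).2.

Lemma laurent_map_monomial (A B : comNzRingType) (f : {rmorphism A -> B}) q k :
  laurent_map f (laurent_monomial q k) = laurent_monomial (map_poly f q) k.
Proof.
apply/laurentP/eqP; have /(congr1 (map_poly f)) := laurent_repr (q, k).
by rewrite !rmorphM /= !map_polyXn.
Qed.

Section LaurentMap.
Variables (A B : comNzRingType) (f : {rmorphism A -> B}).
Let mapE (q : laurent_frac A) : laurent_map f (\pi_(laurent A) q) =
  laurent_monomial (map_poly f q.1) q.2.
Proof. by case: q => q k; exact: laurent_map_monomial. Qed.

Fact laurent_map_is_zmod : zmod_morphism (laurent_map f).
Proof.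
elim/quotW=> x; elim/quotW=> y.
transitivity (laurent_map f (\pi_(laurent A) (laurent_addf x (laurent_oppf y)))).
  by rewrite -pi_laurent_add -pi_laurent_opp.
rewrite (mapE x : laurent_map f (\pi x) = _).
rewrite (mapE y : laurent_map f (\pi y) = _) mapE.
rewrite -[RHS]/(laurent_add _ (laurent_opp _)) /laurent_monomial.
rewrite pi_laurent_opp pi_laurent_add /laurent_addf /=.
rewrite rmorphD 2!rmorphM /= !map_polyXn.
by rewrite rmorphN.
Qed.

Fact laurent_map_is_monoid : monoid_morphism (laurent_map f).
Proof.
split; first by rewrite [1]/(laurent_monomial 1 0) laurent_map_monomial rmorph1.
elim/quotW=> x; elim/quotW=> y.
transitivity (laurent_map f (\pi_(laurent A) (laurent_mulf x y))).
  by rewrite -pi_laurent_mul.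
rewrite (mapE x : laurent_map f (\pi x) = _).
rewrite (mapE y : laurent_map f (\pi y) = _) mapE /= rmorphM.
by rewrite -[RHS]/(laurent_mul _ _) /laurent_monomial !laurentE.
Qed.
HB.instance Definition _ := GRing.isZmodMorphism.Build _ _ _ laurent_map_is_zmod.
HB.instance Definition _ := GRing.isMonoidMorphism.Build _ _ _ laurent_map_is_monoid.
End LaurentMap.

(* The letter (i, b) is sigma_(i+1) if b = false, its inverse if b = true. *)
Definition braid_word (n : nat) : Type := seq ('I_n.-1 * bool).
HB.instance Definition _ n := Choice.on (braid_word n).

Inductive braid_rel n : braid_word n -> braid_word n -> Prop :=
| braid_rel_refl u : braid_rel u u
| braid_rel_sym u v : braid_rel u v -> braid_rel v u
| braid_rel_trans u v w : braid_rel u v -> braid_rel v w -> braid_rel u w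
| braid_rel_cat u u' v v' :
    braid_rel u u' -> braid_rel v v' -> braid_rel (u ++ v) (u' ++ v')
| braid_rel_inv (i : 'I_n.-1) b : braid_rel [:: (i, b); (i, ~~ b)] [::]
| braid_rel_far (i j : 'I_n.-1) : (i.+1 < j)%N ->
    braid_rel [:: (i, false); (j, false)] [:: (j, false); (i, false)]
| braid_rel_adj (i j : 'I_n.-1) : i.+1 = j :> nat ->
    braid_rel [:: (i, false); (j, false); (i, false)]
              [:: (j, false); (i, false); (j, false)].

Section BraidGroup.
Variable n : nat.
Implicit Types u v w : braid_word n.

Definition braid_relb u v := `[< braid_rel u v >].

Lemma braid_relb_refl : reflexive braid_relb.
Proof. by move=> u; apply/asboolP/braid_rel_refl. Qed.

Lemma braid_relb_sym : symmetric braid_relb.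
Proof.
by move=> u v; apply/asboolP/asboolP => uv; apply: braid_rel_sym.
Qed.

Lemma braid_relb_trans : transitive braid_relb.
Proof.
move=> v u w /asboolP uv /asboolP vw; apply/asboolP.
exact: braid_rel_trans uv vw.
Qed.

Canonical braid_equiv :=
  EquivRel braid_relb braid_relb_refl braid_relb_sym braid_relb_trans.

Definition braid : Type := {eq_quot braid_relb}.
HB.instance Definition _ : EqQuotient _ braid_relb braid := EqQuotient.on braid.
HB.instance Definition _ := Choice.on braid.

Lemma braidP u v : \pi_braid u = \pi_braid v <-> braid_rel u v.
Proof. by split=> [/eqmodP/asboolP|uv] //; apply/eqmodP/asboolP. Qed.

Lemma braid_repr u : braid_rel (repr (\pi_braid u)) u.
Proof. by apply/braidP; rewrite reprK. Qed.

Definition inv_word u : braid_word n := rev [seq (l.1, ~~ l.2) | l <- u].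

Lemma inv_word_cat u v : inv_word (u ++ v) = inv_word v ++ inv_word u.
Proof. by rewrite /inv_word map_cat rev_cat. Qed.

Lemma inv_wordK : involutive inv_word.
Proof.
move=> u; rewrite /inv_word map_rev revK -map_comp map_id_in // => -[i b] _.
by rewrite /= negbK.
Qed.

Lemma inv_word_mull u : braid_rel (inv_word u ++ u) [::].
Proof.
elim: u => [|[i b] u IHu]; first exact: braid_rel_refl.
have -> : inv_word ((i, b) :: u) ++ (i, b) :: u =
    inv_word u ++ ([:: (i, ~~ b); (i, b)] ++ u).
  by rewrite /inv_word /= rev_cons cat_rcons.
apply: braid_rel_trans IHu; apply: braid_rel_cat; first exact: braid_rel_refl.
rewrite -[X in braid_rel _ X]cat0s.
apply: braid_rel_cat; last exact: braid_rel_refl.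
by rewrite -{2}[b]negbK; apply: braid_rel_inv.
Qed.

Lemma inv_word_mulr u : braid_rel (u ++ inv_word u) [::].
Proof. by rewrite -{1}[u]inv_wordK; apply: inv_word_mull. Qed.

Definition braid_one : braid := \pi_braid [::].
Definition braid_mul (a b : braid) : braid := \pi_braid (repr a ++ repr b).
Definition braid_inv (a : braid) : braid := \pi_braid (inv_word (repr a)).

Lemma pi_braid_mul u v : braid_mul (\pi u) (\pi v) = \pi_braid (u ++ v).
Proof. by apply/braidP; apply: braid_rel_cat; apply: braid_repr. Qed.

Fact braid_mulA : associative braid_mul.
Proof.
by elim/quotW=> u; elim/quotW=> v; elim/quotW=> w; rewrite !pi_braid_mul catA.
Qed.

Fact braid_mul1 : left_id braid_one braid_mul.
Proof. by elim/quotW=> u; rewrite pi_braid_mul. Qed.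

Fact braid_1mul : right_id braid_one braid_mul.
Proof. by elim/quotW=> u; rewrite pi_braid_mul cats0. Qed.

Fact braid_mulV : left_inverse braid_one braid_inv braid_mul.
Proof.
move=> a; rewrite -{2}[a]reprK pi_braid_mul; apply/braidP.
exact: inv_word_mull.
Qed.

Fact braid_Vmul : right_inverse braid_one braid_inv braid_mul.
Proof.
move=> a; rewrite -{1}[a]reprK pi_braid_mul; apply/braidP.
exact: inv_word_mulr.
Qed.

HB.instance Definition _ := isGroup.Build braid
  braid_mulA braid_mul1 braid_1mul braid_mulV braid_Vmul.

End BraidGroup.

Definition periodic_braid (n : nat) (b : braid n) : Prop :=
  exists2 k : nat, (0 < k)%N & forall c : braid n, commute (b ^+ k)%g c.

Section PuncturedDisk.
Variables (R : realType) (n : nat).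
Local Notation plane := (R * R)%type.

Definition eucl_dist (z w : plane) : R :=
  Num.sqrt ((z.1 - w.1) ^+ 2 + (z.2 - w.2) ^+ 2).

(* The disk has the segment from (0, 0) to (n + 1, 0) as a diameter; its
   punctures are (1, 0), ..., (n, 0). *)
Definition disk_center : plane := (n.+1%:R / 2, 0).
Definition puncture (i : 'I_n) : plane := (i.+1%:R, 0).
Definition disk_boundary : set plane :=
  [set z | eucl_dist z disk_center = n.+1%:R / 2].
Definition punctured_disk : set plane :=
  [set z | eucl_dist z disk_center <= n.+1%:R / 2] `\` range puncture.

Definition disk_homeo (f : plane -> plane) : Prop :=
  [/\ {within punctured_disk, continuous f},
      forall z, disk_boundary z -> f z = z &
      exists g : plane -> plane,
        [/\ {within punctured_disk, continuous g},
            set_fun punctured_disk punctured_disk f,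
            set_fun punctured_disk punctured_disk g,
            {in punctured_disk, cancel f g} &
            {in punctured_disk, cancel g f}]].

Definition isotopic (f g : plane -> plane) : Prop :=
  exists H : R -> plane -> plane,
    [/\ {within [set tz : R * plane | 0 <= tz.1 <= 1 /\ punctured_disk tz.2],
           continuous (fun tz => H tz.1 tz.2)},
        forall t, 0 <= t <= 1 -> disk_homeo (H t),
        {in punctured_disk, H 0 =1 f} &
        {in punctured_disk, H 1 =1 g}].

(* The half twist exchanging the punctures number i+1 and i+2. It is supported
   in the disk of radius 1 about their midpoint, rotates the concentric disk of
   radius 1/2 by pi, clockwise for the letter (i, false), and interpolates the
   angle linearly in between. *)
Definition half_twist (l : 'I_n.-1 * bool) (z : plane) : plane :=
  let c : plane := (l.1%:R + 3 / 2, 0) in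
  let theta := (-1) ^+ (~~ l.2) * pi *
    Num.max 0 (Num.min 1 (2 - 2 * eucl_dist z c)) in
  (c.1 + (z.1 - c.1) * cos theta - (z.2 - c.2) * sin theta,
   c.2 + (z.1 - c.1) * sin theta + (z.2 - c.2) * cos theta).

(* Braids act from the right: the first letter of a word is performed first. *)
Definition word_homeo (w : braid_word n) (z : plane) : plane :=
  foldl (fun x l => half_twist l x) z w.

Definition represents (f : plane -> plane) (b : braid n) : Prop :=
  disk_homeo f /\
  exists2 w : braid_word n, \pi_(braid n) w = b & isotopic (word_homeo w) f.

Definition simple_closed_curve (C : set plane) : Prop :=
  exists g : R -> plane,
    [/\ {within `[0, 1], continuous g}, g 0 = g 1,
        set_inj `[0, 1[ g & C = g @` `[0, 1]].

Definition encloses (C : set plane) (z : plane) : Prop :=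
  bounded_set (connected_component (~` C) z).

Definition essential (C : set plane) : Prop :=
  (1 < #|[set i : 'I_n | `[< encloses C (puncture i) >]]%SET| < n)%N.

Definition reducible_braid (b : braid n) : Prop :=
  exists (f : plane -> plane) (L : set (set plane)),
    [/\ represents f b,
        L !=set0,
        forall C, L C ->
          [/\ C `<=` punctured_disk, simple_closed_curve C & essential C],
        forall C D, L C -> L D -> C <> D -> C `&` D = set0 &
        [set f @` C | C in L] = L].

Definition pseudo_Anosov (b : braid n) : Prop := ~ periodic_braid b /\ ~ reducible_braid b.

Definition all_pseudo_Anosov (H : set (braid n)) : Prop :=
  forall b, H b -> b <> 1%g -> pseudo_Anosov b.

End PuncturedDisk.

Arguments reducible_braid R {n} b.
Arguments pseudo_Anosov R {n} b.
Arguments all_pseudo_Anosov R {n} H.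

Definition normal_subgroup (G : groupType) (H : set G) : Prop :=
  [/\ H 1%g, forall x y, H x -> H y -> H (x * y^-1)%g &
      forall x y, H x -> H (x ^ y)%g].

Section Burau.
Variables (A : comNzRingType) (t tV : A).

Definition mx3 (s : seq (seq A)) : 'M[A]_3 := \matrix_(i, j) nth 0 (nth [::] s i) j.

Definition burau4_letter (l : 'I_4.-1 * bool) : 'M[A]_3 :=
  match nat_of_ord l.1, l.2 with
  | 0%N, false => mx3 [:: [:: - t; 0; 0]; [:: 1; 1; 0]; [:: 0; 0; 1]]
  | 1%N, false => mx3 [:: [:: 1; t; 0]; [:: 0; - t; 0]; [:: 0; 1; 1]]
  | _, false => mx3 [:: [:: 1; 0; 0]; [:: 0; 1; t]; [:: 0; 0; - t]]
  | 0%N, true => mx3 [:: [:: - tV; 0; 0]; [:: tV; 1; 0]; [:: 0; 0; 1]]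
  | 1%N, true => mx3 [:: [:: 1; 1; 0]; [:: 0; - tV; 0]; [:: 0; tV; 1]]
  | _, true => mx3 [:: [:: 1; 0; 0]; [:: 0; 1; 1]; [:: 0; 0; - tV]]
  end.

Definition burau4_word (w : braid_word 4) : 'M[A]_3 :=
  foldr (fun l M => burau4_letter l *m M) 1%:M w.

Lemma burau4_word_cat u v :
  burau4_word (u ++ v) = burau4_word u *m burau4_word v.
Proof. by elim: u => [|l u IHu] /=; rewrite ?mul1mx // IHu mulmxA. Qed.

Hypothesis tK : t * tV = 1.

Lemma burau4_word_rel u v : braid_rel u v -> burau4_word u = burau4_word v.
Proof.
elim=> {u v} //=.
- by move=> u v w _ -> _ ->.
- by move=> u u' v v' _ IHu _ IHv; rewrite !burau4_word_cat IHu IHv.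
- have tVK : tV * t = 1 by rewrite mulrC.
  move=> [[|[|[|//]]] Hi] []; rewrite mulmx1; apply/matrixP;
    move=> [[|[|[|//]]] H1] [[|[|[|//]]] H2];
    rewrite !mxE !big_ord_recl !big_ord0 !mxE /=;
    rewrite ?(mulr0, mul0r, mul1r, mulr1, addr0, add0r, mulrN, mulNr, opprK);
    by rewrite ?(tK, tVK, subrr, addNr).
- move=> [[|[|[|//]]] Hi] [[|[|[|//]]] Hj] //= _; rewrite !mulmx1;
    apply/matrixP; move=> [[|[|[|//]]] H1] [[|[|[|//]]] H2];
    rewrite !mxE !big_ord_recl !big_ord0 !mxE /=; ring.
- move=> [[|[|[|//]]] Hi] [[|[|[|//]]] Hj] //= _; rewrite !mulmx1;
    apply/matrixP; move=> [[|[|[|//]]] H1] [[|[|[|//]]] H2];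
    do 2! rewrite !mxE !big_ord_recl !big_ord0 /=; rewrite !mxE /=; ring.
Qed.

End Burau.

Definition burau4 (b : braid 4) : 'M[laurent int]_3 :=
  burau4_word (laurent_t int) (laurent_tV int) (repr b).

Lemma burau4_pi (w : braid_word 4) :
  burau4 (\pi w) = burau4_word (laurent_t int) (laurent_tV int) w.
Proof. exact/burau4_word_rel/braid_repr/laurent_tK. Qed.

Lemma burau4_1 : burau4 1%g = 1%:M.
Proof. exact: burau4_pi. Qed.

Lemma burau4M (a b : braid 4) : burau4 (a * b)%g = burau4 a *m burau4 b.
Proof.
by rewrite -[a]reprK -[b]reprK [(_ * _)%g]pi_braid_mul !burau4_pi
  burau4_word_cat.
Qed.

Definition burau4_mod (p : nat) (b : braid 4) : 'M[laurent 'Z_p]_3 :=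
  map_mx (laurent_map (fun m : int => m%:~R : 'Z_p)) (burau4 b).

Local Notation phi p := (laurent_map (fun m : int => m%:~R : 'Z_p)).

Lemma burau4_mod_pi p (w : braid_word 4) :
  burau4_mod p (\pi w) = burau4_word (laurent_t 'Z_p) (laurent_tV 'Z_p) w.
Proof.
rewrite /burau4_mod burau4_pi; elim: w => [|l w IHw] /=; first exact: map_mx1.
rewrite map_mxM IHw; congr (_ *m _).
have Et : phi p (laurent_t int) = laurent_t 'Z_p.
  by rewrite laurent_map_monomial map_polyX.
have EtV : phi p (laurent_tV int) = laurent_tV 'Z_p.
  by rewrite laurent_map_monomial rmorph1.
have mN x : phi p (- x) = - phi p x.
  exact: (rmorphN (laurent_map (intmul (1 : 'Z_p)))).
have m0 : phi p 0 = 0.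
  exact: (rmorph0 (laurent_map (intmul (1 : 'Z_p)))).
have m1 : phi p 1 = 1.
  exact: (rmorph1 (laurent_map (intmul (1 : 'Z_p)))).
case: l => [[[|[|[|//]]] Hi] []]; apply/matrixP;
  move=> [[|[|[|//]]] H1] [[|[|[|//]]] H2]; rewrite !mxE /=;
  by rewrite ?mN ?Et ?EtV ?m0 ?m1.
Qed.

Lemma burau4_modM p (a b : braid 4) :
  burau4_mod p (a * b)%g = burau4_mod p a *m burau4_mod p b.
Proof.
by rewrite -[a]reprK -[b]reprK [(_ * _)%g]pi_braid_mul !burau4_mod_pi
  burau4_word_cat.
Qed.

Definition burau4_mod_ker (p : nat) : set (braid 4) :=
  [set b | burau4_mod p b = 1%:M].

(* Main.v *)
Require Import Defs.
From HB Require Import structures.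
From mathcomp Require Import all_boot all_order all_algebra.
From mathcomp Require Import generic_quotient zify ring lra.

(** A braid acts on the free group on four letters, the fundamental group of the punctured disk.
Periodic braids of the kernel are excluded algebraically.  For a reducible braid, the holonomy
of a reduction curve in the free group is conjugate, by Hurwitz transitivity, to the image
under a braid of the product of the first two or three letters.  A braid of the kernel is pure,
so it maps the class of the curve to a conjugate of a power of itself: either the image of the
curve is the curve, or it is disjoint from it and encloses the same punctures.  After conjugation
the braid preserves a standard curve up to conjugacy, hence lies in an explicit subgroup, on
which the Burau representation modulo [p] is faithful by a ping-pong argument.

On the topological side, a loop is rounded to a simple closed walk on a brick lattice, whose
crossings with the axis form a meander; cutting a meander along a chord computes its holonomy
as a product of conjugates of distinct letters, and compares two disjoint meanders.  The
letters that occur are the enclosed punctures: a curve that does not wind around a point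
carries a continuous angle function, which Tietze's theorem extends to the plane. *)

Set Implicit Arguments.
Unset Strict Implicit.
Unset Printing Implicit Defensive.

Import Order.TTheory GRing.Theory Num.Theory.

(** * Free groups *)

(** A reduction curve is never straightened by a homeomorphism of the disk. Only two invariants are
    extracted from it: the conjugacy class of its holonomy and the set of punctures it encloses.
    When the image of the curve is the curve itself, one only sees that the class goes to that of
    some power; the exponent is fixed afterwards by killing all letters but one, because a pure
    braid preserves exponent sums. Membership of a braid in an explicit subgroup is deduced from its
    action on the free group, so Artin's action must be faithful. This is obtained by combing off
    the fourth strand, which leaves a free group, and by applying the Burau matrices to the three
    remaining strands. The ping-pong compares degrees and leading coefficients, and it multiplies
    only by monic polynomials. It therefore ignores both the characteristic and the zero divisors of
    ['Z_p], and works uniformly in [p]. Kernel braids are pure because at t = 1 the Burau matrices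
    come from the permutation of the strands. *)

Module FreeGroup.
Local Open Scope group_scope.

(** Generators are indexed by all natural numbers, so that a single group serves every number of
    strands; a braid on n strands fixes the letters of index at least n. *)
Definition fg_letter : Type := (nat * bool)%type.
HB.instance Definition _ := Choice.on fg_letter.

Definition linv (l : fg_letter) : fg_letter := (l.1, ~~ l.2).

Lemma linvK : involutive linv.
Proof. by case=> i b; rewrite /linv /= negbK. Qed.

Lemma linv_neq l : linv l != l.
Proof. by case: l => i []; rewrite /linv /= xpair_eqE eqxx. Qed.

Definition fgred : pred (seq fg_letter) := sorted (fun a b => b != linv a).

Arguments fgred : simpl never.

Definition push (l : fg_letter) (w : seq fg_letter) : seq fg_letter :=
  if w is a :: w' then if a == linv l then w' else l :: w else [:: l].

Definition fmul (u v : seq fg_letter) := foldr push v u.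
Definition finv (u : seq fg_letter) := rev (map linv u).

Lemma fgred_cons l w : fgred (l :: w) -> fgred w.
Proof. exact: path_sorted. Qed.

Lemma push_reduced l w : fgred w -> fgred (push l w).
Proof.
case: w => [|a w] //=; case: eqP => [_|/eqP al]; first exact: fgred_cons.
by rewrite /fgred /= al.
Qed.

Lemma pushK l w : fgred w -> push (linv l) (push l w) = w.
Proof.
case: w => [|a w] /=; first by rewrite linvK eqxx.
case: eqP => [->|_] /=; last by rewrite linvK eqxx.
by rewrite /fgred; case: w => [|b w] //= /andP[/negPf ->].
Qed.

Lemma pushVK l w : fgred w -> push l (push (linv l) w) = w.
Proof. by move=> rw; rewrite -{1}(linvK l) pushK. Qed.

Lemma fmul_reduced u v : fgred v -> fgred (fmul u v).
Proof. by move=> rv; elim: u => //= l u; apply: push_reduced. Qed.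

Lemma fmul_push l w v : fgred v -> fmul (push l w) v = push l (fmul w v).
Proof.
case: w => [|a w] //= rv; case: eqP => [->|_] //=.
by rewrite pushVK // fmul_reduced.
Qed.

Lemma fmulA u v w : fgred w -> fmul u (fmul v w) = fmul (fmul u v) w.
Proof. by move=> rw; elim: u => //= l u IHu; rewrite fmul_push // IHu. Qed.

Lemma fmul_cat u v w : fmul (u ++ v) w = fmul u (fmul v w).
Proof. by rewrite /fmul foldr_cat. Qed.

Lemma fmul_reducedE u v : fgred (u ++ v) -> fmul u v = u ++ v.
Proof.
elim: u => [|l u IHu]; first by [].
move=> ruv; rewrite /= IHu; last exact: fgred_cons ruv.
by move: ruv; rewrite /fgred /=; case: (u ++ v) => [|a s] //= /andP[/negPf ->].
Qed.

Lemma finvK : involutive finv.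
Proof.
by move=> u; rewrite /finv map_rev revK -map_comp map_id_in // => l _ /=;
   rewrite linvK.
Qed.

Lemma finv_reduced u : fgred u -> fgred (finv u).
Proof.
rewrite /fgred /finv => ru; rewrite rev_sorted sorted_map.
apply: sub_sorted ru => a b /=; rewrite linvK => ba.
by apply: contra ba => /eqP ->.
Qed.

Lemma fmulV_cat u w : fgred w -> fmul (finv u) (fmul u w) = w.
Proof.
elim: u w => //= l u IHu w rw; rewrite /finv /= rev_cons -cats1 fmul_cat /=.
by rewrite pushK ?fmul_reduced // -/(finv u) IHu.
Qed.

Record fg := Fg {fgval :> seq fg_letter; _ : fgred fgval}.
HB.instance Definition _ := [isSub for fgval].
HB.instance Definition _ := [Choice of fg by <:].

Implicit Types g h : fg.
Lemma fgP g : fgred g. Proof. by case: g. Qed.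
#[export] Hint Resolve fgP : core.

HB.lock Definition fg_mul g h : fg := Fg (fmul_reduced g (fgP h)).
Definition fg_one : fg := @Fg [::] isT.
HB.lock Definition fg_inv g : fg := Fg (finv_reduced (fgP g)).

Lemma fgval_mul g h : fgval (fg_mul g h) = fmul g h.
Proof. by rewrite unlock. Qed.
Lemma fgval_inv g : fgval (fg_inv g) = finv g.
Proof. by rewrite unlock. Qed.

Lemma fmulw1 (w : seq fg_letter) : fgred w -> fmul w [::] = w.
Proof. by move=> rw; rewrite fmul_reducedE ?cats0. Qed.

Fact fg_mulA : associative fg_mul.
Proof. by move=> u v w; apply: val_inj; rewrite /= !fgval_mul fmulA. Qed.
Fact fg_mul1 : left_id fg_one fg_mul.
Proof. by move=> u; apply: val_inj; rewrite /= fgval_mul. Qed.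
Fact fg_1mul : right_id fg_one fg_mul.
Proof. by move=> u; apply: val_inj; rewrite /= fgval_mul fmulw1. Qed.
Fact fg_mulV : left_inverse fg_one fg_inv fg_mul.
Proof.
move=> u; apply: val_inj; rewrite /= fgval_mul fgval_inv -{2}(fmulw1 (fgP u)).
exact: fmulV_cat.
Qed.
Fact fg_Vmul : right_inverse fg_one fg_inv fg_mul.
Proof.
move=> u; rewrite -{1}[u](_ : fg_inv (fg_inv u) = u) ?fg_mulV //.
by apply: val_inj; rewrite /= !fgval_inv finvK.
Qed.
HB.instance Definition _ := isGroup.Build fg fg_mulA fg_mul1 fg_1mul fg_mulV fg_Vmul.

Lemma fg_mulE g h : fgval (g * h) = fmul g h. Proof. exact: fgval_mul. Qed.
Lemma fg_invE g : fgval g^-1 = finv g. Proof. exact: fgval_inv. Qed.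
Lemma fg_oneE : fgval 1 = [::]. Proof. by []. Qed.

Definition Fl (l : fg_letter) : fg := @Fg [:: l] isT.
Definition gen i : fg := Fl (i, false).

Lemma FlV l : (Fl l)^-1 = Fl (linv l).
Proof. by apply: val_inj; rewrite /= fg_invE. Qed.

Lemma FlE i b : Fl (i, b) = if b then (gen i)^-1 else gen i.
Proof. by case: b => //; rewrite /gen FlV. Qed.

Lemma Fg_cons l w (rw : fgred (l :: w)) :
  Fg rw = Fl l * Fg (fgred_cons rw).
Proof.
apply: val_inj; rewrite /= fg_mulE /=; move: rw; rewrite /fgred /=; case: w => [|a s] /= rw; first by [].
by case/andP: rw => /negPf ->.
Qed.

Lemma fg_ind (P : fg -> Prop) : P 1 ->
  (forall i g, P g -> P (gen i * g)) -> (forall i g, P g -> P ((gen i)^-1 * g)) ->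
  forall g, P g.
Proof.
move=> P1 PM PV [w rw]; elim: w rw => [|[i b] w IHw] rw.
  by have -> : Fg rw = 1 by exact: val_inj.
by rewrite Fg_cons FlE; case: b rw => rw; [apply: PV | apply: PM]; apply: IHw.
Qed.

Section Morph.
Variables (G H : groupType) (h : G -> H).
Hypothesis hM : {morph h : x y / x * y}.
Lemma morph_mul1 : h 1 = 1.
Proof. by apply: (mulIg (h 1)); rewrite -hM !mul1g. Qed.
Lemma morph_mulV x : h x^-1 = (h x)^-1.
Proof. by apply: (mulIg (h x)); rewrite -hM !mulVg morph_mul1. Qed.
Lemma morph_mulJ x y : h (x ^ y) = h x ^ h y.
Proof. by rewrite !conjgE !hM morph_mulV. Qed.
End Morph.

Section Lift.
Variables (G : groupType) (f : nat -> G).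

Definition letter_val (l : fg_letter) := if l.2 then (f l.1)^-1 else f l.1.
Definition word_val (w : seq fg_letter) := foldr (fun l x => letter_val l * x) 1 w.
Definition fgext (g : fg) : G := word_val g.

Lemma letter_valV l : letter_val (linv l) = (letter_val l)^-1.
Proof. by case: l => i []; rewrite /letter_val /= ?invgK. Qed.

Lemma word_val_push l w : word_val (push l w) = letter_val l * word_val w.
Proof.
case: w => [|a w] //=; case: eqP => [->|//].
by rewrite letter_valV mulVKg.
Qed.

Lemma word_val_fmul u v : word_val (fmul u v) = word_val u * word_val v.
Proof. by elim: u => [|l u IHu] /=; rewrite ?mul1g // word_val_push IHu mulgA. Qed.

Lemma word_val_cat u v : word_val (u ++ v) = word_val u * word_val v.
Proof. by elim: u => [|l u IHu] /=; rewrite ?mul1g // IHu mulgA. Qed.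

Lemma fgext1 : fgext 1 = 1. Proof. by []. Qed.
Lemma fgextM x y : fgext (x * y) = fgext x * fgext y.
Proof. by rewrite /fgext fg_mulE word_val_fmul. Qed.
Lemma fgextV x : fgext x^-1 = (fgext x)^-1.
Proof. by apply: (mulIg (fgext x)); rewrite -fgextM !mulVg. Qed.
Lemma fgextX i : fgext (gen i) = f i.
Proof. by rewrite /fgext /= mulg1. Qed.
Lemma fgextXn n x : fgext (x ^+ n) = fgext x ^+ n.
Proof. by elim: n => // n IHn; rewrite !expgS fgextM IHn. Qed.
End Lift.
Arguments fgext {G} f g.

Lemma fgext_unique (G : groupType) (h : fg -> G) :
  {morph h : x y / x * y} -> h =1 fgext (fun i => h (gen i)).
Proof.
move=> hM.
by elim/fg_ind => [|i g IH|i g IH]; rewrite ?(morph_mul1 hM) // hM ?(morph_mulV hM) IH fgextM ?fgextV fgextX.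
Qed.

Lemma eq_fgext (G : groupType) (f f' : nat -> G) : f =1 f' -> fgext f =1 fgext f'.
Proof.
by move=> E; elim/fg_ind=> [|i g IH|i g IH] //; rewrite !fgextM ?fgextV !fgextX E IH.
Qed.

Lemma fgext_comp (G H : groupType) (f : nat -> G) (h : G -> H) :
  {morph h : x y / x * y} -> forall g, h (fgext f g) = fgext (h \o f) g.
Proof.
move=> hM g; rewrite -[h _]/((h \o fgext f) g) (@fgext_unique _ (h \o fgext f)); last first.
  by move=> x y /=; rewrite fgextM hM.
by apply: eq_fgext => i /=; rewrite fgextX.
Qed.

Lemma fgext_id g : fgext gen g = g.
Proof. by rewrite -(@fgext_unique _ id). Qed.

Lemma size_push l w : (size (push l w) <= (size w).+1)%N.
Proof. by case: w => [|a w] //=; case: ifP => // _; rewrite /= -addn2 leq_addr. Qed.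
End FreeGroup.
Import FreeGroup.

(** * The Hurwitz action *)

Module Hurwitz.
Local Open Scope group_scope.

Lemma fgred_cat u v : fgred (u ++ v) = 
  [&& fgred u, fgred v & [|| u == [::], v == [::] | head (0%N, true) v != linv (last (0%N, true) u)]].
Proof.
case: u => [|a u] /=; first by rewrite andbT.
rewrite /fgred /= cat_path; case: v => [|b v] //=; rewrite ?andbT //.
by congr andb; rewrite andbC.
Qed.

Lemma fg_mul_size (g h : fg) : (size (fgval (g * h)%g) <= size g + size h)%N.
Proof.
rewrite fg_mulE; elim: (fgval g) => //= l u IHu.
exact: leq_trans (size_push _ _) _.
Qed.

Lemma fg_mul_cat (g h : fg) : fgred (g ++ h) -> fgval (g * h) = g ++ h.
Proof. by move=> r; rewrite fg_mulE fmul_reducedE. Qed.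

Lemma fg_eq1 (g : fg) : size g = 0%N -> g = 1.
Proof. by move/size0nil => g0; apply: val_inj. Qed.

Lemma fg_cons_val (g : fg) l w : fgval g = l :: w ->
  exists2 h : fg, g = Fl l * h & fgval h = w.
Proof.
case: g => u ru /= uE; subst u; exists (Fg (fgred_cons ru)) => //.
exact: Fg_cons.
Qed.

Lemma fg_rcons_val (g : fg) l w : fgval g = rcons w l ->
  exists2 h : fg, g = h * Fl l & fgval h = w.
Proof.
move=> gE; have : fgval g^-1 = linv l :: finv w.
  by rewrite fg_invE gE /finv map_rcons rev_rcons.
case/fg_cons_val => h gVE hE; exists h^-1; last by rewrite fg_invE hE finvK.
by rewrite -[g]invgK gVE invgM FlV linvK.
Qed.

Lemma Fl_cons (l : fg_letter) (g : fg) :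
  fgred (l :: g) -> fgval (Fl l * g) = l :: g.
Proof. by move=> r; apply: (@fg_mul_cat (Fl l) g). Qed.

(** Let x be [gen i]. If the first letter of g is x or its inverse, it is stripped off and induction
    applies. Otherwise x g is reduced and starts with x, whereas g x is either shorter or still
    starts with the first letter of g. *)
Lemma commute_Fl (i : nat) (g : fg) : commute g (gen i) ->
  exists n : nat, g = gen i ^+ n \/ g = gen i ^- n.
Proof.
have [n] := ubnP (size g); elim: n g => // n IHn g; rewrite ltnS => sg cg.
case gE: (fgval g) => [|[j b] w].
  by exists 0; left; apply: val_inj.
have [jE|ji] := eqVneq j i.
  subst j; have [h hE hw] := fg_cons_val gE; rewrite FlE in hE.
  have ch : commute h (gen i).
    have -> : h = (if b then gen i else (gen i)^-1) * g.
      by rewrite hE; case: b {gE hE}; rewrite ?mulKg ?mulVKg.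
    apply: commute_sym; apply: commuteM; last exact: commute_sym.
    by case: b {gE hE} => //; apply: commuteV.
  have [|m hm] := IHn h _ ch; first by move: sg; rewrite gE hw.
  case: b gE hE => gE hE; case: hm => hm.
  - case: m hm => [|m] hm; first by exists 1%N; right; rewrite hE hm expg0 mulg1 expg1.
    by exists m; left; rewrite hE hm expgS mulKg.
  - by exists m.+1; right; rewrite hE hm expgSr invgM.
  - by exists m.+1; left; rewrite hE hm expgS.
  - case: m hm => [|m] hm; first by exists 1%N; left; rewrite hE hm expg0 invg1 mulg1 expg1.
    by exists m; right; rewrite hE hm expgSr invgM mulVKg.
have r1 : fgred ((i, false) :: fgval g).
  have := fgP g; rewrite gE /fgred /= => ->; rewrite andbT.
  by rewrite /linv xpair_eqE (negPf ji).
have := congr1 fgval cg; rewrite [RHS](Fl_cons r1) => E.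
have [u [l gE']] : exists u l, fgval g = rcons u l.
  by rewrite gE lastI; eexists; eexists.
have [h hE hw] := fg_rcons_val gE'.
have [lE|li] := eqVneq l (i, true).
  have sz := congr1 size gE'; rewrite size_rcons -hw in sz.
  have gh : g * gen i = h by rewrite hE lE FlE mulgVK.
  by move/(congr1 size): E; rewrite gh /=; lia.
have r2 : fgred (fgval g ++ gen i).
  rewrite fgred_cat fgP /= {2}gE' last_rcons; apply/orP; right.
  rewrite /fgred /=; apply: contra li => /eqP; case: l {gE' hE} => [k c] [-> /=].
  by case: c.
rewrite (fg_mul_cat r2) gE /= in E; case: E => [ij _ _].
by rewrite ij eqxx in ji.
Qed.

Lemma fg_expr_red (g : fg) n : fgred (fgval g ++ fgval g) ->
  size (fgval (g ^+ n)) = (n * size g)%N /\ (0 < n -> exists v, fgval (g ^+ n) = fgval g ++ v)%N.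
Proof.
move=> rgg; have [->|g0] : g = 1 \/ (g <> 1) by case: (eqVneq g 1) => [|/eqP]; [left|right].
  by rewrite expg1n muln0; split=> // _; exists [::].
elim: n => [|n [IHs IHv]]; first by [].
have E : fgval (g ^+ n.+1) = fgval g ++ fgval (g ^+ n).
  rewrite expgS fg_mul_cat //; case: n IHs IHv => [|n] IHs IHv.
    by rewrite /= cats0 fgP.
  have [v vE] := IHv isT; rewrite vE.
  have : fgred (g ^+ n.+1) by []; rewrite vE.
  move: rgg; rewrite !fgred_cat fgP /= => c1 /andP[rv c2]; rewrite rv c2 /=.
  by move: c1; case: (fgval g).
split=> [|_]; last by exists (fgval (g ^+ n)).
by rewrite E size_cat IHs mulSn.
Qed.

(** The powers of a cyclically reduced word grow in length, and any other word is conjugate to a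
    shorter one. *)
Lemma fg_torsion_free (g : fg) n : (0 < n)%N -> g ^+ n = 1 -> g = 1.
Proof.
move=> n0; have [m] := ubnP (size g); elim: m g => // m IHm g; rewrite ltnS => sg gn.
have [rgg|] := boolP (fgred (fgval g ++ fgval g)).
  have [E _] := fg_expr_red n rgg; rewrite gn /= in E.
  by apply: fg_eq1; move/esym/eqP: E; rewrite muln_eq0 => /orP[/eqP n00|/eqP //]; rewrite n00 in n0.
rewrite fgred_cat fgP /=; case gE: (fgval g) => [|l w] //=; rewrite ?orbF negbK => /eqP lE.
have [h hE hw] := fg_cons_val gE.
case/lastP: w gE hw lE => [|w l'] gE hw lE.
  by move/eqP: lE; rewrite /= eq_sym (negPf (linv_neq l)).
rewrite last_rcons in lE; have [k kE kw] := fg_rcons_val hw.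
have gk : g = k ^ (Fl l)^-1 by rewrite hE kE lE conjgE invgK FlV linvK mulgA.
have k1 : k = 1.
  apply: IHm; first by move: sg; rewrite gE kw /= size_rcons; lia.
  by apply/eqP; rewrite -(conjg_eq1 _ (Fl l)^-1) conjXg -gk gn.
by rewrite gk k1 conj1g.
Qed.

(** The endomorphism that fixes [gen j] and kills the other letters sends g to 1, as g is a power of
    [gen i], and to g, as g is a power of [gen j]. *)
Lemma commute_gen2 (i j : nat) (g : fg) : i != j ->
  commute g (gen i) -> commute g (gen j) -> g = 1.
Proof.
move=> ij /commute_Fl[n gi] /commute_Fl[m gj].
pose f k : fg := if k == j then gen j else 1.
have f1 : fgext f g = 1.
  by case: gi => ->; rewrite ?liftV ?fgextV fgextXn fgextX /f (negPf ij) expg1n ?invg1.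
have f2 : fgext f g = g.
  by case: gj => ->; rewrite ?fgextV fgextXn fgextX /f eqxx.
by rewrite -f2 f1.
Qed.

Section Hurwitz.
Variable G : groupType.
Implicit Types (y : nat -> G) (l : nat * bool) (w : seq (nat * bool)).

(** The elementary Hurwitz moves. Both directions preserve the product of the two entries
    concerned. *)
Definition mv l y : nat -> G := fun j =>
  if l.2 then if j == l.1 then y l.1 * y l.1.+1 * (y l.1)^-1
              else if j == l.1.+1 then y l.1 else y j
  else if j == l.1 then y l.1.+1
       else if j == l.1.+1 then (y l.1.+1)^-1 * y l.1 * y l.1.+1 else y j.

Definition hact w y := foldr mv y w.

Lemma eq_mv l y y' : y =1 y' -> mv l y =1 mv l y'.
Proof. by move=> E j; rewrite /mv !E. Qed.

Lemma eq_hact w y y' : y =1 y' -> hact w y =1 hact w y'.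
Proof. by move=> E; elim: w => //= l w IHw; apply: eq_mv. Qed.

Lemma hact_cat u v y : hact (u ++ v) y = hact u (hact v y).
Proof. by rewrite /hact foldr_cat. Qed.

Lemma mvK i b y : mv (i, b) (mv (i, ~~ b) y) =1 y.
Proof.
move=> j; rewrite /mv /=; case: b => /=; rewrite !eqxx;
  have -> : (i.+1 == i) = false by lia.
  by case: eqP => [->|_]; [|case: eqP => [->|//]]; rewrite ?mulgA ?mulgV ?mul1g ?mulgK ?mulVKg.
case: eqP => [->|_] //; case: eqP => [->|//].
by rewrite !mulgA mulVg mul1g mulgVK.
Qed.

End Hurwitz.

Lemma hact_morph (G H : groupType) (h : G -> H) w (y : nat -> G) :
  {morph h : x y / x * y} -> h \o hact w y =1 hact w (h \o y).
Proof.
move=> hM; elim: w => //= l w IHw j; rewrite /= /mv.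
by case: l.2; do 2?case: eqP => //= _; rewrite ?hM ?(morph_mulV hM) -?IHw.
Qed.

Lemma mv_nth (G : groupType) (s1 s2 : seq G) a b c :
  mv (size s1, c) (nth 1 (s1 ++ a :: b :: s2)) =1
  nth 1 (s1 ++ (if c then [:: a * b * a^-1, a & s2] else [:: b, b^-1 * a * b & s2])).
Proof.
move=> j; rewrite /mv /= !nth_cat ltnn subnn ltnNge leqW //= subSn // subnn /=.
case: (ltngtP j (size s1)) => [js|js|->]; rewrite ?subnn /=.
- by case: c; rewrite ?(ltn_eqF js) ?ltn_eqF //; lia.
- case: (eqVneq j (size s1).+1) => [->|jS].
    by rewrite subSn // subnn; case: c.
  have [k ->] : exists k, j = ((size s1) + k.+2)%N by exists (j - size s1 - 2)%N; lia.
  by rewrite addKn /=; case: c.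
- by case: c.
Qed.

Definition cval (p : fg * nat) : fg := p.1 * gen p.2 * p.1^-1.

(** The conjugator does not end with the letter it conjugates, so that conjugator, letter and
    inverse conjugator form a reduced word as they stand. *)
Definition cmin (p : fg * nat) :=
  (fgval p.1 == [::]) || ((last (0%N, true) (fgval p.1)).1 != p.2).

Lemma cmin_red p b : cmin p -> fgred (fgval p.1 ++ [:: (p.2, b)]).
Proof.
case: p => g a; rewrite /cmin /= fgred_cat fgP /= => /orP[->//|ne].
apply/orP; right; apply: contra ne => /eqP.
by case: (last _ _) => c d [-> _] /=.
Qed.

Lemma cmin_ex (p : fg * nat) : exists q, [/\ cval q = cval p, q.2 = p.2, cmin q &
  (size q.1 <= size p.1)%N].
Proof.
case: p => g a; have [n] := ubnP (size g); elim: n g => // n IHn g; rewrite ltnS => sg.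
have [cg|] := boolP (cmin (g, a)); first by exists (g, a).
rewrite /cmin /= negb_or; case/lastP gE: {1 2}(fgval g) => [|w [c b]] //.
rewrite negbK => /andP[_]; rewrite gE last_rcons /= => /eqP ca; subst c.
have [h hE hw] := fg_rcons_val gE.
have sh : (size h < size g)%N by rewrite gE size_rcons hw.
have [|q [q1 q2 q3 q4]] := IHn h; first exact: leq_trans sh sg.
rewrite -gE; exists q; split=> //; last exact: leq_trans q4 (ltnW sh).
rewrite q1 /cval /= hE FlE invgM; case: b {gE hE}; rewrite ?invgK !mulgA.
  by rewrite !(mulgK, mulgVK).
by rewrite !(mulgK, mulgVK).
Qed.

Definition cdiff (p q : fg * nat) : fg := p.1^-1 * q.1.
Arguments cdiff : simpl never.

(** In the product of the two conjugates, the word between their middle letters cancels neither of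
    these letters. *)
Definition cok (p q : fg * nat) :=
  let k := fgval (cdiff p q) in
  [|| k == [::] | (head (0%N, true) k != (p.2, true)) && (last (0%N, true) k != (q.2, true))].

Lemma unsorted_split T (r : rel T) s : ~~ sorted r s ->
  exists s1 a b s2, s = s1 ++ a :: b :: s2 /\ ~~ r a b.
Proof.
case: s => //= a s; elim: s a => //= b s IHs a; rewrite negb_and.
case/orP => [rab|/IHs[s1 [c [d [s2 [-> rcd]]]]]]; first by exists [::], a, b, s.
by exists (a :: s1), c, d, s2.
Qed.
Arguments unsorted_split {T r s}.

(** When no neighbours interact, this is the reduced form of the product with the leading conjugator
    [p.1] left out. *)
Fixpoint cword (p : fg * nat) (s : seq (fg * nat)) : seq fg_letter :=
  (p.2, false) :: if s is q :: s' then fgval (cdiff p q) ++ cword q s' else fgval p.1^-1.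

Lemma cword_red p s : all cmin (p :: s) -> path cok p s -> fgred (cword p s).
Proof.
elim: s p => [|q s IHs] p /=.
  rewrite andbT => /(cmin_red true) r _.
  rewrite fg_invE; suff: fgred (finv (fgval p.1 ++ [:: (p.2, true)])) by rewrite /finv map_cat rev_cat.
  exact: finv_reduced.
case/and3P=> cp cq cs /andP[pq ps].
have rq : fgred (cword q s) by apply: IHs ps; rewrite /= cq.
have hq : exists v, cword q s = (q.2, false) :: v by case: (s) => *; eexists.
case: hq rq => v -> rq.
rewrite -[X in fgred X]cat1s fgred_cat (fgred_cat (cdiff p q)) fgP rq /=.
move: pq; rewrite /cok; case: (fgval (cdiff _ _)) => [|a k] /=; first by rewrite /linv /= xpair_eqE ?andbF.
case/andP=> -> lk; rewrite andbT; apply: contra lk => /eqP /(congr1 linv).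
by rewrite linvK /linv /= => <-.
Qed.

Definition cprod (s : seq (fg * nat)) : fg := foldr (fun p x => cval p * x) 1 s.

Lemma cword_val p s : all cmin (p :: s) -> path cok p s ->
  cprod (p :: s) = p.1 * word_val gen (cword p s).
Proof.
elim: s p => [|q s IHs] p.
  move=> _ _ /=; rewrite mulg1 /cval -mulgA; congr (_ * (_ * _)).
  by rewrite -/(fgext gen _^-1) fgext_id.
move=> /= /andP[cp cqs] /andP[pq ps].
rewrite /= [cval q * _](IHs q cqs ps) word_val_cat -/(fgext gen _) fgext_id.
by rewrite /letter_val /cval /cdiff /= !mulgA.
Qed.

Lemma word_val_red w (rw : fgred w) : word_val gen w = Fg rw.
Proof. by rewrite -[LHS]/(fgext gen (Fg rw)) fgext_id. Qed.

Lemma size_cword p s : (size s < size (cword p s))%N.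
Proof.
elim: s p => [|q s IHs] p //=; rewrite size_cat ltnS.
by rewrite (leq_trans (IHs q)) // leq_addl.
Qed.

Lemma cword_tight p s : p.1 = 1 -> size (cword p s) = (size s).+1 ->
  all (fun q => fgval q.1 == [::]) s /\ cword p s = [seq (q.2, false) | q <- p :: s].
Proof.
elim: s p => [|q s IHs] p p1 /=; first by rewrite p1 invg1.
rewrite /cdiff p1 invg1 mul1g size_cat => - [E]; have := size_cword q s => sq.
have q0 : size (fgval q.1) = 0%N by lia.
have q1 := fg_eq1 q0.
have [|-> ->] := IHs q q1; first lia.
by rewrite q1.
Qed.

Lemma cprod_cat s t : cprod (s ++ t) = cprod s * cprod t.
Proof. by elim: s => [|p s IHs] /=; rewrite ?mul1g // IHs mulgA. Qed.

Definition genprod (c : seq nat) : fg := foldr (fun a x => gen a * x) 1 c.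

Lemma genprod_val c : fgval (genprod c) = [seq (a, false) | a <- c].
Proof.
elim: c => //= a c IHc; rewrite -IHc; apply: (@Fl_cons (a, false)).
rewrite IHc; case: (c) IHc => //= b d IHc.
have := fgP (genprod (b :: d)); rewrite IHc /fgred /= => ->.
by rewrite /linv xpair_eqE andbF.
Qed.

(** If the word between the middle letters begins by cancelling the first one, then the conjugator
    of q is that of p followed by the inverse of this letter and a remainder. Conjugating q by
    [cval p] deletes the letter. The other case is symmetric and shortens p. *)
Lemma cok_move p q : cmin p -> cmin q -> ~~ cok p q ->
  exists b p' q', [/\ cmin p', cmin q', 
    (size p'.1 + size q'.1 < size p.1 + size q.1)%N &
    (if b then [:: cval p * cval q * (cval p)^-1; cval p]
     else [:: cval q; (cval q)^-1 * cval p * cval q]) = [:: cval p'; cval q']].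
Proof.
move=> cp cq; rewrite /cok negb_or negb_and !negbK => /andP[k0].
set k := cdiff p q in k0 *.
case/orP=> /eqP kE.
  exists true; have [l kl] : exists l, fgval k = (p.2, true) :: l.
    by move: k0 kE; case: (fgval k) => //= a l _ ->; exists l.
  have [k' kk' k'l] := fg_cons_val kl; rewrite FlE in kk'.
  have sq : size q.1 = (size p.1 + (size k').+1)%N.
    have E : q.1 = p.1 * k by rewrite /k /cdiff mulVKg.
    have r : fgred (fgval p.1 ++ fgval k).
      rewrite fgred_cat !fgP /= kl /=.
      have := cmin_red true cp; rewrite fgred_cat fgP /=.
      by case/orP=> ->; rewrite ?orbT.
    by rewrite E (fg_mul_cat r) size_cat kl /= -k'l.
  have [r [r1 r2 r3 r4]] := cmin_ex (p.1 * k', q.2).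
  exists r, p; split=> //.
    by have /= := leq_trans r4 (fg_mul_size p.1 k'); lia.
  have k'E : k' = gen p.2 * k by rewrite kk' mulVKg.
  rewrite r1; congr [:: _; _]; rewrite /cval /= k'E /k /cdiff !invgM !invgK.
  by rewrite !mulgA ?mulgK ?mulgVK.
exists false; have [l kl] : exists l, fgval k = rcons l (q.2, true).
  by case/lastP: (fgval k) k0 kE => // l a _; rewrite last_rcons => ->; exists l.
have klV : fgval k^-1 = (q.2, false) :: finv l.
  by rewrite fg_invE kl /finv map_rcons rev_rcons.
have [k' kk' k'l] := fg_cons_val klV.
have sq : size p.1 = (size q.1 + (size k').+1)%N.
  have E : p.1 = q.1 * k^-1 by rewrite /k /cdiff invgM invgK mulVKg.
  have r : fgred (fgval q.1 ++ fgval k^-1).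
    rewrite fgred_cat !fgP /= klV /=.
    have := cmin_red false cq; rewrite fgred_cat fgP /=.
    by case/orP=> ->; rewrite ?orbT.
  by rewrite E (fg_mul_cat r) size_cat klV /= -k'l.
have [r [r1 r2 r3 r4]] := cmin_ex (q.1 * k', p.2).
exists q, r; split=> //.
  by have /= := leq_trans r4 (fg_mul_size q.1 k'); lia.
have k'E : k' = (gen q.2)^-1 * k^-1 by rewrite kk' mulKg.
rewrite r1; congr [:: _; _]; rewrite /cval /= k'E /k /cdiff !invgM !invgK.
by rewrite !mulgA ?mulgK ?mulgVK.
Qed.

(* Artin: if no elementary move shortens the conjugators, then the middle
   letters of all the factors survive in the reduced form of the product. *)
Lemma hurwitz_transitive (s : seq (fg * nat)) (c : seq nat) :
  size s = size c -> cprod s = genprod c ->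
  exists2 w : seq (nat * bool), all (fun l => l.1.+1 < size s)%N w &
    hact w (nth 1 (map cval s)) =1 nth 1 (map gen c).
Proof.
move=> sc E.
have [t [tE tc tm]] : exists t, [/\ map cval t = map cval s, size t = size s & all cmin t].
  elim: (s) => [|p s' [t [t1 t2 t3]]]; first by exists [::].
  have [q [q1 q2 q3 q4]] := cmin_ex p.
  by exists (q :: t); split=> /=; rewrite ?q1 ?t1 ?t2 ?q3.
have cpE (u v : seq (fg * nat)) : map cval u = map cval v -> cprod u = cprod v.
  by elim: u v => [|p u IH] [|q v] //= [-> /IH ->].
rewrite -(cpE _ _ tE) in E; rewrite -tE -tc; rewrite -tc in sc; clear cpE tE tc s.
have [n] := ubnP (sumn [seq size (fgval p.1) | p <- t]).
elim: n t sc E tm => // n IHn t tc E tm; rewrite ltnS => sn.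
have [ct|/unsorted_split[s1 [p [q [s2 [tE npq]]]]]] := boolP (sorted cok t).
  exists [::] => //= j; congr nth.
  case: t => [|p s] in tc E tm sn ct *; first by case: (c) tc.
  rewrite (cword_val tm ct) (word_val_red (cword_red tm ct)) in E.
  have /(congr1 fgval) := E; rewrite genprod_val fg_mul_cat /=; last first.
    rewrite fgred_cat fgP cword_red //=.
    have := cmin_red false (allP tm _ (mem_head _ _)); rewrite fgred_cat fgP /=.
    by case: (s) => [|? ?] /=; case/orP=> [->|->] //; rewrite ?orbT.
  move=> E'; have := congr1 size E'; rewrite size_cat size_map -tc /=.
  have := size_cword p s => sz szE.
  (* [genprod c] has one letter per factor, and the surviving middle letters already account for all
     of them. *)
  have p1 : p.1 = 1 by apply: fg_eq1; lia.
  have [|al cE] := @cword_tight p s p1; first by lia.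
  have cc : map fst [seq (a, false) | a <- c] = c by rewrite -map_comp map_id.
  rewrite -cc -E' p1 cE fg_oneE cat0s -!map_comp.
  rewrite -[LHS]/([seq cval i | i <- p :: s]); apply/eq_in_map => q.
  rewrite inE => qs; suff q1 : q.1 = 1 by rewrite /cval /= q1 invg1 mul1g mulg1.
  by case/orP: qs => [/eqP-> //|/(allP al)/eqP q0]; apply: val_inj.
move: (tm); rewrite tE all_cat /= => /and4P[m1 mp mq m2].
have [b [p' [q' [mp' mq' sz bE]]]] := cok_move mp mq npq.
pose t' := s1 ++ p' :: q' :: s2.
have st : size t' = size t by rewrite tE !size_cat.
have mvE : mv (size s1, b) (nth 1 (map cval t)) =1 nth 1 (map cval t').
  move=> j; rewrite tE !map_cat /= -(size_map cval s1) mv_nth.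
  by case: b bE => - [-> ->].
have [|||| w wa wE] := IHn t'.
- by rewrite st.
- rewrite -E tE /t' !cprod_cat /=; congr (_ * _).
  have cE : cval p' * cval q' = cval p * cval q.
    by case: b bE {mvE} => - [<- <-]; rewrite ?mulgVK // !mulgA mulgV mul1g.
  by rewrite mulgA cE -mulgA.
- by rewrite /t' all_cat m1 /= mp' mq' m2.
- by move: sn; rewrite tE /t' !map_cat !sumn_cat /=; lia.
exists (w ++ [:: (size s1, b)]).
  move: wa; rewrite all_cat st tE => -> /=; rewrite size_cat /=; lia.
by move=> j; rewrite hact_cat -wE -tE; apply: eq_hact; exact: mvE.
Qed.
End Hurwitz.
Import Hurwitz.

(** * Braids on three strands *)

Module ThreeBraids.
Local Open Scope group_scope.

Ltac grp := rewrite ?(invgM, invgK, mulgA, mulgK, mulgVK, mulVg, mulgV, mul1g, mulg1, invg1).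

(** The subgroup generated by the family [f]. *)
Definition range (G : groupType) (f : nat -> G) (x : G) : Prop := exists g, x = fgext f g.

Section Range.
Variables (G : groupType) (f : nat -> G).
Lemma range1 : range f 1. Proof. by exists 1. Qed.
Lemma rangeM x y : range f x -> range f y -> range f (x * y).
Proof. by case=> g -> [h ->]; exists (g * h); rewrite fgextM. Qed.
Lemma rangeV x : range f x -> range f x^-1.
Proof. by case=> g ->; exists g^-1; rewrite fgextV. Qed.
Lemma range_gen i : range f (f i).
Proof. by exists (gen i); rewrite fgextX. Qed.
End Range.
#[export] Hint Resolve range1 range_gen : core.

Section ThreeBraids.
Variables (G : groupType) (a b : G).
Hypothesis aba : a * b * a = b * a * b.

Definition s12 (i : nat) : G := if i is 0 then a else b.
(** The full twist on three strands. Together with the squares of a and b it generates the pure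
    braids; [rep3] gives one positive word for each of the six permutations. *)
Definition D3 : G := (a * b * a) * (a * b * a).
Definition pure12 (i : nat) : G := match i with 0 => a * a | 1 => b * b | _ => D3 end.
Definition rep3 (r : nat) : G := nth 1 [:: 1; a; b; a * b; b * a; a * b * a] r.

Let bab : b * a * b = a * b * a. Proof. by rewrite aba. Qed.

Let Da : (a * b * a) * a = b * (a * b * a). Proof. by rewrite {1}aba !mulgA. Qed.
Let Db : (a * b * a) * b = a * (a * b * a). Proof. by rewrite {2}aba !mulgA. Qed.

Lemma D3a : commute D3 a.
Proof. by rewrite /commute /D3; move: (a * b * a) Da Db => d da db; rewrite -mulgA da mulgA db mulgA. Qed.
Lemma D3b : commute D3 b.
Proof. by rewrite /commute /D3; move: (a * b * a) Da Db => d da db; rewrite -mulgA db mulgA da mulgA. Qed.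
Lemma D3E : D3 = a * a * (b * a * a * b).
Proof.
rewrite /D3 {2}aba (_ : _ * _ = a * (b * a * b) * (a * b)); last by rewrite !mulgA.
by rewrite -aba !mulgA.
Qed.
Lemma D3E' : D3 = b * b * (a * b * b * a).
Proof.
rewrite /D3 {1}aba (_ : _ * _ = b * (a * b * a) * (b * a)); last by rewrite !mulgA.
by rewrite aba !mulgA.
Qed.

(* [tab c r = (r', h)] encodes the identity [c * rep3 r = rep3 r' * h]. *)
Definition tab3 (c r : nat) : nat * fg :=
  let A := gen 0 in let B := gen 1 in let D := gen 2 in
  nth (0%N, 1) (if c is 0 then
   [:: (1%N, 1); (0%N, A); (3%N, 1); (2%N, B^-1 * D * A^-1); (5%N, 1); (4%N, B)]
  else
   [:: (2%N, 1); (4%N, 1); (0%N, B); (5%N, 1); (1%N, A^-1 * D * B^-1); (3%N, A)]) r.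

Lemma tab3P c r : (r < 6)%N -> s12 c * rep3 r = rep3 (tab3 c r).1 * fgext pure12 (tab3 c r).2.
Proof.
have H1 : a * (a * b) = b * ((b * b)^-1 * D3 * (a * a)^-1).
  by rewrite D3E'; grp; rewrite -{1}aba Db; grp.
have H2 : b * (b * a) = a * ((a * a)^-1 * D3 * (b * b)^-1).
  by rewrite D3E; grp; rewrite Da aba; grp.
case: c => [|c]; do 6?case: r => [|r] //; move=> _;
  rewrite /tab3 /rep3 /s12 /= ?fgextM ?fgextV ?fgextX /pure12 ?fgext1 ?mulg1 ?mul1g //.
- by rewrite ?mulgA.
- by rewrite -Db aba !mulgA.
- by rewrite mulgA -aba.
- by rewrite -Da !mulgA.
Qed.

Lemma tab3K c r : (r < 6)%N -> ((tab3 c r).1 < 6)%N /\ (tab3 c (tab3 c r).1).1 = r.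
Proof. by case: c => [|c]; do 6?case: r => [|r]. Qed.

(** Left multiplication by a generator permutes the six cosets of the pure braids as in [tab3]. By
    [tab3K] each of these permutations is an involution, so the same table handles the inverse
    letters. *)
Lemma three_braid_form g : exists r h, (r < 6)%N /\ fgext s12 g = rep3 r * fgext pure12 h.
Proof.
elim/fg_ind: g => [|i g [r [h [r6 E]]]|i g [r [h [r6 E]]]].
- by exists 0%N, 1; rewrite mul1g.
- have [t6 _] := tab3K i r6.
  exists (tab3 i r).1, ((tab3 i r).2 * h); split=> //.
  by rewrite !fgextM fgextX E mulgA tab3P // mulgA.
have [t6 tK] := tab3K i r6.
exists (tab3 i r).1, ((tab3 i (tab3 i r).1).2^-1 * h); split=> //.
rewrite fgextM fgextV fgextX E fgextM fgextV; apply: (mulgI (s12 i)).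
by rewrite [RHS]mulgA tab3P // tK !mulgA mulgV mul1g mulgK.
Qed.

Lemma commute_D3 g : commute D3 (fgext s12 g).
Proof.
elim/fg_ind: g => [|[|i] g IH|[|i] g IH]; rewrite ?fgextM ?fgextV ?fgextX /=.
- exact: commute1.
- exact: commuteM D3a IH.
- exact: commuteM D3b IH.
- exact: commuteM (commuteV D3a) IH.
- exact: commuteM (commuteV D3b) IH.
Qed.
End ThreeBraids.
End ThreeBraids.
Import ThreeBraids.

(** * Combing braids on four strands *)

Module FourBraids.
Local Open Scope group_scope.

Section Combing.
Variables (G : groupType) (a b c : G).
Hypotheses (aba : a * b * a = b * a * b) (bcb : b * c * b = c * b * c) (ac : a * c = c * a).

Definition s123 (i : nat) : G := match i with 0 => a | 1 => b | _ => c end.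
(** The standard generators of the pure braids in which only the fourth strand moves: it turns once
    around one of the three others. *)
Definition A14 : G := c * (b * a * a * b^-1) * c^-1.
Definition A24 : G := c * (b * b) * c^-1.
Definition A34 : G := c * c.
Definition A4 (i : nat) : G := match i with 0 => A14 | 1 => A24 | _ => A34 end.
Definition rep4 (j : nat) : G := nth 1 [:: 1; c; c * b; c * b * a] j.
Local Notation K := (range A4).
Local Notation B := (range (s12 a b)).

Lemma rangeJ (f : nat -> G) (P : G -> Prop) (x : G) :
  P 1 -> (forall y z, P y -> P z -> P (y * z)) -> (forall y, P y -> P y^-1) ->
  (forall i, P (f i ^ x)) -> forall k, range f k -> P (k ^ x).
Proof.
move=> P1 PM PV Pf k [g ->]; elim/fg_ind: g => [|i g IH|i g IH].
- by rewrite conj1g.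
- by rewrite fgextM fgextX conjMg; apply: PM.
- by rewrite fgextM fgextV fgextX conjMg conjVg; apply: PM => //; apply: PV.
Qed.

Let comm_ac : commute a c := ac.
Let pq : (b * a * a * b^-1) * (b * b) = (a * a)^-1 * D3 a b.
Proof. by rewrite D3E //; grp. Qed.

Lemma A14_24 : commute (A14 * A24) a.
Proof.
have -> : A14 * A24 = c * ((a * a)^-1 * D3 a b) * c^-1 by rewrite -pq /A14 /A24; grp.
have cm x : commute x a -> commute (c * x * c^-1) a.
  move=> xa; apply/commute_sym; apply: commuteM; last exact: commuteV.
  by apply: commuteM => //; apply: commute_sym.
apply: cm; apply/commute_sym/commuteM; last exact/commute_sym/D3a.
by apply/commuteV/commuteM.
Qed.

Lemma A34_a : commute A34 a.
Proof. by apply/commute_sym/commuteM. Qed.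

Lemma A24_a : A24 ^ a = A14.
Proof.
rewrite /A24 /A14; have E : (b * b) ^ a = b * a * a * b^-1.
  have -> : b * a * a * b^-1 = (b * a * b^-1) ^+ 2 by rewrite expg2; grp.
  rewrite -expg2 conjXg; congr (_ ^+ 2); apply: (mulgI a); rewrite conjgE; grp.
  by rewrite aba; grp.
by rewrite -E !conjMg !conjVg (_ : c ^ a = c) // conjgE -ac mulKg.
Qed.

Lemma A34_b : A34 ^ b = A24.
Proof.
rewrite /A34 /A24; have E : c ^ b = c * b * c^-1.
  by apply: (mulgI b); rewrite conjgE; grp; rewrite bcb; grp.
by rewrite conjMg E; grp.
Qed.

Lemma A14_b : commute A14 b.
Proof.
have Eb : b = c ^ (c * b)^-1.
  by rewrite conjgE invgK; apply: (mulIg (c * b)); grp; rewrite bcb; grp.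
have -> : A14 = (a * a) ^ (c * b)^-1 by rewrite /A14 conjgE; grp.
by rewrite {2}Eb /commute -!conjMg -mulgA ac !mulgA ac.
Qed.

Lemma A24_34 : commute (A24 * A34) b.
Proof.
have -> : A24 * A34 = c * b * b * c by rewrite /A24 /A34; grp.
rewrite /commute (_ : _ * b = c * b * (b * c * b)); last by rewrite !mulgA.
rewrite bcb (_ : _ * _ = (c * b * c) * (b * c)); last by rewrite !mulgA.
by rewrite -bcb !mulgA.
Qed.

Lemma K_a i : K (A4 i ^ a).
Proof.
have rg j : K (A4 j) by exact: range_gen.
have E3 : A34 ^ a = A34 by apply/conjg_fixP/commgP/A34_a.
case: i => [|[|i]] /=; last by rewrite E3; apply: (rg 2).
  have /conjg_fixP E : [~ A14 * A24, a] == 1 by apply/commgP/A14_24.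
  move: (E : _ = _); rewrite conjMg A24_a => /(canRL (mulgK _)) ->.
  by apply: rangeM (rangeV (rg 0%N)); apply: rangeM (rg 0%N) (rg 1%N).
by rewrite A24_a; apply: (rg 0%N).
Qed.

Lemma K_aV i : K (A4 i ^ a^-1).
Proof.
have rg j : K (A4 j) by exact: range_gen.
have E1 : A14 ^ a^-1 = A24 by rewrite -A24_a conjgK.
case: i => [|[|i]] /=.
- by rewrite E1; apply: (rg 1%N).
- have /conjg_fixP E : [~ A14 * A24, a^-1] == 1 by apply/commgP/commuteV/A14_24.
  move: (E : _ = _); rewrite conjMg E1 => /(canRL (mulKg _)) ->.
  by apply: rangeM (rangeV (rg 1%N)) _; apply: rangeM (rg 0%N) (rg 1%N).
- rewrite (_ : A34 ^ _ = A34); first exact: (rg 2).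
  by apply/conjg_fixP/commgP/commuteV/A34_a.
Qed.

Lemma K_b i : K (A4 i ^ b).
Proof.
have rg j : K (A4 j) by exact: range_gen.
case: i => [|[|i]] /=.
- rewrite (_ : A14 ^ _ = A14); first exact: (rg 0%N).
  by apply/conjg_fixP/commgP/A14_b.
- have /conjg_fixP E : [~ A24 * A34, b] == 1 by apply/commgP/A24_34.
  move: (E : _ = _); rewrite conjMg A34_b => /(canRL (mulgK _)) ->.
  by apply: rangeM (rangeV (rg 1%N)); apply: rangeM (rg 1%N) (rg 2).
- by rewrite A34_b; apply: (rg 1%N).
Qed.

Lemma K_bV i : K (A4 i ^ b^-1).
Proof.
have rg j : K (A4 j) by exact: range_gen.
have E1 : A24 ^ b^-1 = A34 by rewrite -A34_b conjgK.
case: i => [|[|i]] /=.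
- rewrite (_ : A14 ^ _ = A14); first exact: (rg 0%N).
  by apply/conjg_fixP/commgP/commuteV/A14_b.
- by rewrite E1; apply: (rg 2).
- have /conjg_fixP E : [~ A24 * A34, b^-1] == 1 by apply/commgP/commuteV/A24_34.
  move: (E : _ = _); rewrite conjMg E1 => /(canRL (mulKg _)) ->.
  by apply: rangeM (rangeV (rg 2)) _; apply: rangeM (rg 1%N) (rg 2).
Qed.

Lemma K_B x k : B x -> K k -> K (k ^ x).
Proof.
have KJ y : (forall i, K (A4 i ^ y)) -> forall k, K k -> K (k ^ y).
  by move=> Ky k'; apply: rangeJ => //; [apply: rangeM | apply: rangeV].
case=> g ->; elim/fg_ind: g k => [|[|i] g IH|[|i] g IH] k Kk;
  rewrite ?fgextM ?fgextV ?fgextX ?conjg1 // ?conjgM; apply: IH; apply: KJ Kk.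
- exact: K_a.
- exact: K_b.
- exact: K_aV.
- exact: K_bV.
Qed.

Definition KB x := exists k y, [/\ K k, B y & x = k * y].

Lemma KB_M x y : KB x -> KB y -> KB (x * y).
Proof.
case=> k [u [Kk Bu ->]] [k' [u' [Kk' Bu' ->]]].
exists (k * k' ^ u^-1), (u * u'); split; last by rewrite conjgE; grp.
  by apply: rangeM Kk (K_B (rangeV Bu) Kk').
exact: rangeM.
Qed.

Lemma KB_V x : KB x -> KB x^-1.
Proof.
case=> k [u [Kk Bu ->]]; exists (k^-1 ^ u), u^-1; split.
- exact: K_B Bu (rangeV Kk).
- exact: rangeV.
- by rewrite conjgE; grp.
Qed.

(* [tab4 i j = (j', h)] encodes the identity [rep4 j * s123 i = h * rep4 j']. *)
Definition tab4 (i j : nat) : nat * G :=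
  nth (0%N, 1) (match i with
   | 0 => [:: (0%N, a); (1%N, a); (3%N, 1); (2%N, A14)]
   | 1 => [:: (0%N, b); (2%N, 1); (1%N, A24); (3%N, a)]
   | _ => [:: (1%N, 1); (0%N, A34); (2%N, b); (3%N, b)] end) j.

Lemma tab4P i j : (j < 4)%N -> rep4 j * s123 i = (tab4 i j).2 * rep4 (tab4 i j).1.
Proof.
case: i => [|[|i]]; do 4?case: j => [|j] //; move=> _; rewrite /tab4 /rep4 /= /A34 /A24 /A14;
  grp => //.
- by rewrite -!(mulgA c) -aba !mulgA -ac.
- by rewrite -(mulgA (c * b)) ac !mulgA -bcb.
Qed.

Lemma tab4K i j : (j < 4)%N -> ((tab4 i j).1 < 4)%N /\ (tab4 i (tab4 i j).1).1 = j.
Proof. by case: i => [|[|i]]; do 4?case: j => [|j]. Qed.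

Lemma KB_K k : K k -> KB k.
Proof. by move=> Kk; exists k, 1; split; rewrite ?mulg1. Qed.
Lemma KB_B x : B x -> KB x.
Proof. by move=> Kk; exists 1, x; split; rewrite ?mul1g. Qed.

Lemma KB_tab4 i j : (j < 4)%N -> KB (tab4 i j).2.
Proof.
have Ba : B a by exact: (range_gen (s12 a b) 0).
have Bb : B b by exact: (range_gen (s12 a b) 1).
have K0 : K A14 by exact: (range_gen A4 0).
have K1 : K A24 by exact: (range_gen A4 1).
have K2 : K A34 by exact: (range_gen A4 2).
by case: i => [|[|i]]; do 4?case: j => [|j] //; move=> _; rewrite /tab4 /=;
  try (by apply: KB_K); apply: KB_B.
Qed.

Lemma combing g : exists k y j, [/\ K k, B y, (j < 4)%N & fgext s123 g = k * y * rep4 j].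
Proof.
suff [x [j [[k [y [Kk By ->]]] j4 E]]] : exists x j, [/\ KB x, (j < 4)%N & fgext s123 g = x * rep4 j].
  by exists k, y, j.
(* [fg_ind] adds letters on the left, whereas the representatives of the cosets stand on the right;
   the induction is therefore run on the inverse. *)
rewrite -[g]invgK fgextV; move: g^-1 => {}g.
elim/fg_ind: g => [|i g [x [j [Hx j4 E]]]|i g [x [j [Hx j4 E]]]].
- by exists 1, 0%N; split; rewrite ?fgext1 ?invg1 ?mulg1 //; apply: KB_K.
- have [t4 tK] := tab4K i j4.
  exists (x * (tab4 i (tab4 i j).1).2^-1), (tab4 i j).1; split=> //.
    by apply: KB_M Hx (KB_V (KB_tab4 _ _)).
  rewrite fgextM fgextX invgM E; apply: (mulIg (s123 i)).
  by rewrite mulgVK -mulgA tab4P // tK !mulgA mulgVK.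
have [t4 tK] := tab4K i j4.
exists (x * (tab4 i j).2), (tab4 i j).1; split=> //; first exact: KB_M Hx (KB_tab4 _ _).
by rewrite fgextM fgextV fgextX invgM invgK E -mulgA tab4P // mulgA.
Qed.

(** The full twist on four strands: the full twist of the first three, and one turn of the fourth
    around all of them. *)
Definition D4 : G := D3 a b * (A14 * A24 * A34).

Lemma D4_a : commute D4 a.
Proof.
apply/commute_sym/commuteM; first exact/commute_sym/D3a.
by apply/commuteM; apply/commute_sym; [exact: A14_24 | exact: A34_a].
Qed.

Lemma D4_b : commute D4 b.
Proof.
apply/commute_sym/commuteM; first exact/commute_sym/D3b.
by rewrite -mulgA; apply/commuteM; apply/commute_sym; [exact: A14_b | exact: A24_34].
Qed.

(** With P = aa and Z = bPb one has PZ = ZP = [D3] and [D4] = P ZcZc. As c commutes with P, it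
    suffices that ZcZc = cZcZ. The braid relation between b and c turns the two sides into bc(PZ)cb
    and bc(ZP)cb. *)
Lemma D4_c : commute D4 c.
Proof.
pose P := a * a; pose Z := b * P * b.
have ZE : Z = P^-1 * D3 a b by rewrite D3E // /Z /P; grp.
have DP : commute (D3 a b) P by apply: commuteM (D3a aba) (D3a aba).
have ZD : Z * P = D3 a b by rewrite ZE -mulgA DP mulKg.
have DZ : P * Z = D3 a b by rewrite ZE mulVKg.
have CP : c * P = P * c by apply: commuteM; apply/commute_sym.
have E : D4 = P * (Z * c * Z * c) by rewrite /D4 -DZ /A14 /A24 /A34 /Z /P; grp.
have E1 : Z * c * Z * c = b * c * (P * Z) * c * b.
  rewrite {1 2}/Z (_ : _ * c = b * P * (b * c * b) * P * b * c); last by rewrite !mulgA.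
  rewrite bcb (_ : _ * c = b * (P * c) * b * (c * P) * b * c); last by rewrite !mulgA.
  rewrite (_ : _ * c = b * (c * P) * b * (P * c) * b * c); last by rewrite CP.
  rewrite (_ : _ * c = b * c * P * b * P * (c * b * c)); last by rewrite !mulgA.
  by rewrite -bcb /Z !mulgA.
have E2 : c * Z * c * Z = b * c * (Z * P) * c * b.
  rewrite {1 2}/Z (_ : _ * _ = c * b * P * (b * c * b) * P * b); last by rewrite !mulgA.
  rewrite bcb (_ : _ * b = c * b * (P * c) * b * (c * P) * b); last by rewrite !mulgA.
  rewrite (_ : _ * b = c * b * (c * P) * b * (P * c) * b); last by rewrite CP.
  rewrite (_ : _ * b = (c * b * c) * P * b * P * c * b); last by rewrite !mulgA.
  by rewrite -bcb /Z !mulgA.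
have F : Z * c * Z * c = c * Z * c * Z by rewrite E1 E2 ZD DZ.
have F' : (Z * c * Z * c) * c = c * (Z * c * Z * c) by rewrite {1}F !mulgA.
rewrite /commute E; move: (Z * c * Z * c) F' => X F'; move: P CP {E E1 E2 F DP ZE ZD DZ Z} => P CP.
by rewrite -mulgA F' !mulgA CP.
Qed.

Lemma commute_D4 g : commute D4 (fgext s123 g).
Proof.
elim/fg_ind: g => [|[|[|i]] g IH|[|[|i]] g IH]; rewrite ?fgextM ?fgextV ?fgextX /=.
- exact: commute1.
- exact: commuteM D4_a IH.
- exact: commuteM D4_b IH.
- exact: commuteM D4_c IH.
- exact: commuteM (commuteV D4_a) IH.
- exact: commuteM (commuteV D4_b) IH.
- exact: commuteM (commuteV D4_c) IH.
Qed.
End Combing.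
End FourBraids.
Import FourBraids.

(** * Artin's representation *)

Module ArtinAction.
Local Open Scope group_scope.
Local Open Scope quotient_scope.

Definition wn n (w : braid_word n) : seq (nat * bool) := [seq (val l.1, l.2) | l <- w].

Lemma hact_rel n (u v : braid_word n) : braid_rel u v ->
  forall (G : groupType) (y : nat -> G), hact (wn u) y =1 hact (wn v) y.
Proof.
elim=> {u v} [u|u v _ IH|u v w _ IHu _ IHv|u u' v v' _ IHu _ IHv|i b|i j ij|i j ij] G y k //.
- by rewrite IH.
- by rewrite IHu IHv.
- by rewrite /wn !map_cat !hact_cat -!/(wn _) IHu; apply: eq_hact => k'; rewrite IHv.
- exact: mvK.
- rewrite /hact /mv /=; move: (nat_of_ord i) (nat_of_ord j) ij => {}i {}j ij.
  have E1 : (j == i) = false by lia.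
  have E2 : (j == i.+1) = false by lia.
  have E3 : (j.+1 == i) = false by lia.
  have E4 : (i == j.+1) = false by lia.
  rewrite ?eqSS ?E1 ?E2 ?E3 ?E4 ![i == j]eq_sym ?[i.+1 == j]eq_sym ?E1 ?E2.
  have [->|ki] := eqVneq k i; first by rewrite [i == j]eq_sym E1 E4.
  by have [->|ki'] := eqVneq k i.+1; rewrite // [i.+1 == j]eq_sym E2 eqSS [i == j]eq_sym E1.
rewrite /hact /mv /= -ij; move: (nat_of_ord i) => {ij}i.
have E1 : (i == i.+1) = false by lia.
have E2 : (i.+1 == i) = false by lia.
have E3 : (i.+2 == i) = false by lia.
have E4 : (i == i.+2) = false by lia.
rewrite ?eqSS ?E1 ?E2 ?E3 ?E4 ?eqxx /=.
have [->|k1] := eqVneq k i; first by rewrite E1 E4.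
have [_|k2] := eqVneq k i.+1; first by [].
by have [_|//] := eqVneq k i.+2; grp.
Qed.

Section Action.
Variable n : nat.
Implicit Types (a b : braid n).

Definition bact (G : groupType) b (y : nat -> G) := hact (wn (repr b)) y.

Lemma bact_pi (G : groupType) (w : braid_word n) (y : nat -> G) :
  bact (\pi_(braid n) w) y =1 hact (wn w) y.
Proof. exact/hact_rel/braid_repr. Qed.

Lemma eq_bact (G : groupType) b (y y' : nat -> G) : y =1 y' -> bact b y =1 bact b y'.
Proof. exact: eq_hact. Qed.

Lemma bactM (G : groupType) a b (y : nat -> G) : bact (a * b) y =1 bact a (bact b y).
Proof.
move=> k; rewrite -[a]reprK -[b]reprK [(_ * _)]pi_braid_mul !bact_pi /wn map_cat hact_cat.
by apply: eq_hact => j; rewrite bact_pi.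
Qed.

Lemma bact1 (G : groupType) (y : nat -> G) : bact 1 y =1 y.
Proof. exact: bact_pi. Qed.

Lemma bact_morph (G H : groupType) (h : G -> H) b (y : nat -> G) :
  {morph h : x y / x * y} -> h \o bact b y =1 bact b (h \o y).
Proof. exact: hact_morph. Qed.

(** Artin's representation. Braids act from the right, so [phi (a * b)] performs [phi a] first. *)
Definition phi b : fg -> fg := fgext (bact b gen).

Lemma phiM b : {morph phi b : x y / x * y}. Proof. exact: fgextM. Qed.
Lemma phi_mul a b g : phi (a * b) g = phi b (phi a g).
Proof.
rewrite [phi a g]/(fgext _ _) (fgext_comp _ (phiM b)).
apply: eq_fgext => j; rewrite bactM (bact_morph a _ (phiM b)).
by apply: eq_bact => k /=; rewrite /phi fgextX.
Qed.
Lemma phi1 g : phi 1 g = g.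
Proof. by rewrite /phi (eq_fgext (bact1 gen)) fgext_id. Qed.

Definition sw (i k : nat) := if k == i then i.+1 else if k == i.+1 then i else k.
Definition pw (w : seq (nat * bool)) (k : nat) := foldl (fun k l => sw l.1 k) k w.
Definition pb b := pw (wn (repr b)).
End Action.

Lemma pw_cat u v k : pw (u ++ v) k = pw v (pw u k).
Proof. exact: foldl_cat. Qed.

Lemma swK i : involutive (sw i).
Proof. by move=> k; rewrite /sw; case: (eqVneq k i) => [->|?]; do ?case: eqP; lia. Qed.

Lemma pw_rel n (u v : braid_word n) : braid_rel u v -> pw (wn u) =1 pw (wn v).
Proof.
elim=> {u v} [u|u v _ IH|u v w _ IHu _ IHv|u u' v v' _ IHu _ IHv|i b|i j ij|i j ij] k //.
- by rewrite IHu IHv.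
- by rewrite /wn !map_cat !pw_cat -!/(wn _) IHu IHv.
- by rewrite /pw /= swK.
- by rewrite /pw /= /sw; do !case: eqP => //=; lia.
- by rewrite /pw /= /sw; do !case: eqP; lia.
Qed.

Lemma pb_pi n (w : braid_word n) : pb (\pi_(braid n) w) =1 pw (wn w).
Proof. exact/pw_rel/braid_repr. Qed.

Lemma pbM n (a b : braid n) k : pb (a * b) k = pb b (pb a k).
Proof.
rewrite -[a]reprK -[b]reprK [(_ * _)]pi_braid_mul !pb_pi /wn map_cat; exact: pw_cat.
Qed.

Lemma pb1 n k : pb (1 : braid n) k = k.
Proof. exact: pb_pi. Qed.

Lemma hact_conj w k : exists h, hact w gen k = h * gen (pw w k) * h^-1.
Proof.
elim: w k => [|[i b] w IH] k /=; first by exists 1; grp.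
have IH' j j' (h : fg) : sw i j = j' -> exists h', 
  h * hact w gen j' * h^-1 = h' * gen (pw w (sw i j)) * h'^-1.
  by move=> ->; have [g ->] := IH j'; exists (h * g); grp.
rewrite [pw _ _]/(pw w (sw i k)) /mv /=; case: b.
- have [->|k1] := eqVneq k i; first by apply: IH'; rewrite /sw eqxx.
  have [->|k2] := eqVneq k i.+1.
    by have := IH' i.+1 i 1; grp; apply; rewrite /sw eqxx; case: eqP; lia.
  by have := IH' k k 1; grp; apply; rewrite /sw (negPf k1) (negPf k2).
- have [->|k1] := eqVneq k i; first by have := IH' i i.+1 1; grp; apply; rewrite /sw eqxx.
  have [->|k2] := eqVneq k i.+1.
    have := IH' i.+1 i (hact w gen i.+1)^-1; rewrite invgK; apply.
    by rewrite /sw eqxx; case: eqP; lia.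
  by have := IH' k k 1; grp; apply; rewrite /sw (negPf k1) (negPf k2).
Qed.

Lemma bact_conj n (b : braid n) k : exists h, bact b gen k = h * gen (pb b k) * h^-1.
Proof. exact: hact_conj. Qed.

Lemma hact_low n (G : groupType) w (y y' : nat -> G) : all (fun l => l.1.+1 < n)%N w ->
  (forall j, (j < n)%N -> y j = y' j) ->
  (forall j, (j < n)%N -> hact w y j = hact w y' j) /\ (forall j, (n <= j)%N -> hact w y j = y j).
Proof.
elim: w => [|[i b] w IH] //= /andP[ij aw] yy; have [H1 H2] := IH aw yy.
split=> j jn; rewrite /mv /=; last first.
  have e1 : (j == i) = false by lia.
  have e2 : (j == i.+1) = false by lia.
  by rewrite e1 e2; case: b; apply: H2.
have [i1 i2] : (i < n)%N /\ (i.+1 < n)%N by lia.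
by rewrite (H1 i i1) (H1 i.+1 i2) (H1 j jn).
Qed.

(* Words with letters below n.+1, as elements of the braid group on n.+2 strands. *)
Section Words.
Variable n : nat.
Definition bw (w : seq (nat * bool)) : braid n.+2 :=
  \pi_(braid n.+2) [seq (inord l.1 : 'I_n.+1, l.2) | l <- w].

Lemma bw_cat u v : bw (u ++ v) = bw u * bw v.
Proof. by rewrite [RHS]pi_braid_mul -map_cat. Qed.
Lemma bw_nil : bw [::] = 1. Proof. by []. Qed.

Lemma bw_inv i : bw [:: (i, true)] = (bw [:: (i, false)])^-1.
Proof.
apply: (mulgI (bw [:: (i, false)])); rewrite mulgV -bw_cat; apply/braidP.
exact: (@braid_rel_inv n.+2 _ false).
Qed.

Lemma wn_inord w : all (fun l => l.1 < n.+1)%N w ->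
  wn ([seq (inord l.1 : 'I_n.+1, l.2) | l <- w] : braid_word n.+2) = w.
Proof.
rewrite /wn -map_comp => aw; apply: map_id_in => -[i b] lw /=.
by rewrite inordK //; apply: (allP aw) lw.
Qed.

Lemma bact_bw (G : groupType) w (y : nat -> G) : all (fun l => l.1 < n.+1)%N w ->
  bact (bw w) y =1 hact w y.
Proof. by move=> aw k; rewrite bact_pi wn_inord. Qed.

Lemma pb_bw w : all (fun l => l.1 < n.+1)%N w -> pb (bw w) =1 pw w.
Proof. by move=> aw k; rewrite pb_pi wn_inord. Qed.

Lemma bw_surj (b : braid n.+2) : exists2 w, all (fun l => l.1 < n.+1)%N w & b = bw w.
Proof.
exists (wn (repr b)).
  by apply/allP => l /mapP[[i c] _ ->] /=.
rewrite -{1}[b]reprK /bw; congr (\pi _); rewrite /wn -map_comp; apply/esym/map_id_in.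
by case=> i c _ /=; rewrite inord_val.
Qed.

Lemma bw_range m w f : (forall i, (i < m)%N -> f i = bw [:: (i, false)]) ->
  all (fun l => l.1 < m)%N w -> range f (bw w).
Proof.
move=> fE; elim: w => [|[i b] w IH] /=; first by rewrite bw_nil.
case/andP=> im /IH Rw; rewrite -[_ :: _]/([:: _] ++ w) bw_cat; apply: rangeM Rw.
by case: b; rewrite ?bw_inv -fE //; try apply: rangeV; apply: range_gen.
Qed.

Lemma range_bw m f : (forall i, exists2 j, (j < m)%N & f i = bw [:: (j, false)]) ->
  forall b, range f b -> exists2 w, all (fun l => l.1 < m)%N w & b = bw w.
Proof.
move=> fE b [g ->]; elim/fg_ind: g => [|i g [w aw E]|i g [w aw E]].
- by exists [::].
- have [j jm fi] := fE i; exists ((j, false) :: w); first by rewrite /= jm.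
  by rewrite -[_ :: _]/([:: _] ++ w) bw_cat -E -fi fgextM fgextX.
- have [j jm fi] := fE i; exists ((j, true) :: w); first by rewrite /= jm.
  by rewrite -[_ :: _]/([:: _] ++ w) bw_cat -E bw_inv -fi fgextM fgextV fgextX.
Qed.

Lemma bw_far i j : (i.+1 < j < n.+1)%N ->
  bw [:: (i, false)] * bw [:: (j, false)] = bw [:: (j, false)] * bw [:: (i, false)].
Proof.
move=> /andP[ij jn]; rewrite -!bw_cat; apply/braidP/(@braid_rel_far n.+2).
by rewrite /= !inordK; lia.
Qed.

Lemma bw_adj i : (i.+1 < n.+1)%N ->
  let s j := bw [:: (j, false)] in s i * s i.+1 * s i = s i.+1 * s i * s i.+1.
Proof.
move=> ij /=; rewrite -!bw_cat; apply/braidP/(@braid_rel_adj n.+2).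
by rewrite /= !inordK; lia.
Qed.
End Words.
End ArtinAction.
Import ArtinAction.

(** * The free group of motions of the fourth strand *)

Module CombedAction.
Local Open Scope group_scope.
Local Open Scope quotient_scope.

Definition s4 (i : nat) : braid 4 := bw 2 [:: (i, false)].
Local Notation a := (s4 0).
Local Notation b := (s4 1).
Local Notation c := (s4 2).

Lemma aba4 : a * b * a = b * a * b. Proof. exact: (@bw_adj 2 0). Qed.
Lemma bcb4 : b * c * b = c * b * c. Proof. exact: (@bw_adj 2 1). Qed.
Lemma ac4 : a * c = c * a. Proof. exact: (@bw_far 2 0 2). Qed.

Local Notation "'A'" := (A4 a b c).

Definition WA (i : nat) : seq (nat * bool) := match i with
  | 0 => [:: (2, false); (1, false); (0, false); (0, false); (1, true); (2, true)]
  | 1 => [:: (2, false); (1, false); (1, false); (2, true)]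
  | _ => [:: (2, false); (2, false)] end%N.
Definition WAV (i : nat) : seq (nat * bool) := match i with
  | 0 => [:: (2, false); (1, false); (0, true); (0, true); (1, true); (2, true)]
  | 1 => [:: (2, false); (1, true); (1, true); (2, true)]
  | _ => [:: (2, true); (2, true)] end%N.

Lemma bw_val w : bw 2 w = word_val s4 w.
Proof.
elim: w => [|[i e] w IH] //=; rewrite -IH /letter_val /= /s4 -bw_inv.
by case: e; rewrite -bw_cat.
Qed.

Lemma A4_bw i : A i = bw 2 (WA i).
Proof. by rewrite bw_val; case: i => [|[|i]]; rewrite /= /A14 /A24 /A34 /letter_val /=; grp. Qed.

Lemma A4V_bw i : (A i)^-1 = bw 2 (WAV i).
Proof. by rewrite bw_val; case: i => [|[|i]]; rewrite /= /A14 /A24 /A34 /letter_val /=; grp. Qed.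

Section Tuple.
Variables (G : groupType) (y : nat -> G).

(** The conjugators that the fourth entry of a tuple picks up under the generators of the combed
    subgroup and under their inverses. *)
Definition tA (i : nat) : G :=
  if i == 0%N then (y 1%N)^-1 ^ (y 2) * ((y 2)^-1 * y 0%N * y 1%N * y 2 * y 3)
  else if i == 1%N then (y 1%N) ^ (y 2) * y 3 else y 2 * y 3.
Definition tAV (i : nat) : G :=
  if i == 0%N then (y 1%N)^-1 ^ (y 2) * ((y 2)^-1 * (y 0%N)^-1 * y 1%N * y 2)
  else if i == 1%N then (y 1%N)^-1 ^ (y 2) else (y 2)^-1.

Lemma hact_WA i : hact (WA i) y 3 = (y 3) ^ (tA i).
Proof. by case: i => [|[|i]]; rewrite /hact /mv /tA /tAV /= ?conjgE; grp. Qed.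
Lemma hact_WAV i : hact (WAV i) y 3 = (y 3) ^ (tAV i).
Proof. by case: i => [|[|i]]; rewrite /hact /mv /tA /tAV /= ?conjgE; grp. Qed.

Hypothesis y3 : y 3 = 1.
Lemma hact_WA1 i j : (j < 3)%N -> hact (WA i) y j = y j.
Proof.
by case: i => [|[|i]]; do 3?case: j => [|j] //; move=> _; rewrite /hact /mv /= ?y3; grp; rewrite ?y3; grp.
Qed.
Lemma hact_WAV1 i j : (j < 3)%N -> hact (WAV i) y j = y j.
Proof.
by case: i => [|[|i]]; do 3?case: j => [|j] //; move=> _; rewrite /hact /mv /= ?y3; grp; rewrite ?y3; grp.
Qed.
End Tuple.

Lemma WA_all i : all (fun l => l.1 < 3)%N (WA i). Proof. by case: i => [|[|i]]. Qed.
Lemma WAV_all i : all (fun l => l.1 < 3)%N (WAV i). Proof. by case: i => [|[|i]]. Qed.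

(** Forgetting the fourth puncture kills its letter. *)
Definition kl : fg -> fg := fgext (fun j => if j == 3 then 1 else gen j).
Lemma klM : {morph kl : x y / x * y}. Proof. exact: fgextM. Qed.

Definition klgen (j : nat) := if j == 3 then 1 else gen j.

Lemma act_K (g : fg) : let y := bact (fgext A g) gen in
  (forall j, (j < 3)%N -> kl (y j) = gen j) /\
  exists2 h, y 3 = gen 3 ^ h & kl h = (fgext (fun i => (tA klgen i)^-1) g)^-1.
Proof.
elim/fg_ind: g => [|i g [IH1 [h IH2 IH3]]|i g [IH1 [h IH2 IH3]]] y.
- split=> [[|[|[|j]]] //|]; rewrite ?/y ?bact1; try by rewrite /kl fgextX.
  by exists 1; rewrite ?bact1 ?conjg1 //= /kl fgext1 invg1.
- set z := bact (fgext A g) gen in IH1 IH2 IH3.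
  have yE k : y k = hact (WA i) z k.
    by rewrite /y fgextM fgextX bactM A4_bw bact_bw ?WA_all.
  have kz3 : kl (z 3) = 1 by rewrite IH2 (morph_mulJ klM) /kl fgextX conj1g.
  have kz j : (j < 4)%N -> kl (z j) = klgen j.
    by rewrite ltnS leq_eqVlt => /orP[/eqP-> //|j3]; rewrite IH1 // /klgen ltn_eqF.
  split=> [j j3|].
    by rewrite yE [kl _](hact_morph _ _ klM) hact_WA1 //=; apply: IH1.
  exists (h * tA z i); first by rewrite yE hact_WA IH2 conjgM.
  rewrite klM IH3 fgextM fgextX invgM invgK; congr (_ * _).
  by case: (i) => [|[|k]]; rewrite /tA ?klM ?(morph_mulV klM) ?(morph_mulJ klM) ?klM ?(morph_mulV klM) ?kz.
- set z := bact (fgext A g) gen in IH1 IH2 IH3.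
  have yE k : y k = hact (WAV i) z k.
    by rewrite /y fgextM fgextV fgextX bactM A4V_bw bact_bw ?WAV_all.
  have kz3 : kl (z 3) = 1 by rewrite IH2 (morph_mulJ klM) /kl fgextX conj1g.
  have kz j : (j < 4)%N -> kl (z j) = klgen j.
    by rewrite ltnS leq_eqVlt => /orP[/eqP-> //|j3]; rewrite IH1 // /klgen ltn_eqF.
  split=> [j j3|].
    by rewrite yE [kl _](hact_morph _ _ klM) hact_WAV1 //=; apply: IH1.
  exists (h * tAV z i); first by rewrite yE hact_WAV IH2 conjgM.
  rewrite klM IH3 fgextM fgextV fgextX invgM !invgK; congr (_ * _).
  by case: (i) => [|[|k]]; rewrite /tA /tAV ?klM ?(morph_mulV klM) ?(morph_mulJ klM) ?klM
    ?(morph_mulV klM) ?kz // /klgen /= ?conjgE; grp.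
Qed.

(** The family [A] is constant from index 2 on, so larger indices are replaced by 2 before words are
    compared. *)
Definition gmin : fg -> fg := fgext (fun i => gen (minn i 2)).
Lemma gminM : {morph gmin : x y / x * y}. Proof. exact: fgextM. Qed.

Lemma A4_gmin g : fgext A g = fgext A (gmin g).
Proof.
rewrite (fgext_comp (fun i => gen (minn i 2)) (@fgextM _ A)).
by apply: eq_fgext => -[|[|[|i]]] /=; rewrite fgextX.
Qed.

(** The conjugator of [gen 3] commutes with it, hence is a power of it and dies under [kl]. By
    [act_K] the image of g under a substitution of the letters is then trivial, and this
    substitution is invertible. *)
Lemma K_faithful g : bact (fgext A g) gen 3 = gen 3 -> gmin g = 1.
Proof.
have [_ [h -> hE]] := act_K g => /conjg_fixP/commgP /commute_sym /commute_Fl [n hn].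
have k1 : kl h = 1.
  by case: hn => ->; rewrite ?(morph_mulV klM) /kl fgextXn fgextX expg1n ?invg1.
(* The inverse of the substitution occurring in [act_K]. This substitution is an involution on the
   first three letters, so the same formulas reappear. *)
pose th (i : nat) : fg :=
  if i == 0%N then ((gen 2)^-1 * (gen 1)^-1 * (gen 0)^-1 * gen 1 * gen 2)
  else if i == 1%N then (gen 2)^-1 * (gen 1)^-1 * gen 2 else (gen 2)^-1.
have /(congr1 (fgext th)) := hE; rewrite k1 fgextV => /esym/eqP.
rewrite fgext1 invg_eq1 => /eqP <-; rewrite (fgext_comp _ (@fgextM _ th)).
apply: eq_fgext => -[|[|i]]; rewrite /tA /klgen /= ?conjgE; grp;
  rewrite ?(fgextM, fgextV, fgextX) /th; grp => //; by rewrite minnE /=.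
Qed.

Lemma K_inj g : fgext A g = 1 -> gmin g = 1.
Proof. by move=> E; apply: K_faithful; rewrite E bact1. Qed.

Lemma K_torsion k n : (0 < n)%N -> range A k -> k ^+ n = 1 -> k = 1.
Proof.
move=> n0 [g ->]; rewrite -fgextXn => /K_inj; rewrite /gmin fgextXn => E.
by rewrite A4_gmin /gmin (fg_torsion_free n0 E).
Qed.

Lemma K_center k : range A k -> commute k (A 0) -> commute k (A 1) -> k = 1.
Proof.
case=> g -> c0 c1.
have H i : (i < 2)%N -> commute (fgext A g) (A i) -> commute (gmin g) (gen i).
  move=> i2 ci; apply/commgP/eqP; have := @K_inj [~ g, gen i].
  rewrite /commg !conjgE !fgextM !fgextV fgextX ci mulKg mulVg => /(_ erefl).
  by rewrite !gminM !(morph_mulV gminM) /gmin fgextX (_ : minn i 2 = i) //; lia.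
by rewrite A4_gmin (@commute_gen2 0 1 (gmin g)) // ?fgext1; apply: H.
Qed.
End CombedAction.
Import CombedAction.

(** * Ping-pong *)

Module PingPong.
Local Open Scope ring_scope.

Section PingPong.
Variables (R : comNzRingType).
Implicit Types (x y u v : {poly R}).

Definition psz (u : {poly R}) : nat := size (polyseq u).
Lemma psz0 : psz 0 = 0%N. Proof. by rewrite /psz size_poly0. Qed.

Lemma size_add_big u v : (psz v < psz u)%N ->
  psz (u + v) = psz u /\ lead_coef (u + v) = lead_coef u.
Proof. by rewrite /psz => h; rewrite size_polyDl // lead_coefDl. Qed.

Lemma size_add_big' u v : (psz u < psz v)%N ->
  psz (u + v) = psz v /\ lead_coef (u + v) = lead_coef v.
Proof. by rewrite addrC; apply: size_add_big. Qed.

Lemma size_mul_monic u v : v \is monic ->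
  (u != 0 -> psz (u * v) = (psz u + psz v).-1) /\ lead_coef (u * v) = lead_coef u.
Proof. by move=> vm; split; [move=> u0; rewrite /psz size_Mmonic | rewrite lead_coef_Mmonic]. Qed.

Definition Dp (k : nat) : {poly R} := 'X^k - 1.
Lemma Dp_monic k : Dp k.+1 \is monic. Proof. exact: monicXnsubC. Qed.
Lemma size_Dp k : psz (Dp k.+1) = k.+2. Proof. by rewrite /psz size_XnsubC. Qed.

Lemma size_X u k : u != 0 -> psz (u * 'X^k) = (psz u + k)%N.
Proof. by move=> u0; rewrite /psz size_mulXn // addnC. Qed.
Lemma lead_X u k : lead_coef (u * 'X^k) = lead_coef u.
Proof. by rewrite lead_coef_Mmonic ?monicXn. Qed.
Lemma size_D u k : u != 0 -> psz (u * Dp k.+1) = (psz u + k.+1)%N.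
Proof. by move=> u0; have [-> // _] := size_mul_monic u (Dp_monic k); rewrite size_Dp; lia. Qed.
Lemma lead_D u k : lead_coef (u * Dp k.+1) = lead_coef u.
Proof. by have [_ ->] := size_mul_monic u (Dp_monic k). Qed.

(* The four ping-pong domains are neighbourhoods, for the degree valuation, of the
   slopes y/x fixed by A and by B: 0 and 1+t (up to lower order), infinity and 1. *)
Definition ty (l : fg_letter) (w : {poly R} * {poly R}) : bool :=
  let: (x, y) := w in
  if l.1 == 0%N then
    if l.2 then [&& x != 0, psz y == (psz x).+1 & lead_coef x == lead_coef y]
    else (psz y < psz x)%N
  else
    if l.2 then [&& x != 0, psz y == psz x & lead_coef x == lead_coef y]
    else (y != 0) && ((x == 0) || (psz x + 2 <= psz y)%N).

Variable e : nat.

(** The action on row vectors in homogeneous coordinates: inverse letters are multiplied by a power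
    of the variable so as to remain polynomial. The case e = 0 is that of the squares of the first
    two generators of the braid group; the case e = 1 arises from a doubled strand. *)
Definition pact (w : {poly R} * {poly R}) (l : fg_letter) : {poly R} * {poly R} :=
  let: (x, y) := w in
  if l.1 == 0%N then
    if l.2 then (x + y * Dp e.+1, y * 'X^(e.+2)) else (x * 'X^(e.+2) - y * Dp e.+1, y)
  else if l.2 then (x * 'X^2, y + x * Dp 1 * 'X^1) else (x, y * 'X^2 - x * Dp 1 * 'X^1).

(** Multiplication by a monic polynomial adds degrees and keeps leading coefficients over any ring.
    In each sum below one term has strictly larger degree, so no cancellation of leading terms can
    occur. *)
Lemma ty_step l m w : (l.1 < 2)%N -> (m.1 < 2)%N -> l != linv m -> ty m w -> ty l (pact w l).
Proof.
have szN u : psz (- u) = psz u by rewrite /psz size_polyN.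
have s0 u : (u == 0) = (psz u == 0)%N by rewrite /psz size_poly_eq0.
have DX u : u != 0 -> psz (u * Dp 1 * 'X^1) = (psz u + 2)%N.
  by move=> u0; rewrite size_X ?s0 size_D //; lia.
have DXl u : lead_coef (u * Dp 1 * 'X^1) = lead_coef u by rewrite lead_X lead_D.
case: w => x y; case: l m => [[|[|//]] lb] [[|[|//]] mb] _ _ lm; case: lb mb lm => [] [] // _ /=.
- case/and3P=> x0 /eqP sy /eqP ll; have y0 : y != 0 by rewrite s0; lia.
  have [|s1 l1] := @size_add_big' x (y * Dp e.+1); first by rewrite size_D //; lia.
  by rewrite s0 s1 size_D // l1 lead_D size_X // lead_X eqxx andbT; lia.
- move=> sxy; have x0 : x != 0 by rewrite s0; lia.
  have [|s1 l1] := @size_add_big (x * 'X^(e.+2)) (- (y * Dp e.+1)).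
    rewrite szN size_X //; have [->|y0] := eqVneq y 0; first by rewrite mul0r psz0; lia.
    by rewrite size_D //; lia.
  by rewrite s1 size_X //; lia.
- case/and3P=> x0 /eqP sy /eqP ll; have y0 : y != 0 by rewrite s0; move: x0; rewrite s0; lia.
  have [|s1 l1] := @size_add_big' x (y * Dp e.+1); first by rewrite size_D //; lia.
  rewrite s0 s1 size_D // l1 lead_D size_X // lead_X eqxx andbT; move: y0; rewrite s0; lia.
- case/andP=> y0 xy.
  have [|s1 l1] := @size_add_big' x (y * Dp e.+1).
    by rewrite size_D //; case/orP: xy => [/eqP ->|]; rewrite ?psz0; lia.
  rewrite s0 s1 size_D // l1 lead_D size_X // lead_X eqxx andbT; move: y0; rewrite s0; lia.
- case/and3P=> x0 /eqP sy /eqP ll; have y0 : y != 0 by rewrite s0; move: x0; rewrite s0; lia.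
  have [|s1 l1] := @size_add_big (x * 'X^(e.+2)) (- (y * Dp e.+1)).
    by rewrite szN size_X // size_D //; lia.
  by rewrite s1 size_X //; lia.
- case/andP=> y0 xy; have [|s1 l1] := @size_add_big' (x * 'X^(e.+2)) (- (y * Dp e.+1)).
    rewrite szN size_D //; have [->|x0] := eqVneq x 0; first by rewrite mul0r psz0; lia.
    by rewrite size_X //; move: xy; rewrite (negPf x0) /=; lia.
  by rewrite s1 szN size_D //; lia.
- case/and3P=> x0 /eqP sy /eqP ll.
  have [|s1 l1] := @size_add_big' y (x * Dp 1 * 'X^1); first by rewrite DX //; lia.
  by rewrite s0 s1 l1 DX // DXl size_X // lead_X eqxx eqxx ?andbT; move: x0; rewrite s0; lia.
- move=> sxy; have x0 : x != 0 by rewrite s0; lia.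
  have [|s1 l1] := @size_add_big' y (x * Dp 1 * 'X^1); first by rewrite DX //; lia.
  by rewrite s0 s1 l1 DX // DXl size_X // lead_X eqxx eqxx ?andbT; lia.
- case/and3P=> x0 /eqP sy /eqP ll; have y0 : y != 0 by rewrite s0; lia.
  have [|s1 l1] := @size_add_big (y * 'X^2) (- (x * Dp 1 * 'X^1)).
    by rewrite szN DX // size_X //; lia.
  by rewrite s0 s1 size_X //; lia.
- move=> sxy; have x0 : x != 0 by rewrite s0; lia.
  have [|s1 l1] := @size_add_big' (y * 'X^2) (- (x * Dp 1 * 'X^1)).
    rewrite szN DX //; have [->|y0] := eqVneq y 0; first by rewrite mul0r psz0; lia.
    by rewrite size_X //; lia.
  by rewrite s0 s1 szN DX //; lia.
- case/and3P=> x0 /eqP sy /eqP ll.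
  have [|s1 l1] := @size_add_big' y (x * Dp 1 * 'X^1); first by rewrite DX //; lia.
  by rewrite s0 s1 l1 DX // DXl size_X // lead_X eqxx eqxx ?andbT; move: x0; rewrite s0; lia.
- case/andP=> y0 xy; have [|s1 l1] := @size_add_big (y * 'X^2) (- (x * Dp 1 * 'X^1)).
    rewrite szN [psz (y * _)]size_X //; have [->|x0] := eqVneq x 0; first by rewrite !mul0r psz0; move: y0; rewrite s0; lia.
    by rewrite DX //; move: xy; rewrite (negPf x0) /=; lia.
  by rewrite s0 s1 size_X //; move: y0 xy; rewrite !s0; lia.
Qed.

Lemma ty_word m s w : (m.1 < 2)%N -> all (fun l => l.1 < 2)%N s ->
  path (fun a b => b != linv a) m s -> ty m w -> ty (last m s) (foldl pact w s).
Proof.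
elim: s m w => //= l s IH m w m2 /andP[l2 s2] /andP[lm ps] tw.
by apply: IH => //; apply: ty_step tw.
Qed.

(** The domains are conical, so they make sense for pairs of Laurent polynomials once denominators
    are cleared. *)
Lemma ty_scale l w k : ty l (w.1 * 'X^k, w.2 * 'X^k) = ty l w.
Proof.
have z0 (u : {poly R}) : (u * 'X^k == 0) = (u == 0).
  have [->|u0] := eqVneq u 0; first by rewrite mul0r eqxx.
  by apply/negP => /eqP /(congr1 psz) /eqP; rewrite size_X // psz0 addn_eq0 size_poly_eq0 (negPf u0).
have p0 (u : {poly R}) : u != 0 -> (0 < psz u)%N by rewrite lt0n /psz size_poly_eq0.
case: w => x y /=; have [->|x0] := eqVneq x 0; have [->|y0] := eqVneq y 0;
  rewrite ?mul0r ?psz0 ?lead_X ?size_X //=; case: l => [[|i] []]; rewrite ?z0 ?eqxx ?(negPf y0) ?(negPf x0) //=;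
  rewrite ?lead_X; try (move: (p0 _ x0)); try (move: (p0 _ y0)); try lia.
Qed.

Lemma Xn_neq0 (u : {poly R}) k : u != 0 -> u * 'X^k != 0.
Proof.
move=> u0; apply/eqP => /(congr1 psz) /eqP; rewrite size_X // psz0 addn_eq0 /psz.
by rewrite size_poly_eq0 (negPf u0).
Qed.

(** Letters of index 1 preserve the line x = 0. The first letter of index 0 moves this line into its
    own domain, and the ping-pong starts there. *)
Lemma pact_0y s y : all (fun l => l.1 < 2)%N s -> fgred s -> y != 0 ->
  (last (1%N, false) s).1 = 0%N -> ty (last (1%N, false) s) (foldl pact (0, y) s).
Proof.
elim: s y => [|[i e'] s IH] y // => s2' rs y0.
have s2 : all (fun l => l.1 < 2)%N s by case/andP: s2'.
have i2 : (i < 2)%N by case/andP: s2'.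
move: (fgred_cons rs) => rs'.
have [i0|i0] := eqVneq i 0%N.
  move=> _; apply: (@ty_word (1%N, false) ((i, e') :: s)) => //=.
  - by move: rs; rewrite /fgred /= => ->; rewrite i0.
  - by rewrite y0 eqxx.
case: s IH {s2'} s2 rs' rs => [|m s] IH s2 rs' rs; first by rewrite /= => E; rewrite E eqxx in i0.
have E : pact (0, y) (i, e') = (0, if e' then y else y * 'X^2).
  by rewrite /pact /= (negPf i0); case: (e') => /=; rewrite !mul0r ?addr0 ?subr0.
move=> lm; rewrite -[foldl _ _ _]/(foldl pact (pact (0, y) (i, e')) (m :: s)) E.
by apply: (IH _ s2 rs' _ lm); case: (e'); rewrite // Xn_neq0.
Qed.

Lemma pact_x0 s x : all (fun l => l.1 < 2)%N s -> fgred s -> x != 0 ->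
  (last (0%N, false) s).1 = 1%N -> ty (last (0%N, false) s) (foldl pact (x, 0) s).
Proof.
elim: s x => [|[i e'] s IH] x // => s2' rs x0.
have s2 : all (fun l => l.1 < 2)%N s by case/andP: s2'.
have i2 : (i < 2)%N by case/andP: s2'.
move: (fgred_cons rs) => rs'.
have [i0|i0] := eqVneq i 0%N; last first.
  move=> _; apply: (@ty_word (0%N, false) ((i, e') :: s)) => //=.
  - by move: rs; rewrite /fgred /= => ->; rewrite andbT /linv /= xpair_eqE (negPf i0).
  - by rewrite psz0 lt0n /psz size_poly_eq0.
case: s IH {s2'} s2 rs' rs => [|m s] IH s2 rs' rs; first by rewrite /= => E; rewrite E in i0.
have E : pact (x, 0) (i, e') = (if e' then x else x * 'X^(e.+2), 0).
  by rewrite /pact /= i0 eqxx; case: (e') => /=; rewrite !mul0r ?addr0 ?subr0.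
move=> lm; rewrite -[foldl _ _ _]/(foldl pact (pact (x, 0) (i, e')) (m :: s)) E.
by apply: (IH _ s2 rs' _ lm); case: (e'); rewrite // Xn_neq0.
Qed.

(** If the last letter has index 0, the test vector (0, 1) is sent into the domain of that letter,
    to which it does not belong. If it has index 1, the vector (1, 0) plays the same part. *)
Lemma ping_pong s : all (fun l => l.1 < 2)%N s -> fgred s ->
  (forall v : {poly R} * {poly R}, v = (1, 0) \/ v = (0, 1) -> exists a b : nat,
     let w := foldl pact v s in
     (v.1 * 'X^a, v.2 * 'X^a) = (w.1 * 'X^b, w.2 * 'X^b)) -> s = [::].
Proof.
case: s => // l s s2 rs H; exfalso.
have n1 : (1 : {poly R}) != 0 by apply: oner_neq0.
have : (last l s).1 = 0%N \/ (last l s).1 = 1%N.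
  by have := allP s2 _ (mem_last l s); case: (last l s).1 => [|[|]] //; [left|right].
case=> E.
  have := pact_0y s2 rs n1 E; have [|a [b Eab]] := H (0, 1); first by right.
  rewrite -(ty_scale _ _ b) -Eab /= !mul0r E eqxx /= psz0 ltn0.
  by case: (last l s).2 => //; rewrite eqxx.
have := pact_x0 s2 rs n1 E; have [|a [b Eab]] := H (1, 0); first by left.
rewrite -(ty_scale _ _ b) -Eab /= !mul0r E eqxx /= psz0.
case: (last l s).2 => //; have := Xn_neq0 a n1 => /negPf ->; rewrite mul1r.
by rewrite /psz size_polyXn.
Qed.
End PingPong.
End PingPong.
Import PingPong.

(** * The Burau representation of pure braids *)

Module BurauPure.
Local Open Scope ring_scope.
Local Open Scope quotient_scope.

Section Iota.
Variable A : comNzRingType.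
Definition iota_l (q : {poly A}) : laurent A := laurent_monomial q 0.
Local Notation io := iota_l.
Local Notation t := (laurent_t A).
Local Notation tV := (laurent_tV A).

Lemma iotaD : {morph io : x y / x + y}.
Proof.
move=> x y; rewrite -[RHS]/(laurent_add _ _) /io /laurent_monomial pi_laurent_add.
by apply/laurentP; rewrite /= !expr0 !mulr1.
Qed.
Lemma iotaM : {morph io : x y / x * y}.
Proof.
move=> x y; rewrite -[RHS]/(laurent_mul _ _) /io /laurent_monomial pi_laurent_mul.
by apply/laurentP; rewrite /= !expr0 !mulr1.
Qed.
Lemma iota1 : io 1 = 1. Proof. by []. Qed.
Lemma iotaN : {morph io : x / - x}.
Proof. by move=> x; apply: (addIr (io x)); rewrite -iotaD !addNr. Qed.
Lemma iotaB : {morph io : x y / x - y}.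
Proof. by move=> x y; rewrite iotaD iotaN. Qed.
Lemma iotaX k : io ('X^k) = t ^+ k.
Proof.
elim: k => [|k IH]; first by rewrite !expr0.
by rewrite !exprS iotaM IH.
Qed.
Lemma iota_inj : injective io.
Proof. by move=> x y /laurentP; rewrite /= !expr0 !mulr1 => /eqP. Qed.
Lemma tK n : t ^+ n * tV ^+ n = 1.
Proof. by rewrite -exprMn laurent_tK expr1n. Qed.
Lemma iotaDp k : io (Dp A k) = t ^+ k - 1.
Proof. by rewrite /Dp iotaB iotaX iota1. Qed.
Lemma iotaMX x k : io (x * 'X^k) = io x * t ^+ k.
Proof. by rewrite iotaM iotaX. Qed.
Lemma iotaMD x k : io (x * Dp A k) = io x * (t ^+ k - 1).
Proof. by rewrite iotaM iotaDp. Qed.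
Lemma t_power_eq m n (x : laurent A) : x != 0 -> (exists k q, q != 0 /\ t ^+ k * x = io q) ->
  t ^+ m * tV ^+ n * x = x -> m = n.
Proof.
move=> x0 [k [q [q0 qE]]] E.
have : t ^+ m * (t ^+ k * x) = t ^+ n * (t ^+ k * x).
  rewrite -{2}E; rewrite !mulrA [_ * tV ^+ n]mulrC !mulrA.
  transitivity ((t ^+ n * tV ^+ n) * (t ^+ m * t ^+ k * x)); last by ring.
  by rewrite tK mul1r.
rewrite qE -!iotaX -!iotaM => /iota_inj /(congr1 (@psz A)).
by rewrite ![_ * q]mulrC !size_X // => /addnI.
Qed.
End Iota.

Section Burau.
Variables (p : nat).
Local Notation L := (laurent 'Z_p).
Local Notation t := (laurent_t 'Z_p).
Local Notation tV := (laurent_tV 'Z_p).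
Local Notation rho := (burau4_mod p).

Definition row3 (x y z : L) : 'rV[L]_3 := \row_j nth 0 [:: x; y; z] j.

Lemma row3E (r : 'rV[L]_3) : r = row3 (r 0 0) (r 0 1) (r 0 2%:R).
Proof.
apply/rowP => -[[|[|[|//]]] H]; rewrite !mxE /=; congr (r _ _); exact/val_inj.
Qed.

Lemma row3_0 x y z : row3 x y z 0 0 = x. Proof. by rewrite mxE. Qed.
Lemma row3_1 x y z : row3 x y z 0 1 = y. Proof. by rewrite mxE. Qed.
Lemma row3_2 x y z : row3 x y z 0 2%:R = z. Proof. by rewrite mxE. Qed.

Lemma rhoM a b : rho (a * b)%g = rho a *m rho b. Proof. exact: burau4_modM. Qed.
Lemma rho1 : rho 1%g = 1%:M. Proof. exact: burau4_mod_pi. Qed.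
Lemma rho_s i : rho (s4 i) = burau4_letter t tV (inord i, false).
Proof. by rewrite /s4 /bw burau4_mod_pi /= mulmx1. Qed.

Lemma rho_inv (r r' : 'rV[L]_3) x : r' *m rho x = r -> r *m rho x^-1%g = r'.
Proof. by move=> <-; rewrite -mulmxA -rhoM mulgV rho1 mulmx1. Qed.

Lemma row_s0 x y z : row3 x y z *m rho (s4 0) = row3 (- t * x + y) y z.
Proof.
rewrite rho_s /burau4_letter inordK //=; apply/rowP => -[[|[|[|//]]] H];
  rewrite !mxE !big_ord_recl !big_ord0 !mxE /=; ring.
Qed.
Lemma row_s1 x y z : row3 x y z *m rho (s4 1) = row3 x (t * x - t * y + z) z.
Proof.
rewrite rho_s /burau4_letter inordK //=; apply/rowP => -[[|[|[|//]]] H];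
  rewrite !mxE !big_ord_recl !big_ord0 !mxE /=; ring.
Qed.
Lemma row_s2 x y z : row3 x y z *m rho (s4 2) = row3 x y (t * y - t * z).
Proof.
rewrite rho_s /burau4_letter inordK //=; apply/rowP => -[[|[|[|//]]] H];
  rewrite !mxE !big_ord_recl !big_ord0 !mxE /=; ring.
Qed.

Section Free.
Variables (e : nat) (A B : braid 4) (adm : 'rV[L]_3 -> Prop) (c1 c2 : 'I_3).
Hypotheses (admA : forall r, adm r -> adm (r *m rho A)) (admAV : forall r, adm r -> adm (r *m rho A^-1%g))
  (admB : forall r, adm r -> adm (r *m rho B)) (admBV : forall r, adm r -> adm (r *m rho B^-1%g)).
Local Notation X r := (r 0 c1).
Local Notation Y r := (r 0 c2).
Hypotheses
  (AX : forall r, adm r -> X (r *m rho A) = X r * t ^+ e.+2 - Y r * (t ^+ e.+1 - 1))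
  (AY : forall r, adm r -> Y (r *m rho A) = Y r)
  (BX : forall r, adm r -> X (r *m rho B) = X r)
  (BY : forall r, adm r -> Y (r *m rho B) = Y r * t ^+ 2 - X r * (t ^+ 1 - 1) * t ^+ 1).

(** The polynomial pair gives the two chosen coordinates of [r] up to a power of t. *)
Definition Rep (r : 'rV[L]_3) (v : {poly 'Z_p} * {poly 'Z_p}) : Prop :=
  adm r /\ exists k, t ^+ k * X r = iota_l v.1 /\ t ^+ k * Y r = iota_l v.2.

Lemma Rep_step r v l : (l.1 < 2)%N -> Rep r v -> Rep (r *m rho (letter_val (s12 A B) l)) (pact e v l).
Proof.
have rV r' x : (r' *m rho x^-1%g) *m rho x = r' by rewrite -mulmxA -rhoM mulVg rho1 mulmx1.
case: v => x y; case: l => -[|[|//]] [] _ [ar [k [/= kx ky]]]; rewrite /letter_val /=.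
- split; first exact: admAV.
  exists (k + e.+2)%N; have a' := admAV ar.
  have := AX a'; have := AY a'; rewrite !rV => EY EX; split.
    by rewrite iotaD iotaMD -kx -ky EX -EY exprD; ring.
  by rewrite iotaMX -ky -EY exprD; ring.
- split; first exact: admA.
  by exists k; rewrite AX // AY //= iotaB iotaMX iotaMD -kx -ky; split=> //; ring.
- split; first exact: admBV.
  exists (k + 2)%N; have a' := admBV ar.
  have := BX a'; have := BY a'; rewrite !rV => EY EX; split.
    by rewrite iotaMX -kx EX exprD; ring.
  by rewrite iotaD iotaMX iotaMD -kx -ky EX EY exprD; ring.
- split; first exact: admB.
  by exists k; rewrite BX // BY //= iotaB !iotaMX iotaMD -kx -ky; split=> //; ring.
Qed.

Lemma Rep_word s r v : all (fun l => l.1 < 2)%N s -> Rep r v ->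
  Rep (r *m rho (word_val (s12 A B) s)) (foldl (pact e) v s).
Proof.
elim: s r v => [|l s IH] r v; first by rewrite /= rho1 mulmx1.
move=> /= /andP[l2 s2] Rrv; rewrite rhoM mulmxA; apply: IH => //; exact: Rep_step.
Qed.

Hypothesis start : forall x y : {poly 'Z_p}, exists r, [/\ adm r, X r = iota_l x & Y r = iota_l y].

(** A nontrivial word cannot even act by a power of t, since ping-pong sees only the projective
    action. The predicate [adm] allows both an invariant plane and a quotient plane. *)
Lemma free_scalar (g : fg) m n : all (fun l => l.1 < 2)%N g ->
  (forall r, adm r -> X (r *m rho (fgext (s12 A B) g)) = t ^+ m * tV ^+ n * X r /\
                      Y (r *m rho (fgext (s12 A B) g)) = t ^+ m * tV ^+ n * Y r) -> g = 1%g.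
Proof.
move=> g2 H; apply: fg_eq1; rewrite (@ping_pong 'Z_p e g g2 (fgP g)) // => v _.
have [r [ar rx ry]] := start v.1 v.2.
have Rr : Rep r v by split=> //; exists 0%N; rewrite !expr0 !mul1r.
have [_ [k [kx ky]]] := Rep_word g2 Rr; have [hx hy] := H r ar.
exists (k + m)%N, n => /=; move: kx ky; rewrite -/(fgext _ g) hx hy rx ry => kx ky.
congr pair; apply: iota_inj; rewrite !iotaMX -?kx -?ky exprD.
  transitivity ((t ^+ n * tV ^+ n) * (iota_l v.1 * (t ^+ k * t ^+ m))); last by ring.
  by rewrite tK mul1r.
transitivity ((t ^+ n * tV ^+ n) * (iota_l v.2 * (t ^+ k * t ^+ m))); last by ring.
by rewrite tK mul1r.
Qed.
End Free.

Local Notation a := (s4 0).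
Local Notation b := (s4 1).
Local Notation c := (s4 2).

(** The first two generators preserve the plane of rows whose last coordinate vanishes. *)
Lemma free3 (g : fg) m n : all (fun l => l.1 < 2)%N g ->
  (forall x y : L, row3 x y 0 *m rho (fgext (s12 (a * a) (b * b))%g g) =
     row3 (t ^+ m * tV ^+ n * x) (t ^+ m * tV ^+ n * y) 0) -> g = 1%g.
Proof.
move=> g2 H; pose adm (r : 'rV[L]_3) := r 0 2%:R = 0.
have admE r : adm r -> r = row3 (r 0 0) (r 0 1) 0 by move=> ar; rewrite {1}[r]row3E ar.
have sA x y : row3 x y 0 *m rho (a * a)%g = row3 (x * t ^+ 2 - y * (t ^+ 1 - 1)) y 0.
  by rewrite rhoM mulmxA !row_s0; congr row3; ring.
have sB x y : row3 x y 0 *m rho (b * b)%g = row3 x (y * t ^+ 2 - x * (t ^+ 1 - 1) * t ^+ 1) 0.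
  by rewrite rhoM mulmxA !row_s1; congr row3; ring.
have sAV x y : row3 x y 0 *m rho (a * a)^-1%g = row3 (tV ^+ 2 * (x + y * (t ^+ 1 - 1))) y 0.
  apply: rho_inv; rewrite sA; congr row3.
  by rewrite mulrAC [_ * t ^+ 2]mulrC tK mul1r addrK.
have sBV x y : row3 x y 0 *m rho (b * b)^-1%g = row3 x (tV ^+ 2 * (y + x * (t ^+ 1 - 1) * t ^+ 1)) 0.
  apply: rho_inv; rewrite sB; congr row3.
  by rewrite mulrAC [_ * t ^+ 2]mulrC tK mul1r addrK.
apply: (@free_scalar 0 (a * a)%g (b * b)%g adm 0 1 _ _ _ _ _ _ _ _ _ g m n) => //.
- by move=> r /admE ->; rewrite sA /adm row3_2.
- by move=> r /admE ->; rewrite sAV /adm row3_2.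
- by move=> r /admE ->; rewrite sB /adm row3_2.
- by move=> r /admE ->; rewrite sBV /adm row3_2.
- by move=> r /admE ->; rewrite sA !row3_0 !row3_1.
- by move=> r /admE ->; rewrite sA !row3_1.
- by move=> r /admE ->; rewrite sB !row3_0.
- by move=> r /admE ->; rewrite sB !row3_0 !row3_1.
- by move=> x y; exists (row3 (iota_l x) (iota_l y) 0); rewrite /adm row3_0 row3_1 row3_2.
- by move=> r /admE ->; rewrite H !row3_0 !row3_1.
Qed.

(** Here the plane is a quotient: under these two braids the first coordinate never contributes to
    the other two. *)
Lemma free2 (g : fg) m n : all (fun l => l.1 < 2)%N g ->
  (forall r : 'rV[L]_3, let r' := r *m rho (fgext (s12 (b * a * a * b) (c * c))%g g) in
     r' 0 1 = t ^+ m * tV ^+ n * r 0 1 /\ r' 0 2%:R = t ^+ m * tV ^+ n * r 0 2%:R) -> g = 1%g.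
Proof.
move=> g2 H.
have sA z x y : exists z', row3 z x y *m rho (b * a * a * b)%g = row3 z' (x * t ^+ 3 - y * (t ^+ 2 - 1)) y.
  by rewrite !rhoM !mulmxA row_s1 !row_s0 row_s1; eexists; congr row3; ring.
have sB z x y : row3 z x y *m rho (c * c)%g = row3 z x (y * t ^+ 2 - x * (t ^+ 1 - 1) * t ^+ 1).
  by rewrite rhoM mulmxA !row_s2; congr row3; ring.
apply: (@free_scalar 1 (b * a * a * b)%g (c * c)%g (fun=> True) 1 2%:R _ _ _ _ _ _ _ _ _ g m n) => //.
- by move=> r _; rewrite {1}[r]row3E; have [z' ->] := sA (r 0 0) (r 0 1) (r 0 2%:R); rewrite row3_1.
- by move=> r _; rewrite {1}[r]row3E; have [z' ->] := sA (r 0 0) (r 0 1) (r 0 2%:R); rewrite row3_2.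
- by move=> r _; rewrite {1}[r]row3E sB row3_1.
- by move=> r _; rewrite {1}[r]row3E sB row3_2.
- by move=> x y; exists (row3 0 (iota_l x) (iota_l y)); rewrite row3_1 row3_2.
Qed.

Lemma row_D3 x y : row3 x y 0 *m rho (D3 a b) = row3 (t ^+ 3 * x) (t ^+ 3 * y) 0.
Proof.
by rewrite /D3 !rhoM !mulmxA row_s0 row_s1 row_s0 row_s0 row_s1 row_s0; congr row3; ring.
Qed.

Lemma rho_D4 : rho (D4 a b c) = (t ^+ 4)%:M.
Proof.
apply/row_matrixP => i; rewrite !rowE mul_mx_scalar; move: (delta_mx _ _) => r.
rewrite [r]row3E; move: (r 0 0) (r 0 1) (r 0 2%:R) => x y z {r i}.
have -> : D4 a b c = (a * b * a * (a * b * a) * (c * b * a * a * b * c))%g.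
  by rewrite /D4 /D3 /A14 /A24 /A34; grp.
rewrite !rhoM !mulmxA !(row_s0, row_s1, row_s2); apply/rowP => -[[|[|[|//]]] H]; rewrite !mxE /=; ring.
Qed.

Lemma rho_s0X k : row3 1 0 0 *m rho (a ^+ k)%g = row3 ((- t) ^+ k) 0 0.
Proof.
elim: k => [|k IH]; first by rewrite expr0 rho1 mulmx1.
by rewrite expgSr rhoM mulmxA IH row_s0 addr0 exprS.
Qed.
End Burau.
End BurauPure.
Import BurauPure.

(** * The Burau representation at t = 1 *)

Module BurauAtOne.
Local Open Scope ring_scope.
Local Open Scope quotient_scope.

Section Affine.
Variable A : comNzRingType.

(* The triple (u, u^-1, c) is the affine map x |-> u x + c. *)
Record aff := Aff {affv : A * A * A; _ : affv.1.1 * affv.1.2 == 1}.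
HB.instance Definition _ := [isSub for affv].
HB.instance Definition _ := [Choice of aff by <:].
Implicit Types f g : aff.

Lemma affP f : (affv f).1.1 * (affv f).1.2 = 1. Proof. by apply/eqP; case: f. Qed.

Fact aff_mul_proof f g : ((affv f).1.1 * (affv g).1.1) * ((affv f).1.2 * (affv g).1.2) == 1.
Proof. by rewrite mulrACA !affP mulr1. Qed.
Definition aff_mul f g : aff :=
  @Aff ((affv f).1.1 * (affv g).1.1, (affv f).1.2 * (affv g).1.2,
        (affv f).2 + (affv f).1.1 * (affv g).2) (aff_mul_proof f g).
Fact aff_inv_proof f : (affv f).1.2 * (affv f).1.1 == 1. Proof. by rewrite mulrC affP. Qed.
Definition aff_inv f : aff :=
  @Aff ((affv f).1.2, (affv f).1.1, - ((affv f).1.2 * (affv f).2)) (aff_inv_proof f).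
Fact aff_one_proof : (1 : A) * 1 == 1. Proof. by rewrite mulr1. Qed.
Definition aff_one : aff := @Aff (1, 1, 0) aff_one_proof.

Fact aff_mulA : associative aff_mul.
Proof. by move=> f g h; apply: val_inj => /=; rewrite !mulrA mulrDr addrA !mulrA. Qed.
Fact aff_mul1 : left_id aff_one aff_mul.
Proof. by case=> [[[u v] c] H]; apply: val_inj => /=; rewrite !mul1r add0r. Qed.
Fact aff_1mul : right_id aff_one aff_mul.
Proof. by case=> [[[u v] c] H]; apply: val_inj => /=; rewrite !mulr1 mulr0 addr0. Qed.
Fact aff_mulV : left_inverse aff_one aff_inv aff_mul.
Proof.
move=> f; apply: val_inj => /=; rewrite [_.1.2 * _.1.1]mulrC !affP.
by rewrite addNr.
Qed.
Fact aff_Vmul : right_inverse aff_one aff_inv aff_mul.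
Proof.
move=> f; apply: val_inj => /=; rewrite [_.1.2 * _.1.1]mulrC !affP mulrN mulrA affP mul1r.
by rewrite subrr.
Qed.
HB.instance Definition _ := isGroup.Build aff aff_mulA aff_mul1 aff_1mul aff_mulV aff_Vmul.

Variables (t tV : A).
Hypothesis ttV : t * tV = 1.

Fact al_proof : tV * t == 1. Proof. by rewrite mulrC ttV. Qed.
(** When every letter is an affine map of slope [tV], the Hurwitz moves act linearly on the
    translation parts. On differences of consecutive translation parts this is the Burau
    representation. *)
Definition al (c : A) : aff := @Aff (tV, t, c) al_proof.

Definition lmv (l : nat * bool) (c : nat -> A) : nat -> A := fun j =>
  if l.2 then if j == l.1 then c l.1 + tV * (c l.1.+1 - c l.1)
              else if j == l.1.+1 then c l.1 else c j
  else if j == l.1 then c l.1.+1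
       else if j == l.1.+1 then c l.1.+1 + t * (c l.1 - c l.1.+1) else c j.
Definition lact w c := foldr lmv c w.

Lemma mv_al l c : mv l (al \o c) =1 al \o lmv l c.
Proof.
move=> j; rewrite /mv /lmv /=; case: l => i b /=.
case: b; do 2?case: eqP => //= _; apply: val_inj => /=.
  have E : tV * tV * t = tV by rewrite -mulrA [tV * t]mulrC ttV mulr1.
  have E2 : t * t * tV = t by rewrite -mulrA ttV mulr1.
  rewrite E E2 mulrN mulrA E; congr (_, _, _); ring.
have E : t * tV * tV = tV by rewrite ttV mul1r.
have E2 : tV * t * t = t by rewrite [tV * t]mulrC ttV mul1r.
by rewrite E E2 ttV; congr (_, _, _); ring.
Qed.

Lemma hact_al w c : hact w (al \o c) =1 al \o lact w c.
Proof.
elim: w => //= l w IH j; rewrite (eq_mv l IH); exact: mv_al.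
Qed.

(** The powers of [tV] form the diagonal change of basis that leads to the given Burau matrices. *)
Definition ecol (c : nat -> A) : 'cV[A]_3 :=
  \col_i nth 0 [:: c 1%N - c 0%N; tV * (c 2%N - c 1%N); tV ^+ 2 * (c 3%N - c 2%N)] i.

Lemma letter_lmv (l : 'I_4.-1 * bool) c :
  burau4_letter t tV l *m ecol c = ecol (lmv (val l.1, l.2) c).
Proof.
have t1 x : t * (tV * x) = x by rewrite mulrA ttV mul1r.
have t2 x : t * (tV ^+ 2 * x) = tV * x by rewrite expr2 -mulrA t1.
have t3 x : tV * (t * x) = x by rewrite mulrA [tV * t]mulrC ttV mul1r.
have t4 x : tV ^+ 2 * (t * x) = tV * x by rewrite expr2 -mulrA t3.
case: l => -[[|[|[|//]]] Hl] []; apply/colP => -[[|[|[|//]]] H];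
  rewrite !mxE !big_ord_recl !big_ord0 !mxE /lmv /=;
  rewrite ?(mulr0, mul0r, mul1r, mulr1, addr0, add0r);
  rewrite ?(mulrDr, mulrN, mulNr, opprK); rewrite ?(t1, t2, t3, t4); ring.
Qed.

Lemma burau_lact (w : braid_word 4) c : burau4_word t tV w *m ecol c = ecol (lact (wn w) c).
Proof.
elim: w => [|l w IH] /=; first by rewrite mul1mx.
by rewrite -mulmxA IH letter_lmv.
Qed.

Lemma ecol_surj (v : 'cV[A]_3) : exists c, ecol c = v.
Proof.
have t1 x : tV * (t * x) = x by rewrite mulrA [tV * t]mulrC ttV mul1r.
exists (nth 0 [:: 0; v 0 0; v 0 0 + t * v 1 0; v 0 0 + t * v 1 0 + t ^+ 2 * v 2%:R 0]).
apply/colP => -[[|[|[|//]]] H]; rewrite !mxE /=.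
- by rewrite subr0; congr (v _ _); apply: val_inj.
- by rewrite addrAC subrr add0r t1; congr (v _ _); apply: val_inj.
- by rewrite addrAC subrr add0r !expr2 -!mulrA !t1; congr (v _ _); apply: val_inj.
Qed.

Lemma eq_ecol c c' : (forall j, (j < 4)%N -> c j = c' j) -> ecol c = ecol c'.
Proof. by move=> E; rewrite /ecol !E. Qed.

(** Artin's action determines the Burau matrix: specialise the letters to affine maps, whose
    differences exhaust all column vectors. *)
Lemma burau_trivial (w : braid_word 4) : (forall j, (j < 4)%N -> hact (wn w) gen j = gen j) ->
  burau4_word t tV w = 1%:M.
Proof.
move=> H; have Mv (v : 'cV[A]_3) : burau4_word t tV w *m v = v.
  have [c <-] := ecol_surj v; rewrite burau_lact; apply: eq_ecol => j j4.
  pose h := fgext (al \o c).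
  have hg : h \o gen =1 al \o c by move=> k; rewrite /h /= fgextX.
  have := hact_al (wn w) c j; rewrite /= -(eq_hact (wn w) hg).
  rewrite -(hact_morph (wn w) gen (@fgextM _ (al \o c))) /= H // -/h.
  by rewrite -[h (gen j)]/((h \o gen) j) hg => -[].
apply/matrixP => i j; have /colP/(_ i) := Mv (delta_mx j 0).
by rewrite -colE !mxE => ->; rewrite eqxx andbT eq_sym.
Qed.

(* At t = 1 the letters permute the entries of c. *)
Lemma lact_perm w c : t = 1 -> tV = 1 -> lact w c =1 c \o pw w.
Proof.
move=> t1 tV1; elim: w => //= -[i b] w IH j; rewrite /lmv /= !IH t1 tV1 !mul1r /pw /= /sw /=.
by rewrite ![c _ + (_ - _)]addrC !subrK; case: b; case: (j == i); case: (j == i.+1).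
Qed.
End Affine.

Section Eval.
Variable A : comNzRingType.
Definition ev1 (x : laurent A) : A := (repr x).1.[1].
Lemma ev1_pi x : ev1 (\pi_(laurent A) x) = x.1.[1].
Proof.
have /(congr1 (horner^~ 1)) := laurent_repr x.
by rewrite /= !hornerM !hornerXn !expr1n !mulr1.
Qed.
Fact ev1_is_zmod : zmod_morphism ev1.
Proof.
elim/quotW=> x; elim/quotW=> y.
rewrite -[X in ev1 X]/(laurent_add _ (laurent_opp _)) pi_laurent_opp pi_laurent_add !ev1_pi /=.
by rewrite hornerD !hornerM !hornerXn !expr1n !mulr1 hornerN.
Qed.
Fact ev1_is_monoid : monoid_morphism ev1.
Proof.
split; first by rewrite [1]/(laurent_monomial 1 0) ev1_pi /= hornerC.
elim/quotW=> x; elim/quotW=> y.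
by rewrite -[X in ev1 X]/(laurent_mul _ _) pi_laurent_mul !ev1_pi /= hornerM.
Qed.
HB.instance Definition _ := GRing.isZmodMorphism.Build _ _ _ ev1_is_zmod.
HB.instance Definition _ := GRing.isMonoidMorphism.Build _ _ _ ev1_is_monoid.

Lemma ev1_burau (w : braid_word 4) :
  map_mx ev1 (burau4_word (laurent_t A) (laurent_tV A) w) = burau4_word 1 1 w.
Proof.
elim: w => [|l w IH] /=; first exact: map_mx1.
rewrite map_mxM IH; congr (_ *m _).
have Et : ev1 (laurent_t A) = 1 by rewrite ev1_pi /= hornerX.
have EtV : ev1 (laurent_tV A) = 1 by rewrite ev1_pi /= hornerC.
case: l => [[[|[|[|//]]] Hi] []]; apply/matrixP;
  move=> [[|[|[|//]]] H1] [[|[|[|//]]] H2]; rewrite !mxE /=;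
  by rewrite ?rmorphN ?rmorph0 ?rmorph1 /= ?Et ?EtV ?rmorph0 ?rmorph1.
Qed.
End Eval.

Local Notation rho := (burau4_mod _).

Lemma rho_word p (b : braid 4) : burau4_mod p b =
  burau4_word (laurent_t 'Z_p) (laurent_tV 'Z_p) (repr b).
Proof. by rewrite -{1}[b]reprK burau4_mod_pi. Qed.

Lemma pw_lt n w k : all (fun l => l.1.+1 < n)%N w -> (k < n)%N -> (pw w k < n)%N.
Proof.
elim: w k => //= l w IH k /andP[ln aw] kn; apply: IH => //=.
by rewrite /sw; do 2?case: eqP; lia.
Qed.

Lemma wn_all n (w : braid_word n.+2) : all (fun l => l.1.+1 < n.+2)%N (wn w).
Proof. by apply/allP => l /mapP[[i c] _ ->] /=; rewrite ltnS; case: i. Qed.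

Lemma pb_lt n (b : braid n.+2) k : (k < n.+2)%N -> (pb b k < n.+2)%N.
Proof. by apply: pw_lt; apply: wn_all. Qed.

Lemma pb_inj n (b : braid n) : injective (pb b).
Proof. by apply: (can_inj (g := pb b^-1%g)) => k; rewrite -pbM mulgV pb1. Qed.

(** At t = 1 the braid permutes the entries of c, and the matrix sees only their differences. If the
    matrix is the identity, permuting the entries amounts to adding a constant, for every c;
    indicator functions show that only the identity permutation does so. *)
Lemma rho_pure p (b : braid 4) : (1 < p)%N -> rho b = 1%:M :> 'M[laurent 'Z_p]_3 ->
  forall j, (j < 4)%N -> pb b j = j.
Proof.
move=> p1 rb.
have B1 : burau4_word (1 : 'Z_p) 1 (repr b) = 1%:M.
  by rewrite -ev1_burau -rho_word rb map_mx1.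
have E (c : nat -> 'Z_p) j : (j < 3)%N -> c (pb b j.+1) - c (pb b j) = c j.+1 - c j.
  have := burau_lact (mulr1 (1 : 'Z_p)) (repr b) c; rewrite B1 mul1mx => /colP E j3.
  have := E (Ordinal j3); rewrite !mxE /=.
  have H k := @lact_perm 'Z_p 1 1 (wn (repr b)) c erefl erefl k.
  by case: j j3 E => [|[|[|//]]] j3 E /=; rewrite ?mul1r ?expr1n ?mul1r !H.
have n1 : (1 : 'Z_p) != 0 by apply: oner_neq0.
have E' (c : nat -> 'Z_p) j : (j < 4)%N -> c (pb b j) = c j + (c (pb b 0%N) - c 0%N).
  elim: j => [|j IH] j4; first by rewrite addrC subrK.
  have := E c j j4 => /eqP; rewrite subr_eq => /eqP ->; rewrite IH ?(ltnW j4) //; ring.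
pose d k := fun j : nat => if j == k then 1 : 'Z_p else 0.
have p0 : pb b 0%N = 0%N.
  apply/eqP/negPn/negP => p0; have p04 : (pb b 0 < 4)%N by apply: pb_lt.
  (* For the indicator of [pb b 0] the added constant is 1. An index j other than 0 and [pb b 0]
     would then also be sent to [pb b 0]. *)
  have [j [j4 j0 jp]] : exists j, [/\ (j < 4)%N, j != 0%N & j != pb b 0].
    by case: (eqVneq (pb b 0) 1%N) => [->|?]; [exists 2 | exists 1%N]; split=> //; rewrite eq_sym.
  have := E' (d (pb b 0%N)) j j4; rewrite /d eqxx (negPf jp) [0%N == _]eq_sym (negPf p0).
  rewrite subr0 add0r; case: eqP => [/pb_inj j00|_ /esym/eqP]; first by rewrite j00 in j0.
  by rewrite (negPf n1).
move=> j j4; have := E' (d j) j j4; rewrite p0 subrr addr0 /d eqxx.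
by case: eqP => // _ /esym/eqP; rewrite (negPf n1).
Qed.

Lemma gen_conj_inj i j (h : fg) : (gen i = h * gen j * h^-1)%g -> i = j.
Proof.
move=> E; apply/eqP/negPn/negP => ij.
pose f k : fg := if k == i then gen 0 else 1%g.
have := congr1 (fgext f) E; rewrite !fgextM fgextV !fgextX /f eqxx eq_sym (negPf ij) mulg1 mulgV.
by move/(congr1 fgval).
Qed.

Lemma trivial_action_pure n (b : braid n) j : bact b gen j = gen j -> pb b j = j.
Proof. by have [h ->] := bact_conj b j => /esym/gen_conj_inj. Qed.

Section Letters2.
Local Open Scope group_scope.
Definition lt2 (g : fg) := all (fun l => l.1 < 2)%N (fgval g).
Lemma push_all (P : pred fg_letter) l w : P l -> all P w -> all P (push l w).
Proof. by case: w => [|m w] /=; [move=> ->|move=> Pl /andP[Pm Pw]; case: ifP => //= _; rewrite Pl Pm]. Qed.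
Lemma lt2M g h : lt2 g -> lt2 h -> lt2 (g * h).
Proof.
rewrite /lt2 fg_mulE => g2 h2; elim: (fgval g) g2 => //= l w IH /andP[l2 w2].
by apply: push_all => //; apply: IH.
Qed.
Lemma lt2V g : lt2 g -> lt2 g^-1.
Proof. by rewrite /lt2 fg_invE /finv all_rev all_map; apply: sub_all => -[]. Qed.
Lemma lt2_1 : lt2 1. Proof. by []. Qed.
Lemma lt2X i : (i < 2)%N -> lt2 (gen i). Proof. by rewrite /lt2 /= => ->. Qed.
Lemma lt2Xn g n : lt2 g -> lt2 (g ^+ n).
Proof. by move=> g2; elim: n => [|n IH]; rewrite ?expgS ?lt2M ?lt2_1. Qed.

(** The full twist is central, so its occurrences are collected in front of a word in the two
    squares, which is ready for ping-pong. A pair of natural exponents m and n stands for the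
    integer m - n, here and below. *)
Lemma pure12_split (G : groupType) (a b : G) (aba : a * b * a = b * a * b) g :
  exists m n g', [/\ lt2 g' & fgext (pure12 a b) g = D3 a b ^+ m * D3 a b ^- n * fgext (s12 (a * a) (b * b)) g'].
Proof.
have Da := D3a aba; have Db := D3b aba.
have cD x m n : commute (D3 a b) x -> x * (D3 a b ^+ m * D3 a b ^- n) = D3 a b ^+ m * D3 a b ^- n * x.
  move=> /commute_sym Dx; rewrite -[LHS]/(x * _); apply: commuteM; first exact: commuteX.
  exact/commuteV/commuteX.
have aux (D : G) m n : D^-1 * (D ^+ m * D ^- n) = D ^+ m * D ^- n.+1.
  rewrite mulgA expgSr invgM [RHS]mulgA; congr (_ * _).
  by apply: commute_sym; apply: commuteV; apply/commute_sym/commuteX.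
elim/fg_ind: g => [|i g [m [n [g' [g2 E]]]]|i g [m [n [g' [g2 E]]]]].
- by exists 0%N, 0%N, 1; rewrite expg0 invg1 !mulg1.
- case: i => [|[|i]]; rewrite fgextM fgextX E /=.
  + exists m, n, (gen 0 * g'); split; first by rewrite lt2M.
    by rewrite fgextM fgextX /= mulgA cD ?mulgA //; apply: commuteM.
  + exists m, n, (gen 1 * g'); split; first by rewrite lt2M.
    by rewrite fgextM fgextX /= mulgA cD ?mulgA //; apply: commuteM.
  + by exists m.+1, n, g'; split=> //; rewrite expgS !mulgA.
- case: i => [|[|i]]; rewrite fgextM fgextV fgextX E /=.
  + exists m, n, ((gen 0)^-1 * g'); split; first by rewrite lt2M // lt2V.
    by rewrite fgextM fgextV fgextX /= mulgA cD ?mulgA //; apply/commuteV/commuteM.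
  + exists m, n, ((gen 1)^-1 * g'); split; first by rewrite lt2M // lt2V.
    by rewrite fgextM fgextV fgextX /= mulgA cD ?mulgA //; apply/commuteV/commuteM.
  + by exists m, n.+1, g'; split=> //; rewrite mulgA aux.
Qed.
End Letters2.
End BurauAtOne.
Import BurauAtOne.

(** * Periodic braids in the kernel *)

Module PeriodicKernel.
Local Open Scope group_scope.
Local Open Scope quotient_scope.

Local Notation a := (s4 0).
Local Notation b := (s4 1).
Local Notation c := (s4 2).
Local Notation A := (A4 a b c).
Local Notation rho := (burau4_mod _).
Local Notation DD := (D4 a b c).

Lemma fgval_inj (g h : fg) : fgval g = fgval h -> g = h. Proof. exact: val_inj. Qed.

Section Calc.
(* Evaluation on plain words, where [vm_compute] can be used. *)
Definition mvl (l : nat * bool) (y : nat -> seq fg_letter) : nat -> seq fg_letter := fun j =>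
  if l.2 then if j == l.1 then fmul (fmul (y l.1) (y l.1.+1)) (finv (y l.1))
              else if j == l.1.+1 then y l.1 else y j
  else if j == l.1 then y l.1.+1
       else if j == l.1.+1 then fmul (fmul (finv (y l.1.+1)) (y l.1)) (y l.1.+1) else y j.
Lemma fgval_hact w (y : nat -> fg) j :
  fgval (hact w y j) = foldr mvl (fun j => fgval (y j)) w j.
Proof.
elim: w j => //= l w IH j; rewrite /mv /mvl.
by case: l.2; do 2?case: eqP => _; rewrite ?fg_mulE ?fg_invE ?IH.
Qed.
End Calc.

Section Tuples.
Variables (G : groupType) (y : nat -> G).
Definition delta4 (y : nat -> G) : G := y 0%N * y 1%N * y 2 * y 3.

Lemma delta4_hact w : all (fun l => l.1 < 3)%N w -> delta4 (hact w y) = delta4 y.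
Proof.
elim: w => //= -[i e] w IH /andP[i3 /IH <-]; move: (hact w y) => z.
by case: i i3 => [|[|[|//]]] _; case: e; rewrite /delta4 /mv /=; grp.
Qed.

Lemma from_gen j : y j = fgext y (gen j). Proof. by rewrite fgextX. Qed.

Lemma bact_from_gen n (x : braid n) j : bact x y j = fgext y (bact x gen j).
Proof.
rewrite [RHS](bact_morph x gen (@fgextM _ y)); apply: eq_bact => k; exact: from_gen.
Qed.
End Tuples.

Lemma DD_bw : DD = bw 2 [seq (i, false) | i <- [:: 0; 1; 0; 0; 1; 0; 2; 1; 0; 0; 1; 2]]%N.
Proof.
by rewrite bw_val /= /letter_val /= /D4 /D3 /A14 /A24 /A34; grp.
Qed.

(** Both sides are natural in the tuple, so it suffices to evaluate the word of the full twist on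
    the free generators, by computation. *)
Lemma DD_act (G : groupType) (y : nat -> G) j : (j < 4)%N -> bact DD y j = y j ^ delta4 y.
Proof.
move=> j4; rewrite bact_from_gen.
suff -> : bact DD gen j = gen j ^ delta4 gen.
  by rewrite (morph_mulJ (@fgextM _ y)) /delta4 !fgextM !fgextX.
rewrite DD_bw bact_bw //; apply: fgval_inj; rewrite fgval_hact conjgE /delta4 !(fg_mulE, fg_invE).
by case: j j4 => [|[|[|[|//]]]] _; vm_compute.
Qed.

Definition s3 (i : nat) : braid 3 := bw 1 [:: (i, false)].

Lemma D3_act3 (G : groupType) (y : nat -> G) j : (j < 3)%N ->
  bact (D3 (s3 0) (s3 1)) y j = y j ^ (y 0%N * y 1%N * y 2).
Proof.
move=> j3; rewrite bact_from_gen.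
suff -> : bact (D3 (s3 0) (s3 1)) gen j = gen j ^ (gen 0 * gen 1 * gen 2).
  by rewrite (morph_mulJ (@fgextM _ y)) !fgextM !fgextX.
have -> : D3 (s3 0) (s3 1) = bw 1 [seq (i, false) | i <- [:: 0; 1; 0; 0; 1; 0]]%N.
  by rewrite /D3 /s3 -!bw_cat.
rewrite bact_bw //; apply: fgval_inj; rewrite fgval_hact conjgE !(fg_mulE, fg_invE).
by case: j j3 => [|[|[|//]]] _; vm_compute.
Qed.

Lemma bact_low n (G : groupType) (x : braid n.+2) (y y' : nat -> G) :
  (forall j, (j < n.+2)%N -> y j = y' j) ->
  (forall j, (j < n.+2)%N -> bact x y j = bact x y' j) /\ (forall j, (n.+2 <= j)%N -> bact x y j = y j).
Proof. by move=> E; apply: hact_low E; apply: wn_all. Qed.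

Lemma delta4_bact (G : groupType) (x : braid 4) (y : nat -> G) : delta4 (bact x y) = delta4 y.
Proof. by apply: delta4_hact; have := wn_all (repr x); apply: sub_all. Qed.

Lemma DDX_act (G : groupType) (y : nat -> G) m n j : (j < 4)%N ->
  bact (DD ^+ m * DD ^- n) y j = y j ^ (delta4 y ^+ m * delta4 y ^- n).
Proof.
have E1 k (z : nat -> G) i : (i < 4)%N -> bact (DD ^+ k) z i = z i ^ (delta4 z ^+ k).
  elim: k i => [|k IH] i i4; first by rewrite bact1 conjg1.
  by rewrite expgS bactM DD_act // delta4_bact IH // expgSr [RHS]conjgM.
have E2 k (z : nat -> G) i : (i < 4)%N -> bact (DD ^- k) z i = z i ^ (delta4 z ^- k).
  move=> i4; have := E1 k (bact (DD ^- k) z) i i4; rewrite -bactM mulgV bact1 delta4_bact => ->.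
  by rewrite conjgK.
move=> j4; rewrite bactM E1 // delta4_bact E2 //; move: (delta4 y) => d; rewrite -conjgM.
congr (_ ^ _); apply: commuteX; apply: commute_sym; apply: commuteV; exact: commuteX.
Qed.

Lemma K_kill (G : groupType) (y : nat -> G) g : y 3 = 1 -> forall j, (j < 4)%N -> bact (fgext A g) y j = y j.
Proof.
move=> y3; elim/fg_ind: g => [|i g IH|i g IH] j j4; first by rewrite fgext1 bact1.
- rewrite fgextM fgextX bactM A4_bw bact_bw ?WA_all //.
  have z3 : bact (fgext A g) y 3 = 1 by rewrite IH.
  move: j4; rewrite ltnS leq_eqVlt => /orP[/eqP->|j3]; last by rewrite hact_WA1 // IH // ltnW.
  by rewrite hact_WA z3 conj1g y3.
- rewrite fgextM fgextV fgextX bactM A4V_bw bact_bw ?WAV_all //.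
  have z3 : bact (fgext A g) y 3 = 1 by rewrite IH.
  move: j4; rewrite ltnS leq_eqVlt => /orP[/eqP->|j3]; last by rewrite hact_WAV1 // IH // ltnW.
  by rewrite hact_WAV z3 conj1g y3.
Qed.

Lemma pb_range n (f : nat -> braid n) x k : (forall i, pb (f i) k = k) -> range f x -> pb x k = k.
Proof.
move=> fk [g ->]; elim/fg_ind: g => [|i g IH|i g IH]; first by rewrite fgext1 pb1.
  by rewrite fgextM fgextX pbM fk.
rewrite fgextM fgextV fgextX pbM (_ : pb (f i)^-1 k = k) //.
by apply: (pb_inj (b := f i)); rewrite -pbM mulVg pb1 fk.
Qed.

Lemma pb_s n i : (i < n.+1)%N -> pb (bw n [:: (i, false)]) =1 sw i.
Proof. by move=> i_n k; rewrite pb_bw //= i_n. Qed.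

Lemma pw_WA i k : pw (WA i) k = k.
Proof.
case: i => [|[|i]].
- by rewrite -[LHS]/(sw 2 (sw 1 (sw 0 (sw 0 (sw 1 (sw 2 k)))))) !swK.
- by rewrite -[LHS]/(sw 2 (sw 1 (sw 1 (sw 2 k)))) !swK.
- by rewrite -[LHS]/(sw 2 (sw 2 k)) !swK.
Qed.

Lemma pb_K k i : range A k -> pb k i = i.
Proof. by apply: pb_range => j; rewrite A4_bw pb_bw ?WA_all ?pw_WA. Qed.

Section Rep3.
Variable n : nat.
Let x0 := bw n.+1 [:: (0%N, false)].
Let x1 := bw n.+1 [:: (1%N, false)].
Lemma rep3_pure r : (r < 6)%N -> pb (rep3 x0 x1 r) 0 = 0%N -> pb (rep3 x0 x1 r) 1 = 1%N -> r = 0%N.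
Proof.
by do 6?case: r => [|r] //; rewrite /rep3 /= ?pbM !pb_s.
Qed.
Lemma pb_pure12 x k : range (pure12 x0 x1) x -> pb x k = k.
Proof.
by apply: pb_range => -[|[|i]] /=; rewrite ?/D3 !pbM !pb_s //= ?swK.
Qed.
Lemma pure_form x : range (s12 x0 x1) x -> pb x 0 = 0%N -> pb x 1 = 1%N ->
  exists m n g, lt2 g /\ x = D3 x0 x1 ^+ m * D3 x0 x1 ^- n * fgext (s12 (x0 * x0) (x1 * x1)) g.
Proof.
have aba : x0 * x1 * x0 = x1 * x0 * x1 by apply: (@bw_adj n.+1 0).
case=> g ->; have [r [h [r6 ->]]] := three_braid_form aba g => p0 p1.
have ph k : pb (fgext (pure12 x0 x1) h) k = k by apply: pb_pure12; exists h.
rewrite !pbM !ph in p0 p1; have -> := rep3_pure r6 p0 p1.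
have [m [k [g' [g2 ->]]]] := pure12_split aba h.
by exists m, k, g'; rewrite /rep3 /= mul1g.
Qed.
End Rep3.

Lemma central_split (G : groupType) (D k : G) m n : (forall z, commute D z) ->
  (D * k^-1) ^+ m * (D * k^-1) ^- n = (k ^- m * k ^+ n) * (D ^+ m * D ^- n).
Proof.
move=> Dc; have E j : (D * k^-1) ^+ j = k ^- j * D ^+ j.
  by rewrite expgMn // expVgn; apply/commute_sym/commuteX/commute_sym.
rewrite !E invgM invgK -!mulgA; congr (_ * _); rewrite !mulgA.
have cz : commute (D ^+ m * D ^- n) (k ^+ n).
  by apply/commute_sym/commuteM; [|apply: commuteV]; apply/commuteX/commute_sym.
by rewrite [LHS]cz !mulgA.
Qed.

Local Close Scope group_scope.
Local Open Scope ring_scope.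
Arguments pb {n} b k%_N.
Arguments gen i%_N.
Arguments sw i%_N k%_N.

Section Kernel.
Variable p : nat.
Hypothesis p1 : (1 < p)%N.
Local Notation t := (laurent_t 'Z_p).
Local Notation tV := (laurent_tV 'Z_p).
Local Notation rho := (burau4_mod p).

Lemma row_D3X m n (x y : laurent 'Z_p) :
  row3 x y 0 *m rho (D3 a b ^+ m * D3 a b ^- n)%g =
  row3 (t ^+ (3 * m) * tV ^+ (3 * n) * x) (t ^+ (3 * m) * tV ^+ (3 * n) * y) 0.
Proof.
have E k u v : row3 u v 0 *m rho (D3 a b ^+ k)%g = row3 (t ^+ (3 * k) * u) (t ^+ (3 * k) * v) 0.
  elim: k u v => [|k IH] u v; first by rewrite muln0 expr0 rho1 mulmx1 !mul1r.
  by rewrite expgS rhoM mulmxA row_D3 IH mulnS exprD; congr row3; rewrite mulrCA mulrA.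
have F z : t ^+ (3 * n) * (t ^+ (3 * m) * tV ^+ (3 * n) * z) = t ^+ (3 * m) * z.
  transitivity ((t ^+ (3 * n) * tV ^+ (3 * n)) * (t ^+ (3 * m) * z)); first by ring.
  by rewrite tK mul1r.
by rewrite rhoM mulmxA E; apply: rho_inv; rewrite E !F.
Qed.

Lemma row_DDX m n (r : 'rV[laurent 'Z_p]_3) :
  r *m rho (DD ^+ m * DD ^- n)%g = (t ^+ (4 * m) * tV ^+ (4 * n)) *: r.
Proof.
have E k (u : 'rV[laurent 'Z_p]_3) : u *m rho (DD ^+ k)%g = t ^+ (4 * k) *: u.
  elim: k u => [|k IH] u; first by rewrite muln0 expr0 rho1 mulmx1 scale1r.
  by rewrite expgS rhoM mulmxA rho_D4 mul_mx_scalar IH scalerA mulnS exprD; congr (_ *: _); rewrite mulrC.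
rewrite rhoM mulmxA E; apply: rho_inv; rewrite E scalerA; congr (_ *: _).
transitivity ((t ^+ (4 * n) * tV ^+ (4 * n)) * t ^+ (4 * m)); first by ring.
by rewrite tK mul1r.
Qed.

Lemma one_neq0 : (1 : laurent 'Z_p) != 0. Proof. exact: oner_neq0. Qed.

Lemma t_power1 m n : t ^+ m * tV ^+ n = 1 -> m = n.
Proof.
move=> E; apply: (@t_power_eq 'Z_p m n 1 one_neq0); last by rewrite mulr1.
by exists 0%N, 1; rewrite oner_neq0 expr0 mul1r iota1.
Qed.

(** The full twist of three strands is scalar on the plane of [free3], so the word in the two
    squares is scalar as well, hence trivial. A remaining twist would show as a power of t. *)
Lemma pure3_kernel (y : braid 4) : range (s12 a b) y -> pb y 0 = 0%N -> pb y 1 = 1%N ->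
  rho y = 1%:M -> y = 1%g.
Proof.
move=> Ry p0 py1 ry; have [m [n [g [g2 E]]]] := pure_form Ry p0 py1.
have g1 : g = 1%g.
  apply: (@free3 p g (3 * n) (3 * m) g2) => u v.
  have -> : fgext (s12 (a * a)%g (b * b)%g) g = ((D3 a b ^+ n * D3 a b ^- m) * y)%g.
    rewrite E; move: (fgext _ _) => W; move: (D3 a b) => d.
    by rewrite !mulgA mulgVK mulgV mul1g.
  by rewrite rhoM mulmxA row_D3X ry mulmx1.
move: E; rewrite g1 fgext1 mulg1 => E.
have : row3 1 0 0 *m rho y = row3 1 0 0 by rewrite ry mulmx1.
rewrite E row_D3X => /rowP/(_ 0); rewrite !mxE /= mulr1 => /t_power1 mn.
have -> : m = n by lia.
by rewrite mulgV.
Qed.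

Lemma B_words y : range (s12 a b) y -> exists2 w, all (fun l => l.1 < 2)%N w & y = bw 2 w.
Proof. by apply: range_bw => -[|i] /=; [exists 0%N | exists 1%N]. Qed.

Lemma B_fix3 (G : groupType) y (z : nat -> G) : range (s12 a b) y -> bact y z 3%N = z 3%N.
Proof.
move=> /B_words[w aw ->]; rewrite bact_bw; last by apply: sub_all aw => l /=; lia.
have [_ H] := @hact_low 3 G w z z aw (fun j _ => erefl); exact: H.
Qed.

(** A braid on the first three strands fixes the fourth letter, and among the combed braids only the
    trivial one does so. *)
Lemma KB_trivial x : range A x -> range (s12 a b) x -> x = 1%g.
Proof.
case=> g -> /(@B_fix3 _ _ gen) /K_faithful E.
by rewrite A4_gmin E fgext1.
Qed.

Lemma surj4 (x : braid 4) : range (s123 a b c) x.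
Proof.
have [w aw ->] := bw_surj x; apply: (@bw_range 2 3) aw => -[|[|[|i]]] //.
Qed.

Lemma combing4 x : pb x 3 = 3%N -> exists k y, [/\ range A k, range (s12 a b) y & x = (k * y)%g].
Proof.
have [g ->] := surj4 x; have [k [y [j [Kk By j4 ->]]]] := combing aba4 bcb4 ac4 g => p3.
exists k, y; split=> //.
have pk i : pb k i = i by apply: pb_K.
have py : pb y 3 = 3%N.
  have [w aw ->] := B_words By; rewrite pb_bw; last by apply: sub_all aw => l /=; lia.
  elim: w aw {By p3} => //= l w IH /andP[l2 /IH E]; rewrite /pw /= (_ : sw l.1 3 = 3%N) //.
  by rewrite /sw; do !case: eqP; lia.
rewrite !pbM pk py in p3; suff -> : j = 0%N by rewrite mulg1.
by move: p3; do 4?case: j j4 => [|j] j4 //; rewrite /rep4 /= ?pbM !pb_s.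
Qed.

(** Forgetting the fourth puncture shows that the three-strand factor acts trivially. Its Burau
    matrix is then the identity, and [pure3_kernel] removes it. The other factor fixes the fourth
    letter, so [K_faithful] applies. *)
Theorem faithful (x : braid 4) : (forall j, (j < 4)%N -> bact x gen j = gen j) -> x = 1%g.
Proof.
move=> tx; have px j : (j < 4)%N -> pb x j = j by move=> /tx; apply: trivial_action_pure.
have [k [y [[g kE] By E]]] := combing4 (px 3 isT).
have kz j : (j < 3)%N -> bact y gen j = gen j.
  move=> j3; pose z := bact y gen.
  have zl : forall i, (i < 4)%N -> kl (z i) = klgen i.
    move=> i i4; have := tx i i4; rewrite E bactM => /(congr1 kl).
    rewrite [kl (bact _ _ _)](bact_morph k z klM) kE K_kill //; first by move=> /= ->; rewrite /kl fgextX.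
    by rewrite /= /z B_fix3 // /kl fgextX.
  have [w aw yE] := B_words By.
  have := zl j (ltnW j3); rewrite [kl (z j)](bact_morph y gen klM) /klgen ltn_eqF //.
  have aw' : all (fun l => l.1 < 3)%N w by apply: sub_all aw => l /=; lia.
  rewrite yE !bact_bw // => <-.
  have kg i : (i < 3)%N -> gen i = (kl \o gen) i by move=> i3; rewrite /= /kl fgextX ltn_eqF.
  by have [H _] := @hact_low 3 _ w gen (kl \o gen) aw kg; apply: H.
have ty : forall j, (j < 4)%N -> bact y gen j = gen j.
  by move=> j; rewrite ltnS leq_eqVlt => /orP[/eqP->|/kz //]; rewrite B_fix3.
have y1 : y = 1%g.
  apply: pure3_kernel => //; try exact/trivial_action_pure/ty.
  rewrite rho_word; apply: burau_trivial => //; exact: laurent_tK.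
move: E; rewrite y1 mulg1 kE => E.
have /K_faithful g1 : bact (fgext A g) gen 3%N = gen 3 by rewrite -E tx.
by rewrite E A4_gmin g1 fgext1.
Qed.

Lemma expKB k y n : range A k -> range (s12 a b) y ->
  exists2 k', range A k' & ((k * y) ^+ n = k' * y ^+ n)%g.
Proof.
move=> Kk By; elim: n => [|n [k' Kk' E]]; first by exists 1%g; rewrite ?mulg1.
exists (k' * k ^ (y ^- n))%g.
  apply: rangeM => //; apply: (K_B aba4 bcb4 ac4) => //; apply: rangeV.
  by elim: n {E} => [|n IH]; rewrite ?expgS; [apply: range1 | apply: rangeM].
by rewrite expgSr E conjgE invgK expgSr !mulgA mulgVK.
Qed.

Lemma commutator_lt2 g h : lt2 g -> lt2 h -> lt2 [~ g, h]%g.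
Proof. by move=> g2 h2; rewrite /commg conjgE !lt2M ?lt2V. Qed.

Lemma fgext_comm (f : nat -> braid 4) g i : commute (fgext f g) (f i) -> fgext f [~ g, gen i]%g = 1%g.
Proof. by move=> cg; rewrite /commg conjgE !fgextM !fgextV fgextX cg mulKg mulVg. Qed.

Theorem periodic_kernel (x : braid 4) : rho x = 1%:M -> periodic_braid x -> x = 1%g.
Proof.
move=> rx [N N0 cN]; have px := rho_pure p1 rx.
have [k [y [Kk By xE]]] := combing4 (px 3 isT).
have [k' Kk' xN] := expKB N Kk By.
have yy n : range (s12 a b) (y ^+ n)%g.
  by elim: n => [|n IH]; rewrite ?expgS; [apply: range1 | apply: rangeM].
(* The power of x is central. Hence the commutator of [y ^+ N] with a three-strand braid lies both
   in the combed subgroup and in the three-strand subgroup, which meet trivially. *)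
have cy z : range (s12 a b) z -> commute (y ^+ N)%g z.
  move=> Bz; have := cN z; rewrite xE xN => E.
  have : (k'^-1 * k' ^ z^-1)%g = (y ^+ N * z * y ^- N * z^-1)%g.
    move: (y ^+ N)%g E => Y E; apply: (mulgI k'); rewrite mulVKg conjgE invgK !mulgA.
    by rewrite [in RHS](E : k' * Y * z = z * (k' * Y))%g !mulgA mulgK.
  move=> F; have : (y ^+ N * z * y ^- N * z^-1)%g = 1%g.
    apply: KB_trivial.
      rewrite -F; apply: rangeM; first exact: rangeV.
      exact: (K_B aba4 bcb4 ac4 (rangeV Bz)).
    by do !apply: rangeM => //; apply: rangeV.
  by move/(congr1 (fun u => (u * z * y ^+ N)%g)); rewrite mul1g !mulgVK.
have Ba : range (s12 a b) a by exact: (range_gen (s12 a b) 0).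
have Bb : range (s12 a b) b by exact: (range_gen (s12 a b) 1).
have [p0 p1'] : pb y 0 = 0%N /\ pb y 1 = 1%N.
  have pk i : pb k i = i by apply: pb_K.
  by have := px 0%N isT; have := px 1%N isT; rewrite xE !pbM !pk.
have [m [n [g [g2 yE]]]] := pure_form By p0 p1'.
pose W := fgext (s12 (a * a) (b * b))%g; pose d := (D3 a b ^+ m * D3 a b ^- n)%g.
have dc z : range (s12 a b) z -> commute d z.
  case=> h ->; apply/commute_sym/commuteM.
    by apply/commuteX/commute_sym/commute_D3/aba4.
  by apply/commuteV/commuteX/commute_sym/commute_D3/aba4.
have WB h : range (s12 a b) (W h).
  rewrite /W; elim/fg_ind: h => [|[|i] h IH|[|i] h IH]; rewrite ?fgext1 ?fgextM ?fgextV ?fgextX //=;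
  by apply: rangeM => //; try apply: rangeV; apply: rangeM.
have yNE : (y ^+ N = d ^+ N * W (g ^+ N))%g.
  by rewrite yE expgMn; [rewrite /W fgextXn | exact: (dc _ (WB g))].
have cW z : range (s12 a b) z -> commute (W (g ^+ N)%g) z.
  move=> Bz; have -> : (W (g ^+ N) = d ^- N * y ^+ N)%g by rewrite yNE mulKg.
  apply/commute_sym/commuteM; last exact/commute_sym/cy.
  exact/commuteV/commuteX/commute_sym/dc.
(* The commutator of [g ^+ N] with a letter represents the trivial braid, so it is trivial in the
   free group by [free3]. Then g is trivial, as a free group has no torsion and no centre in rank
   two. *)
have gN i : (i < 2)%N -> commute (g ^+ N)%g (gen i).
  move=> i2; apply/commgP/eqP; apply: (@free3 p _ 0 0).
    by apply: commutator_lt2; [exact: lt2Xn | exact: lt2X].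
  move=> u v; rewrite (@fgext_comm (s12 (a * a) (b * b))%g); last first.
    by apply: cW; case: i i2 => [|[|//]] _ /=; apply: rangeM.
  by rewrite rho1 mulmx1 expr0 !mul1r.
have g1 : g = 1%g.
  apply: (fg_torsion_free N0); apply: (@commute_gen2 0 1) => //; exact: gN.
move: yE; rewrite g1 fgext1 mulg1 => yE.
(* The turn of the fourth strand around the others, by which the two full twists differ. It lets x
   be rewritten as a central twist times a combed braid [k2], some power of which is central. *)
pose kap := (A14 a b c * A24 b c * A34 c)%g.
have Kkap : range A kap.
  by apply: rangeM; [apply: rangeM|]; [exact: (range_gen A 0) | exact: (range_gen A 1) | exact: (range_gen A 2)].
have D4c z : commute DD z by have [h ->] := surj4 z; exact: commute_D4 aba4 bcb4 ac4 h.
have D3E' : D3 a b = (DD * kap^-1)%g by rewrite /D4 mulgK.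
have KX z j : range A z -> range A (z ^+ j)%g.
  by move=> Kz; elim: j => [|j IH]; rewrite ?expgS; [apply: range1 | apply: rangeM].
have [k2 Kk2 xE2] : exists2 k2, range A k2 & x = (k2 * (DD ^+ m * DD ^- n))%g.
  exists (k * (kap ^- m * kap ^+ n))%g.
    by apply: rangeM Kk _; apply: rangeM (rangeV (KX _ _ Kkap)) (KX _ _ Kkap).
  by rewrite xE yE D3E' (central_split kap m n D4c); exact: mulgA.
have k2N : (k2 ^+ N)%g = 1%g.
  have cz z : commute (k2 ^+ N)%g z.
    have -> : (k2 ^+ N = x ^+ N * (DD ^+ m * DD ^- n) ^- N)%g.
      rewrite xE2 expgMn ?mulgK //; apply/commuteM; first exact/commuteX/commute_sym.
      exact/commuteV/commuteX/commute_sym.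
    apply/commute_sym/commuteM; first exact/commute_sym/cN.
    apply/commuteV/commuteX/commuteM; first exact/commuteX/commute_sym.
    exact/commuteV/commuteX/commute_sym.
  by apply: K_center => //; apply: KX.
have k21 : k2 = 1%g by apply: K_torsion N0 Kk2 k2N.
move: xE2; rewrite k21 mul1g => xE2.
have : row3 1 0 0 *m rho x = row3 1 0 0 by rewrite rx mulmx1.
rewrite xE2 row_DDX => /rowP/(_ 0); rewrite !mxE /= mulr1 => /t_power1 mn.
have -> : m = n by lia.
by rewrite mulgV.
Qed.
End Kernel.
End PeriodicKernel.
Import PeriodicKernel.

(** * Reductions of braids on four strands *)

Module StrandReduction.
Local Open Scope group_scope.
Local Open Scope quotient_scope.

Local Notation a := (s4 0).
Local Notation b := (s4 1).
Local Notation c := (s4 2).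
Local Notation DD := (D4 a b c).

Section Inverse.
Variable G : groupType.
Definition winv (w : seq (nat * bool)) := rev [seq (l.1, ~~ l.2) | l <- w].
Lemma hact_winv w (y : nat -> G) : hact (winv w) (hact w y) =1 y.
Proof.
elim: w y => //= -[i e] w IH y j; rewrite /winv /= rev_cons -cats1 hact_cat -/(winv w) -[RHS](IH y j).
apply: eq_hact => k /=; rewrite -{2}[e]negbK; exact: mvK.
Qed.
End Inverse.
Lemma all_winv (P : pred nat) w : all (fun l => P l.1) w -> all (fun l => P l.1) (winv w).
Proof. by rewrite /winv all_rev all_map; apply: sub_all => -[]. Qed.

(* Only the full twists of two strands preserve the order of the strands. *)
Lemma two_strands (G : groupType) (y : nat -> G) w : all (fun l => l.1 < 1)%N w ->
  exists m n, let d := y 0%N * y 1%N in let z := d ^+ m * d ^- n in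
  if odd (size w) then hact w y 0%N = y 1%N ^ z /\ hact w y 1%N = (y 0%N ^ y 1%N) ^ z
  else hact w y 0%N = y 0%N ^ z /\ hact w y 1%N = y 1%N ^ z.
Proof.
have [u uE] : exists u, u = y 0%N by exists (y 0%N).
have [v vE] : exists v, v = y 1%N by exists (y 1%N).
rewrite -uE -vE.
have aux (D : G) m n : D^-1 * (D ^+ m * D ^- n) = D ^+ m * D ^- n.+1.
  rewrite mulgA expgSr invgM [RHS]mulgA; congr (_ * _).
  by apply: commute_sym; apply: commuteV; apply/commute_sym/commuteX.
have aux' (D : G) m n : D * (D ^+ m * D ^- n) = D ^+ m.+1 * D ^- n by rewrite mulgA expgS.
have J z (s t : G) : (s * t) ^ z = s ^ z * t ^ z by exact: conjMg.
elim: w => [|[i e] w IH] /=.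
  by move=> _; exists 0%N, 0%N; rewrite !expg0 mulgV !conjg1 uE vE.
case/andP=> i0 /IH [m [n]]; have -> : i = 0%N by lia.
case: (odd (size w)) => /= -[E0 E1]; case: e; rewrite /mv /= E0 E1.
- by exists m, n; rewrite -conjVg -!J; split=> //; congr (_ ^ _); rewrite conjgE; grp.
- exists m.+1, n; rewrite -aux'; move: (_ ^+ m * _) => z; rewrite !conjgE; split; grp; reflexivity.
- exists m, n.+1; rewrite -aux; move: (_ ^+ m * _) => z; rewrite !conjgE; split; grp; reflexivity.
- by exists m, n; rewrite -conjVg -!J; split=> //; congr (_ ^ _); rewrite conjgE; grp.
Qed.

Definition subst_at (i : nat) (g : fg) : fg -> fg := fgext (fun k => if k == i then g else gen k).
Lemma subst_atM i g : {morph subst_at i g : x y / x * y}. Proof. exact: fgextM. Qed.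
Lemma subst_gen i g k : subst_at i g (gen k) = if k == i then g else gen k.
Proof. exact: fgextX. Qed.

Lemma nth_morph (h : fg -> fg) (hM : {morph h : x y / x * y}) s : h \o nth 1 s =1 nth 1 (map h s).
Proof.
move=> j; elim: s j => [|x s IH] [|j] /=; rewrite ?(morph_mul1 hM) //; exact: IH.
Qed.

(** Hurwitz transitivity is about conjugates of letters. An automorphism turning a product of
    several letters into one letter lets a block of strands be treated as a single strand. *)
Lemma hurwitz_auto (th th' : fg -> fg) (thM : {morph th : x y / x * y}) (th'M : {morph th' : x y / x * y})
  (thK : cancel th th') (s : seq (fg * nat)) (Y : seq fg) (cs : seq nat) :
  map cval s = map th Y -> size s = size cs -> foldr (fun x y => th x * y) 1 Y = genprod cs ->
  exists2 w, all (fun l => l.1.+1 < size s)%N w & hact w (nth 1 Y) =1 nth 1 (map (fun k => th' (gen k)) cs).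
Proof.
move=> sY sc E; have [|w aw H] := hurwitz_transitive sc.
  rewrite -E; elim: s Y sY {sc E} => [|q s IH] [|x Y] //= [-> /IH ->] //.
exists w => // j; have := H j; rewrite sY => /(congr1 th').
rewrite [th' (hact _ _ _)](hact_morph w _ th'M) [th' (nth _ _ _)](nth_morph th'M) -map_comp /= => <-.
apply: eq_hact => k; rewrite [RHS](nth_morph th'M) -map_comp.
by rewrite (eq_map (g := id)) ?map_id // => x /=; rewrite thK.
Qed.

Section Red.
Variable p : nat.
Hypothesis p1 : (1 < p)%N.

Lemma D4c z : commute DD z.
Proof. by have [h ->] := surj4 z; exact: commute_D4 aba4 bcb4 ac4 h. Qed.

Lemma bact_gen_conj (x : braid 4) j : (forall j, (j < 4)%N -> pb x j = j) -> (j < 4)%N ->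
  exists h, bact x gen j = cval (h, j).
Proof. by move=> px j4; have [h ->] := bact_conj x j; exists h; rewrite px. Qed.

Lemma pb_DDX m n j : (j < 4)%N -> pb (DD ^+ m * DD ^- n) j = j.
Proof.
move=> j4; have [h] := bact_conj (DD ^+ m * DD ^- n) j; rewrite DDX_act //; move: (_ * _) (pb _ _) => z k.
rewrite conjgE => E; apply/esym/(@gen_conj_inj _ _ (z * h)).
by apply: (mulgI z^-1); apply: (mulIg z); move: E; grp.
Qed.

(** The block of the first three strands and the fourth strand form a tuple of length two, which
    moves by a power of the full twist. After untwisting, the braid preserves the product of the
    first three letters and fixes the fourth letter. Hurwitz transitivity realises the same effect
    by a three-strand braid, and the two agree because Artin's action is faithful. *)
Lemma reduce3 (x : braid 4) g : (forall j, (j < 4)%N -> pb x j = j) ->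
  bact x gen 0 * bact x gen 1%N * bact x gen 2 = g * (gen 0 * gen 1 * gen 2) * g^-1 ->
  exists y m n, range (s12 a b) y /\ x = y * (DD ^+ m * DD ^- n).
Proof.
move=> px E; have [h hE] := bact_gen_conj px (isT : (3 < 4)%N).
pose c3 := gen 0 * gen 1 * gen 2; pose Yc := g * c3 * g^-1.
pose th := subst_at 2 ((gen 0 * gen 1)^-1 * gen 2); pose th' := subst_at 2 c3.
have thK : cancel th th'.
  move=> u; rewrite /th /th' /subst_at (fgext_comp _ (@fgextM _ _)) -[RHS]fgext_id.
  apply: eq_fgext => k /=; case: (eqVneq k 2) => [->|k2].
    by rewrite fgextM fgextV fgextM !fgextX /= /c3; grp.
  by rewrite fgextX (negPf k2).
have thc : th c3 = gen 2 by rewrite /th /c3 !subst_atM !subst_gen /=; grp.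
have thM : {morph th : u v / u * v} by exact: subst_atM.
have th3 : th (gen 3) = gen 3 by rewrite /th subst_gen.
have c3E : c3 = gen 0 * gen 1 * gen 2 by [].
have YcE : Yc = g * c3 * g^-1 by [].
have [th'2 th'3] : th' (gen 2) = c3 /\ th' (gen 3) = gen 3 by rewrite /th' !subst_gen.
have th'M : {morph th' : u v / u * v} by exact: subst_atM.
clearbody Yc th th'; clearbody c3; rewrite -c3E -YcE in E.
have [||| w aw wE] := @hurwitz_auto th th' thM th'M thK
    [:: (th g, 2); (th h, 3)] [:: Yc; bact x gen 3] [:: 2; 3].
- by rewrite /= hE YcE /cval !thM !(morph_mulV thM) thc th3.
- by [].
- rewrite /= mulg1 /genprod /= mulg1 -thM.
  have -> : Yc * bact x gen 3 = c3 * gen 3 by rewrite -E c3E; exact: delta4_bact.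
  by rewrite thM thc th3.
have wE0 : hact w (nth 1 [:: Yc; bact x gen 3]) =1 nth 1 [:: c3; gen 3].
  by move=> j; rewrite wE /= th'2 th'3.
have aw1 : all (fun l => l.1 < 1)%N (winv w) by apply: (@all_winv (fun i => i < 1)%N).
have YE j : nth 1 [:: Yc; bact x gen 3] j = hact (winv w) (nth 1 [:: c3; gen 3]) j.
  by rewrite -(hact_winv w (nth 1 [:: Yc; bact x gen 3]) j); apply: eq_hact.
have [m [n]] := two_strands (nth 1 [:: c3; gen 3]) aw1.
rewrite -!YE /=; case: ifP => [_ [H _]|_ [H0 H1]].
  (* An odd number of half twists would make the block conjugate to the fourth letter; killing all
     letters but the first tells them apart. *)
  pose f k : fg := if k == 0%N then gen 0 else 1.
  have := congr1 (fgext f) H; rewrite (morph_mulJ (@fgextM _ f)) fgextX /f /= conj1g.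
  rewrite YcE c3E !fgextM fgextV !fgextX /f /= !mulg1 => /(congr1 (fun u => u ^ fgext f g)).
  by rewrite conj1g conjgE; grp => /(congr1 fgval).
have deltaE : c3 * gen 3 = delta4 gen by rewrite c3E.
rewrite deltaE in H0 H1.
pose x' := x * (DD ^+ n * DD ^- m).
have cz : (delta4 gen ^+ m * delta4 gen ^- n) * (delta4 gen ^+ n * delta4 gen ^- m) = 1 :> fg.
  by rewrite !mulgA mulgVK mulgV.
have x'E j : (j < 4)%N -> bact x' gen j = bact x gen j ^ (delta4 gen ^+ n * delta4 gen ^- m).
  move=> j4; rewrite bactM.
  have [H _] := @bact_low 2 _ x (bact (DD ^+ n * DD ^- m) gen)
    ((fun u => u ^ (delta4 gen ^+ n * delta4 gen ^- m)) \o gen) (fun k k4 => DDX_act gen n m k4).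
  rewrite H // -(bact_morph x gen) // => u v; exact: conjMg.
have px' j : (j < 4)%N -> pb x' j = j by move=> j4; rewrite pbM px // pb_DDX.
have [h0 E0] := bact_gen_conj px' (isT : (0 < 4)%N).
have [h1 E1] := bact_gen_conj px' (isT : (1 < 4)%N).
have [h2 E2] := bact_gen_conj px' (isT : (2 < 4)%N).
have c3' : bact x' gen 0 * bact x' gen 1%N * bact x' gen 2 = c3.
  by rewrite !x'E // -!conjMg E H0 -conjgM cz conjg1.
have [|| w' aw' w'E] := @hurwitz_transitive [:: (h0, 0%N); (h1, 1%N); (h2, 2)] [:: 0; 1; 2]%N; first by [].
  by rewrite /cprod /genprod /= -E0 -E1 -E2 !mulg1 !mulgA c3' c3E.
have aw2 : all (fun l => l.1.+1 < 3)%N w' by [].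
have w'x : bw 2 w' * x' = 1.
  apply: (faithful p1) => j j4; rewrite bactM bact_bw; last by apply: sub_all aw2 => l /=; lia.
  have [L1 L2] := hact_low (y := bact x' gen) (y' := nth 1 [:: bact x' gen 0; bact x' gen 1%N; bact x' gen 2]) aw2
    ltac:(by move=> [|[|[|//]]] _).
  move: j4; rewrite ltnS leq_eqVlt => /orP[/eqP->|j3].
    by rewrite L2 // x'E // H1 -conjgM cz conjg1.
  by rewrite L1 // E0 E1 E2 w'E; case: j j3 => [|[|[|//]]].
exists x', m, n; split.
  have -> : x' = (bw 2 w')^-1 by apply: (mulgI (bw 2 w')); rewrite w'x mulgV.
  by apply: rangeV; apply: (@bw_range 2 2) => // -[|[|]].
rewrite /x'; move: {px H0 H1 px' x'E E0 E1 E2 c3' w'x x' E hE} DD => d; grp; reflexivity.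
Qed.

End Red.
End StrandReduction.
Import StrandReduction.

(** * Reducible braids in the kernel *)

Module ReductionKernel.
Local Open Scope group_scope.
Local Open Scope quotient_scope.

Local Notation a := (s4 0).
Local Notation b := (s4 1).
Local Notation c := (s4 2).
Local Notation DD := (D4 a b c).

Section Fuse.
Variable G : groupType.
Implicit Type y : nat -> G.
(* Fusing the first two strands: the double of the first strand of a 3-braid. *)
Definition fuse y : nat -> G := nth 1 [:: y 0%N * y 1%N; y 2; y 3].

Lemma eq_fuse y y' : y =1 y' -> fuse y =1 fuse y'. Proof. by move=> E [|[|[|j]]]; rewrite /fuse /= ?E. Qed.

Lemma fuse_baab y j : (j < 3)%N -> fuse (bact (b * a * a * b) y) j = bact (s3 0 * s3 0) (fuse y) j.
Proof.
have -> : b * a * a * b = bw 2 [:: (1, false); (0, false); (0, false); (1, false)]%N.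
  by rewrite /s4 -!bw_cat.
have -> : s3 0 * s3 0 = bw 1 [:: (0, false); (0, false)]%N by rewrite /s3 -!bw_cat.
case: j => [|[|[|//]]] _; rewrite /fuse /= !bact_bw // /hact /= /mv /=; grp; reflexivity.
Qed.

Lemma fuse_cc y j : (j < 3)%N -> fuse (bact (c * c) y) j = bact (s3 1 * s3 1) (fuse y) j.
Proof.
have -> : c * c = bw 2 [:: (2, false); (2, false)]%N by rewrite /s4 -!bw_cat.
have -> : s3 1 * s3 1 = bw 1 [:: (1, false); (1, false)]%N by rewrite /s3 -!bw_cat.
case: j => [|[|[|//]]] _; rewrite /fuse /= !bact_bw // /hact /= /mv /=; grp; reflexivity.
Qed.

(** On fused tuples the four-strand braid acts as the three-strand one. Twists inside the doubled
    strand are invisible, since they preserve the product of its two letters. *)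
Definition fuses (x : braid 4) (x' : braid 3) :=
  forall y j, (j < 3)%N -> fuse (bact x y) j = bact x' (fuse y) j.
Lemma fuses1 : fuses 1 1.
Proof. by move=> y j _; rewrite bact1; apply: eq_fuse => k; rewrite bact1. Qed.
Lemma fusesM x z x' z' : fuses x x' -> fuses z z' -> fuses (x * z) (x' * z').
Proof.
move=> Hx Hz y j j3; rewrite bactM (eq_fuse (bactM x z y)) Hx //.
by have [-> //] := @bact_low 1 _ x' (fuse (bact z y)) (bact z' (fuse y)) (fun k k3 => Hz y k k3).
Qed.
Lemma fusesV x x' : fuses x x' -> fuses x^-1 x'^-1.
Proof.
move=> H y j j3.
have E k : (k < 3)%N -> bact x' (fuse (bact x^-1 y)) k = fuse y k.
  by move=> k3; rewrite -H //; apply: eq_fuse => i; rewrite -bactM mulgV bact1.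
have [/(_ j j3) <- _] := @bact_low 1 _ x'^-1 _ _ E.
by rewrite -bactM mulVg bact1.
Qed.
Lemma fusesX x x' m : fuses x x' -> fuses (x ^+ m) (x' ^+ m).
Proof. by move=> H; elim: m => [|m IH]; rewrite ?expgS; [exact: fuses1|exact: fusesM]. Qed.

Lemma fuses_DD : fuses DD (D3 (s3 0) (s3 1)).
Proof.
move=> y j j3; rewrite D3_act3 //.
case: j j3 => [|[|[|//]]] _; rewrite /fuse /= ?DD_act // -?conjMg /delta4 -!mulgA //.
Qed.

Lemma fuses_W g : lt2 g -> fuses (fgext (s12 (b * a * a * b) (c * c)) g) (fgext (s12 (s3 0 * s3 0) (s3 1 * s3 1)) g).
Proof.
move=> _; elim/fg_ind: g => [|i g IH|i g IH]; rewrite ?fgext1; first exact: fuses1.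
  by rewrite !fgextM !fgextX; apply: fusesM IH; case: i => [|i]; [exact: fuse_baab | exact: fuse_cc].
rewrite !fgextM !fgextV !fgextX; apply: fusesM IH; apply: fusesV.
by case: i => [|i]; [exact: fuse_baab | exact: fuse_cc].
Qed.
End Fuse.

Lemma power_word w : all (fun l => l.1 < 1)%N w -> exists i j, bw 2 w = a ^+ i * a ^- j.
Proof.
elim: w => [|[k e] w IH] /=; first by exists 0%N, 0%N; rewrite bw_nil !expg0 mulgV.
case/andP=> k1 /IH [i [j E]]; have -> : k = 0%N by lia.
rewrite -cat1s bw_cat E; case: e.
  exists i, j.+1; rewrite bw_inv -/a expgSr invgM !mulgA; congr (_ * _).
  by apply: commute_sym; apply: commuteV; apply/commute_sym/commuteX.
by exists i.+1, j; rewrite -/a expgS mulgA.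
Qed.

Section Red.
Variable p : nat.
Hypothesis p1 : (1 < p)%N.
(** The fused tuple defines a pure three-strand braid [be]. The full twist and the two squares have
    doubles among the four-strand braids, so [be] lifts to some C. What remains of x after dividing
    by C fixes the fused tuple, hence only twists the two fused strands around each other. *)
Lemma reduce2 (x : braid 4) g : (forall j, (j < 4)%N -> pb x j = j) ->
  bact x gen 0 * bact x gen 1%N = g * (gen 0 * gen 1) * g^-1 ->
  exists m n h i j, lt2 h /\
    x = DD ^+ m * DD ^- n * fgext (s12 (b * a * a * b) (c * c)) h * (a ^+ i * a ^- j).
Proof.
move=> px E.
have [h2 h2E] := bact_gen_conj px (isT : (2 < 4)%N).
have [h3 h3E] := bact_gen_conj px (isT : (3 < 4)%N).
pose z := gen 0 * gen 1; pose Z := g * z * g^-1.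
pose th := subst_at 1 ((gen 0)^-1 * gen 1); pose th' := subst_at 1 z.
have thK : cancel th th'.
  move=> u; rewrite /th /th' /subst_at (fgext_comp _ (@fgextM _ _)) -[RHS]fgext_id.
  apply: eq_fgext => k /=; case: (eqVneq k 1%N) => [->|k2].
    by rewrite fgextM fgextV !fgextX /= /z; grp.
  by rewrite fgextX (negPf k2).
have thz : th z = gen 1 by rewrite /th /z !subst_atM !subst_gen /=; grp.
have thM : {morph th : u v / u * v} by exact: subst_atM.
have [th2 th3] : th (gen 2) = gen 2 /\ th (gen 3) = gen 3 by rewrite /th !subst_gen.
have zE : z = gen 0 * gen 1 by [].
have ZE : Z = g * z * g^-1 by [].
have [th'1 th'2 th'3] : [/\ th' (gen 1) = z, th' (gen 2) = gen 2 & th' (gen 3) = gen 3].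
  by rewrite /th' !subst_gen.
have th'M : {morph th' : u v / u * v} by exact: subst_atM.
clearbody Z th th'; clearbody z; rewrite -zE -ZE in E.
pose y := nth 1 [:: Z; bact x gen 2; bact x gen 3].
have yE : fuse (bact x gen) =1 y by move=> j; rewrite /fuse /y E.
have y0E : fuse gen =1 nth 1 [:: z; gen 2; gen 3] by move=> j; rewrite /fuse zE.
have [||| w aw wE] := @hurwitz_auto th th' thM th'M thK
    [:: (th g, 1%N); (th h2, 2); (th h3, 3)] [:: Z; bact x gen 2; bact x gen 3] [:: 1; 2; 3]%N.
- by rewrite /= h2E h3E ZE /cval !thM !(morph_mulV thM) thz th2 th3.
- by [].
- rewrite /= mulg1 /genprod /= mulg1 -!thM.
  have -> : Z * (bact x gen 2 * bact x gen 3) = z * gen 2 * gen 3.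
    by rewrite -E zE mulgA; exact: (delta4_bact x gen).
  by rewrite !thM thz th2 th3 mulgA.
have aw2 : all (fun l => l.1 < 2)%N (winv w) by apply: (@all_winv (fun i => i < 2)%N); apply: sub_all aw => l /=.
pose be := bw 1 (winv w).
have beE j : y j = bact be (fuse gen) j.
  rewrite /be bact_bw // -(hact_winv w y j) ; apply: eq_hact => k.
  by rewrite /y wE /= th'1 th'2 th'3 y0E.
have pbe j : (j < 3)%N -> pb be j = j.
  move=> j3; have [h hE] := bact_conj be j.
  have := beE j; rewrite bact_from_gen hE !fgextM fgextV fgextX.
  (* Killing the second letter turns the fused block into a single letter, after which conjugates of
     letters reveal the permutation of [be]. *)
  pose q := fgext (fun k => nth 1 [:: gen 0; 1; gen 1%N; gen 2] k).
  have qM : {morph q : u v / u * v} by exact: fgextM.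
  have qz : q z = gen 0 by rewrite zE qM /q !fgextX /= mulg1.
  have qf k : (k < 3)%N -> q (fuse gen k) = gen k.
    by rewrite y0E; case: k => [|[|[|//]]] _ //=; rewrite ?qz // /q fgextX.
  have [h' hE'] : exists h', q (y j) = h' * gen j * h'^-1.
    case: j j3 {hE} => [|[|[|//]]] _; rewrite /y /= ?ZE ?h2E ?h3E /cval !qM (morph_mulV qM) ?qz.
    - by exists (q g).
    - by exists (q h2); rewrite /q !fgextX.
    - by exists (q h3); rewrite /q !fgextX.
  move=> /(congr1 q); rewrite hE' !qM (morph_mulV qM) qf ?pb_lt //.
  move: (pb be j) (q _) => k u F; apply/esym/(@gen_conj_inj _ _ (h'^-1 * u)).
  by apply: (mulgI h'); apply: (mulIg h'^-1); move: F; grp.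
have [m [n [g' [g2 be']]]] : exists m n g', lt2 g' /\ be = D3 (s3 0) (s3 1) ^+ m * D3 (s3 0) (s3 1) ^- n *
    fgext (s12 (s3 0 * s3 0) (s3 1 * s3 1)) g'.
  apply: (@pure_form 0); [|exact: pbe|exact: pbe].
  by apply: (@bw_range 1 2) => // -[|[|]].
pose C := DD ^+ m * DD ^- n * fgext (s12 (b * a * a * b) (c * c)) g'.
have CE : @fuses fg C be.
  rewrite be'; apply: fusesM; last exact: fuses_W.
  by apply: fusesM; [|apply: fusesV]; apply: fusesX; exact: fuses_DD.
pose x' := C^-1 * x.
have fx' j : (j < 3)%N -> fuse (bact x' gen) j = fuse gen j.
  move=> j3; rewrite (eq_fuse (bactM C^-1 x gen)) (fusesV CE) //.
  have [/(_ j j3) -> _] := @bact_low 1 _ be^-1 _ _ (fun k k3 => etrans (yE k) (beE k)).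
  by rewrite -bactM mulVg bact1.
have [h0' E0] := bact_conj x' 0.
have [h1' E1] := bact_conj x' 1.
have [|| w' aw' w'E] := @hurwitz_transitive [:: (h0', pb x' 0); (h1', pb x' 1)] [:: 0; 1]%N; first by [].
  by rewrite /cprod /genprod /= !mulg1 /cval -E0 -E1; exact: (fx' 0%N).
have aw3 : all (fun l => l.1.+1 < 2)%N w' by [].
have w'x : bw 2 w' * x' = 1.
  apply: (faithful p1) => j j4; rewrite bactM bact_bw; last by apply: sub_all aw3 => l /=; lia.
  have [L1 L2] := hact_low (y := bact x' gen) (y' := nth 1 [:: bact x' gen 0; bact x' gen 1%N]) aw3
    ltac:(by move=> [|[|//]] _).
  case: j j4 => [|[|[|[|//]]]] _; [rewrite L1 //|rewrite L1 //|rewrite L2 //|rewrite L2 //].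
  - by rewrite E0 E1 w'E.
  - by rewrite E0 E1 w'E.
  - exact: (fx' 1%N).
  - exact: (fx' 2).
have [j [i ij]] := power_word aw3.
exists m, n, g', i, j; split=> //; rewrite -/C.
have -> : a ^+ i * a ^- j = x'; last by rewrite /x' mulVKg.
by apply: (mulgI (bw 2 w')); rewrite w'x ij !mulgA mulgVK mulgV.
Qed.
End Red.

Local Close Scope group_scope.
Local Open Scope ring_scope.
Arguments pb {n} b k%_N.
Arguments gen i%_N.
Section Kernel.
Variable p : nat.
Hypothesis p1 : (1 < p)%N.
Local Notation t := (laurent_t 'Z_p).
Local Notation tV := (laurent_tV 'Z_p).
Local Notation rho := (burau4_mod p).

(** Braids of the first three strands do not change the last coordinate of a row, so this coordinate
    reads off the exponent of the full twist. *)
Lemma kernel3 (x : braid 4) (g : fg) : rho x = 1%:M ->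
  (bact x gen 0 * bact x gen 1%N * bact x gen 2 = g * (gen 0 * gen 1 * gen 2) * g^-1)%g -> x = 1%g.
Proof.
move=> rx E; have px := rho_pure p1 rx.
have [y [m [n [By xE]]]] := reduce3 p1 px E.
have py j : (j < 4)%N -> pb y j = j by move=> j4; have := px j j4; rewrite xE pbM pb_DDX // pb_lt.
have y3 (r : 'rV_3) : (r *m rho y) 0 2%:R = r 0 2%:R.
  have s_3 i (u : 'rV_3) : (u *m rho (s12 a b i)) 0 2%:R = u 0 2%:R.
    by rewrite {1}[u]row3E; case: i => [|i]; rewrite (row_s0, row_s1) row3_2.
  have [h ->] := By; elim/fg_ind: h r => [|i h IH|i h IH] r; first by rewrite fgext1 rho1 mulmx1.
    by rewrite fgextM fgextX rhoM mulmxA IH s_3.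
  rewrite fgextM fgextV fgextX rhoM mulmxA IH -(s_3 i) -mulmxA -rhoM mulVg rho1 mulmx1 //.
have : (row3 0 0 1 *m rho x) 0 2%:R = 1 by rewrite rx mulmx1 row3_2.
rewrite xE rhoM mulmxA row_DDX mxE y3 row3_2 mulr1 => /t_power1 mn.
have mn' : m = n by lia.
move: rx; rewrite xE mn' mulgV mulg1 => ry.
by apply: (pure3_kernel p1) => //; apply: py.
Qed.

(** The first generator affects only the first coordinate of a row. The last two coordinates
    therefore detect the free part and the full twist, and the first one then detects the twists of
    the two fused strands. *)
Lemma kernel2 (x : braid 4) (g : fg) : rho x = 1%:M ->
  (bact x gen 0 * bact x gen 1%N = g * (gen 0 * gen 1) * g^-1)%g -> x = 1%g.
Proof.
move=> rx E; have px := rho_pure p1 rx.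
have [m [n [h [i [j [h2 xE]]]]]] := reduce2 p1 px E.
pose la := t ^+ (4 * m) * tV ^+ (4 * n).
have aX k (r : 'rV_3) : (r *m rho (a ^+ k)%g) 0 1 = r 0 1 /\ (r *m rho (a ^+ k)%g) 0 2%:R = r 0 2%:R.
  elim: k r => [|k IH] r; first by rewrite expg0 rho1 mulmx1.
  by rewrite expgS rhoM mulmxA !(IH _).1 !(IH _).2 {1 3}[r]row3E row_s0 row3_1 row3_2.
have aXV k (r : 'rV_3) : (r *m rho (a ^- k)%g) 0 1 = r 0 1 /\ (r *m rho (a ^- k)%g) 0 2%:R = r 0 2%:R.
  have [<- <-] := aX k (r *m rho (a ^- k)%g).
  by rewrite -mulmxA -rhoM mulVg rho1 mulmx1.
have h1 : h = 1%g.
  apply: (@free2 p h (4 * n) (4 * m) h2) => r /=; set F := rho _.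
  have rE : (la *: (r *m F)) *m rho (a ^+ i)%g *m rho (a ^- j)%g = r.
    have : r *m rho x = r by rewrite rx mulmx1.
    rewrite xE; move: (DD ^+ m * DD ^- n)%g (@row_DDX p m n) => D DE.
    by rewrite !rhoM !mulmxA DE scalemxAl.
  have la1 u v : la * u = v -> u = t ^+ (4 * n) * tV ^+ (4 * m) * v.
    move=> <-; transitivity ((t ^+ (4 * n) * tV ^+ (4 * n)) * (t ^+ (4 * m) * tV ^+ (4 * m)) * u).
      by rewrite !tK !mul1r.
    by rewrite /la; ring.
  split; apply: la1.
    by have := congr1 (fun u : 'rV_3 => u 0 1) rE; rewrite (aXV j _).1 (aX i _).1 mxE.
  by have := congr1 (fun u : 'rV_3 => u 0 2%:R) rE; rewrite (aXV j _).2 (aX i _).2 mxE.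
move: xE; rewrite h1 fgext1 mulg1 => xE.
have mn : m = n.
  have : (row3 0 0 1 *m rho x) 0 2%:R = 1 by rewrite rx mulmx1 row3_2.
  rewrite xE rhoM mulmxA row_DDX rhoM mulmxA (aXV _ _).2 (aX _ _).2 mxE row3_2 mulr1 => /t_power1; lia.
move: xE; rewrite mn mulgV mul1g => xE; rewrite xE.
suff -> : i = j by rewrite mulgV.
have : row3 1 0 0 *m rho (a ^+ i)%g = row3 1 0 0 *m rho (a ^+ j)%g.
  by rewrite -[in RHS](mul1mx (rho _)) -rx xE -rhoM mulgVK.
(* Squaring removes the signs of the powers of - t. *)
rewrite !rho_s0X => /rowP/(_ 0); rewrite !mxE /= => /(congr1 (fun u => u ^+ 2)).
rewrite -!exprM ![(_ * 2)%N]mulnC !exprM !sqrrN -!exprM => E2.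
have : t ^+ (2 * i) * tV ^+ (2 * j) = 1 by rewrite E2 tK.
by move/t_power1; lia.
Qed.

Lemma gen0_neq1 : gen 0 <> 1%g. Proof. by move/(congr1 fgval). Qed.

(* [k] is the number of punctures inside the reduction curve. *)
Theorem reduction_kernel (x v : braid 4) (g : fg) (k d : nat) : k = 2 \/ k = 3 -> rho x = 1%:M ->
  let C := phi v (genprod (iota 0 k)) in
  (phi x C = g * C ^+ d * g^-1)%g \/ (phi x C = g * C ^- d * g^-1)%g -> x = 1%g.
Proof.
move=> k23 rx C xC.
have rv : rho (v * x * v^-1)%g = 1%:M.
  by rewrite !rhoM rx mulmx1 -rhoM mulgV rho1.
suff: (v * x * v^-1)%g = 1%g.
  by move=> E; apply: (mulgI v); apply: (mulIg v^-1)%g; rewrite E mulg1 mulgV.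
have py := rho_pure p1 rv; set y := (v * x * v^-1)%g in rv py *.
pose c0 := genprod (iota 0 k).
have [g' yc] : exists g', (phi y c0 = g' * c0 ^+ d * g'^-1)%g \/ (phi y c0 = g' * c0 ^- d * g'^-1)%g.
  have vK : phi (v^-1)%g C = c0 by rewrite -phi_mul mulgV phi1.
  have pX n : phi (v^-1)%g (C ^+ n)%g = (c0 ^+ n)%g.
    by elim: n => [|n IH]; rewrite ?(morph_mul1 (phiM _)) // !expgS phiM IH vK.
  exists (phi (v^-1)%g g); rewrite /y !phi_mul -/C.
  by case: xC => ->; [left|right]; rewrite !phiM !(morph_mulV (phiM _)) pX.
have bE j : (j < 4)%N -> exists h, bact y gen j = cval (h, j) by exact: bact_gen_conj.
(* Kill all letters but the first. Conjugations disappear, and both [c0] and its image become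
   [gen 0], because y is pure. Comparing exponents leaves the exponent d = 1 with a positive
   sign. *)
have {yc} yc : (phi y c0 = g' * c0 * g'^-1)%g.
  pose q := fgext (fun k => if k == 0%N then gen 0 else 1%g).
  have qM : {morph q : u v / (u * v)%g} by exact: fgextM.
  have q0 u : commute (q u) (gen 0).
    apply/commute_sym; elim/fg_ind: u => [|i u IH|i u IH].
    - by rewrite (morph_mul1 qM); exact: commute1.
    - rewrite qM; apply: commuteM IH; rewrite /q fgextX; case: eqP => _; [exact: commute_refl|exact: commute1].
    - rewrite qM (morph_mulV qM); apply: commuteM IH; apply: commuteV.
      by rewrite /q fgextX; case: eqP => _; [exact: commute_refl|exact: commute1].
  have qc : q c0 = gen 0.
    by rewrite /c0; case: k23 => ->; rewrite /genprod /= !qM /q !fgextX fgext1 /= !mulg1.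
  have qX n : q (c0 ^+ n)%g = (gen 0 ^+ n)%g.
    by elim: n => [|n IH]; rewrite ?(morph_mul1 qM) // !expgS qM IH qc.
  have qJ u w : q (u * w * u^-1)%g = (q u * q w * (q u)^-1)%g by rewrite !qM (morph_mulV qM).
  have qy : q (phi y c0) = gen 0.
    have [h0 E0] := bE 0%N isT; have [h1 E1] := bE 1%N isT; have [h2 E2] := bE 2%N isT.
    have q0' : q (bact y gen 0%N) = gen 0 by rewrite E0 /cval qJ {2}/q fgextX /= q0 mulgK.
    have q1 j h : (0 < j)%N -> q (cval (h, j)) = 1%g.
      by move=> j0; rewrite /cval qJ {2}/q fgextX -[_ == _]negbK -lt0n j0 mulg1 mulgV.
    by rewrite /c0; case: k23 => ->; rewrite /genprod /= !phiM !/(phi _ (gen _)) /phi !fgextX fgext1 !qM q0' ?E1 ?E2 !q1 // (morph_mul1 qM) !mulg1.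
  have qg : (q g' * gen 0 ^+ d * (q g')^-1 = gen 0 ^+ d)%g by rewrite (commuteX d (q0 g')) mulgK.
  have qgV : (q g' * gen 0 ^- d * (q g')^-1 = gen 0 ^- d)%g by rewrite (commuteV (commuteX d (q0 g'))) mulgK.
  case: yc => E; have := congr1 q E; rewrite qJ qy ?(morph_mulV qM) qX ?qg ?qgV.
    case: d {qX xC qg qgV} E => [|[|d]] E; [by move/gen0_neq1|by rewrite E expg1|].
    rewrite expgS => F; case: gen0_neq1; apply: (fg_torsion_free (ltn0Sn d)).
    by apply: (mulgI (gen 0)); rewrite -F mulg1.
  move/(congr1 (fun u => u * gen 0 ^+ d)%g); rewrite mulVg -expgS => F.
  by case: gen0_neq1; apply: (fg_torsion_free (ltn0Sn d)).
move: yc; rewrite {}/c0; case: k23 => ->; rewrite /genprod /= !phiM /phi !fgextX fgext1 !mulg1 ?mulgA => E.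
  by apply: (kernel2 rv (g := g')); rewrite E !mulgA.
by apply: (kernel3 rv (g := g')); rewrite E !mulgA.
Qed.
End Kernel.
End ReductionKernel.
Import ReductionKernel.

(** * Transverse loops *)

Module Meander.
Local Open Scope group_scope.

(* A transverse simple loop is encoded by the list of its arcs above the axis: an arc [(a, b)] leaves
   the axis at the abscissa [a] and comes back at [b], and the next arc below the axis starts at [b]. *)
Definition arc := (int * int)%type.
Definition lt_z (x y : int) := (x < y)%R.
Local Infix "<z" := lt_z (at level 70).

(** Whether u lies under the arc c. Two arcs do not cross when both ends of the second lie on the
    same side of the first. *)
Definition pr (u : int) (c : arc) := (c.1 <z u) (+) (c.2 <z u).
Definition nc (c d : arc) := pr d.1 c == pr d.2 c.
Definition ncs (L : seq arc) := forall c d, c \in L -> d \in L -> c.1 != d.1 -> nc c d.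
Definition keys (s : seq arc) := flatten [seq [:: c.1; c.2] | c <- s].
(** The lower arcs are determined by the upper ones: each leads from the end of an arc to the
    beginning of the next. For the closed loop the starting point d is the end of the last arc. *)
Fixpoint lw (d : int) (s : seq arc) : seq arc := if s is c :: s' then (d, c.1) :: lw c.2 s' else [::].
Definition lst (d : int) (s : seq arc) := last d (map snd s).
Definition lows s := lw (lst 0%R s) s.
(** The parity of the crossings on the left of u, which tells whether a point u of the axis is
    inside the loop. *)
Definition par (u : int) (s : seq arc) := foldr (fun c e => pr u c (+) e) false s.
Definition valid s := [/\ uniq (keys s), ncs s & ncs (lows s)].

Lemma keys_cat s1 s2 : keys (s1 ++ s2) = keys s1 ++ keys s2.
Proof. by rewrite /keys map_cat flatten_cat. Qed.
Lemma par_cat u s1 s2 : par u (s1 ++ s2) = par u s1 (+) par u s2.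
Proof. by elim: s1 => //= c s1 ->; rewrite addbA. Qed.
Lemma lw_cat d s1 s2 : lw d (s1 ++ s2) = lw d s1 ++ lw (lst d s1) s2.
Proof. by elim: s1 d => //= c s1 IH d; rewrite IH. Qed.
Lemma lst_cat d s1 s2 : lst d (s1 ++ s2) = lst (lst d s1) s2.
Proof. by rewrite /lst map_cat last_cat. Qed.

Lemma par_lw u d s : par u (lw d s) = (d <z u) (+) (lst d s <z u) (+) par u s.
Proof.
elim: s d => [|c s IH] d /=; first by rewrite addbF addbb.
rewrite IH /pr /= -[lst d _]/(lst c.2 s).
by move: (d <z u) (c.1 <z u) (c.2 <z u) (lst _ _ <z u) (par u s) => [] [] [] [] [].
Qed.
Lemma par_lows u s : par u (lows s) = par u s.
Proof.
case: s => // c s; by rewrite /lows par_lw addbb.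
Qed.

Lemma par_const (u v : int) s : (forall c, c \in s -> nc c (u, v)) -> par u s = par v s.
Proof.
elim: s => //= c s IH H; rewrite IH; last by move=> d ds; apply: H; rewrite inE ds orbT.
by rewrite (eqP (H c (mem_head _ _))).
Qed.
Lemma par_perm u s s' : perm_eq s s' -> par u s = par u s'.
Proof.
move=> p; have E r : par u r = odd (\sum_(c <- r) pr u c).
  by elim: r => [|c r IH]; rewrite ?big_nil //= big_cons oddD IH oddb.
by rewrite !E (perm_big _ p).
Qed.
Lemma mem_keys c s : c \in s -> (c.1 \in keys s) && (c.2 \in keys s).
Proof. by elim: s => //= d s IH; rewrite inE => /orP[/eqP->|/IH/andP[a b]]; rewrite !inE ?a ?b ?eqxx ?orbT. Qed.
Lemma keys_mem k s : k \in keys s -> exists2 c, c \in s & k = c.1 \/ k = c.2.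
Proof.
elim: s => //= c s IH; rewrite !inE => /or3P[/eqP->|/eqP->|/IH [d ds E]].
- by exists c; [exact: mem_head|left].
- by exists c; [exact: mem_head|right].
- by exists d; rewrite ?inE ?ds ?orbT.
Qed.
Lemma keys_perm s s' : perm_eq s s' -> perm_eq (keys s) (keys s').
Proof. by move=> p; apply: perm_flatten; apply: perm_map. Qed.

Lemma lows_fst s : map fst (lows s) = rotr 1 (map snd s).
Proof.
case: (lastP s) => // s' c; rewrite map_rcons rotr1_rcons /lows -cats1 lst_cat /=.
suff E d r c' : map fst (lw d (rcons r c')) = d :: map snd r by rewrite cats1 E.
by elim: r d => [|e r IH] d //=; rewrite IH.
Qed.
Lemma lows_snd d s : map snd (lw d s) = map fst s.
Proof. by elim: s d => //= c s IH d; rewrite IH. Qed.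

Lemma lows_rot s1 s2 : perm_eq (lows (s1 ++ s2)) (lows (s2 ++ s1)).
Proof.
rewrite /lows !lst_cat !lw_cat; case: s1 => [|c1 s1]; first by rewrite cats0.
case: s2 => [|c2 s2]; first by rewrite cats0.
rewrite perm_catC perm_cat //.
Qed.
Lemma valid_rot s1 s2 : valid (s1 ++ s2) -> valid (s2 ++ s1).
Proof.
case=> u n1 n2; split; first by rewrite (perm_uniq (keys_perm (permEl (perm_catC s2 s1)))).
  by move=> c d; rewrite !mem_cat !(orbC (_ \in s2)) -!mem_cat; apply: n1.
by move=> c d; rewrite !(perm_mem (lows_rot s2 s1)); apply: n2.
Qed.

Lemma uniq_fst_snd s c d : uniq (keys s) -> c \in s -> d \in s -> (c.1 == d.1 -> c = d) /\ (c.2 == d.2 -> c = d) /\ c.1 != d.2.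
Proof.
elim: s => //= e s IH /and3P[e1 e2 us]; rewrite !inE => /orP[/eqP->|cs] /orP[/eqP->|ds].
- by rewrite inE negb_or in e1; case/andP: e1.
- have /andP[d1 d2] := mem_keys ds; rewrite inE negb_or in e1; case/andP: e1 => e12 e1.
  split; first by move/eqP=> E; rewrite E d1 in e1.
  split; first by move/eqP=> E; rewrite E d2 in e2.
  by apply: contraNneq e1 => ->.
- have /andP[d1 d2] := mem_keys cs; rewrite inE negb_or in e1; case/andP: e1 => e12 e1.
  split; first by move/eqP=> E; rewrite -E d1 in e1.
  split; first by move/eqP=> E; rewrite -E d2 in e2.
  by apply: contraNneq e2 => <-.
- exact: IH.
Qed.

(* Following the loop, the parity of the number of crossings on the left alternates. *)
Lemma par_flip s c (L : seq arc) : ncs L -> uniq (map fst L) -> (forall u, par u L = par u s) -> c \in L -> c.1 != c.2 ->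
  par c.1 s = ~~ par c.2 s.
Proof.
move=> nL uL E cL c12; rewrite -!E; case/splitPr: cL E uL nL => L1 L2 _ uL nL.
have H : par c.1 (L1 ++ L2) = par c.2 (L1 ++ L2).
  apply: par_const => d; rewrite mem_cat => dL; apply: (nL d c); rewrite ?mem_cat ?inE ?eqxx ?orbT //.
    by case/orP: dL => ->; rewrite ?orbT.
  move: uL; rewrite map_cat /= cat_uniq /= => /and3P[_ /norP[n1 _] /andP[n2 _]].
  by case/orP: dL => dL; [apply: contraNneq n1 => <-|apply: contraNneq n2 => <-]; apply: map_f.
move: H; rewrite !par_cat /= /pr /lt_z !ltxx addFb addbF => H.
move: H c12; move: (par c.1 L1) (par c.1 L2) (par c.2 L1) (par c.2 L2) => b1 b2 b3 b4.
by case: ltgtP => // _; case: b1 b2 b3 b4 => [] [] [] [].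
Qed.

Section Chain.
Variable F : int -> bool.
(** Upper and lower arcs alternate along the loop, so a function that agrees at both ends of every
    arc is constant on the crossings. *)
Lemma chain d s : (forall c, c \in s -> F c.1 = F c.2) -> (forall c, c \in lw d s -> F c.1 = F c.2) ->
  forall k, k \in keys s -> F k = F d.
Proof.
elim: s d => //= c s IH d H1 H2 k; have E1 := H1 c (mem_head _ _); have E2 := H2 _ (mem_head _ _).
rewrite /= in E2; rewrite !inE => /or3P[/eqP->|/eqP->|ks]; rewrite -?E1 //.
rewrite (IH c.2) -?E1 //.
  by move=> e es; apply: H1; rewrite inE es orbT.
by move=> e es; apply: H2; rewrite inE es orbT.
Qed.
End Chain.

Definition adj (p q : int) (K : seq int) := forall z, z \in K -> ((z <z p) = (z <z q)) /\ ((p <z z) = (q <z z)).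
Lemma pr_adj p q K u : adj p q K -> u \in K -> pr u (p, q) = false.
Proof. by move=> a /a[_]; rewrite /pr /= => ->; rewrite addbb. Qed.

Lemma ncs_sub L L' : {subset L' <= L} -> ncs L -> ncs L'.
Proof. by move=> sub nL c d /sub cL /sub; apply: nL. Qed.

(** The arcs are rejoined through the chord from p to q. As no other crossing lies between p and q,
    a point is under the new arc exactly when it is under one and only one of the two old arcs. *)
Lemma ncs_merge (L : seq arc) p x y q (K := y :: x :: flatten [seq [:: c.1; c.2] | c <- L]) :
  adj p q K -> uniq (map fst ((p, x) :: (y, q) :: L)) -> ncs ((p, x) :: (y, q) :: L) -> ncs ((y, x) :: L).
Proof.
move=> aK /= /and3P[]; rewrite inE negb_or => /andP[py pL] yL uL nL.
have aK' c : c \in L -> c.1 \in K /\ c.2 \in K.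
  by move=> /mem_keys/andP[]; rewrite !inE => -> ->; rewrite !orbT.
have n1 c : c \in L -> nc (p, x) c /\ nc c (p, x).
  move=> cL; split; apply: nL; rewrite ?inE ?eqxx ?cL ?orbT //=.
    by apply: contraNneq pL => ->; apply: map_f.
  by apply: contraNneq pL => <-; apply: map_f.
have n2 c : c \in L -> nc (y, q) c /\ nc c (y, q).
  move=> cL; split; apply: nL; rewrite ?inE ?eqxx ?cL ?orbT //=.
    by apply: contraNneq yL => ->; apply: map_f.
  by apply: contraNneq yL => <-; apply: map_f.
move=> c d; rewrite !inE => /orP[/eqP->|cL] /orP[/eqP->|dL]; rewrite ?eqxx // => cd.
- have [k1 k2] := aK' _ dL; have [_ E1] := aK _ k1; have [_ E2] := aK _ k2.
  have [/eqP F1 _] := n1 _ dL; have [/eqP F2 _] := n2 _ dL; move: F1 F2; rewrite /nc /pr /= E1 E2.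
  by do 6?[case: (_ <z _)].
- have [k1 k2] := aK' _ cL; have [E1 _] := aK _ k1; have [E2 _] := aK _ k2.
  have [_ /eqP F1] := n1 _ cL; have [_ /eqP F2] := n2 _ cL; move: F1 F2; rewrite /nc /pr /= E1 E2.
  by move=> <- ->.
- by apply: nL; rewrite ?inE ?cL ?dL ?orbT.
Qed.
Definition swp (c : arc) : arc := (c.2, c.1).
Lemma ncs_merge' (L : seq arc) p x y q (K := y :: x :: flatten [seq [:: c.1; c.2] | c <- L]) :
  adj p q K -> uniq (map fst ((x, p) :: (q, y) :: L)) -> ncs ((x, p) :: (q, y) :: L) -> ncs ((x, y) :: L).
Proof.
move=> aK /= /and3P[]; rewrite inE negb_or => /andP[py pL] yL uL nL.
have aK' c : c \in L -> c.1 \in K /\ c.2 \in K.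
  by move=> /mem_keys/andP[]; rewrite !inE => -> ->; rewrite !orbT.
have n1 c : c \in L -> nc (x, p) c /\ nc c (x, p).
  move=> cL; split; apply: nL; rewrite ?inE ?eqxx ?cL ?orbT //=.
    by apply: contraNneq pL => ->; apply: map_f.
  by apply: contraNneq pL => <-; apply: map_f.
have n2 c : c \in L -> nc (q, y) c /\ nc c (q, y).
  move=> cL; split; apply: nL; rewrite ?inE ?eqxx ?cL ?orbT //=.
    by apply: contraNneq yL => ->; apply: map_f.
  by apply: contraNneq yL => <-; apply: map_f.
move=> c d; rewrite !inE => /orP[/eqP->|cL] /orP[/eqP->|dL]; rewrite ?eqxx // => cd.
- have [k1 k2] := aK' _ dL; have [_ E1] := aK _ k1; have [_ E2] := aK _ k2.
  have [/eqP F1 _] := n1 _ dL; have [/eqP F2 _] := n2 _ dL; move: F1 F2; rewrite /nc /pr /= E1 E2.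
  by do 6?[case: (_ <z _)].
- have [k1 k2] := aK' _ cL; have [E1 _] := aK _ k1; have [E2 _] := aK _ k2.
  have [_ /eqP F1] := n1 _ cL; have [_ /eqP F2] := n2 _ cL; move: F1 F2; rewrite /nc /pr /= E1 E2.
  by move=> -> <-.
- by apply: nL; rewrite ?inE ?cL ?dL ?orbT.
Qed.

Lemma uniq_fst s : uniq (keys s) -> uniq (map fst s).
Proof.
elim: s => //= c s IH /and3P[c1 c2 /IH ->]; rewrite andbT; apply: contra c1 => /mapP[d /mem_keys/andP[d1 _] ->].
by rewrite inE d1 orbT.
Qed.
Lemma uniq_snd s : uniq (keys s) -> uniq (map snd s).
Proof.
elim: s => //= c s IH /and3P[c1 c2 /IH ->]; rewrite andbT; apply: contra c2 => /mapP[d /mem_keys/andP[_ d1] ->].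
by rewrite d1.
Qed.
Lemma uniq_lows s : uniq (keys s) -> uniq (map fst (lows s)).
Proof. by rewrite lows_fst rotr_uniq; apply: uniq_snd. Qed.
Lemma mem_lw c d s : c \in lw d s -> (c.1 = d \/ c.1 \in keys s) /\ c.2 \in keys s.
Proof.
elim: s d => //= e s IH d; rewrite inE => /orP[/eqP->|/IH[H1 H2]] /=.
  by split; [left|rewrite !inE eqxx].
split; last by rewrite !inE H2 !orbT.
by right; case: H1 => [->|]; rewrite !inE ?eqxx ?orbT // => ->; rewrite !orbT.
Qed.
Lemma lst_mem d c s : lst d (c :: s) \in keys (c :: s).
Proof.
elim: s c => [|e s IH] c; rewrite /lst /=; first by rewrite !inE eqxx orbT.
by have := IH e; rewrite /lst /= !inE => /orP[/eqP->|/orP[/eqP->|->]]; rewrite ?eqxx !orbT.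
Qed.

Lemma uniq_keysP c s : uniq (keys (c :: s)) = [&& c.1 != c.2, c.1 \notin keys s, c.2 \notin keys s & uniq (keys s)].
Proof. by rewrite /= inE negb_or -!andbA. Qed.

Lemma valid_flip s c : valid s -> c \in s -> par c.1 s = ~~ par c.2 s.
Proof.
case=> u n1 n2 cs; apply: (@par_flip s c s) => //; first exact: uniq_fst.
have [_ [_ H]] := uniq_fst_snd u cs cs; exact: H.
Qed.

Section Split.
Variables (p x y q : int) (M B : seq arc).
Let s := (p, x) :: M ++ (y, q) :: B.
Let A := M ++ [:: (y, x)].
Hypothesis vs : valid s.
Hypothesis es : forall c, c \in s -> par c.1 s = false.
Hypothesis pmin : forall k, k \in keys s -> k != p -> p <z k.
Hypothesis qmin : forall k, k \in keys s -> k != p -> k != q -> q <z k.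

Let us : uniq (keys s). Proof. by case: vs. Qed.
Lemma keysAB : perm_eq (keys s) (p :: q :: keys A ++ keys B).
Proof.
have -> : keys s = [:: p; x] ++ keys M ++ [:: y; q] ++ keys B.
  by rewrite /s -cat1s keys_cat keys_cat -[(y, q) :: B]cat1s keys_cat.
have -> : keys A = keys M ++ [:: y; x] by rewrite keys_cat.
by apply/permP => P; rewrite /= !count_cat /=; lia.
Qed.
Let uAB : uniq (p :: q :: keys A ++ keys B). Proof. by rewrite -(perm_uniq keysAB). Qed.
Lemma adjAB : adj p q (keys A ++ keys B).
Proof.
move=> z zAB; have zs : z \in keys s by rewrite (perm_mem keysAB) !inE zAB !orbT.
have zp : z != p by apply: contraTneq uAB => <-; rewrite /= inE zAB orbT.
have zq : z != q by apply: contraTneq uAB => <-; rewrite /= zAB andbF.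
have := pmin zs zp; have := qmin zs zp zq; rewrite /lt_z; lia.
Qed.
Lemma par_min k K : (forall z, z \in keys K -> k <z z) -> par k K = false.
Proof.
move=> H; elim: K H => //= c K IH H; rewrite IH ?addbF; last by move=> z zK; apply: H; rewrite !inE zK !orbT.
have := H c.1; have := H c.2; rewrite !inE !eqxx !orbT /pr /lt_z => /(_ isT) h2 /(_ isT) h1; lia.
Qed.

Let sub_s c : c \in M ++ (y, q) :: B -> c \in s. Proof. by move=> cs; rewrite inE cs orbT. Qed.
Let Lx := lw x (rcons M (y, q)).
Let lows_perm : perm_eq (lows s) ((lst q B, p) :: Lx ++ lw q B).
Proof.
rewrite /lows /s /Lx /= -cat_rcons lw_cat.
have -> : lst 0%R ((p, x) :: rcons M (y, q) ++ B) = lst q B by rewrite -cat_cons -rcons_cons -cats1 !lst_cat.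
by have -> : lst x (rcons M (y, q)) = q by rewrite -cats1 lst_cat.
Qed.
Let nlow c d : c \in (lst q B, p) :: Lx ++ lw q B -> d \in (lst q B, p) :: Lx ++ lw q B -> c.1 != d.1 -> nc c d.
Proof. by rewrite -!(perm_mem lows_perm); case: vs => _ _ H; exact: H. Qed.
Let ulow : uniq (map fst ((lst q B, p) :: Lx ++ lw q B)).
Proof. by rewrite -(perm_uniq (perm_map fst lows_perm)); apply: uniq_lows. Qed.
Let nup : ncs s. Proof. by case: vs. Qed.
Let ups : uniq (map fst s). Proof. exact: uniq_fst. Qed.

Let LxE : Lx = lows A.
Proof. by rewrite /Lx /lows /A -cats1 !lw_cat lst_cat. Qed.
Let lowA c : c \in lows A -> c.1 \in keys A /\ c.2 \in keys A.
Proof.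
have xA : x \in keys A by rewrite /A keys_cat mem_cat !inE eqxx !orbT.
by rewrite /lows {1}/A lst_cat => /mem_lw[[->|H] ->].
Qed.
Let kAB k : k \in keys A \/ k \in keys B -> [/\ (p <z k) = (q <z k), k \in keys s, p <z k & q <z k].
Proof.
move=> kAB; have kAB' : k \in keys A ++ keys B by rewrite mem_cat; case: kAB => ->; rewrite ?orbT.
have ks : k \in keys s by rewrite (perm_mem keysAB) !inE kAB' !orbT.
have [_ E] := adjAB kAB'.
have zp : k != p by apply: contraTneq uAB => <-; rewrite /= inE kAB' orbT.
have zq : k != q by apply: contraTneq uAB => <-; rewrite /= kAB' andbF.
by split=> //; [apply: pmin|apply: qmin].
Qed.
Let up_ne c d : c \in s -> d \in s -> c != d -> nc c d.
Proof.
move=> cs ds cd; apply: nup => //; apply: contra cd => E; apply/eqP.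
by have [H _] := uniq_fst_snd us cs ds; apply: H.
Qed.
Let us2 : uniq (M ++ (y, q) :: B).
Proof. by have := map_uniq ups; rewrite /s /= => /andP[]. Qed.

(** The arcs of A do not cross those of B, so the parity with respect to B is constant along A. It
    is read at x, which an upper arc of the uncut loop joins to the leftmost crossing p. *)
Lemma par_AB k : k \in keys A -> par k B = false.
Proof.
have x0 : par x B = false.
  rewrite -(par_const (u := p)); first by apply: par_min => z zB; have [] := kAB (or_intror zB).
  move=> c cB; apply: (@up_ne c (p, x)); rewrite ?mem_head //; first by rewrite sub_s // mem_cat inE cB !orbT.
  have /andP[c1 _] := mem_keys cB; have [_ _ + _] := kAB (or_intror c1).
  by apply: contraTneq => -> /=; rewrite /lt_z ltxx.
move=> kA; rewrite -x0.
have [->//|kx] := eqVneq k x.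
apply: (@chain (fun k => par k B) x (rcons M (y, q))); last first.
- move: kA; rewrite /A -cats1 !keys_cat !mem_cat /= !inE (negPf kx).
  by case/or3P => [->|/orP[->|]|]; rewrite ?orbT.
- rewrite -/Lx => c cL; have cA : c \in lows A by rewrite -LxE.
  have E : par c.1 ((lst q B, p) :: lw q B) = par c.2 ((lst q B, p) :: lw q B).
    apply: par_const => d dB; apply: (nlow (c := d) (d := c)).
    + by move: dB; rewrite !inE mem_cat => /orP[->|->]; rewrite ?orbT.
    + by rewrite inE mem_cat cL orbT.
    move: ulow; rewrite /= map_cat mem_cat cat_uniq => /and4P[/norP[n1 _] _ /hasPn n2 _].
    move: dB; rewrite inE => /orP[/eqP->|dB] /=; first by apply: contraNneq n1 => ->; apply: map_f.
    by apply: contraTneq (n2 _ (map_f fst dB)) => ->; rewrite negbK; apply: map_f.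
  have [/or_introl/kAB[e1 _ _ _] /or_introl/kAB[e2 _ _ _]] := lowA cA.
  move: E; rewrite /= !par_lw /pr /= e1 e2.
  by do 4?[case: (_ <z _)]; case: (par _ _); case: (par _ _).
- move=> c cM; apply: par_const => d dB; apply: (@up_ne d c).
  + by rewrite sub_s // mem_cat inE dB !orbT.
  + by rewrite sub_s //; move: cM; rewrite mem_rcons mem_cat !inE => /orP[->|->]; rewrite ?orbT.
  move: us2; rewrite -cat_rcons cat_uniq => /and3P[_ /hasPn H _].
  by apply: contraTneq cM => <-; apply: H.
Qed.

Lemma par_BA k : k \in keys B -> par k A = false.
Proof.
have q0 : par q A = false by apply: par_min => z zA; have [] := kAB (or_introl zA).
move=> kB; rewrite -q0; apply: (@chain (fun k => par k A) q B) => //.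
- move=> c cB; have /andP[c1 c2] := mem_keys cB.
  have [e1 _ _ _] := kAB (or_intror c1); have [e2 _ _ _] := kAB (or_intror c2).
  have E : par c.1 ((p, x) :: M ++ [:: (y, q)]) = par c.2 ((p, x) :: M ++ [:: (y, q)]).
    have cs : c \in s by rewrite sub_s // mem_cat inE cB !orbT.
    apply: par_const => d dA; apply: (@up_ne d c) => //.
      by move: dA; rewrite /s !inE !mem_cat !inE => /or3P[->|->|->]; rewrite ?orbT.
    have := map_uniq ups; rewrite /s -cat_rcons -cats1 -cat_cons cat_uniq => /and3P[_ /hasPn H _].
    by apply: contraTneq dA => ->; apply: H.
  move: E; rewrite /A /= !par_cat /= /pr /= e1 e2.
  move: (q <z _) (x <z _) (y <z _) (par _ _) (q <z _) (x <z _) (y <z _) (par _ _).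
  by do 8!case.
- move=> c cL; rewrite -!(par_lows _ A) -LxE.
  apply: par_const => d dL; apply: (nlow (c := d) (d := c)).
  + by rewrite inE mem_cat dL orbT.
  + by rewrite inE mem_cat cL !orbT.
  move: ulow; rewrite /= map_cat cat_uniq => /and4P[_ _ /hasPn n2 _].
  by apply: contraTneq (n2 _ (map_f fst cL)) => <-; rewrite negbK; apply: map_f.
Qed.

Let par_sE k : k \in keys A \/ k \in keys B -> par k s = par k A (+) par k B.
Proof.
move=> /kAB[e _ _ _]; rewrite /s /A /= !par_cat /= /pr /= e.
by move: (q <z _) (x <z _) (y <z _) (par _ _) (par _ _); do 5!case.
Qed.

Let uA : uniq (keys A). Proof. by move: uAB; rewrite /= cat_uniq => /and5P[]. Qed.
Let uB : uniq (keys B).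
Proof. by move: uAB; rewrite /= cat_uniq => /and5P[]. Qed.

(** At a crossing of A the parity of the whole loop is that of A plus that of B, and the latter
    vanishes by [par_AB]. The condition on parities is thus inherited by the half. *)
Lemma good_A : valid A /\ forall c, c \in A -> par c.1 A = false.
Proof.
split; last first.
  move=> c cA; have /andP[c1 _] := mem_keys cA.
  have := par_sE (or_introl c1); rewrite (par_AB c1) addbF => <-.
  move: cA; rewrite mem_cat inE => /orP[cM|/eqP->]; first by apply: es; rewrite sub_s // mem_cat cM.
  by apply: (es (c := (y, q))); rewrite sub_s // mem_cat mem_head orbT.
split=> //.
- apply: (@ncs_sub ((y, x) :: M)); first by move=> c; rewrite mem_cat !inE orbC.
  have sub c : c \in (p, x) :: (y, q) :: M -> c \in s.
    by rewrite /s !inE mem_cat !inE; case/or3P => ->; rewrite ?orbT.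
  apply: (@ncs_merge M p x y q) (ncs_sub sub nup).
    move=> z zK; apply: adjAB; rewrite mem_cat /A keys_cat mem_cat !inE.
    by move: zK; rewrite -/(keys M) !inE /= => /or3P[->|->|->]; rewrite ?orbT.
  move: ups; rewrite /s /= map_cat /= mem_cat cat_uniq /= !inE !negb_or.
  by move=> /andP[/and3P[-> -> _] /and3P[-> /andP[-> _] _]].
- rewrite -LxE; apply: ncs_sub (_ : ncs (lows s)); last by case: vs.
  by move=> c cL; rewrite (perm_mem lows_perm) inE mem_cat cL orbT.
Qed.

Lemma good_B : valid B /\ forall c, c \in B -> par c.1 B = false.
Proof.
split; last first.
  move=> c cB; have /andP[c1 _] := mem_keys cB.
  have := par_sE (or_intror c1); rewrite (par_BA c1) addFb => <-.
  by apply: es; rewrite sub_s // mem_cat inE cB !orbT.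
split=> //.
- by apply: ncs_sub nup => c cB; rewrite sub_s // mem_cat inE cB !orbT.
case: {2 3}B (erefl B) => // b B' EB; rewrite /lows /= -/(lst b.2 B').
have lE : lst q B = lst b.2 B' by rewrite EB.
have sub c : c \in (lst b.2 B', p) :: (q, b.1) :: lw b.2 B' -> c \in (lst q B, p) :: Lx ++ lw q B.
  by rewrite lE EB /= !inE mem_cat !inE => /or3P[->|->|->]; rewrite ?orbT.
apply: (@ncs_merge' _ p _ _ q).
- move=> z zK; apply: adjAB; rewrite mem_cat; apply/orP; right.
  have bB : lst b.2 B' \in keys B by rewrite EB; apply: (@lst_mem 0%R).
  move: zK; rewrite !inE => /or3P[/eqP->|/eqP->|]; rewrite ?bB //; first by rewrite EB inE eqxx.
  move=> /(@keys_mem _ (lw b.2 B')) [c /mem_lw [c1 c2] [->|->]]; rewrite EB !inE ?c2 ?orbT //.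
  by case: c1 => [->|->]; rewrite ?eqxx ?orbT.
- move: ulow; rewrite lE EB /= map_cat /= mem_cat inE !cat_uniq /= !negb_or.
  by move=> /and4P[/and3P[_ n1 n2] _ _ /andP[n3 ->]]; rewrite n1 n2 n3.
by move=> c d /sub cL /sub; apply: nlow.
Qed.
End Split.

(** The case where the chord itself bounds an upper arc: this arc is removed, and the two lower arcs
    at its ends are joined. *)
Lemma good_rest p q B : valid ((p, q) :: B) -> (forall c, c \in (p, q) :: B -> par c.1 ((p, q) :: B) = false) ->
  adj p q (keys B) -> valid B /\ forall c, c \in B -> par c.1 B = false.
Proof.
move=> [u n1 n2] e a.
split; last first.
  move=> c cB; have /andP[c1 _] := mem_keys cB.
  have := e c; rewrite inE cB orbT /= (pr_adj a c1); exact.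
have uB : uniq (keys B) by move: u; rewrite uniq_keysP => /and4P[].
split=> //; first by apply: ncs_sub n1 => c cB; rewrite inE cB orbT.
have ul := uniq_lows u; case: B u n1 n2 {e} a ul uB => // b B u n1 n2 a ul uB.
apply: (@ncs_merge' _ p _ _ q) ul n2 => z zK; apply: a.
have bB : lst b.2 B \in keys (b :: B) by apply: (@lst_mem 0%R).
move: zK; rewrite in_cons => /orP[/eqP->|]; first by rewrite inE eqxx.
rewrite in_cons => /orP[/eqP->//|].
move=> /(@keys_mem _ (lw b.2 B)) [c /mem_lw [c1 c2] [->|->]]; rewrite !inE ?c2 ?orbT //.
by case: c1 => [->|->]; rewrite ?eqxx ?orbT.
Qed.
End Meander.
Import Meander.

(** * Holonomy of one meander as a product of conjugates of letters *)

Module MeanderHolonomy.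
Local Open Scope group_scope.

Local Infix "<z" := lt_z (at level 70).

Lemma cprod_cat s1 s2 : cprod (s1 ++ s2) = cprod s1 * cprod s2.
Proof. by elim: s1 => [|c s1 IH] /=; rewrite ?mul1g // IH mulgA. Qed.
Definition cj (h : fg) (s : seq (fg * nat)) := [seq (h * c.1, c.2) | c <- s].
Lemma cprod_cj h s : cprod (cj h s) = h * cprod s * h^-1.
Proof. by elim: s => [|c s IH] /=; [grp | rewrite IH /cval /=; grp]. Qed.
Lemma cj_snd h s : map snd (cj h s) = map snd s.
Proof. by rewrite -map_comp. Qed.
Lemma genprod_cat u v : genprod (u ++ v) = genprod u * genprod v.
Proof. by elim: u => [|c u IH] /=; rewrite ?mul1g // IH mulgA. Qed.
Lemma genprod_cprod u : genprod u = cprod [seq (1, i) | i <- u].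
Proof. by elim: u => //= i u ->; rewrite /cval /= mul1g invg1 mulg1. Qed.

Section Loop.
Variable loc : int -> nat.
Hypothesis loc_mono : forall x y, (x <= y)%R -> (loc x <= loc y)%N.
(** [loc k] counts the punctures on the left of k. A downward crossing at k contributes [kap k] and
    an upward one its inverse; [lam i] tells whether the puncture i is inside. *)
Definition kap (k : int) : fg := (genprod (iota 0 (loc k)))^-1.
Definition hol s : fg := foldr (fun c h => (kap c.1)^-1 * kap c.2 * h) 1 s.
Definition lam i s := foldr (fun c e => (loc c.1 <= i)%N (+) (loc c.2 <= i)%N (+) e) false s.

Lemma hol_cat s1 s2 : hol (s1 ++ s2) = hol s1 * hol s2.
Proof. by elim: s1 => [|c s1 IH] /=; rewrite ?mul1g // IH !mulgA. Qed.
Lemma lam_cat i s1 s2 : lam i (s1 ++ s2) = lam i s1 (+) lam i s2.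
Proof. by elim: s1 => //= c s1 ->; rewrite addbA. Qed.

Lemma kap_between p q : (p <= q)%R ->
  (kap q)^-1 * kap p = cprod (cj (genprod (iota 0 (loc p))) [seq (1, i) | i <- iota (loc p) (loc q - loc p)]).
Proof.
move=> /loc_mono pq; rewrite cprod_cj -genprod_cprod /kap invgK.
by rewrite -{1}(subnKC pq) seq.iotaD genprod_cat.
Qed.

Lemma ex_min (ks : seq int) : ks != [::] -> exists2 m, m \in ks & forall k, k \in ks -> (m <= k)%R.
Proof.
elim: ks => // k [|k' ks] IH _.
  by exists k => [|z]; rewrite inE // => /eqP->.
have [//|m mks mm] := IH; case: (leP k m) => km.
  exists k; first exact: mem_head.
  by move=> z; rewrite inE => /orP[/eqP->|/mm]; [|apply: le_trans].
exists m; first by rewrite inE mks orbT.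
by move=> z; rewrite inE => /orP[/eqP->|/mm //]; apply: ltW.
Qed.
Lemma ex_max (ks : seq int) : ks != [::] -> exists2 m, m \in ks & forall k, k \in ks -> (k <= m)%R.
Proof.
move=> ks0; have [|m] := @ex_min (map (fun k => - k)%R ks); first by case: ks ks0.
case/mapP=> k kks -> H; exists k => // z zks; rewrite -lerN2; apply: H; exact: map_f.
Qed.

Lemma lam_par i m s : (forall k, k \in keys s -> (loc k <= i)%N = (k <z m)) -> lam i s = par m s.
Proof.
elim: s => //= c s IH H; rewrite /pr -!H ?inE ?eqxx ?orbT // IH // => k ks; apply: H.
by rewrite !inE ks !orbT.
Qed.
Lemma lam_ex i s : lam i s -> exists2 k, k \in keys s & (loc k <= i)%N.
Proof.
elim: s => //= c s IH; case: (leqP (loc c.1) i) => [c1 _|_]; first by exists c.1; rewrite ?mem_head.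
case: (leqP (loc c.2) i) => [c2 _|_]; first by exists c.2; rewrite ?inE ?eqxx ?orbT.
by move=> /= /IH[k ks ki]; exists k; rewrite ?inE ?ks ?orbT.
Qed.

(** Let m be the rightmost crossing of either loop on the left of the puncture i. It belongs to one
    loop, and for the other loop the parity at i is the parity at m, which vanishes. *)
Lemma lam_disjoint i s1 s2 : uniq (keys s1 ++ keys s2) ->
  (forall k, k \in keys s1 -> par k s2 = false) -> (forall k, k \in keys s2 -> par k s1 = false) ->
  lam i s1 -> lam i s2 -> False.
Proof.
move=> u H1 H2 l1 l2; pose ks := [seq k <- keys s1 ++ keys s2 | (loc k <= i)%N].
have [|m] := @ex_max ks.
  have [k ks1 ki] := lam_ex l1; apply: contraTneq (_ : k \in ks) => [->//|].
  by rewrite mem_filter ki mem_cat ks1.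
rewrite mem_filter mem_cat => /andP[mi mks] mm.
have main s : {subset keys s <= keys s1 ++ keys s2} -> m \notin keys s -> par m s = false -> lam i s -> False.
  move=> sub ms ps; rewrite (@lam_par i m) ?ps // => k ks'; rewrite /lt_z lt_neqAle.
  have -> : k != m by apply: contraTneq ks' => ->.
  apply/idP/idP => /= [ki|/loc_mono km]; last exact: leq_trans km mi.
  by apply: mm; rewrite mem_filter ki sub.
move: u; rewrite cat_uniq => /and3P[_ /hasPn nu _].
case/orP: mks => m12.
  by apply: (main s2) l2; [move=> k; rewrite mem_cat => ->; rewrite orbT|apply: contraTN m12 => /nu|exact: H1].
by apply: (main s1) l1; [move=> k; rewrite mem_cat => -> |exact: nu|exact: H2].
Qed.

Lemma hol_rot s1 s2 : hol (s2 ++ s1) = (hol s1)^-1 * hol (s1 ++ s2) * hol s1.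
Proof. by rewrite !hol_cat; grp. Qed.

(** Arcs begin at crossings with an even number of crossings on their left. This is the orientation
    for which the inverse of the holonomy is a product of conjugates of letters, without inverses of
    letters. *)
Definition positive s := valid s /\ forall c, c \in s -> par c.1 s = false.

Lemma positive_rot s1 s2 : positive (s1 ++ s2) -> positive (s2 ++ s1).
Proof.
case=> v e; split; first exact: valid_rot.
move=> c; rewrite (par_perm _ (permEl (perm_catC s2 s1))) mem_cat orbC -mem_cat; exact: e.
Qed.

Definition letters s (S : seq (fg * nat)) :=
  [/\ (hol s)^-1 = cprod S, uniq (map snd S) & forall i, (i \in map snd S) = lam i s].

Lemma letters_rot s1 s2 S : letters (s1 ++ s2) S -> exists S', letters (s2 ++ s1) S'.
Proof.
case=> E u H; exists (cj (hol s1)^-1 S); split; rewrite ?cj_snd //.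
  by rewrite cprod_cj -E hol_rot; grp.
by move=> i; rewrite H !lam_cat addbC.
Qed.

(* Cutting along the chord joining the two leftmost crossings splits the loop in two. *)
Theorem loop_letters s : positive s -> exists S, letters s S.
Proof.
have [n] := ubnP (size s); elim: n s => // n IH s; rewrite ltnS => sn ps.
case: s sn ps => [|c0 s0] sn ps; first by exists [::]; split; rewrite ?invg1.
have [//|p pk pmin] := @ex_min (keys (c0 :: s0)).
have [[u _ _] e] := ps.
(* Nothing lies to the left of p, so p is the beginning of an arc, and the loop is rotated to start
   there. *)
have par_p : par p (c0 :: s0) = false.
  apply/negbTE/negP => pp.
  have E : par p (c0 :: s0) = par p (c0 :: s0) by [].
  move: pp; apply/negP; elim: (c0 :: s0) pmin => //= c s IHs pmin.
  rewrite (negbTE (IHs _)) ?addbF; last by move=> k ks; apply: pmin; rewrite !inE ks !orbT.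
  have := pmin c.1; have := pmin c.2; rewrite !inE !eqxx !orbT /pr /lt_z => /(_ isT) h1 /(_ isT) h2; lia.
have [c cs pc] := keys_mem pk.
have {}pc : p = c.1.
  case: pc => // pc; have := valid_flip ps.1 cs; by rewrite -pc par_p (e _ cs).
case/splitPr: cs sn ps pmin u {e par_p pk} => s1 s2; case: c pc => _ b /= <- sn ps pmin u.
have [s' Es'] : exists s', s' = (p, b) :: s2 ++ s1 by eexists.
suff [S LS] : exists S, letters s' S.
  by move: LS; rewrite Es' -cat_cons => /letters_rot.
have {}ps : positive s' by rewrite Es' -cat_cons; apply: positive_rot.
have sn' : (size s' <= n)%N by rewrite Es' -cat_cons size_cat addnC -size_cat.
have {}u : uniq (keys s') by case: ps => -[].
have {}pmin k : k \in keys s' -> k != p -> p <z k.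
  move=> ks kp; rewrite /lt_z lt_neqAle eq_sym kp; apply: pmin.
  by rewrite (perm_mem (keys_perm (permEl (perm_catC s1 _)))) cat_cons -Es'.
have [|q] := @ex_min (b :: keys (s2 ++ s1)); first by [].
move=> qk qm.
have qs : q \in keys s' by rewrite Es' inE qk orbT.
have qp : q != p by apply: contraTneq u; rewrite Es' /= => <-; rewrite qk.
have qmin k : k \in keys s' -> k != p -> k != q -> q <z k.
  rewrite {1}Es' inE => /orP[/eqP->|/qm]; first by rewrite eqxx.
  by move=> qk' _ kq; rewrite /lt_z lt_neqAle eq_sym kq.
(* Only p lies to the left of q, so q is the end of an arc. *)
have par_q : par q s'.
  have H L : {subset keys L <= b :: keys (s2 ++ s1)} -> par q L = false.
    elim: L => //= c L IHL sub; rewrite IHL ?addbF; last by move=> k kL; apply: sub; rewrite !inE kL !orbT.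
    have := qm c.1 (sub _ _); have := qm c.2 (sub _ _).
    by rewrite !inE !eqxx !orbT /pr /lt_z => /(_ isT) h1 /(_ isT) h2; lia.
  rewrite Es' /= H ?addbF; last by move=> k; rewrite inE => ->; rewrite orbT.
  have := pmin _ qs qp; have := qm b (mem_head _ _); rewrite /pr /lt_z /=; lia.
have [vs es] := ps.
have [c cs qc] := keys_mem qs.
have {}qc : q = c.2 by case: qc => // qc; move: par_q; rewrite qc es.
have {qc}cs : (c.1, q) \in s' by rewrite qc -surjective_pairing.
move: (c.1) cs => y cs {c}.
have btw i : (i \in iota (loc p) (loc q - loc p)) = (loc p <= i)%N (+) (loc q <= i)%N.
  have /loc_mono : (p <= q)%R by have := pmin _ qs qp; apply: ltW.
  rewrite mem_iota; lia.
have bE := kap_between (ltW (pmin _ qs qp)).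
have sndE (l : seq nat) : map snd [seq ((1 : fg), i) | i <- l] = l by rewrite -map_comp map_id.
move: cs; rewrite {1}Es' inE => /orP[/eqP[_ qb]|/splitPr cs].
  set B := s2 ++ s1 in Es'.
  have aB : adj p q (keys B).
    move=> z zB; have zs : z \in keys s' by rewrite Es' !inE zB !orbT.
    move: u; rewrite Es' uniq_keysP -qb => /and4P[_ /= n1 n2 _].
    have zp : z != p by apply: contraNneq n1 => <-.
    have zq : z != q by apply: contraNneq n2 => <-.
    have := pmin _ zs zp; have := qmin _ zs zp zq; rewrite /lt_z; lia.
  rewrite -qb in Es'; rewrite Es' in vs es; have pB := good_rest vs es aB.
  have [|SB [EB uB HB]] := IH B _ pB; first by move: sn'; rewrite Es'.
  have H i : lam i B -> (loc p <= i)%N (+) (loc q <= i)%N -> False.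
    move=> lB; suff -> : (loc p <= i)%N (+) (loc q <= i)%N = false by [].
    have [k kB ki] := lam_ex lB; have [_ E] := aB k kB.
    have kp : p <z k.
      have ks : k \in keys s' by rewrite Es' !inE kB !orbT.
      by apply: pmin => //; apply: contraTneq kB => ->; move: u; rewrite Es' uniq_keysP => /and4P[].
    have kq : q <z k by rewrite -E.
    by rewrite !(leq_trans (loc_mono (ltW _)) ki).
  exists (SB ++ cj (genprod (iota 0 (loc p))) [seq (1, i) | i <- iota (loc p) (loc q - loc p)]).
  rewrite Es'; split.
  - rewrite cprod_cat -bE -EB /=; grp; reflexivity.
  - rewrite map_cat cj_snd sndE cat_uniq uB iota_uniq andbT /=.
    by apply/hasPn => i; rewrite btw HB => ib; apply/negP => /H; apply.
  move=> i; rewrite map_cat cj_snd sndE mem_cat btw HB /=.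
  by case l: (lam i B); [move/H: l|]; case: (_ (+) _) => // /(_ isT).
case: cs Es' => M B Es'.
rewrite Es' in vs es pmin qmin.
have [kA kB] := (@par_AB _ _ _ _ _ _ vs pmin qmin, @par_BA _ _ _ _ _ _ vs pmin qmin).
have pA := good_A vs es pmin qmin; have pB := good_B vs es pmin qmin.
set A := M ++ _ in kA kB pA.
have sz : (size A + size B < n)%N by move: sn'; rewrite Es' /A /= !size_cat /=; lia.
have [|SA [EA uA HA]] := IH A _ pA; first exact: leq_ltn_trans (leq_addr _ _) sz.
have [|SB [EB uB HB]] := IH B _ pB; first exact: leq_ltn_trans (leq_addl _ _) sz.
have uAB : uniq [:: p, q & keys A ++ keys B] by rewrite -(perm_uniq (keysAB vs)) -Es'.
have kpq k : k \in keys A ++ keys B -> p <z k /\ q <z k.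
  move=> kAB; have ks : k \in keys ((p, b) :: M ++ (y, q) :: B) by rewrite (perm_mem (keysAB vs)) !inE kAB !orbT.
  have kp : k != p by apply: contraTneq uAB => <-; rewrite /= inE kAB orbT.
  have kq : k != q by apply: contraTneq uAB => <-; rewrite /= kAB andbF.
  by split; [apply: pmin|apply: qmin].
have Hb i L : {subset keys L <= keys A ++ keys B} -> lam i L -> (loc p <= i)%N (+) (loc q <= i)%N -> False.
  move=> sub lB; suff -> : (loc p <= i)%N (+) (loc q <= i)%N = false by [].
  have [k kL ki] := lam_ex lB; have [kp kq] := kpq k (sub _ kL).
  by rewrite !(leq_trans (loc_mono (ltW _)) ki).
have subA : {subset keys A <= keys A ++ keys B} by move=> k; rewrite mem_cat => ->.
have subB : {subset keys B <= keys A ++ keys B} by move=> k; rewrite mem_cat orbC => ->.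
have HAB i : lam i A -> lam i B -> False.
  by apply: lam_disjoint kA kB; move: uAB => /= /and3P[].
(* The chord contributes the punctures between p and q; the letters of the other half are conjugated
   by the arc that leads to it. *)
pose SP := cj (genprod (iota 0 (loc p))) [seq (1, i) | i <- iota (loc p) (loc q - loc p)].
exists (SB ++ SP ++ cj ((kap p)^-1 * kap b) SA).
rewrite Es'; split.
- rewrite !cprod_cat cprod_cj -bE -EB -EA /A !hol_cat /= !hol_cat /=; grp; reflexivity.
- rewrite !map_cat !cj_snd sndE !cat_uniq uA uB iota_uniq !andbT /=.
  apply/andP; split.
    apply/hasPn => i; rewrite mem_cat btw HA => /orP[ib|lA]; apply/negP; rewrite HB => lB.
      exact: Hb lB ib.
    exact: HAB lA lB.
  by apply/hasPn => i; rewrite HA => lA; apply/negP; rewrite btw; apply: Hb lA.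
move=> i; rewrite !map_cat !cj_snd sndE !mem_cat btw HA HB /= !lam_cat /=.
have := @HAB i; have := Hb i _ subA; have := Hb i _ subB; rewrite /A lam_cat /=.
move: (lam i B) (lam i M) (loc p <= i)%N (loc q <= i)%N (loc b <= i)%N (loc y <= i)%N.
by (do 6!case); move=> //= h1 h2 h3; first [case: (h1 isT isT)|case: (h2 isT isT)|case: (h3 isT isT)].
Qed.
End Loop.
End MeanderHolonomy.
Import MeanderHolonomy.

(** * Complements of meanders and pairs of disjoint meanders *)

Module MeanderPairs.
Local Open Scope group_scope.

Local Infix "<z" := lt_z (at level 70).

Lemma chain2 (F : int -> bool) d s : (forall c, c \in s -> F c.2 = ~~ F c.1) -> (forall c, c \in lw d s -> F c.2 = ~~ F c.1) ->
  forall c, c \in s -> F c.1 = ~~ F d.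
Proof.
elim: s d => //= c s IH d H1 H2 e; have /= E2 := H2 _ (mem_head _ _).
rewrite inE => /orP[/eqP->//|es]; rewrite (IH c.2) //.
- by rewrite H1 ?mem_head // E2 negbK.
- by move=> f fs; apply: H1; rewrite inE fs orbT.
- by move=> f fs; apply: H2; rewrite inE fs orbT.
Qed.

Lemma lows_mem c s : c \in lows s -> c.1 \in map snd s /\ c.2 \in map fst s.
Proof.
move=> cs; split; first by rewrite -(mem_rotr 1) -lows_fst; apply: map_f.
by rewrite -(lows_snd (lst 0%R s)); apply: map_f.
Qed.

Lemma lows_neq s c : uniq (keys s) -> c \in lows s -> c.1 != c.2.
Proof.
move=> u /lows_mem[/mapP[d ds ->] /mapP[e es ->]]; rewrite eq_sym.
by have [_ [_]] := uniq_fst_snd u es ds.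
Qed.

(** The parity changes along every arc, upper or lower, so it takes the same value at all beginnings
    of upper arcs. *)
Lemma par_same s c d : valid s -> c \in s -> d \in s -> par c.1 s = par d.1 s.
Proof.
move=> vs; have [u n1 n2] := vs.
suff H e : e \in s -> par e.1 s = ~~ par (lst 0%R s) s by move=> cs ds; rewrite !H.
apply: (@chain2 (fun k => par k s)) => [f fs|f fs]; first by rewrite (valid_flip vs fs) negbK.
have fl : f \in lows s by [].
by rewrite (par_flip n2 (uniq_lows u) (fun v => par_lows v s) fl (lows_neq u fl)) negbK.
Qed.

Definition rs (s : seq arc) := rev (map swp s).
Lemma rs_cons c s : rs (c :: s) = rcons (rs s) (swp c).
Proof. by rewrite /rs /= rev_cons. Qed.
Lemma mem_rs c s : (c \in rs s) = (swp c \in s).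
Proof.
rewrite /rs mem_rev; apply/mapP/idP => [[[a b] ds ->] //|cs]; exists (swp c) => //; by case: c cs.
Qed.
Lemma keys_rs s : perm_eq (keys (rs s)) (keys s).
Proof.
elim: s => // c s IH; rewrite rs_cons -cats1 keys_cat.
rewrite perm_catC -[keys (c :: s)]/([:: c.1; c.2] ++ keys s) perm_cat //.
by apply/permP => P /=; rewrite !addn0 addnC.
Qed.
Lemma par_rs u s : par u (rs s) = par u s.
Proof.
elim: s => // c s IH; rewrite rs_cons -cats1 par_cat /= IH addbF addbC; congr (_ (+) _).
by rewrite /pr /= addbC.
Qed.
Lemma lw_rcons d s c : lw d (rcons s c) = rcons (lw d s) (lst d s, c.1).
Proof. by rewrite -!cats1 lw_cat. Qed.
Lemma lst_rcons d s c : lst d (rcons s c) = c.2.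
Proof. by rewrite -cats1 lst_cat. Qed.
Lemma lows_rs s : perm_eq (lows (rs s)) (map swp (lows s)).
Proof.
have H s' d e : rcons (lw d (rs s')) (lst d (rs s'), e) = rs (rcons (lw e s') (lst e s', d)).
  elim: s' d e => [|c s' IH] d e; first by [].
  by rewrite rs_cons lw_rcons lst_rcons [rcons _ _ in RHS]/= rs_cons -IH.
case: s => // c s.
have -> : lows (rs (c :: s)) = rcons (lw c.1 (rs s)) (lst c.1 (rs s), c.2).
  by rewrite /lows rs_cons lst_rcons lw_rcons.
rewrite H /rs perm_rev; apply: perm_map.
by rewrite /lows /= -/(lst c.2 s) perm_rcons.
Qed.
Lemma uniq_map_eq (T U : eqType) (f : T -> U) L x y : uniq (map f L) -> x \in L -> y \in L -> f x = f y -> x = y.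
Proof.
elim: L => //= z L IH /andP[zL u]; rewrite !inE => /orP[/eqP->|xL] /orP[/eqP->|yL] E //; last exact: IH.
  by move: zL; rewrite E map_f.
by move: zL; rewrite -E map_f.
Qed.
Lemma ncs_rs L L' : (forall c, c \in L' -> swp c \in L) -> ncs L -> uniq (map fst L) -> ncs L'.
Proof.
move=> sub nL uL c d cL dL cd; have := nL _ _ (sub c cL) (sub d dL).
have inj : (swp c).1 != (swp d).1.
  apply: contraNneq cd => /(uniq_map_eq uL (sub c cL) (sub d dL)).
  by case: c d {cL dL} => [? ?] [? ?] [_ ->].
move=> /(_ inj); rewrite /nc /pr /= => /eqP E; apply/eqP.
by rewrite addbC -E addbC.
Qed.
Lemma valid_rs s : valid s -> valid (rs s).
Proof.
case=> u n1 n2; split; first by rewrite (perm_uniq (keys_rs s)).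
  by apply: ncs_rs n1 (uniq_fst u) => c; rewrite mem_rs.
apply: ncs_rs n2 (uniq_lows u) => c; rewrite (perm_mem (lows_rs s)) => /mapP[[a b] d ->] //.
Qed.

Section Loops.
Variable loc : int -> nat.
Hypothesis loc_mono : forall x y, (x <= y)%R -> (loc x <= loc y)%N.
Local Notation kap := (kap loc).
Local Notation hol := (hol loc).
Local Notation lam := (lam loc).

Lemma hol_rs s : hol (rs s) = (hol s)^-1.
Proof.
elim: s => [|c s IH]; first by rewrite invg1.
rewrite rs_cons -cats1 hol_cat IH /=; grp; reflexivity.
Qed.
Lemma lam_rs i s : lam i (rs s) = lam i s.
Proof.
elim: s => // c s IH; rewrite rs_cons -cats1 lam_cat IH /= addbF.
by move: (lam i s) (loc c.1 <= i)%N (loc c.2 <= i)%N => [] [] [].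
Qed.

(** Reversing the loop exchanges beginnings and ends, which have opposite parities. *)
Lemma positive_or s : valid s -> positive s \/ positive (rs s).
Proof.
move=> vs; case: (boolP (all (fun c => ~~ par c.1 s) s)) => [/allP H|/allPn[d ds /negPn pd]].
  by left; split=> // c /H /negPf.
right; split; first exact: valid_rs.
move=> c; rewrite mem_rs par_rs => cs; have := valid_flip vs cs.
by rewrite (par_same vs cs ds) pd /= => /esym/negbTE.
Qed.

Lemma loop_form s : valid s -> exists S, (hol s = cprod S \/ hol s = (cprod S)^-1) /\
  uniq (map snd S) /\ (forall i, (i \in map snd S) = lam i s).
Proof.
move=> /positive_or[] /(loop_letters loc_mono)[S [E u H]]; exists S.
  by rewrite -E invgK; split; [right|].
split; first by left; rewrite -E hol_rs invgK.
by split=> // i; rewrite H lam_rs.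
Qed.

(* Moving the leftmost crossing to the far right, through infinity. *)
Section Infinity.
Variables (q Q : int) (K : seq int).
Hypotheses (qmin : forall k, k \in K -> k != q -> q <z k) (Qmax : forall k, k \in K -> k <z Q).
Definition mv1 (k : int) := if k == q then Q else k.
Definition mv2 (c : arc) : arc := (mv1 c.1, mv1 c.2).
Lemma mv1_inj : {in K &, injective mv1}.
Proof.
move=> a b aK bK; rewrite /mv1; have := Qmax aK; have := Qmax bK; rewrite /lt_z.
by case: eqP => [->|_]; case: eqP => [->|_] //; lia.
Qed.
Lemma nc_mv c d : c.1 \in K -> c.2 \in K -> d.1 \in K -> d.2 \in K -> uniq [:: c.1; c.2; d.1; d.2] ->
  nc c d -> nc (mv2 c) (mv2 d).
Proof.
case: c d => [a b] [a' b'] /= aK bK aK' bK' u; rewrite /nc /pr /mv2 /mv1 /=.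
have h z : z \in K -> (z != q -> (q < z)%R) /\ (z < Q)%R by move=> zK; split; [apply: qmin|apply: Qmax].
have [a1 a2] := h _ aK; have [b1 b2] := h _ bK; have [a1' a2'] := h _ aK'; have [b1' b2'] := h _ bK'.
move: u; rewrite !inE !negb_or /lt_z; move: a1 b1 a1' b1'.
by do 4![case: eqP => [?|/eqP ?]]; subst=> //=; lia.
Qed.
Lemma lw_mv d s : lw (mv1 d) (map mv2 s) = map mv2 (lw d s).
Proof. by elim: s d => //= c s IH d; rewrite IH. Qed.
Lemma lst_mv d s : lst (mv1 d) (map mv2 s) = mv1 (lst d s).
Proof. by elim: s d => //= c s IH d; rewrite /lst /=; apply: (IH c.2). Qed.
Lemma lows_mv s : lows (map mv2 s) = map mv2 (lows s).
Proof. by case: s => // c s; rewrite /lows -lw_mv -lst_mv. Qed.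
Lemma keys_mv s : keys (map mv2 s) = map mv1 (keys s).
Proof. by elim: s => // c s IH; rewrite -[LHS]/(mv1 c.1 :: mv1 c.2 :: keys (map mv2 s)) IH. Qed.
End Infinity.

Lemma keys_split s : perm_eq (keys s) (map fst s ++ map snd s).
Proof.
elim: s => // c s /permP IH; apply/permP => P; have := IH P.
by rewrite -[keys (c :: s)]/(c.1 :: c.2 :: keys s) !count_cat /=; lia.
Qed.
Lemma keys_lows s : perm_eq (keys (lows s)) (keys s).
Proof.
rewrite (perm_trans (keys_split _)) // perm_sym (perm_trans (keys_split _)) //.
rewrite lows_fst /lows lows_snd perm_catC perm_cat // perm_sym perm_rotr //.
Qed.
Lemma uniq4 L c d : uniq (keys L) -> c \in L -> d \in L -> c.1 != d.1 -> uniq [:: c.1; c.2; d.1; d.2].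
Proof.
move=> u cL dL cd; have [_ [H1 H2]] := uniq_fst_snd u cL dL; have [_ [_ H3]] := uniq_fst_snd u dL cL.
have [_ [_ H4]] := uniq_fst_snd u cL cL; have [_ [_ H5]] := uniq_fst_snd u dL dL.
rewrite /= !inE !negb_or cd H2 H4 H5 /= eq_sym H3 andbT /=.
by apply: contra cd => /H1 ->.
Qed.

Lemma valid_mv q Q s : valid s -> (forall k, k \in keys s -> k != q -> q <z k) ->
  (forall k, k \in keys s -> k <z Q) -> valid (map (mv2 q Q) s).
Proof.
move=> [u n1 n2] qmin Qmax.
have main L : uniq (keys L) -> {subset keys L <= keys s} -> ncs L -> ncs (map (mv2 q Q) L).
  move=> uL sub nL _ _ /mapP[c cL ->] /mapP[d dL ->] cd.
  have cd' : c.1 != d.1 by apply: contraNneq cd => /= ->.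
  have [/andP[c1 c2] /andP[d1 d2]] := (mem_keys cL, mem_keys dL).
  by apply: (nc_mv qmin Qmax); rewrite ?sub ?(uniq4 uL) //; apply: nL.
split; last 1 first.
- rewrite lows_mv; apply: main => //; first by rewrite (perm_uniq (keys_lows s)).
  by move=> k; rewrite (perm_mem (keys_lows s)).
- by rewrite keys_mv (map_inj_in_uniq (mv1_inj Qmax)).
- exact: main.
Qed.

Lemma hol_rot_form s1 s2 S : (hol (s1 ++ s2))^-1 = cprod S -> (hol (s2 ++ s1))^-1 = cprod (cj (hol s1)^-1 S).
Proof. by rewrite cprod_cj => <-; rewrite hol_rot; grp. Qed.

Lemma lam_below i q s : (forall k, k \in keys s -> (q <= k)%R) -> (i < loc q)%N -> lam i s = false.
Proof.
move=> H iq; apply/negbTE/negP => /(lam_ex)[k /H/loc_mono kq ki].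
by move: (leq_ltn_trans ki iq); rewrite ltnNge kq.
Qed.

(** The reversed loop, with its leftmost crossing q moved to a point Q on the right of all
    punctures, is again positive. It encloses exactly the punctures to the right of q that are
    outside s. Its letters, those of s and the punctures to the left of q multiply to the product of
    all four letters. *)
Lemma positive_complement s : positive s -> s != [::] -> (forall k0, exists2 Q, k0 <z Q & loc Q = 4%N) ->
  exists g S S', [/\ (hol s)^-1 = g * cprod S * g^-1, cprod (S ++ S') = genprod (iota 0 4),
    perm_eq (map snd (S ++ S')) (iota 0 4) & forall i, (i \in map snd S) = lam i s].
Proof.
move=> ps s0 top; have [S [ES uS HS]] := loop_letters loc_mono ps.
have [|q qk qmin] := @ex_min (keys s); first by case: s s0 {ps ES HS}.
have [|z _ zmax] := @ex_max (keys s); first by case: s s0 {ps ES HS qk qmin}.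
have [Q zQ Q4] := top z; have {}zQ k : k \in keys s -> k <z Q by move=> /zmax kz; apply: le_lt_trans kz zQ.
have [u _ _] := ps.1.
have qpar : par q s = false.
  elim: (s) qmin => //= c s' IHs H.
  rewrite IHs ?addbF; last by move=> k ks; apply: H; rewrite !inE ks !orbT.
  have := H c.1; have := H c.2; rewrite !inE !eqxx !orbT /pr /lt_z => /(_ isT) h1 /(_ isT) h2; lia.
have [c cs qc] := keys_mem qk.
have {}qc : q = c.1 by case: qc => // E; have := valid_flip ps.1 cs; rewrite -E qpar (ps.2 _ cs).
case/splitPr: cs qk u ps s0 qmin zQ zmax qpar ES HS => s1 s2; case: c qc => _ b /= <-.
move=> qk u ps _ qmin zQ _ qpar ES HS.
have kQ : perm_eq (keys ((q, b) :: s2 ++ s1)) (keys (s1 ++ (q, b) :: s2)).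
  by apply: keys_perm; rewrite -cat_cons (permEl (perm_catC _ _)).
pose N := rs (s2 ++ s1); have wE : rs ((q, b) :: s2 ++ s1) = rcons N (b, q) by rewrite rs_cons.
have kw k : (k \in keys (rcons N (b, q))) = (k \in keys (s1 ++ (q, b) :: s2)).
  by rewrite -wE (perm_mem (keys_rs _)) (perm_mem kQ).
have pw : positive ((q, b) :: s2 ++ s1) by rewrite -cat_cons; apply: positive_rot.
have vw : valid (rcons N (b, q)) by rewrite -wE; apply: valid_rs; case: pw.
have uw : uniq (keys (rcons N (b, q))) by case: vw.
have kN k : k \in keys N -> k != q.
  move: uw; rewrite -cats1 keys_cat cat_uniq => /and3P[_ /hasPn H _]; apply: contraTneq => ->.
  by apply: H; rewrite !inE eqxx orbT.
have bq : b != q by move: uw; rewrite -cats1 keys_cat cat_uniq /= inE => /and4P[].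
have mvE : map (mv2 q Q) (rcons N (b, q)) = rcons N (b, Q).
  rewrite map_rcons {2}/mv2 /= {2}/mv1 eqxx {1}/mv1 (negPf bq); congr rcons.
  rewrite -[RHS]map_id; apply/eq_in_map => c /mem_keys/andP[/kN c1 /kN c2].
  by rewrite /mv2 /mv1 (negPf c1) (negPf c2); case: c {c1 c2}.
have qlt k : k \in keys (rcons N (b, q)) -> k != q -> q <z k.
  by rewrite kw /lt_z lt_neqAle eq_sym => /qmin -> ->.
have vQ : valid (rcons N (b, Q)).
  by rewrite -mvE; apply: valid_mv => // k; rewrite kw; apply: zQ.
have pQ : positive (rcons N (b, Q)).
  split=> // c cs; have {cs}[c' cs cE] : exists2 c', c' \in rcons N (b, q) & c.1 = c'.1.
    by move: cs; rewrite mem_rcons inE => /orP[/eqP->|cN]; [exists (b, q)|exists c]; rewrite // mem_rcons ?mem_head // inE cN orbT.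
  have c1k : c'.1 \in keys (rcons N (b, q)) by case/andP: (mem_keys cs).
  have c1q : c'.1 != q.
    have qs : (b, q) \in rcons N (b, q) by rewrite mem_rcons mem_head.
    by have [_ [_]] := uniq_fst_snd uw cs qs.
  have E : par c'.1 (rcons N (b, Q)) = ~~ par c'.1 (rcons N (b, q)).
    have := qlt _ c1k c1q; have : c'.1 <z Q by apply: zQ; rewrite -kw.
    rewrite -!cats1 !par_cat /= /pr /= /lt_z => h1 h2.
    have -> : (Q < c'.1)%R = false by apply/negbTE; rewrite -leNgt ltW.
    by rewrite h2; case: (par _ _); case: (b < _)%R.
  rewrite cE E -wE par_rs; move: cs; rewrite -wE mem_rs => cs.
  by have := valid_flip pw.1 cs; rewrite (pw.2 _ cs) /= => /esym/negbFE ->.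
have [S2 [E2 u2 H2]] := loop_letters loc_mono pQ.
have holw : hol (rcons N (b, q)) = cprod (cj (hol s1)^-1 S).
  by rewrite -wE hol_rs -cat_cons (hol_rot_form ES).
have dE : genprod (iota 0 4) = cprod S2 * cprod (cj (hol s1)^-1 S) * genprod (iota 0 (loc q)).
  have kQE : (kap Q)^-1 = genprod (iota 0 4) by rewrite -Q4; apply: invgK.
  have kqE : (kap q)^-1 = genprod (iota 0 (loc q)) by apply: invgK.
  rewrite -E2 -holw -!cats1 !hol_cat -kQE -kqE /=; grp; reflexivity.
pose S3 := S2 ++ [seq (1, i) | i <- iota 0 (loc q)].
pose X := cprod S2; pose Y := hol s1.
have sndE (l : seq nat) : map snd [seq ((1 : fg), i) | i <- l] = l by rewrite -map_comp map_id.
have lamE i : lam i (rcons N (b, Q)) = lam i (s1 ++ (q, b) :: s2) (+) (loc q <= i)%N (+) (4 <= i)%N.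
  have -> : lam i (s1 ++ (q, b) :: s2) = lam i (rcons N (b, q)).
    by rewrite -wE lam_rs -cat_cons !lam_cat addbC.
  rewrite -!cats1 !lam_cat /= Q4; by do 4?case: (_ <= i)%N; case: (lam _ _).
have q4 : (loc q <= 4)%N by rewrite -Q4; apply: loc_mono; apply: ltW; apply: zQ.
have lamq i : (i < loc q)%N -> lam i (s1 ++ (q, b) :: s2) = false by apply: lam_below.
have lam4 i : (4 <= i)%N -> lam i (s1 ++ (q, b) :: s2) = false.
  move=> i4; elim: (s1 ++ _) zQ => //= c r IH H; rewrite IH; last by move=> k kr; apply: H; rewrite !inE kr !orbT.
  have l k : k \in keys (c :: r) -> (loc k <= i)%N.
    by move=> /H /ltW /loc_mono; rewrite Q4 => /leq_trans; apply.
  by rewrite !l ?inE ?eqxx ?orbT.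
pose S' := cj (hol s1)^-1 S.
exists (hol s1), S', (cj (cprod S')^-1 S2 ++ [seq (1, i) | i <- iota 0 (loc q)]); split.
- by rewrite cprod_cj ES; grp.
- rewrite -[RHS]/(genprod (iota 0 4)) dE -/S' !cprod_cat cprod_cj -genprod_cprod; grp; reflexivity.
- apply: (@uniq_perm _ _ (iota 0 4)); rewrite ?iota_uniq // !map_cat !cj_snd sndE.
    rewrite !cat_uniq uS u2 iota_uniq /= andbT; apply/andP; split.
      apply/hasPn => i; rewrite mem_cat mem_iota H2 HS lamE add0n /= => H; apply/negP => l.
      have iq : (i < loc q)%N = false by apply/negP => /lamq; rewrite l.
      by move: H; rewrite l iq orbF leqNgt iq; case: leqP => // /lam4; rewrite l.
    apply/hasPn => i; rewrite mem_iota H2 lamE /= add0n => iq; rewrite lamq // addFb leqNgt iq /=.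
    by rewrite -ltnNge (leq_trans iq q4).
  move=> i; rewrite !mem_cat !mem_iota HS H2 lamE !add0n /=.
  have [iq|iq] := ltnP i (loc q); first by rewrite (leq_trans iq q4) !orbT.
  have [i4|i4] := ltnP i 4; first by case: (lam _ _).
  by rewrite lam4.
by move=> i; rewrite cj_snd HS.
Qed.

(** No arc of the second loop crosses the first loop, so by [chain] the second loop lies on one side
    of it. *)
Lemma joint_const s1 s2 : uniq (keys s1 ++ keys s2) -> ncs (s1 ++ s2) -> ncs (lows s1 ++ lows s2) ->
  forall k k', k \in keys s2 -> k' \in keys s2 -> par k s1 = par k' s1.
Proof.
move=> u n1 n2; have ua := u; move: ua; rewrite cat_uniq => /and3P[u1 /hasPn nu u2].
suff H k : k \in keys s2 -> par k s1 = par (lst 0%R s2) s1 by move=> k k' /H -> /H ->.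
have ne c d : c \in s1 -> d \in s2 -> c.1 != d.1.
  by move=> /mem_keys/andP[c1 _] /mem_keys/andP[d1 _]; apply: contraTneq c1 => ->; apply: nu.
apply: (@chain (fun k => par k s1)) => c cs.
  by apply: par_const => d ds; apply: (n1 d c); rewrite ?mem_cat ?ds ?cs ?orbT // ne.
rewrite -!(par_lows _ s1); apply: par_const => d ds; apply: (n2 d c); rewrite ?mem_cat ?ds ?cs ?orbT //.
have /andP[+ _] := mem_keys ds; have cs' : c \in lows s2 by [].
have /andP[+ _] := mem_keys cs'; rewrite !(perm_mem (keys_lows _)) => c1 d1.
by apply: contraTneq d1 => ->; apply: nu.
Qed.

Definition joint s1 s2 := [/\ uniq (keys s1 ++ keys s2), ncs (s1 ++ s2) & ncs (lows s1 ++ lows s2)].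
Lemma ncs_perm L L' : L =i L' -> ncs L -> ncs L'.
Proof. by move=> E nL c d; rewrite -!E; apply: nL. Qed.
Lemma joint_sym s1 s2 : joint s1 s2 -> joint s2 s1.
Proof.
case=> u n1 n2; split; first by rewrite (perm_uniq (permEl (perm_catC _ _))).
  by apply: ncs_perm n1 => c; rewrite !mem_cat orbC.
by apply: ncs_perm n2 => c; rewrite !mem_cat orbC.
Qed.
Lemma joint_perm s1 s1' s2 : perm_eq s1 s1' -> perm_eq (lows s1) (lows s1') -> joint s1 s2 -> joint s1' s2.
Proof.
move=> p1 p2 [u n1 n2]; split.
- by rewrite -(perm_uniq (perm_cat (keys_perm p1) (perm_refl _))).
- by apply: ncs_perm n1 => c; rewrite !mem_cat (perm_mem p1).
by apply: ncs_perm n2 => c; rewrite !mem_cat (perm_mem p2).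
Qed.
Lemma joint_rot s1 s1' s2 : joint (s1 ++ s1') s2 -> joint (s1' ++ s1) s2.
Proof. by apply: joint_perm; [rewrite perm_catC|exact: lows_rot]. Qed.
Lemma joint_rs s1 s2 : joint s1 s2 -> joint (rs s1) s2.
Proof.
case=> u n1 n2.
have u1 : uniq (keys s1) by move: u; rewrite cat_uniq => /and3P[].
have nu : forall k, k \in keys s2 -> k \notin keys s1 by move: u; rewrite cat_uniq => /and3P[_ /hasPn].
have sl c d : nc (swp c) d = nc c d by rewrite /nc /pr /= [in LHS]addbC [X in _ == X]addbC.
have sr c d : nc c (swp d) = nc c d by rewrite /nc /= eq_sym.
have half L1 L2 L1' : ncs (L1 ++ L2) -> (forall c, c \in L1' -> swp c \in L1) -> uniq (map fst L1) ->
    {subset keys L1 <= keys s1} -> {subset keys L2 <= keys s2} -> ncs (L1' ++ L2).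
  move=> nL sub uf k1 k2 c d.
  have ne e f : e \in L1 -> f \in L2 -> e.1 != f.1 /\ f.1 != e.1.
    move=> /mem_keys/andP[/k1 e1 _] /mem_keys/andP[/k2/nu f1 _].
    by split; apply: contraTneq e1; [move=> ->|move=> <-].
  rewrite !mem_cat => /orP[/sub c1|c2] /orP[/sub d1|d2] cd.
  - rewrite -sl -sr; apply: nL; rewrite ?mem_cat ?c1 ?d1 //.
    apply: contraNneq cd => /(uniq_map_eq uf c1 d1).
    by case: (c) (d) => [? ?] [? ?] [_ ->].
  - by rewrite -sl; apply: nL; rewrite ?mem_cat ?c1 ?d2 ?orbT //; case: (ne _ _ c1 d2).
  - by rewrite -sr; apply: nL; rewrite ?mem_cat ?d1 ?c2 ?orbT //; case: (ne _ _ d1 c2).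
  - by apply: nL; rewrite ?mem_cat ?c2 ?d2 ?orbT.
split; first by rewrite (perm_uniq (perm_cat (keys_rs s1) (perm_refl _))).
  by apply: half n1 _ (uniq_fst u1) _ _ => // c; rewrite mem_rs.
apply: half n2 _ (uniq_lows u1) _ _.
- by move=> c; rewrite (perm_mem (lows_rs s1)) => /mapP[[a b] d ->].
- by move=> k; rewrite (perm_mem (keys_lows s1)).
- by move=> k; rewrite (perm_mem (keys_lows s2)).
Qed.

(** The connected sum of two disjoint loops along the short chord from p to q. *)
Lemma joint_merge p x M N y q : joint ((p, x) :: M) (rcons N (y, q)) ->
  adj p q (x :: y :: keys M ++ keys N) -> valid (N ++ (y, x) :: M).
Proof.
case=> u n1 n2 a.
have kE : perm_eq (keys ((p, x) :: M) ++ keys (rcons N (y, q))) (p :: q :: keys (N ++ (y, x) :: M)).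
  apply/permP => P; rewrite -cats1 !keys_cat -[keys (_ :: M)]/([:: p; x] ++ keys M).
  by rewrite -[keys ((y, x) :: M)]/([:: y; x] ++ keys M) -[keys [:: _]]/[:: y; q] /= !count_cat /= ?count_cat /=; lia.
have uK := u; rewrite (perm_uniq kE) /= in uK; case/and3P: uK => _ _ uK.
split=> //.
- apply: (@ncs_perm ((y, x) :: (M ++ N))).
    by move=> c; rewrite !(inE, mem_cat); case: (c \in M); case: (c == _); rewrite ?orbT ?orbF.
  apply: (@ncs_merge (M ++ N) p x y q).
  + move=> z; rewrite -/(keys (M ++ N)) keys_cat !inE => H; apply: a; rewrite !inE; case/or3P: H => ->; rewrite ?orbT //.
  + move: (uniq_fst (s := (p, x) :: M ++ rcons N (y, q))); rewrite -cat_cons keys_cat => /(_ u).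
    rewrite (perm_uniq (_ : perm_eq _ (map fst ((p, x) :: (y, q) :: M ++ N)))) //.
    by apply: perm_map; rewrite cat_cons perm_cons -rcons_cat perm_rcons.
  apply: ncs_perm n1 => c; rewrite !(inE, mem_cat, mem_rcons).
  by case: (c \in M); case: (c == _); case: (c == _); rewrite ?orbT ?orbF.
pose l := lst x M.
have l1 : lows ((p, x) :: M) = (l, p) :: lw x M by [].
have l2 : lows (rcons N (y, q)) = lw q (rcons N (y, q)) by rewrite /lows lst_rcons.
have l3 : lows (N ++ (y, x) :: M) = lw l (rcons N (y, q)) ++ lw x M.
  rewrite /lows lst_cat lw_cat -[lst _ ((y, x) :: M)]/l lw_rcons -cat_rcons; exact: erefl.
have ul : uniq (map fst ((l, p) :: lw x M ++ lw q (rcons N (y, q)))).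
  rewrite -cat_cons map_cat -l1 -l2 !lows_fst.
  have -> : forall L L' : seq int, uniq (rotr 1 L ++ rotr 1 L') = uniq (L ++ L').
    by move=> L L'; apply: perm_uniq; apply: perm_cat; rewrite perm_rotr.
  by rewrite -map_cat; apply: uniq_snd; rewrite keys_cat.
rewrite l3; rewrite l1 l2 in n2; move: n2 ul.
have lk : l \in x :: keys M.
  by rewrite /l; case: (M) => [|c M']; [rewrite inE eqxx|rewrite inE (@lst_mem x) orbT].
have mrest h c r : rcons N (y, q) = h :: r -> c \in lw h.2 r -> (c.1 \in keys N \/ c.1 = y) /\ (c.2 \in keys N \/ c.2 = y).
  case: N kE a u n1 l2 l3 uK => [|h' N'] _ _ _ _ _ _ _ /= [<- <-] //.
  rewrite lw_rcons mem_rcons inE => /orP[/eqP->|/mem_lw[c1 c2]] /=.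
    split; last by right.
    left; case: N' => [|e N'']; first by rewrite !inE eqxx orbT.
    by rewrite -[keys [:: h', e & N'']]/(h'.1 :: h'.2 :: keys (e :: N'')) in_cons in_cons lst_mem !orbT.
  by split; left; [case: c1 => [->|c1]|]; rewrite !inE ?eqxx ?c1 ?c2 ?orbT.
case E : (rcons N (y, q)) => [|h r]; first by case: (N) E.
rewrite /= => n2 ul; apply: (@ncs_perm ((l, h.1) :: (lw h.2 r ++ lw x M))); first by move=> c; rewrite !(inE, mem_cat).
have hk : h.1 \in keys N \/ h.1 = y by case: (N) E => [|h' N'] /= [<- _]; [right|left; rewrite inE eqxx].
have yk z : z \in keys N \/ z = y -> z \in x :: y :: keys M ++ keys N.
  by case=> [zN|->]; rewrite !(inE, mem_cat) ?zN ?eqxx ?orbT.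
have xk z : z \in x :: keys M -> z \in x :: y :: keys M ++ keys N.
  by rewrite !(inE, mem_cat) => /orP[->|->]; rewrite ?orbT.
apply: (@ncs_merge' _ p _ _ q).
- move=> z; rewrite -/(keys (lw h.2 r ++ lw x M)) !inE keys_cat mem_cat => H; apply: a.
  case/or4P: H => [/eqP->|/eqP->|/keys_mem[c cr]|/keys_mem[c cM]].
  + exact: yk.
  + exact: xk.
  + by have [c1 c2] := mrest _ _ _ E cr; case=> ->; apply: yk.
  have [c1 c2] := mem_lw cM; case=> ->; apply: xk; rewrite inE ?c2 ?orbT //.
  by case: c1 => [->|->]; rewrite ?eqxx ?orbT.
- have pE : perm_eq (l :: [seq i.1 | i <- lw x M ++ (q, h.1) :: lw h.2 r]) (l :: q :: [seq i.1 | i <- lw h.2 r ++ lw x M]).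
    by rewrite perm_cons !map_cat perm_catC.
  by rewrite -[uniq _]/(uniq (l :: q :: [seq i.1 | i <- lw h.2 r ++ lw x M])) -(perm_uniq pE).
apply: ncs_perm n2 => c; rewrite !(inE, mem_cat).
by case: (c == _); case: (c == _); case: (c \in _); case: (c \in _).
Qed.

(** Change of base point and of orientation. *)
Definition same_loop (s s' : seq arc) := [/\ perm_eq (keys s') (keys s), forall i, lam i s' = lam i s &
  exists g, hol s' = g * hol s * g^-1 \/ hol s' = g * (hol s)^-1 * g^-1].

Lemma same_rot s1 s2 : same_loop (s1 ++ s2) (s2 ++ s1).
Proof.
split; first by apply: keys_perm; rewrite perm_catC.
  by move=> i; rewrite !lam_cat addbC.
by exists (hol s1)^-1; left; rewrite hol_rot; grp.
Qed.
Lemma same_rs s : same_loop s (rs s).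
Proof.
split; [exact: keys_rs|by move=> i; rewrite lam_rs|exists 1; right].
by rewrite hol_rs; grp.
Qed.
Lemma same_trans s s' s'' : same_loop s s' -> same_loop s' s'' -> same_loop s s''.
Proof.
case=> k1 l1 [g1 h1] [k2 l2 [g2 h2]]; split; first exact: perm_trans k2 k1.
  by move=> i; rewrite l2.
exists (g2 * g1); case: h1 h2 => -> [] ->; [left|right|right|left]; grp; reflexivity.
Qed.

Lemma orient s1 s2 p : joint s1 s2 -> p \in keys s1 -> exists x M, joint ((p, x) :: M) s2 /\ same_loop s1 ((p, x) :: M).
Proof.
have main s : joint s s2 -> p \in map fst s -> exists x M, joint ((p, x) :: M) s2 /\ same_loop s ((p, x) :: M).
  move=> J /mapP[[p' x] /splitPr cs /= ->]; case: cs J => a b J; exists x, (b ++ a).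
  by rewrite -cat_cons; split; [exact: joint_rot|exact: same_rot].
move=> J /keys_mem[c cs [pc|pc]]; first by apply: main => //; rewrite pc map_f.
have [||x [M [J' S']]] := main (rs s1); first exact: joint_rs.
  by rewrite pc; apply/mapP; exists (swp c); rewrite ?mem_rs //; case: c cs {pc}.
by exists x, M; split=> //; apply: same_trans (same_rs s1) S'.
Qed.

Lemma conj_cases (G : groupType) (u v w w' g1 g2 : G) : w = g1 * u * g1^-1 \/ w = g1 * u^-1 * g1^-1 ->
  w' = g2 * v * g2^-1 \/ w' = g2 * v^-1 * g2^-1 -> w' = w^-1 ->
  exists g, v = g * u * g^-1 \/ v = g * u^-1 * g^-1.
Proof.
have X : v = g2^-1 * (g2 * v * g2^-1) * g2 by grp.
have X' : v = (g2^-1 * (g2 * v^-1 * g2^-1) * g2)^-1 by grp.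
move=> h1 h2 E; exists (g2^-1 * g1).
by case: h2 => h2; [rewrite X -h2 E|rewrite X' -h2 E]; case: h1 => ->; [right|left|left|right]; grp.
Qed.
Lemma merge_keys (p x y q : int) (M N : seq arc) :
  perm_eq (keys ((p, x) :: M) ++ keys (rcons N (y, q))) (p :: q :: (x :: y :: keys M ++ keys N)).
Proof.
apply/permP => P; rewrite -cats1 !keys_cat -[keys (_ :: M)]/([:: p; x] ++ keys M).
by rewrite -[keys [:: _]]/[:: y; q] /= !count_cat /= ?count_cat /=; lia.
Qed.
Lemma adj_right (p q z : int) : p <z q -> (q <= z)%R -> z != p -> z != q -> (z <z p) = (z <z q) /\ (p <z z) = (q <z z).
Proof. rewrite /lt_z; lia. Qed.
Lemma adj_left (p q z : int) : p <z q -> (z <z q -> (z <= p)%R) -> z != p -> z != q -> (z <z p) = (z <z q) /\ (p <z z) = (q <z z).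
Proof. rewrite /lt_z => pq; case: (ltgtP z q) => // zq' h zp _; [have := h isT|]; lia. Qed.

(** Let p be the last crossing of the first loop before q. No puncture separates p from q: otherwise
    each loop would be outside the other, and they could not share an enclosed puncture. The
    connected sum at p and q encloses the symmetric difference of two equal sets, so its holonomy is
    trivial. Up to conjugation and orientation it is also the product of the two holonomies. *)
Lemma parallel_lt s1 s2 i0 m1 q : joint s1 s2 -> (forall i, lam i s1 = lam i s2) -> lam i0 s1 ->
  m1 \in keys s1 -> (forall k, k \in keys s1 -> (m1 <= k)%R) ->
  q \in keys s2 -> (forall k, k \in keys s2 -> (q <= k)%R) -> m1 <z q ->
  exists g, hol s2 = g * hol s1 * g^-1 \/ hol s2 = g * (hol s1)^-1 * g^-1.
Proof.
move=> J L l0 m1k m1m qk qm m1q; have [u n1 n2] := J.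
have nu k : k \in keys s1 -> k \in keys s2 -> False.
  by move=> k1 k2; move: u; rewrite cat_uniq => /and3P[_ /hasPn/(_ k k2) /negP].
have [|p] := @ex_max [seq k <- keys s1 | k <z q].
  have : m1 \in [seq k <- keys s1 | k <z q] by rewrite mem_filter m1q.
  by apply: contraTneq => ->.
rewrite mem_filter => /andP[pq pk] pm.
have {}pm k : k \in keys s1 -> k <z q -> (k <= p)%R by move=> k1 kq; apply: pm; rewrite mem_filter kq.
have pqE : loc p = loc q.
  apply/eqP; rewrite eqn_leq (loc_mono (ltW pq)) /= leqNgt; apply/negP => lt_pq.
  have lq : lam (loc p) s2 = false by apply: lam_below lt_pq.
  have p0 : par q s1 = false.
    rewrite -(L (loc p)) in lq; rewrite -lq; apply/esym; apply: lam_par => k k1; apply/idP/idP => H.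
      by rewrite /lt_z ltNge; apply/negP => /loc_mono qk'; move: (leq_trans qk' H); rewrite leqNgt lt_pq.
    by apply: loc_mono; apply: pm.
  apply: (lam_disjoint (i := i0) loc_mono u _ _ l0); last by rewrite -L.
    move=> k k1; have [u' n1' n2'] := joint_sym J; rewrite (joint_const u' n1' n2' k1 m1k).
    elim: (s2) qm => //= c r IH H; rewrite IH ?addbF; last by move=> z zr; apply: H; rewrite !inE zr !orbT.
    have := H c.1; have := H c.2; rewrite !inE !eqxx !orbT /pr => /(_ isT) h1 /(_ isT) h2.
    by rewrite /lt_z !ltNge !(le_trans (ltW m1q)).
  by move=> k k2; rewrite (joint_const u n1 n2 k2 qk).
have [x [M [J1 S1]]] := orient J pk.
have [y [N [J2 S2]]] := orient (joint_sym J1) qk.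
have J3 : joint ((p, x) :: M) (rcons (rs N) (y, q)) by apply: joint_sym; have := joint_rs J2; rewrite rs_cons.
have S3 : same_loop s2 (rcons (rs N) (y, q)) by apply: same_trans S2 _; have := same_rs ((q, y) :: N); rewrite rs_cons.
have [k1 l1 [g1 h1]] := S1; have [k2 l2 [g2 h2]] := S3.
have v3 : valid (rs N ++ (y, x) :: M).
  apply: (joint_merge J3) => z zK.
  have u3 : uniq (keys ((p, x) :: M) ++ keys (rcons (rs N) (y, q))) by case: J3.
  have keysE : perm_eq (keys ((p, x) :: M) ++ keys (rcons (rs N) (y, q))) (p :: q :: (x :: y :: keys M ++ keys (rs N))).
    exact: merge_keys.
  have zp : z != p /\ z != q.
    move: u3; rewrite (perm_uniq keysE) cons_uniq => /andP[np]; rewrite cons_uniq => /andP[nq _].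
    split; first by apply: contraNneq np => <-; rewrite inE zK orbT.
    by apply: contraNneq nq => <-.
  have : z \in keys s1 ++ keys s2.
    have : z \in keys ((p, x) :: M) ++ keys (rcons (rs N) (y, q)) by rewrite (perm_mem keysE) in_cons [X in _ || X]in_cons zK !orbT.
    by rewrite (perm_mem (perm_cat k1 k2)).
  case: zp => zp zq; rewrite mem_cat => /orP[z1|/qm z2]; last exact: adj_right.
  exact: adj_left pq (pm _ z1) zp zq.
have [S [hS [_ lS]]] := loop_form v3.
have S0 : S = [::].
  suff H i : i \in map snd S = false by case: (S) H => // e r /(_ e.2); rewrite inE eqxx.
  rewrite lS !lam_cat /=; have := l1 i; have := l2 i; rewrite -cats1 lam_cat /= -L -pqE.
  by move: (loc p <= i)%N (loc x <= i)%N (loc y <= i)%N (lam i (rs N)) (lam i M) (lam i s1) => [] [] [] [] [] [].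
have {hS} hS : hol (rs N ++ (y, x) :: M) = 1 by rewrite S0 /= invg1 in hS; case: hS.
have kE : kap p = kap q by rewrite /kap pqE.
have mE : hol (rcons (rs N) (y, q)) * hol ((p, x) :: M) = 1.
  rewrite -hS -!cats1 !hol_cat /= kE; grp; reflexivity.
have {mE}hE : hol (rcons (rs N) (y, q)) = (hol ((p, x) :: M))^-1 by apply: (mulIg (hol ((p, x) :: M))); rewrite mE mulVg.
exact: conj_cases h1 h2 hE.
Qed.

Theorem parallel_loops s1 s2 i0 : joint s1 s2 -> (forall i, lam i s1 = lam i s2) -> lam i0 s1 ->
  exists g, hol s2 = g * hol s1 * g^-1 \/ hol s2 = g * (hol s1)^-1 * g^-1.
Proof.
move=> J L l1; have l2 : lam i0 s2 by rewrite -L.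
have ne s : lam i0 s -> keys s != [::] by case: s.
have [m1 k1 m1m] := ex_min (ne _ l1); have [m2 k2 m2m] := ex_min (ne _ l2).
case: (ltgtP m1 m2) => [m12|m21|E].
- exact: (parallel_lt J L l1 k1 m1m k2 m2m m12).
- have [g H] := parallel_lt (joint_sym J) (fun i => esym (L i)) l2 k2 m2m k1 m1m m21.
  by exists g^-1; case: H => ->; [left|right]; grp.
case: J; rewrite cat_uniq => /and3P[_ /hasPn/(_ m2 k2)]; by rewrite /= -E k1.
Qed.
End Loops.
End MeanderPairs.
Import MeanderPairs.

(** * Closed walks on a brick lattice *)

Module BrickWall.
Local Open Scope group_scope.

Local Infix "<z" := lt_z (at level 70).

(* The vertices are the bricks of a wall; [v.1] is the row of the brick [v], and the row [0] is
   the first one above the axis. *)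
Definition vertex := (int * int)%type.
(** A brick touches two bricks of its own row and two of each neighbouring row, which is shifted by
    half a brick. At most three bricks meet at a corner, so walks without common vertices cannot
    cross. *)
Definition adjv (u v : vertex) : bool :=
  ((v.1 == u.1) && ((v.2 == u.2 + 1) || (u.2 == v.2 + 1)) ||
   (v.1 == u.1 + 1) && ((v.2 == u.2) || (v.2 == u.2 + 1)) ||
   (u.1 == v.1 + 1) && ((u.2 == v.2) || (u.2 == v.2 + 1)))%R.
Definition up (v : vertex) : bool := (0 <= v.1)%R.
(** Up to normalisation, the abscissa at which a step between the two sides crosses the axis. *)
Definition key (u v : vertex) : int := (u.2 + v.2)%R.

(** Whether the edge crosses the ray that leaves q to the right along the upper side of its row. *)
Definition ev (q u v : vertex) : bool :=
  ((u.1 == q.1) && (v.1 == q.1 + 1) && (q.2 < u.2) || (v.1 == q.1) && (u.1 == q.1 + 1) && (q.2 < v.2))%R.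
Definition right_of (r c : int) (v : vertex) : bool := ((v.1 == r) && (c < v.2))%R.

Lemma adjv_cases (x y x' y' : int) : adjv (x, y) (x', y') -> exists dx dy : int,
  [/\ x' = (x + dx)%R, y' = (y + dy)%R & (dx, dy) \in [:: (0, 1); (0, -1); (1, 0); (1, 1); (-1, 0); (-1, -1)]%R].
Proof.
by move=> H; exists (x' - x)%R, (y' - y)%R; split; [lia|lia|]; move: H; rewrite /adjv /= !inE !xpair_eqE; lia.
Qed.

Lemma ev_horizontal (q q' u v : vertex) : adjv u v -> u != q -> u != q' -> v != q -> v != q' ->
  q'.1 = q.1 -> (q'.2 = q.2 + 1)%R -> ev q u v = ev q' u v.
Proof.
case: q q' u v => [a b] [a' b'] [x y] [x' y'] /adjv_cases[dx [dy [-> -> d]]] + + + + /= E1 E2.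
rewrite {}E1 {}E2 /ev !xpair_eqE /=; move: d.
by rewrite !inE => /or4P[/eqP[-> ->]|/eqP[-> ->]|/eqP[-> ->]|/or3P[]/eqP[-> ->]]; lia.
Qed.
Definition ev0 (x y x' y' : int) : bool :=
  ((x == 0) && (x' == 1) && (0 < y) || (x' == 0) && (x == 1) && (0 < y'))%R.
Lemma evE (q u v : vertex) : ev q u v = ev0 (u.1 - q.1) (u.2 - q.2) (v.1 - q.1) (v.2 - q.2).
Proof. by rewrite /ev /ev0 !subr_eq0 !subr_gt0 !subr_eq ![(1 + _)%R]addrC. Qed.
Lemma right_ofE (q v : vertex) : right_of q.1 q.2 v = (v.1 - q.1 == 0)%R && (0 < v.2 - q.2)%R.
Proof. by rewrite /right_of subr_eq0 subr_gt0. Qed.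
Lemma neqE (q v : vertex) : (v != q) = ((v.1 - q.1 != 0)%R || (v.2 - q.2 != 0)%R).
Proof. by case: q v => [? ?] [? ?]; rewrite xpair_eqE negb_and !subr_eq0. Qed.

Ltac eval_eqs := repeat match goal with |- context [@eq_op ?T ?x ?y] =>
  let v := eval vm_compute in (@eq_op T x y) in
  first [constr_eq v true | constr_eq v false]; change (@eq_op T x y) with v end.
Ltac refute_eqs := repeat match goal with |- context [@eq_op ?T ?x ?y] =>
  let E := fresh in have E : (@eq_op T x y) = false; [by lia|rewrite E; clear E] end.

(** Between the rays of q and q' lies the part of the row of q' on the right of q'. An edge crosses
    exactly one of the rays when exactly one of its ends lies there. *)
Lemma ev_vertical (q q' u v : vertex) : adjv u v -> u != q -> u != q' -> v != q -> v != q' ->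
  (q'.1 = q.1 + 1)%R -> (q'.2 = q.2)%R \/ (q'.2 = q.2 + 1)%R ->
  ev q u v (+) ev q' u v = right_of q'.1 q'.2 u (+) right_of q'.1 q'.2 v.
Proof.
move=> uv; rewrite !evE !right_ofE !neqE => + + + + E1 E2.
have [X HX] : exists X, X = (u.1 - q.1)%R by eexists.
have [Y HY] : exists Y, Y = (u.2 - q.2)%R by eexists.
case: q q' u v uv E1 E2 HX HY => [a b] [a' b'] [x y] [x' y'] /adjv_cases[dx [dy [-> -> d]]] /= -> E2 HX HY.
have {E2} [e [e01 ->]] : exists e : int, (e = 0 \/ e = 1)%R /\ b' = (b + e)%R.
  by exists (b' - b)%R; split; lia.
have -> : (x - a)%R = X by []. have -> : (x + dx - a)%R = (X + dx)%R by lia.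
have -> : (x - (a + 1))%R = (X - 1)%R by lia. have -> : (x + dx - (a + 1))%R = (X + dx - 1)%R by lia.
have -> : (y - b)%R = Y by []. have -> : (y + dy - b)%R = (Y + dy)%R by lia.
have -> : (y - (b + e))%R = (Y - e)%R by lia. have -> : (y + dy - (b + e))%R = (Y + dy - e)%R by lia.
clear HX HY x y a b a' b' x' y'; rewrite /ev0.
move: d; rewrite !inE => /or4P[/eqP[-> ->]|/eqP[-> ->]|/eqP[-> ->]|/or3P[]/eqP[-> ->]];
case: e01 => ->; have [[->|->]|[->|H]] : (X = 0 \/ X = 1)%R \/ ((X = 2)%R \/ ((X < 0) || (2 < X)))%R by lia.
all: first [match goal with H : is_true (_ || _) |- _ => refute_eqs end | eval_eqs]; rewrite /=; lia.
Qed.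
(** For q in the first row above the axis, the ray can likewise be pushed down through that row onto
    the axis. *)
Lemma ev_axis (q u v : vertex) : adjv u v -> u != q -> v != q -> q.1 = 0%R ->
  ev q u v (+) ((up u (+) up v) && (q.2 < (if up u then u.2 else v.2)))%R = right_of 0 q.2 u (+) right_of 0 q.2 v.
Proof.
move=> uv + + E; rewrite evE !neqE.
have rE w : right_of 0 q.2 w = (w.1 == 0)%R && (0 < w.2 - q.2)%R by rewrite -E right_ofE E subr0.
rewrite !rE E !subr0 -subr_gt0.
have -> : ((if up u then u.2 else v.2) - q.2)%R = (if up u then u.2 - q.2 else v.2 - q.2)%R by case: ifP.
case: q u v uv E {rE} => [a b] [x y] [x' y'] /adjv_cases[dx [dy [-> -> d]]] /= _.
have E : (y + dy - b)%R = (y - b + dy)%R by lia.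
rewrite !{}E.
move: (y - b)%R => w; rewrite /ev0 /up /=.
move: d; rewrite !inE => /or4P[/eqP[-> ->]|/eqP[-> ->]|/eqP[-> ->]|/or3P[]/eqP[-> ->]];
have [[->|->]|[->|H]] : (x = 0 \/ x = 1)%R \/ ((x = -1)%R \/ ((x < -1) || (1 < x)))%R by lia.
all: try (rewrite /=; lia).
Qed.
End BrickWall.
Import BrickWall.

(** * From simple closed lattice walks to meanders *)

Module LatticeWalk.
Local Open Scope group_scope.

Local Infix "<z" := lt_z (at level 70).

Fixpoint cr (e : vertex -> vertex -> bool) (u : vertex) (p : seq vertex) : bool :=
  if p is v :: p' then e u v (+) cr e v p' else false.
Lemma cr_telescope (e : vertex -> vertex -> bool) (m : vertex -> bool) u p :
  (forall v w, v \in u :: p -> w \in u :: p -> adjv v w -> e v w = m v (+) m w) ->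
  path adjv u p -> cr e u p = m u (+) m (last u p).
Proof.
elim: p u => [|v p IH] u H /=; first by rewrite addbb.
case/andP=> uv pp; rewrite IH //; last by move=> x y xp yp; apply: H; rewrite inE ?xp ?yp orbT.
by rewrite H ?inE ?eqxx ?orbT // addbA -[_ (+) m v (+) m v]addbA addbb addbF.
Qed.
Lemma cr_xor e e' u p : cr (fun v w => e v w (+) e' v w) u p = cr e u p (+) cr e' u p.
Proof.
elim: p u => //= v p IH u; rewrite IH.
by move: (e u v) (e' u v) (cr e v p) (cr e' v p) => [] [] [] [].
Qed.

Section Planar.
Variables (a b : vertex) (P : seq vertex).
Hypotheses (adjP : path adjv a (rcons P b)) (upP : all up P) (na : ~~ up a) (nb : ~~ up b) (P0 : P != [::]).
Let PP v : v \in a :: rcons P b -> up v -> v \in P.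
Proof. by rewrite inE mem_rcons inE => /or3P[/eqP->|/eqP->|->//]; [rewrite (negPf na)|rewrite (negPf nb)]. Qed.
Let neP q v : up q -> q \notin P -> v \in a :: rcons P b -> v != q.
Proof. by move=> uq qP vP; apply: contraNneq qP => E; rewrite -E; apply: PP => //; rewrite E. Qed.

(** A discrete Jordan argument: the parity of the crossings of P with the ray from q does not change
    when q moves to a neighbour off P. The correction terms telescope and vanish at the two ends,
    which lie below the axis. *)
Lemma cr_step q q' : up q -> up q' -> q \notin P -> q' \notin P -> adjv q q' ->
  cr (ev q) a (rcons P b) = cr (ev q') a (rcons P b).
Proof.
wlog W : q q' / ((q'.1 = q.1 /\ q'.2 = q.2 + 1) \/ (q'.1 = q.1 + 1 /\ (q'.2 = q.2 \/ q'.2 = q.2 + 1)))%R.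
  move=> H uq uq' qP q'P adj.
  have [W|W] : ((q'.1 = q.1 /\ q'.2 = q.2 + 1) \/ (q'.1 = q.1 + 1 /\ (q'.2 = q.2 \/ q'.2 = q.2 + 1)))%R \/
    ((q.1 = q'.1 /\ q.2 = q'.2 + 1) \/ (q.1 = q'.1 + 1 /\ (q.2 = q'.2 \/ q.2 = q'.2 + 1)))%R.
      by move: adj; rewrite /adjv; lia.
    exact: H.
  by apply/esym/H => //; move: adj; rewrite /adjv; lia.
move=> uq uq' qP q'P _; have n1 v := @neP q v uq qP; have n2 v := @neP q' v uq' q'P.
suff : cr (fun v w => ev q v w (+) ev q' v w) a (rcons P b) = false.
  by rewrite cr_xor; do 2!case: (cr _ _ _).
case: W => [[W1 W2]|[W1 W2]].
  rewrite (@cr_telescope _ (fun=> false)) // => v w vP wP vw.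
  by rewrite (@ev_horizontal q q') ?n1 ?n2 // addbb.
rewrite (@cr_telescope _ (right_of q'.1 q'.2)) //; last first.
  by move=> v w vP wP vw; rewrite (@ev_vertical q q') ?n1 ?n2.
rewrite last_rcons; have r v : ~~ up v -> right_of q'.1 q'.2 v = false.
  by move: uq; rewrite /up /right_of; lia.
by rewrite !r.
Qed.

Lemma cr_path q p : path adjv q p -> all up (q :: p) -> all (fun v => v \notin P) (q :: p) ->
  cr (ev q) a (rcons P b) = cr (ev (last q p)) a (rcons P b).
Proof.
elim: p q => //= v p IH q /andP[qv pp] /and3P[uq uv up'] /and3P[qP vP pP].
by rewrite (cr_step uq uv qP vP qv) IH //= ?uv ?vP.
Qed.

(** The ray is pushed onto the axis, which the walk crosses only on entering and on leaving the
    upper side. *)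
Lemma cr_axis q : q.1 = 0%R -> q \notin P ->
  cr (ev q) a (rcons P b) = (q.2 < (head a P).2)%R (+) (q.2 < (last a P).2)%R.
Proof.
move=> q0 qP; have uq : up q by rewrite /up q0.
have n1 v := @neP q v uq qP.
pose c v w := ((up v (+) up w) && (q.2 < (if up v then v.2 else w.2)))%R.
have : cr (fun v w => ev q v w (+) c v w) a (rcons P b) = false.
  rewrite (@cr_telescope _ (right_of 0 q.2)) ?last_rcons //; last first.
    by move=> v w vP wP vw; rewrite ev_axis ?n1.
  have r v : ~~ up v -> right_of 0 q.2 v = false by rewrite /up /right_of; lia.
  by rewrite !r.
rewrite cr_xor => E.
have -> : (q.2 < (head a P).2)%R (+) (q.2 < (last a P).2)%R = cr c a (rcons P b); last first.
  by move: E; do 2!case: (cr _ _ _).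
case: (P) upP P0 => // h P' /= /andP[uh uP'] _; rewrite /c (negPf na) uh /=; congr (_ (+) _).
elim: P' h uh uP' => [|h' P' IH] h uh /= uP'; first by rewrite uh (negPf nb) /= addbF.
by case/andP: uP' => uh' uP'; rewrite -IH // uh uh' /=.
Qed.
End Planar.

(** A run on one side of the axis, between the vertex before it and the vertex after it on the other
    side. *)
Definition piece := (vertex * seq vertex * vertex)%type.
Definition arcp (x : piece) : arc := (key x.1.1 (head x.1.1 x.1.2), key (last x.1.1 x.1.2) x.2).
Definition upper (x : piece) : bool :=
  [&& path adjv x.1.1 (rcons x.1.2 x.2), all up x.1.2, ~~ up x.1.1, ~~ up x.2 & x.1.2 != [::]].

(** Two edges lead from a brick of row 0 to the row below, whence two possible keys for one
    column. *)
Lemma key_col (u v : vertex) c : adjv u v -> ~~ up u -> up v -> v.1 = 0%R /\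
  (key u v = 2 * v.2 \/ key u v + 1 = 2 * v.2)%R /\ ((key u v = c \/ True)).
Proof. by case: u v => [x y] [x' y']; rewrite /adjv /up /key /= => H1 H2 H3; split; [|split; [|right]]; lia. Qed.
Lemma adjvC u v : adjv u v = adjv v u.
Proof. by rewrite /adjv; lia. Qed.
Lemma keyC u v : key u v = key v u. Proof. by rewrite /key addrC. Qed.

Lemma upperP x : upper x -> [/\ adjv x.1.1 (head x.1.1 x.1.2), adjv x.2 (last x.1.1 x.1.2), up (head x.1.1 x.1.2), up (last x.1.1 x.1.2) &
  head x.1.1 x.1.2 \in x.1.2 /\ last x.1.1 x.1.2 \in x.1.2].
Proof.
case: x => [[a [|h P]] b] /and5P[] //=; rewrite rcons_path => /and3P[ah pp lb] /andP[uh uP] _ _ _.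
rewrite ah adjvC lb uh mem_head mem_last; split=> //.
by case: (lastP P) uP => // P' z; rewrite all_rcons last_rcons => /andP[].
Qed.

Lemma key_lt (k k' c c' : int) : (k = 2 * c \/ k + 1 = 2 * c)%R -> (k' = 2 * c' \/ k' + 1 = 2 * c')%R ->
  c != c' -> (k < k')%R = ~~ (c' < c)%R.
Proof. lia. Qed.
Lemma key_neq (k k' c c' : int) : (k = 2 * c \/ k + 1 = 2 * c)%R -> (k' = 2 * c' \/ k' + 1 = 2 * c')%R ->
  c != c' -> k' != k.
Proof. lia. Qed.
(** The run of y avoids that of x, so by [cr_path] its two ends see the same parity; by [cr_axis]
    this parity is the position relative to the arc of x. *)
Lemma nc_upper x y : upper x -> upper y -> ~~ has (mem x.1.2) y.1.2 -> nc (arcp x) (arcp y).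
Proof.
move=> ux uy dis; have [x1 x2 x3 x4 [x5 x6]] := upperP ux; have [y1 y2 y3 y4 [y5 y6]] := upperP uy.
have /and5P[px upx nax nbx x0] := ux; have /and5P[py upy nay nby y0] := uy.
have dis' v : v \in y.1.2 -> v \notin x.1.2 by move=> vy; apply: contra dis => vx; apply/hasP; exists v.
have [h0 [hk _]] := key_col 0%R y1 nay y3; have [l0 [lk _]] := key_col 0%R y2 nby y4.
have [h0' [hk' _]] := key_col 0%R x1 nax x3; have [l0' [lk' _]] := key_col 0%R x2 nbx x4.
have E : cr (ev (head y.1.1 y.1.2)) x.1.1 (rcons x.1.2 x.2) = cr (ev (last y.1.1 y.1.2)) x.1.1 (rcons x.1.2 x.2).
  case: (y.1.2) y0 py upy dis' {y1 y2 y3 y4 y5 y6 h0 hk l0 lk dis} => // h P _ /=.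
  rewrite rcons_path => /and3P[_ pp _] uP d.
  by apply: cr_path => //; apply/allP => v; apply: d.
move: E; rewrite !cr_axis //; try exact: dis'.
have ne u v : u \in x.1.2 -> v \in y.1.2 -> u.1 = 0%R -> v.1 = 0%R -> u.2 != v.2.
  move=> ux' vy u0 v0; apply: contraTneq vy => uv; rewrite (_ : v = u) ?(contraTN (dis' u)) //.
  by case: (u) (v) u0 v0 uv => [? ?] [? ?] /= -> -> ->.
rewrite /nc /pr /arcp /lt_z /= ![key (last _ _) _]keyC.
rewrite (key_lt hk' hk (ne _ _ x5 y5 h0' h0)) (key_lt hk' lk (ne _ _ x5 y6 h0' l0)).
rewrite (key_lt lk' hk (ne _ _ x6 y5 l0' h0)) (key_lt lk' lk (ne _ _ x6 y6 l0' l0)).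
by do 4!case: (_ < _)%R.
Qed.

Lemma upper_key_neq x y : upper x -> upper y -> ~~ has (mem x.1.2) y.1.2 ->
  ~~ has (mem [:: (arcp x).1; (arcp x).2]) [:: (arcp y).1; (arcp y).2].
Proof.
move=> ux uy dis; have [x1 x2 x3 x4 [x5 x6]] := upperP ux; have [y1 y2 y3 y4 [y5 y6]] := upperP uy.
have /and5P[_ _ nax nbx _] := ux; have /and5P[_ _ nay nby _] := uy.
have dis' v : v \in y.1.2 -> v \notin x.1.2 by move=> vy; apply: contra dis => vx; apply/hasP; exists v.
have [h0 [hk _]] := key_col 0%R y1 nay y3; have [l0 [lk _]] := key_col 0%R y2 nby y4.
have [h0' [hk' _]] := key_col 0%R x1 nax x3; have [l0' [lk' _]] := key_col 0%R x2 nbx x4.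
have ne u v : u \in x.1.2 -> v \in y.1.2 -> u.1 = 0%R -> v.1 = 0%R -> u.2 != v.2.
  move=> ux' vy u0 v0; apply: contraTneq vy => uv; rewrite (_ : v = u) ?(contraTN (dis' u)) //.
  by case: (u) (v) u0 v0 uv => [? ?] [? ?] /= -> -> ->.
rewrite /arcp; apply/hasPn => k; rewrite [fst (_, _)]/= [snd (_, _)]/= ![key (last _ _) _]keyC !inE => /orP[]/eqP->; rewrite ?inE negb_or; apply/andP; split.
- exact: key_neq hk' hk (ne _ _ x5 y5 h0' h0).
- exact: key_neq lk' hk (ne _ _ x6 y5 l0' h0).
- exact: key_neq hk' lk (ne _ _ x5 y6 h0' l0).
- exact: key_neq lk' lk (ne _ _ x6 y6 l0' l0).
Qed.

Definition verts (ps : seq piece) : seq vertex := flatten [seq x.1.2 | x <- ps].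
Lemma verts_disjoint ps x y : uniq (verts ps) -> x \in ps -> y \in ps -> x = y \/ ~~ has (mem x.1.2) y.1.2.
Proof.
have sub z (r : seq piece) v : z \in r -> v \in z.1.2 -> v \in verts r.
  by move=> zr vz; apply/flattenP; exists z.1.2 => //; apply/mapP; exists z.
elim: ps => //= z ps IH; rewrite /verts /= cat_uniq => /and3P[_ /hasPn n u].
rewrite !inE => /orP[/eqP->|xs] /orP[/eqP->|ys]; [by left| | |exact: IH].
  by right; apply/hasPn => v vy; apply: n; apply: sub vy.
by right; apply/hasPn => v vz; apply/negP => vx; move: (n _ (sub _ _ _ xs vx)); rewrite /= vz.
Qed.
Lemma ncs_upper ps : all upper ps -> uniq (verts ps) -> ncs (map arcp ps).
Proof.
move=> /allP ups u _ _ /mapP[x xs ->] /mapP[y ys ->] ne.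
by have [E|] := verts_disjoint u xs ys; [rewrite E eqxx in ne|apply: nc_upper; apply: ups].
Qed.
Lemma uniq_upper ps : all upper ps -> uniq (verts ps) -> (forall x, x \in ps -> (arcp x).1 != (arcp x).2) ->
  uniq (keys (map arcp ps)).
Proof.
elim: ps => // x ps IH /= /andP[ux ups]; rewrite /verts /= cat_uniq => /and3P[_ /hasPn n u] ne.
have {}IH := IH ups u (fun y ys => ne y (mem_behead (s := x :: ps) ys)).
have d k : k \in [:: (arcp x).1; (arcp x).2] -> k \notin keys (map arcp ps).
  move=> kx; apply/negP => /keys_mem[_ /mapP[y ys ->] ky].
  have /hasPn : ~~ has (mem [:: (arcp x).1; (arcp x).2]) [:: (arcp y).1; (arcp y).2].
    apply: upper_key_neq => //; first exact: (allP ups).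
    by apply/hasPn => v vy; apply: n; apply/flattenP; exists y.1.2 => //; apply: map_f.
  by move=> /(_ k); rewrite /= kx; case: ky => ->; rewrite !inE eqxx ?orbT => /(_ isT).
rewrite inE negb_or ne ?mem_head // IH !d // !inE eqxx ?orbT //.
Qed.

(* The half-turn exchanging the two sides of the axis. *)
Definition turn (v : vertex) : vertex := (- 1 - v.1, - v.2)%R.
Definition turnp (x : piece) : piece := (turn x.1.1, map turn x.1.2, turn x.2).
Lemma turnK : involutive turn. Proof. by move=> [a b]; rewrite /turn /=; congr pair; lia. Qed.
Lemma adj_turn u v : adjv (turn u) (turn v) = adjv u v.
Proof.
case: u v => [x y] [x' y']; apply/idP/idP => /adjv_cases[dx [dy [E1 E2 d]]]; rewrite /= in E1 E2; move: d; rewrite !inE /adjv /=;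
by case/or4P => [/eqP[? ?]|/eqP[? ?]|/eqP[? ?]|/or3P[]/eqP[? ?]]; subst dx dy; lia.
Qed.
Lemma up_turn v : up (turn v) = ~~ up v. Proof. by rewrite /up /turn /=; lia. Qed.
Definition lower x := upper (turnp x).
Lemma arcp_turn x : arcp (turnp x) = (- (arcp x).1, - (arcp x).2)%R.
Proof.
have k u v : key (turn u) (turn v) = (- key u v)%R by rewrite /key /= opprD.
case: x => [[a P] b]; rewrite /arcp /=; case: P => [|h P] /=; first by rewrite !k.
by rewrite last_map !k.
Qed.
Lemma ncs_lower ps : all lower ps -> uniq (verts ps) -> ncs (map arcp ps).
Proof.
move=> lps u.
have H : ncs (map arcp (map turnp ps)).
  apply: ncs_upper; first by rewrite all_map.
  rewrite /verts -map_comp -[map _ ps]/(map (map turn \o (fun x => x.1.2)) ps) map_comp -map_flatten.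
  by rewrite map_inj_uniq //; apply: can_inj turnK.
move=> c d cs ds cd.
have tr e : e \in map arcp ps -> (- e.1, - e.2)%R \in map arcp (map turnp ps).
  by case/mapP=> x xs ->; rewrite -arcp_turn; apply: map_f; apply: map_f.
have := H _ _ (tr _ ds) (tr _ cs); rewrite /= eqr_opp eq_sym => /(_ cd).
by rewrite /nc /pr /lt_z /= !ltrN2; do 4!case: (_ < _)%R.
Qed.

Lemma aux_size (x y z n : nat) : (0 < x)%N -> (x + y + z <= n)%N -> (z < n)%N.
Proof. lia. Qed.
Lemma aux_col (k k' c c' : int) : (k = 2 * c \/ k + 1 = 2 * c)%R -> (k' = 2 * c' \/ k' + 1 = 2 * c')%R -> k = k' -> c = c'.
Proof. lia. Qed.
Lemma aux_row v w : adjv v w -> ~~ up v -> w.1 = 0%R -> v.1 = (-1)%R.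
Proof. by case: v w => [? ?] [? ?]; rewrite /adjv /up /=; lia. Qed.

(* Runs of a closed walk on either side of the axis. *)
Definition run := (seq vertex * seq vertex)%type.
Definition verts_of (rs : seq run) : seq vertex := flatten [seq r.1 ++ r.2 | r <- rs].
Definition okrun (r : run) := [&& r.1 != [::], all up r.1, r.2 != [::] & all (fun v => ~~ up v) r.2].

Lemma split_runs vs u : up (head u vs) -> ~~ up (last u vs) -> vs != [::] ->
  exists rs, vs = verts_of rs /\ all okrun rs.
Proof.
have [n] := ubnP (size vs); elim: n vs u => // n IH vs u; rewrite ltnS => sn hu lu v0.
pose i := find (fun v => ~~ up v) vs; pose U := take i vs; pose rest := drop i vs.
have hasL : has (fun v => ~~ up v) vs.
  by apply/hasP; exists (last u vs) => //; case: (vs) v0 => // v vs' _; rewrite /= mem_last.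
have iL : (i < size vs)%N by rewrite -has_find.
have upU : all up U.
  apply/allP => v /(nthP u)[j]; rewrite size_takel ?(ltnW iL) // => ji <-.
  by rewrite nth_take //; have := before_find u ji; move/negbFE.
have U0 : U != [::].
  rewrite -size_eq0 size_takel ?(ltnW iL) // /i; case: (vs) hu v0 => // v vs' /= hv _; rewrite hv //.
have rE : rest = nth u vs i :: drop i.+1 vs by rewrite /rest (drop_nth u).
have nlow : ~~ up (nth u vs i) := nth_find u hasL.
pose j := find up rest; pose L := take j rest; pose rem := drop j rest.
have lowL : all (fun v => ~~ up v) L.
  apply/allP => v /(nthP u)[k]; rewrite size_take => kj <-.
  have {}kj : (k < j)%N by move: kj; case: ifP => // /negbT; rewrite -leqNgt => H /leq_trans; apply.
  by rewrite nth_take //; have := before_find u kj; move/negbT.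
have j0 : (0 < j)%N by rewrite /j rE /= (negPf nlow).
have L0 : L != [::] by rewrite /L rE; case: (j) j0.
have vsE : vs = (U ++ L) ++ rem by rewrite -catA /L /rem cat_take_drop /U /rest cat_take_drop.
have ok : okrun (U, L) by rewrite /okrun U0 upU L0 lowL.
case E : (rem == [::]).
  by exists [:: (U, L)]; rewrite /verts_of /= ok cats0 {1}vsE (eqP E) cats0.
have [|||| rs [rsE oks]] := IH rem u.
- have := sn; rewrite {1}vsE !size_cat; have : (0 < size U)%N by rewrite lt0n size_eq0.
  exact: aux_size.
- have hr : has up rest by rewrite has_find ltnNge; apply: contraFN E => H; rewrite /rem drop_oversize.
  by rewrite /rem (drop_nth u) -?has_find //=; apply: nth_find.
- by move: lu; rewrite {1}vsE last_cat; case: (rem) E => //= r rem' _; rewrite (lastI r rem') last_rcons.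
- by rewrite E.
by exists ((U, L) :: rs); rewrite /verts_of /= -/(verts_of rs) -rsE ok oks -vsE.
Qed.

(** Here [r0] is the run preceding the list. A closed walk is treated by taking for it the last run
    of the list. *)
Fixpoint upc (r0 : run) (rs : seq run) : seq piece :=
  if rs is r :: rs' then (last (0, 0)%R r0.2, r.1, head (0, 0)%R r.2) :: upc r rs' else [::].
Fixpoint lpc (r0 : run) (rs : seq run) : seq piece :=
  if rs is r :: rs' then (last (0, 0)%R r0.1, r0.2, head (0, 0)%R r.1) :: lpc r rs' else [::].

Lemma head_eq (T : Type) (x y : T) s : s <> [::] -> head x s = head y s. Proof. by case: s. Qed.
Lemma last_eq (T : Type) (x y : T) s : s <> [::] -> last x s = last y s. Proof. by case: s. Qed.

Lemma lw_upc r0 rs : okrun r0 -> all okrun rs ->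
  lw (key (last (0, 0)%R r0.1) (head (0, 0)%R r0.2)) (map arcp (upc r0 rs)) = map arcp (lpc r0 rs).
Proof.
elim: rs r0 => //= r rs IH r0 ok0 /andP[ok oks]; rewrite /arcp /=.
have /and4P[/eqP a1 _ /eqP a2 _] := ok0; have /and4P[/eqP b1 _ /eqP b2 _] := ok.
rewrite -IH // (head_eq (last (0, 0)%R r0.2) (0, 0)%R b1) (last_eq (last (0, 0)%R r0.2) (0, 0)%R b1).
by rewrite (head_eq (last (0, 0)%R r0.1) (0, 0)%R a2) (last_eq (last (0, 0)%R r0.1) (0, 0)%R a2).
Qed.

Lemma pieces_ok r0 rs : okrun r0 -> all okrun rs ->
  path adjv (last (0, 0)%R r0.1) r0.2 -> path adjv (last (0, 0)%R r0.2) (verts_of rs) ->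
  all upper (upc r0 rs) /\ all lower (lpc r0 rs).
Proof.
elim: rs r0 => //= r rs IH r0 ok0 /andP[ok oks] p0.
have /and4P[/eqP a1 upa /eqP a2 lowa] := ok0; have /and4P[/eqP b1 upb /eqP b2 lowb] := ok.
rewrite /verts_of /= -catA !cat_path => /and3P[p1 p2 p3].
have nlast (s : seq vertex) : s <> [::] -> all (fun v => ~~ up v) s -> ~~ up (last (0, 0)%R s) /\ ~~ up (head (0, 0)%R s).
  by case: s => // v s _ H; split; [apply: (allP H); rewrite /= mem_last|apply: (allP H); rewrite mem_head].
have ulast (s : seq vertex) : s <> [::] -> all up s -> up (last (0, 0)%R s) /\ up (head (0, 0)%R s).
  by case: s => // v s _ H; split; [apply: (allP H); rewrite /= mem_last|apply: (allP H); rewrite mem_head].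
have [||H1 H2] := IH r ok oks.
- by rewrite (last_eq _ (last (0, 0)%R r0.2) b1).
- by rewrite (last_eq _ (last (last (0, 0)%R r0.2) r.1) b2).
rewrite H1 H2 !andbT; split.
  rewrite /upper /= rcons_path p1 upb; have [-> _] := nlast _ a2 lowa; have [_ ->] := nlast _ b2 lowb.
  by case: (r.2) b2 p2 => //= v ? _ /andP[-> _] /=; apply/eqP.
rewrite /lower /upper /turnp /= -map_rcons path_map.
rewrite (@eq_path _ _ adjv) ?rcons_path; last by move=> x y /=; rewrite adj_turn.
rewrite p0 !up_turn; have [-> _] := ulast _ a1 upa; have [_ ->] := ulast _ b1 upb.
rewrite all_map (@eq_all _ _ (fun v => ~~ up v)) ?lowa; last by move=> v; rewrite /= up_turn.
have -> : last (last (0, 0)%R r0.1) r0.2 = last (0, 0)%R r0.2 by apply: last_eq.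
by case: (r.1) b1 p1 => //= v ? _ /andP[-> _] /=; case: (r0.2) a2.
Qed.

Lemma verts_sub r0 rs : subseq (verts (upc r0 rs)) (verts_of rs) /\ subseq (verts (lpc r0 rs)) (r0.2 ++ verts_of rs).
Proof.
elim: rs r0 => [|r rs IH] r0 /=; first by rewrite sub0seq.
have [H1 H2] := IH r; rewrite /verts /verts_of /= -/(verts _) -/(verts _) -/(verts_of _); split.
  by rewrite -catA; apply: cat_subseq => //; apply: subseq_trans H1 (suffix_subseq _ _).
apply: cat_subseq => //; apply: subseq_trans H2 _; rewrite -catA; exact: suffix_subseq.
Qed.

Lemma upc_at r0 rs x : r0.2 <> [::] -> all okrun rs -> x \in upc r0 rs ->
  exists s1 s2, last (0, 0)%R r0.2 :: verts_of rs = s1 ++ x.1.1 :: x.1.2 ++ x.2 :: s2.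
Proof.
elim: rs r0 => //= r rs IH r0 a2 /andP[ok oks]; have /and4P[_ _ /eqP b2 _] := ok.
rewrite inE /verts_of /= -/(verts_of rs) => /orP[/eqP->|xs] /=.
  exists [::], (behead r.2 ++ verts_of rs); rewrite /= -catA; congr (_ :: _ ++ _).
  by case: (r.2) b2.
have [s1 [s2 E]] := IH r b2 oks xs; exists (last (0, 0)%R r0.2 :: r.1 ++ belast (head (0, 0)%R r.2) (behead r.2) ++ s1), s2.
rewrite /= -!catA -E -cat_rcons; congr (_ :: _ ++ _ ++ _).
by case: (r.2) b2 => //= v s _; rewrite lastI.
Qed.
Lemma upc_rcons r0 rs r : upc r0 (rcons rs r) = rcons (upc r0 rs) (last (0, 0)%R (last r0 rs).2, r.1, head (0, 0)%R r.2).
Proof. by elim: rs r0 => //= r' rs IH r0; rewrite IH. Qed.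

Section Walk.
Variable loc : int -> nat.
Variable lcol : int -> nat.
Hypothesis locE : forall k c, (k = 2 * c \/ k + 1 = 2 * c)%R -> loc k = lcol c.
Definition kcol (c : int) : fg := (genprod (iota 0 (lcol c)))^-1.
(** The contribution of one step to the holonomy, read at the column of its upper end. By [locE] the
    two edges below a brick have the same punctures on their left. *)
Definition stepv (u v : vertex) : fg :=
  if up u then if up v then 1 else kcol u.2 else if up v then (kcol v.2)^-1 else 1.
Fixpoint wprod (u : vertex) (p : seq vertex) : fg := if p is v :: p' then stepv u v * wprod v p' else 1.
Lemma wprod_cat u p p' : wprod u (p ++ p') = wprod u p * wprod (last u p) p'.
Proof. by elim: p u => [|v p IH] u /=; rewrite ?mul1g // IH mulgA. Qed.
Lemma wprod_side u p b : all (fun v => up v == b) (u :: p) -> wprod u p = 1.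
Proof.
elim: p u => //= v p IH u /and3P[/eqP ub /eqP vb vp]; rewrite IH /= ?vb ?eqxx //.
by rewrite /stepv ub vb mulg1; case: (b).
Qed.
Lemma stepv_cross u v : adjv u v -> ~~ up u -> up v -> stepv u v = (kap loc (key u v))^-1 /\ stepv v u = kap loc (key v u).
Proof.
move=> uv uu uv'; have [_ [H _]] := key_col 0%R uv uu uv'.
by rewrite /stepv (negPf uu) uv' /kap (locE H) [key v u]keyC (locE H).
Qed.

Lemma hol_runs r0 rs : okrun r0 -> all okrun rs -> path adjv (last (0, 0)%R r0.2) (verts_of rs) ->
  wprod (last (0, 0)%R r0.2) (verts_of rs) = hol loc (map arcp (upc r0 rs)).
Proof.
elim: rs r0 => //= r rs IH r0 ok0 /andP[ok oks].
have /and4P[/eqP a1 upa /eqP a2 lowa] := ok0; have /and4P[/eqP b1 upb /eqP b2 lowb] := ok.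
rewrite /verts_of /= -/(verts_of rs) -catA !cat_path => /and3P[p1 p2 p3].
rewrite !wprod_cat (last_eq _ (0, 0)%R b1) (last_eq _ (0, 0)%R b2) IH //; last first.
  by move: p3; rewrite (last_eq _ (0, 0)%R b2).
rewrite mulgA; congr (_ * _).
have nl : ~~ up (last (0, 0)%R r0.2).
  by case: (r0.2) a2 lowa => // v s _ H; apply: (allP H); rewrite /= mem_last.
have ul : up (last (0, 0)%R r.1).
  by case: (r.1) b1 upb => // v s _ H; apply: (allP H); rewrite /= mem_last.
have {}p2 : path adjv (last (0, 0)%R r.1) r.2 by rewrite -(last_eq (last (0, 0)%R r0.2) (0, 0)%R b1).
rewrite /arcp /= (head_eq (last (0, 0)%R r0.2) (0, 0)%R b1); congr (_ * _).
  case: (r.1) b1 upb p1 => //= v s _ /andP[uv us] /andP[av _].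
  rewrite (@wprod_side v s true) ?mulg1; first by case: (stepv_cross av nl uv).
  by rewrite /= uv; apply: sub_all us => w ->.
case: (r.2) b2 lowb p2 => //= v s _ /andP[uv us] /andP[av _].
rewrite (@wprod_side v s false) ?mulg1; last first.
  by rewrite /= (negPf uv) /=; apply: sub_all us => w /negPf ->.
by rewrite adjvC in av; case: (stepv_cross av uv ul).
Qed.

(** The arcs s are those of the upper runs [ps] of the walk. The lower runs [ls] are read in a
    rearrangement [ws] of the walk, because the first of them may wrap around its end. *)
Definition traces (vs : seq vertex) (s : seq arc) := exists ps ls, [/\ s = map arcp ps /\ uniq (keys s),
  {subset lows s <= map arcp ls}, all upper ps /\ all lower ls, subseq (verts ps) vs &
  exists2 ws, perm_eq ws vs & subseq (verts ls) ws].

Lemma trace_rot vs : uniq vs -> path adjv (last (0, 0)%R vs) vs -> up (head (0, 0)%R vs) -> ~~ up (last (0, 0)%R vs) ->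
  (2 < size vs)%N -> exists2 s, traces vs s & wprod (last (0, 0)%R vs) vs = hol loc s.
Proof.
move=> u pv hu nl sz; have v0 : vs != [::] by case: (vs) sz.
have [rs [vsE oks]] := split_runs hu nl v0.
case: (lastP rs) vsE oks => [E|rs' r0 vsE oks]; first by rewrite E in v0.
have ok0 : okrun r0 by move: oks; rewrite all_rcons => /andP[].
have /and4P[/eqP a1 upa /eqP a2 lowa] := ok0.
have lE : last (0, 0)%R vs = last (0, 0)%R r0.2.
  by rewrite vsE /verts_of map_rcons flatten_rcons !last_cat (last_eq _ (0, 0)%R a2).
have vr : vs = verts_of (rcons rs' r0) := vsE.
have [pU pL] : all upper (upc r0 (rcons rs' r0)) /\ all lower (lpc r0 (rcons rs' r0)).
  apply: pieces_ok => //; last by rewrite -lE -vr.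
  move: pv; rewrite {2}vsE /verts_of map_rcons flatten_rcons !cat_path => /and3P[_ _].
  by rewrite (last_eq _ (0, 0)%R a1).
have [s1 _] := verts_sub r0 (rcons rs' r0).
have s2 : subseq (verts (lpc r0 (rcons rs' r0))) (r0.2 ++ verts_of rs' ++ r0.1).
  rewrite catA -[X in subseq X _]cats0; apply: cat_subseq; last exact: sub0seq.
  move: {1 3}r0 => r1; elim: (rs') r1 => [|r rs1 IH] r1 /=; first by rewrite /verts /= cats0.
  rewrite /verts /verts_of /= -/(verts _) -/(verts_of _); apply: cat_subseq => //.
  apply: subseq_trans (IH r) _; rewrite -catA; exact: suffix_subseq.
rewrite -vr in s1.
have ws : perm_eq (r0.2 ++ verts_of rs' ++ r0.1) vs.
  by rewrite vsE /verts_of map_rcons flatten_rcons perm_catC -catA.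
exists (map arcp (upc r0 (rcons rs' r0))); last first.
  rewrite lE [in LHS]vr hol_runs //; by rewrite -lE -vr.
exists (upc r0 (rcons rs' r0)), (lpc r0 (rcons rs' r0)); split=> //; last 1 first.
- by exists (r0.2 ++ verts_of rs' ++ r0.1).
- split=> //; apply: uniq_upper => //; first exact: subseq_uniq s1 u.
  move=> x xs; have ux := allP pU _ xs; have [x1 x2 x3 x4 [x5 x6]] := upperP ux.
  have /and5P[_ _ nax nbx _] := ux.
  have [h0' [hk' _]] := key_col 0%R x1 nax x3; have [l0' [lk' _]] := key_col 0%R x2 nbx x4.
  (* Equal keys force the run to consist of one brick whose neighbours in the walk coincide. A
     simple closed walk would then have only two vertices. *)
  apply/negP => /eqP; rewrite /arcp /= => E.
  have hl : head x.1.1 x.1.2 = last x.1.1 x.1.2.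
    have : (head x.1.1 x.1.2).2 = (last x.1.1 x.1.2).2 by apply: (aux_col hk' lk'); rewrite E keyC.
    by move: h0' l0'; case: (head _ _) (last _ _) => [? ?] [? ?] /= -> -> ->.
  have ab : x.1.1 = x.2.
    have a1' : x.1.1.2 = x.2.2 by move: E; rewrite /key hl addrC => /addrI.
    have : x.1.1.1 = x.2.1.
      by rewrite (aux_row x1 nax h0') (aux_row x2 nbx l0').
    by move: a1'; case: (x.1.1) (x.2) => [? ?] [? ?] /= -> ->.
  have ux2 : uniq x.1.2.
    apply: subseq_uniq u; apply: subseq_trans s1; rewrite /verts.
    elim: (upc _ _) xs => //= z zs IH; rewrite inE => /orP[/eqP->|/IH H]; first exact: prefix_subseq.
    exact: subseq_trans H (suffix_subseq _ _).
  have [h hE] : exists h, x.1.2 = [:: h].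
    case: (x.1.2) hl x5 ux2 => //= h; case/lastP => [|P w]; first by exists h.
    by rewrite last_rcons => <- _; rewrite mem_rcons mem_head.
  have [t1 [t2]] := upc_at a2 oks xs; rewrite -lE -vr hE ab.
  case: t1 => [|z t1] [E1 E2].
    move: u sz E1; rewrite E2 /=; case/lastP: t2 {E2} => [|t2 w] //= u _.
    by move: u; rewrite last_rcons => /and3P[_ + _] E1; rewrite -E1 mem_rcons mem_head.
  by move: u; rewrite E2 cat_uniq /= !inE eqxx orbT => /and3P[].
- move=> c; rewrite /lows.
  suff -> : lst 0%R (map arcp (upc r0 (rcons rs' r0))) = key (last (0, 0)%R r0.1) (head (0, 0)%R r0.2).
    by rewrite lw_upc.
  rewrite upc_rcons map_rcons lst_rcons /arcp /=; congr key; exact: last_eq.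
Qed.

Lemma wprod_rot p q : exists g, wprod (last (0, 0)%R (q ++ p)) (q ++ p) = g * wprod (last (0, 0)%R (p ++ q)) (p ++ q) * g^-1.
Proof.
case: (eqVneq p [::]) => [->|/eqP p0]; first by exists 1; rewrite cats0 /= mul1g invg1 mulg1.
case: (eqVneq q [::]) => [->|/eqP q0]; first by exists 1; rewrite cats0 /= mul1g invg1 mulg1.
rewrite !wprod_cat !last_cat !(last_eq (last _ q) (0, 0)%R p0) !(last_eq (last _ p) (0, 0)%R q0).
by move: (wprod _ p) (wprod _ q) => x y; exists x^-1; rewrite invgK mulKg.
Qed.

Theorem trace vs : uniq vs -> path adjv (last (0, 0)%R vs) vs ->
  wprod (last (0, 0)%R vs) vs = 1 \/ exists s vs' g, [/\ perm_eq vs' vs, traces vs' s &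
    wprod (last (0, 0)%R vs) vs = g * hol loc s * g^-1].
Proof.
move=> u pv; have [sz|sz] := leqP (size vs) 2.
  left; case: vs u pv sz => [|v [|w [|//]]] //= _ _ _; rewrite ?mulg1 /stepv.
    by case: (up v).
  by case: (up v); case: (up w); rewrite ?mulg1 ?mul1g ?mulgV ?mulVg.
have [aU|] := boolP (all up vs).
  left; apply: (@wprod_side _ _ true); apply/allP => v; rewrite inE => vv.
  rewrite eqb_id; apply: (allP aU).
  by case/orP: vv => [/eqP->|//]; case: (vs) sz => // ? ? _; rewrite /= mem_last.
have [aL _|] := boolP (all (fun v => ~~ up v) vs).
  left; apply: (@wprod_side _ _ false); apply/allP => v; rewrite inE => vv.
  rewrite eqbF_neg; apply: (allP aL).
  by case/orP: vv => [/eqP->|//]; case: (vs) sz => // ? ? _; rewrite /= mem_last.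
move=> /allPn[a av ua] /allPn[b bv ub]; rewrite negbK in ua; right.
have [s1 [s2 vsE]] : exists s1 s2, vs = s1 ++ b :: s2 by case/splitPr: bv => s1 s2; exists s1, s2.
pose w := (b :: s2) ++ s1; pose i := find up w.
have hasw : has up w by apply/hasP; exists a => //; rewrite /w mem_cat orbC -mem_cat -vsE.
pose P := take i w; pose Q := drop i w.
have iw : (i < size w)%N by rewrite -has_find.
have i0 : (0 < i)%N by rewrite /i /= (negPf ub).
have wE : w = P ++ Q by rewrite cat_take_drop.
have pQ : perm_eq (Q ++ P) vs by rewrite perm_catC -wE /w perm_catC -vsE.
have hQ : up (head (0, 0)%R (Q ++ P)) by rewrite /Q (drop_nth (0, 0)%R) //=; apply: nth_find.
have lP : ~~ up (last (0, 0)%R (Q ++ P)).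
  have sP : size P = i by rewrite size_takel // ltnW.
  rewrite last_cat (last_nth (0, 0)%R) sP -[i]prednK //= nth_take ?prednK //.
  by rewrite (before_find (0, 0)%R) ?prednK.
have cv : cycle adjv vs by rewrite (cycle_path (0, 0)%R).
have cw : cycle adjv w.
  by rewrite /w -(rot_size_cat s1 (b :: s2)) rot_cycle -vsE.
have cQ : cycle adjv (Q ++ P).
  by rewrite -(rot_size_cat P Q) rot_cycle -wE.
have [||||| s tr E] := @trace_rot (Q ++ P); rewrite -?(cycle_path (0, 0)%R) ?(perm_uniq pQ) ?(perm_size pQ) //.
have [g1 E1] := wprod_rot Q P; have [g2 E2] := wprod_rot (b :: s2) s1.
exists s, (Q ++ P), (g2 * g1); split=> //.
rewrite {1 2}vsE E2 -/w wE E1 E; grp; reflexivity.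
Qed.
End Walk.

Lemma traces_perm vs s : uniq vs -> traces vs s -> valid s.
Proof.
move=> u [ps [ls [[-> uk] sub [pU pL] s1 [ws pw s2]]]]; split=> //.
  by apply: ncs_upper => //; apply: subseq_uniq s1 u.
by apply: ncs_sub sub _; apply: ncs_lower => //; apply: subseq_uniq s2 _; rewrite (perm_uniq pw).
Qed.

Lemma traces_joint vs1 vs2 s1 s2 : uniq (vs1 ++ vs2) -> traces vs1 s1 -> traces vs2 s2 -> joint s1 s2.
Proof.
move=> u [ps1 [ls1 [[-> uk1] sub1 [pU1 pL1] q1 [ws1 pw1 r1]]]] [ps2 [ls2 [[-> uk2] sub2 [pU2 pL2] q2 [ws2 pw2 r2]]]].
have up12 : uniq (verts (ps1 ++ ps2)).
  by apply: subseq_uniq u; rewrite /verts map_cat flatten_cat; apply: cat_subseq.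
have ul12 : uniq (verts (ls1 ++ ls2)).
  have H : subseq (verts (ls1 ++ ls2)) (ws1 ++ ws2) by rewrite /verts map_cat flatten_cat; apply: cat_subseq.
  apply: subseq_uniq H _.
  by rewrite (perm_uniq (perm_cat pw1 pw2)).
split.
- rewrite -keys_cat -map_cat; apply: uniq_upper => //; first by rewrite all_cat pU1.
  have ne (s : seq arc) c : uniq (keys s) -> c \in s -> c.1 != c.2.
    by move=> us cs; have [_ [_]] := uniq_fst_snd us cs cs.
  by move=> x; rewrite mem_cat => /orP[] xs; [apply: ne uk1 _|apply: ne uk2 _]; apply: map_f.
- by rewrite -map_cat; apply: ncs_upper => //; rewrite all_cat pU1.
apply: (@ncs_sub (map arcp (ls1 ++ ls2))); last by apply: ncs_lower => //; rewrite all_cat pL1.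
by move=> c; rewrite map_cat !mem_cat => /orP[/sub1->|/sub2->]; rewrite ?orbT.
Qed.
End LatticeWalk.
Import LatticeWalk.

From mathcomp Require Import all_classical all_reals all_analysis.
Import numFieldNormedType.Exports.

(** * Holonomy of loops in the punctured plane *)

Module Holonomy.
Local Open Scope classical_set_scope.
Local Open Scope ring_scope.

Section Uniform.
Variables (R : realType) (T : pseudoMetricType R) (K : set T).
Hypothesis cK : compact K.

Lemma uniform_radius (P : R -> T -> Prop) :
  (forall r r' x, 0 < r' <= r -> P r x -> P r' x) ->
  (forall x, K x -> exists2 r, 0 < r & forall y, K y -> ball x r y -> P r y) ->
  exists2 r, 0 < r & forall x, K x -> P r x.
Proof.
move=> anti loc; have /compact_near_coveringP H := cK.
have : \forall r \near 0^'+, K `<=` (fun x => K x -> P r x).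
  apply: H => x /loc[r r0 Hr]; near=> y r' => /= Ky.
  apply: (anti r); last first.
    by apply: Hr => //; near: y; apply/nbhs_ballP; exists r.
  by apply/andP; split; near: r'; [exact: nbhs_right_gt|exact: nbhs_right_le].
rewrite /= => Hn; have [r [r0 Hr]] : exists r : R, 0 < r /\ K `<=` (fun x => K x -> P r x).
  have := @filter_ex _ (0^'+ : set_system R) _ _ (filterI (nbhs_right_gt (0 : R)) Hn).
  by move=> [r [r0 Hr]]; exists r.
by exists r => // x Kx; apply: Hr.
Unshelve. all: by end_near. Qed.

Lemma lebesgue_number (Q : T -> T -> Prop) :
  (forall x, K x -> exists2 r, 0 < r & forall y z, K y -> K z -> ball x r y -> ball x r z -> Q y z) ->
  exists2 r, 0 < r & forall x y, K x -> K y -> ball x r y -> Q x y.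
Proof.
move=> loc; have [||r r0 H] := @uniform_radius (fun r x => forall y, K y -> ball x r y -> Q x y).
- by move=> r r' x /andP[_ rr] H y Ky xy; apply: H => //; apply: le_ball xy.
- move=> x /loc[r r0 H]; exists (r / 2); first by rewrite divr_gt0.
  move=> y Ky xy z Kz yz; apply: H => //; first by apply: le_ball xy; lra.
  by rewrite [r]splitr; apply: ball_triangle xy yz.
by exists r => // x y Kx; apply: H.
Qed.
End Uniform.

Section Continuity.
Variables (R : realType) (T : pseudoMetricType R) (S : pseudoMetricType R) (K : set T) (f : T -> S).
Hypothesis cf : {within K, continuous f}.
Lemma within_ball x e : K x -> 0 < e -> exists2 r, 0 < r & forall y, K y -> ball x r y -> ball (f x) e (f y).
Proof.
move=> Kx e0; have /subspace_continuousP/(_ x Kx) := cf.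
move=> /(_ _ (nbhsx_ballx _ _ e0)) /nbhs_ballP[r r0 Hr]; exists r => // y Ky xy.
exact: (Hr y xy Ky).
Qed.
Hypothesis cK : compact K.
Lemma uniformly_continuous e : 0 < e -> exists2 r, 0 < r & forall x y, K x -> K y -> ball x r y -> ball (f x) e (f y).
Proof.
move=> e0; apply: (lebesgue_number cK) => x Kx; have e2 : 0 < e / 2 by rewrite divr_gt0.
have [r r0 H] := within_ball Kx e2; exists r => // y z Ky Kz xy xz; rewrite [e]splitr.
by apply: (@ball_triangle _ _ (f x)); [apply/ball_sym; apply: H|apply: H].
Qed.
End Continuity.

Section Cocycle.
Variables (R : realType) (G : groupType) (kappa : R -> G) (bad : set R).
Local Notation plane := (R * R)%type.
Hypothesis kappa_const : forall x y, x <= y -> (forall b, bad b -> ~ (x <= b <= y)) -> kappa x = kappa y.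
Implicit Types z w : plane.

Definition above z : bool := 0 <= z.2.
(** The contribution of a short step. Points of the axis count as above, and [kappa] is read at the
    upper point. *)
Definition cross z w : G :=
  if above z then if above w then 1%g else kappa z.1 else if above w then ((kappa w.1)^-1)%g else 1%g.
Definition clear z e := forall b, bad b -> ~ ball z e ((b, 0) : plane).

Lemma ballE z e w : ball z e w <-> `|z.1 - w.1| < e /\ `|z.2 - w.2| < e.
Proof. by split=> [[]|[]]. Qed.

(** Balls are squares. One with points on both sides of the axis meets the axis over its whole
    width, so if it is clear of bad points then [kappa] is constant over that width. *)
Lemma kappa_box z e a b : clear z e -> ball z e a -> ball z e b -> above a -> ~~ above b ->
  forall c, ball z e c -> kappa c.1 = kappa a.1.
Proof.
move=> cl /ballE[a1 a2] /ballE[b1 b2] ua ub c /ballE[c1 c2].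
have H x y : `|z.1 - x| < e -> `|z.1 - y| < e -> x <= y -> kappa x = kappa y.
  move=> x1 y1 xy; apply: kappa_const => // d bd /andP[xd dy]; apply: (cl d bd); apply/ballE; split=> /=.
    by move: x1 y1; rewrite !ltr_norml => /andP[? ?] /andP[? ?]; apply/andP; split; lra.
  move: ua ub a2 b2; rewrite /above -ltNge !ltr_norml => ? ? /andP[? ?] /andP[? ?]; apply/andP; split; lra.
by case: (leP c.1 a.1) => [/H->//|/ltW /H->//].
Qed.

Lemma cocycle z e a b c : clear z e -> ball z e a -> ball z e b -> ball z e c ->
  (cross a b * cross b c)%g = cross a c.
Proof.
move=> cl za zb zc; have H x y := @kappa_box z e x y cl.
rewrite /cross; case: (boolP (above a)) => ua; case: (boolP (above b)) => ub; case: (boolP (above c)) => uc;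
  rewrite ?mulg1 ?mul1g ?mulVg ?mulgV //.
- by rewrite (H a c za zc ua uc b zb).
- by rewrite (H a b za zb ua ub c zc) mulgV.
- by rewrite (H b a zb za ub ua c zc).
Qed.

Fixpoint hprod (p : nat -> plane) n : G := if n is n'.+1 then (hprod p n' * cross (p n') (p n'.+1))%g else 1%g.

Lemma cross_id z : cross z z = 1%g. Proof. by rewrite /cross; case: above. Qed.

Lemma hprod_local (p : nat -> plane) z e n : clear z e -> (forall j, (j <= n)%N -> ball z e (p j)) ->
  hprod p n = cross (p 0%N) (p n).
Proof.
move=> cl; elim: n => [|n IH] H /=; first by rewrite cross_id.
rewrite IH; last by move=> j jn; apply: H; apply: leqW.
by apply: (cocycle cl); apply: H.
Qed.
Lemma hprod_add (p : nat -> plane) m n : hprod p (m + n) = (hprod p m * hprod (fun j => p (m + j)%N) n)%g.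
Proof. by elim: n => [|n IH]; rewrite ?addn0 ?mulg1 // addnS /= IH mulgA addnS. Qed.
Lemma eq_hprod (p q : nat -> plane) n : (forall j, (j <= n)%N -> p j = q j) -> hprod p n = hprod q n.
Proof. by elim: n => //= n IH H; rewrite IH ?H // => j jn; apply: H; apply: leqW. Qed.

Definition pts (g : R -> plane) N j := g (j%:R / N%:R).
(** The products over regular subdivisions are eventually constant; the holonomy is their eventual
    value. *)
Definition HOL (g : R -> plane) h := exists N0, forall N, (N0 < N)%N -> hprod (pts g N) N = h.
Definition unit_I : set R := `[0, 1].

Lemma unitP (j N : nat) : (j <= N)%N -> (0 < N)%N -> unit_I (j%:R / N%:R).
Proof.
move=> jN N0; rewrite /unit_I /= in_itv /= divr_ge0 ?ler0n // ler_pdivrMr ?ltr0n // mul1r ler_nat //.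
Qed.

Definition upath (g : R -> plane) := forall e, 0 < e ->
  exists2 r, 0 < r & forall s t, unit_I s -> unit_I t -> `|s - t| < r -> ball (g s) e (g t).
Definition uclear (g : R -> plane) := exists2 e, 0 < e & forall t, unit_I t -> clear (g t) e.

Lemma fine_mesh (r : R) : 0 < r -> exists N0, forall N, (N0 < N)%N -> (N%:R)^-1 < r.
Proof.
move=> r0; exists (Num.truncn r^-1) => N HN.
rewrite invf_plt ?posrE // ?ltr0n ?(leq_ltn_trans _ HN) //.
by apply: lt_le_trans (Num.Theory.truncnS_gt _) _; rewrite ler_nat.
Qed.

(** Two fine subdivisions give the same product as their common refinement, because the step cocycle
    is trivial on small triangles. *)
Lemma HOL_exists g : upath g -> uclear g -> exists h, HOL g h.
Proof.
move=> ug [e e0 cg]; have [r r0 Hr] := ug e e0; have [N0 HN0] := fine_mesh r0.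
have refine N k : (N0 < N)%N -> (0 < k)%N -> hprod (pts g N) N = hprod (pts g (N * k)) (N * k).
  move=> HN k0; have Npos : (0 < N)%N by apply: leq_ltn_trans HN.
  suff H m : (m <= N)%N -> hprod (pts g N) m = hprod (pts g (N * k)) (m * k) by rewrite H.
  have ptE j : pts g (N * k) (j * k) = pts g N j.
    by rewrite /pts !natrM -mulf_div divff ?mulr1 // pnatr_eq0 -lt0n.
  elim: m => [|m IH] mN; first by rewrite mul0n.
  rewrite mulSn addnC hprod_add /= IH 1?ltnW //; congr (_ * _)%g.
  rewrite (@hprod_local _ (pts g N m) e); last 2 first.
  - by apply: cg; apply: unitP => //; apply: ltnW.
  - move=> j jk; rewrite -ptE; have mk : (m * k + j <= N * k)%N.
      by apply: leq_trans (leq_add (leqnn _) jk) _; rewrite -mulSnr leq_mul2r mN orbT.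
    have Nk0 : (0 < N * k)%N by rewrite muln_gt0 Npos.
    apply: Hr; [apply: unitP|apply: unitP|] => //; first by rewrite leq_mul2r 1?ltnW ?orbT.
    rewrite natrD mulrDl opprD addrA subrr add0r normrN ger0_norm ?divr_ge0 ?ler0n //.
    apply: le_lt_trans (HN0 N HN); rewrite ler_pdivrMr ?ltr0n // natrM mulrA mulVf ?mul1r ?ler_nat //.
    by rewrite pnatr_eq0 -lt0n.
  by rewrite addn0 ptE -mulSnr ptE.
exists (hprod (pts g N0.+1) N0.+1), N0 => N HN.
by rewrite (refine N N0.+1) // mulnC -refine // (leq_ltn_trans _ HN).
Qed.

Lemma HOL_uniq g h h' : HOL g h -> HOL g h' -> h = h'.
Proof.
move=> [N1 H1] [N2 H2]; rewrite -(H1 (N1 + N2).+1) ?ltnS ?leq_addr //.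
by rewrite (H2 (N1 + N2).+1) ?ltnS ?leq_addl.
Qed.

(** On a fine grid every small square commutes, so the products along consecutive rows are conjugate
    by the step joining their base points. *)
Lemma HOL_homotopy (H : R -> R -> plane) h h' :
  (forall e, 0 < e -> exists2 r, 0 < r & forall s t s' t', unit_I s -> unit_I t -> unit_I s' -> unit_I t' ->
     `|s - s'| < r -> `|t - t'| < r -> ball (H s t) e (H s' t')) ->
  (exists2 e, 0 < e & forall s t, unit_I s -> unit_I t -> clear (H s t) e) ->
  (forall s, unit_I s -> H s 0 = H s 1) ->
  HOL (H 0) h -> HOL (H 1) h' -> exists g, h' = (g * h * g^-1)%g.
Proof.
move=> uH [e e0 cH] loop [N1 h1] [N2 h2]; have [r r0 Hr] := uH e e0; have [N0 HN0] := fine_mesh r0.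
have [N [N0N N1N N2N N_gt0]] : exists N, [/\ (N0 < N)%N, (N1 < N)%N, (N2 < N)%N & (0 < N)%N].
  by exists (N0 + N1 + N2).+1; split; lia.
pose P i j := H (i%:R / N%:R) (j%:R / N%:R).
have dist i : `|i%:R / N%:R - i.+1%:R / N%:R| < r :> R.
  by rewrite -mulrBl -opprB -natrB // subSnn mulNr mul1r normrN ger0_norm ?invr_ge0 // HN0.
have z0 i : `|i%:R / N%:R - i%:R / N%:R| < r :> R by rewrite subrr normr0.
have sq i j : (i < N)%N -> (j < N)%N ->
    (cross (P i j) (P i j.+1) * cross (P i j.+1) (P i.+1 j.+1) = cross (P i j) (P i.+1 j) * cross (P i.+1 j) (P i.+1 j.+1))%g.
  move=> iN jN; have cl : clear (P i j) e by apply: cH; apply: unitP => //; apply: ltnW.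
  have B i' j' : (i' <= N)%N -> (j' <= N)%N -> `|i%:R / N%:R - i'%:R / N%:R| < r :> R ->
      `|j%:R / N%:R - j'%:R / N%:R| < r :> R -> ball (P i j) e (P i' j').
    by move=> i'N j'N d1 d2; apply: Hr => //; apply: unitP => //; apply: ltnW.
  by rewrite !(cocycle cl) //; apply: B => //; apply: ltnW.
pose q i := cross (P i 0%N) (P i.+1 0%N).
have row i m : (i < N)%N -> (m <= N)%N -> (hprod (P i) m * cross (P i m) (P i.+1 m) = q i * hprod (P i.+1) m)%g.
  move=> iN; elim: m => [|m IH] mN; first by rewrite /= mul1g mulg1.
  by rewrite /= -mulgA sq // mulgA IH 1?ltnW // mulgA.
have conj i : (i < N)%N -> hprod (P i.+1) N = ((q i)^-1 * hprod (P i) N * q i)%g.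
  move=> iN; have E : P i N = P i 0%N /\ P i.+1 N = P i.+1 0%N.
    by rewrite /P divff ?mul0r ?pnatr_eq0 -?lt0n //; split; rewrite -loop //; apply: unitP => //; apply: ltnW.
  by have := row i N iN (leqnn _); rewrite !E.1 !E.2 -/(q i) -mulgA => ->; rewrite mulKg.
have all_conj i : (i <= N)%N -> exists g, hprod (P i) N = (g * hprod (P 0%N) N * g^-1)%g.
  elim: i => [|i IH] iN; first by exists 1%g; rewrite mul1g invg1 mulg1.
  have [g E] := IH (ltnW iN); exists ((q i)^-1 * g)%g.
  by rewrite conj // E invgM invgK !mulgA.
have [g E] := all_conj N (leqnn _); exists g.
rewrite -(h1 N) // -(h2 N) //; have P0 : P 0%N = pts (H 0) N by rewrite /P mul0r.
have PN : P N = pts (H 1) N by rewrite /P divff // pnatr_eq0 -lt0n.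
by rewrite -P0 -PN.
Qed.
End Cocycle.
End Holonomy.
Import Holonomy.

(** * Loops avoiding the punctures and their free homotopies *)

Module Paths.
Local Open Scope classical_set_scope.
Local Open Scope ring_scope.

Section Pcont.
Variables (R : realType) (T S U : pseudoMetricType R).
Definition pcont (K : set T) (f : T -> S) := forall x, K x -> forall e, 0 < e ->
  exists2 r, 0 < r & forall y, K y -> ball x r y -> ball (f x) e (f y).
Lemma pcontP (K : set T) (f : T -> S) : {within K, continuous f} <-> pcont K f.
Proof.
split=> [cf x Kx e e0|H]; first exact: within_ball.
apply/subspace_continuousP => x Kx A /nbhs_ballP[e e0 He]; have [r r0 Hr] := H x Kx e e0.
by apply/nbhs_ballP; exists r => // y xy Ky; apply: He; apply: Hr.
Qed.
Lemma cts_pcont (K : set T) (f : T -> S) : continuous f -> pcont K f.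
Proof. by move=> cf; apply/pcontP; apply: continuous_subspaceT. Qed.
Lemma pcont_uniform (K : set T) (f : T -> S) : compact K -> pcont K f -> forall e, 0 < e ->
  exists2 r, 0 < r & forall x y, K x -> K y -> ball x r y -> ball (f x) e (f y).
Proof. by move=> cK /pcontP cf e e0; apply: uniformly_continuous. Qed.
End Pcont.
Lemma pcont_comp (R : realType) (T S U : pseudoMetricType R) (K : set T) (L : set S) (f : T -> S) (g : S -> U) :
  pcont K f -> (forall x, K x -> L (f x)) -> pcont L g -> pcont K (g \o f).
Proof.
move=> cf fL cg x Kx e e0; have [r r0 Hr] := cg (f x) (fL x Kx) e e0.
have [r' r'0 Hr'] := cf x Kx r r0; exists r' => // y Ky xy.
by apply: Hr; [apply: fL|apply: Hr'].
Qed.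

Section Paths.
Variables (R : realType) (G : groupType) (kappa : R -> G) (bad : set R) (l : seq R).
Local Notation plane := (R * R)%type.
Hypothesis kappa_const : forall x y, x <= y -> (forall b, bad b -> ~ (x <= b <= y)) -> kappa x = kappa y.
Hypothesis badl : forall b, bad b -> b \in l.
Local Notation I := (@unit_I R).
Implicit Types z w : plane.
Definition avoids z := forall b, bad b -> z <> (b, 0).

Lemma clear_exists z : avoids z -> exists2 e, 0 < e & clear bad z e.
Proof.
move=> az; suff [e e0 H] : exists2 e, 0 < e & forall b, b \in l -> bad b -> ~ ball z e ((b, 0) : plane).
  by exists e => // b bb; apply: H => //; apply: badl.
elim: (l) => [|b s [e e0 He]]; first by exists 1.
have [bb|nb] := pselect (bad b); last first.
  by exists e => // c; rewrite inE => /orP[/eqP->|/He].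
have d0 : 0 < Num.max `|z.1 - b| `|z.2 - 0|.
  rewrite lt_max !normr_gt0 !subr_eq0; apply: contra_notT (az b bb).
  by rewrite negb_or !negbK => /andP[/eqP h1 /eqP h2]; case: (z) h1 h2 => x y /= -> ->.
exists (Num.min e (Num.max `|z.1 - b| `|z.2 - 0|)); first by rewrite lt_min e0.
move=> c; rewrite inE => /orP[/eqP-> _|cs bc]; last first.
  by move=> bl; apply: (He c cs bc); apply: le_ball bl; rewrite ge_min lexx.
by move=> /ballE[/= h1 h2]; move: h1 h2; rewrite !lt_min !lt_max !ltxx /= orbF => /andP[_ h1] /andP[_ h2]; lra.
Qed.
Lemma clear_le z r r' : r' <= r -> clear bad z r -> clear bad z r'.
Proof. by move=> rr cl b bb bl; apply: (cl b bb); apply: le_ball bl. Qed.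
Lemma clear_ball z w r r' : ball z r w -> clear bad z (r + r') -> clear bad w r'.
Proof. by move=> zw cl b bb bl; apply: (cl b bb); apply: ball_triangle zw bl. Qed.

Lemma uclear_compact (T : pseudoMetricType R) (K : set T) (F : T -> plane) : compact K -> pcont K F ->
  (forall x, K x -> avoids (F x)) -> exists2 e, 0 < e & forall x, K x -> clear bad (F x) e.
Proof.
move=> cK cF aF; apply: (@uniform_radius _ _ K cK (fun r x => clear bad (F x) r)).
  by move=> r r' x /andP[_ rr]; apply: clear_le.
move=> x Kx; have [e e0 He] := clear_exists (aF x Kx); have e2 : 0 < e / 2 by rewrite divr_gt0.
have [r r0 Hr] := cF x Kx _ e2; exists (Num.min r (e / 2)); first by rewrite lt_min r0.
move=> y Ky xy; apply: (@clear_ball (F x) _ (e / 2)).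
  by apply: Hr => //; apply: le_ball xy; rewrite ge_min lexx.
apply: (@clear_le _ e); last exact: He.
have : Num.min r (e / 2) <= e / 2 by rewrite ge_min lexx orbT.
move: (Num.min r (e / 2)) => m; lra.
Qed.

Definition gloop (g : R -> plane) := [/\ pcont I g, g 0 = g 1 & forall t, I t -> avoids (g t)].
Lemma unit_compact : compact I. Proof. exact: segment_compact. Qed.
Lemma pcont_upath (g : R -> plane) : pcont I g -> upath g.
Proof. by move=> cg e e0; apply: (pcont_uniform unit_compact cg e0). Qed.
Lemma gloop_uclear g : gloop g -> uclear bad g.
Proof. by case=> cg _ ag; apply: (uclear_compact unit_compact cg). Qed.
Lemma gloop_HOL g : gloop g -> exists h, HOL kappa g h.
Proof. by move=> lg; apply: (HOL_exists kappa_const); [case: lg => /pcont_upath|apply: gloop_uclear]. Qed.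
Lemma HOL_ext g g' h : (forall t, I t -> g t = g' t) -> HOL kappa g h -> HOL kappa g' h.
Proof.
move=> E [N0 H]; exists N0 => N HN; rewrite -(H N HN); apply: eq_hprod => j jN.
by rewrite /pts E //; apply: unitP => //; apply: leq_ltn_trans HN.
Qed.
Lemma gloop_ext g g' : (forall t, I t -> g t = g' t) -> gloop g -> gloop g'.
Proof.
have I0 : I 0 by rewrite /unit_I /= in_itv /= lexx ler01.
have I1 : I 1 by rewrite /unit_I /= in_itv /= lexx ler01.
move=> E [cg e ag]; split; last by move=> t It; rewrite -E //; apply: ag.
  by move=> x Kx e' e0; have [r r0 H] := cg x Kx e' e0; exists r => // y Ky xy; rewrite -!E //; apply: H.
by rewrite -!E.
Qed.
Lemma free_homotopy (H : R -> R -> plane) h h' :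
  pcont (I `*` I) (fun st : R * R => H st.1 st.2) -> (forall s t, I s -> I t -> avoids (H s t)) ->
  (forall s, I s -> H s 0 = H s 1) -> HOL kappa (H 0) h -> HOL kappa (H 1) h' -> exists g, h' = (g * h * g^-1)%g.
Proof.
move=> cH aH lH; apply: (HOL_homotopy kappa_const) => //.
  move=> e e0; have cII := compact_setX unit_compact unit_compact.
  have [r r0 Hr] := pcont_uniform cII cH e0; exists r => // s t s' t' Is It Is' It' d1 d2.
  by apply: (Hr (s, t) (s', t')).
have [e e0 He] := uclear_compact (compact_setX unit_compact unit_compact) cH (fun st Kst => aH _ _ Kst.1 Kst.2).
by exists e => // s t Is It; apply: (He (s, t)).
Qed.
End Paths.

Lemma HOL_morph (R : realType) (G G' : groupType) (kappa : R -> G) (E : G -> G') (EM : {morph E : x y / (x * y)%g}) g h :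
  HOL kappa g h -> HOL (E \o kappa) g (E h).
Proof.
move=> [N0 H]; exists N0 => N HN; rewrite -(H N HN); move: (pts g N) => p.
have cE z w : cross (E \o kappa) z w = E (cross kappa z w).
  by rewrite /cross; case: above; case: above; rewrite /= ?(morph_mul1 EM) ?(morph_mulV EM).
clear -cE EM; elim: N => [|n IH] /=; first by rewrite (morph_mul1 EM).
by rewrite IH cE EM.
Qed.
End Paths.
Import Paths.

(** * Half twists *)

Module HalfTwist.
Local Open Scope classical_set_scope.
Local Open Scope ring_scope.

Definition K (k : nat) : fg := ((genprod (iota 0 k))^-1)%g.
Definition sigma (i : nat) : fg -> fg := fgext (mv (i, false) gen).

Lemma sigmaM i : {morph sigma i : x y / (x * y)%g}. Proof. exact: fgextM. Qed.
Lemma sigma1 i : sigma i 1%g = 1%g. Proof. exact: (morph_mul1 (@sigmaM i)). Qed.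
Lemma sigmaV i : {morph sigma i : x / (x^-1)%g}. Proof. exact: (morph_mulV (@sigmaM i)). Qed.
(** A half twist preserves the crossings of the axis except those between the two punctures that it
    exchanges, which are the subject of [sigma_K1]. *)
Lemma sigma_K i k : (i < 3)%N -> (k <= 4)%N -> k != i.+1 -> sigma i (K k) = K k.
Proof.
move=> i3 k4 ki; rewrite /K sigmaV; congr (_^-1)%g; move: ki.
case: k k4 => [|[|[|[|[|//]]]]] _; case: i i3 => [|[|[|//]]] _ // _;
  rewrite /genprod /= !sigmaM sigma1 /sigma !fgextX /mv /=; grp; reflexivity.
Qed.
Lemma sigma_K1 i : (i < 3)%N -> sigma i (K i.+1) = (K i.+2 * (K i.+1)^-1 * K i)%g.
Proof.
case: i => [|[|[|//]]] _; rewrite /K sigmaV /genprod /= !sigmaM sigma1 /sigma !fgextX /mv /=; grp; reflexivity.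
Qed.

Section Plane.
Variable R : realType.
Local Notation plane := (R * R)%type.
Definition lx (x : R) : nat := ((1 <= x)%R + (2 <= x)%R + (3 <= x)%R + (4 <= x)%R)%N.
Definition kx (x : R) : fg := K (lx x).
Definition badx : set R := [set x | x = 1 \/ x = 2 \/ x = 3 \/ x = 4].
Lemma lx4 x : (lx x <= 4)%N. Proof. by rewrite /lx; do 4!case: (_ <= x). Qed.
Lemma kx_const x y : x <= y -> (forall b, badx b -> ~ (x <= b <= y)) -> kx x = kx y.
Proof.
move=> xy nb; rewrite /kx /lx.
have H b : badx b -> (b <= x) = (b <= y).
  move=> bb; apply/idP/idP => [/le_trans-> //|by_]; rewrite leNgt; apply/negP => xb.
  by apply: (nb b bb); rewrite (ltW xb) by_.
by rewrite !H //; rewrite /badx /=; tauto.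
Qed.
Local Notation cross := (@cross R fg kx).

Section Twist.
Variable i : nat.
Hypothesis i3 : (i < 3)%N.
Let c : R := i%:R + 3 / 2.
Definition rad (z : plane) : R := Num.sqrt ((z.1 - c) ^+ 2 + z.2 ^+ 2).
Definition mm (z : plane) : R := Num.max 0 (Num.min 1 (2 - 2 * rad z)).
Definition tau (z : plane) : plane :=
  (c + (z.1 - c) * cos (pi * mm z) + z.2 * sin (pi * mm z), z.2 * cos (pi * mm z) - (z.1 - c) * sin (pi * mm z)).

Lemma lx_at k x : (k <= 2)%N -> `|x - (i%:R + k%:R + 1 / 2)| < 1 / 2 -> lx x = (i + k)%N.
Proof.
move=> k2; rewrite ltr_norml => /andP[h1 h2]; have E : lx x = (i + k)%N :> nat; last by [].
have b (j : nat) : (j%:R <= x) = (j <= i + k)%N.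
  apply/idP/idP => H.
    rewrite -ltnS -(ltr_nat R) -addn1 !natrD; move: h1 h2 H; lra.
  by apply: (@le_trans _ _ (i + k)%:R); rewrite ?ler_nat // natrD; move: h1 h2; lra.
rewrite /lx (b 1%N) (b 2) (b 3) (b 4); move: i3 k2; lia.
Qed.
Lemma lx_left x : x < c - 1 / 2 -> (lx x <= i)%N.
Proof.
rewrite /c => h; have b (j : nat) : (i < j)%N -> (j%:R <= x) = false.
  move=> ij; apply/negbTE; rewrite -ltNge; have : (i.+1)%:R <= j%:R :> R by rewrite ler_nat.
  rewrite -addn1 natrD; move: h; lra.
have b' (j : nat) : ((j%:R <= x)%R <= (j <= i))%N by case: (leqP j i) => [_|/b ->//]; exact: leq_b1.
have h1 : ((1 <= x)%R <= (1 <= i))%N := b' 1%N.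
have [h2 h3 h4] := And3 (b' 2) (b' 3) (b' 4); move: h1 h2 h3 h4; rewrite /lx.
by move: (1 <= x) (2 <= x) (3 <= x) (4 <= x) => x1 x2 x3 x4; move: i3; clear; lia.
Qed.
Lemma lx_right x : c + 1 / 2 <= x -> (i.+2 <= lx x)%N.
Proof.
rewrite /c => h; have b (j : nat) : (j <= i.+2)%N -> (j%:R <= x).
  rewrite -(ler_nat R) -addn2 natrD => H; apply: le_trans H _; move: h; lra.
have b' (j : nat) : ((j <= i.+2) <= (j%:R <= x)%R)%N by case: (leqP j i.+2) => [/b ->|_].
have h1 : ((1 <= i.+2) <= (1 <= x)%R)%N := b' 1%N.
have [h2 h3 h4] := And3 (b' 2) (b' 3) (b' 4); move: h1 h2 h3 h4; rewrite /lx.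
by move: (1 <= x) (2 <= x) (3 <= x) (4 <= x) => x1 x2 x3 x4; move: i3; clear; lia.
Qed.

Lemma rad_x z : `|z.1 - c| <= rad z.
Proof. by rewrite -sqrtr_sqr ler_wsqrtr // lerDl sqr_ge0. Qed.
Lemma rad_axis z : z.2 = 0 -> rad z = `|z.1 - c|.
Proof. by move=> z0; rewrite /rad z0 expr0n addr0 sqrtr_sqr. Qed.
Lemma rad_tau z : rad (tau z) = rad z.
Proof.
rewrite /rad /tau /=; congr Num.sqrt; have := cos2Dsin2 (pi * mm z).
move: (cos _) (sin _) (z.1 - c) z.2 => C S X Y E.
transitivity ((X ^+ 2 + Y ^+ 2) * (C ^+ 2 + S ^+ 2)); first by ring.
by rewrite E mulr1.
Qed.
Lemma mm_out z : 1 <= rad z -> mm z = 0.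
Proof. by move=> h; rewrite /mm max_l // ge_min; apply/orP; right; lra. Qed.
Lemma mm_in z : rad z <= 1 / 2 -> mm z = 1.
Proof. by move=> h; rewrite /mm min_l ?max_r //; lra. Qed.
Lemma mm_01 z : 0 <= mm z <= 1.
Proof. by rewrite /mm le_max lexx ge_max ler01 /= ge_min lexx. Qed.
Lemma mm_between z : 1 / 2 < rad z < 1 -> 0 < mm z < 1.
Proof. by move=> /andP[h1 h2]; rewrite /mm min_r ?max_r; lra. Qed.
Lemma sin_mm z : 0 <= sin (pi * mm z).
Proof.
have /andP[h0 h1] := mm_01 z; apply: sin_ge0_pi; rewrite mulr_ge0 ?pi_ge0 //=.
by rewrite ger_pMr ?pi_gt0.
Qed.
Lemma sin_mm_gt0 z : 1 / 2 < rad z < 1 -> 0 < sin (pi * mm z).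
Proof.
move=> /mm_between/andP[h0 h1]; apply: sin_gt0_pi; rewrite mulr_gt0 ?pi_gt0 //=.
by rewrite gtr_pMr ?pi_gt0.
Qed.
Lemma cos_mm_gt0 z : 3 / 4 < rad z -> 0 < cos (pi * mm z).
Proof.
move=> h; have /andP[h0 h1] := mm_01 z; have h2 : mm z < 1 / 2 by rewrite /mm gt_max gt_min; apply/andP; split; [|apply/orP; right]; lra.
have p0 := pi_gt0 R; have k1 : 0 <= pi * mm z by rewrite mulr_ge0 ?pi_ge0.
have k2 : pi * mm z < pi * (1 / 2) by rewrite ltr_pM2l.
by apply: cos_gt0_pihalf; apply/andP; split; lra.
Qed.
Lemma tau_out z : 1 <= rad z -> tau z = z.
Proof.
move=> /mm_out h; rewrite /tau h mulr0 cos0 sin0 !mulr1 !mulr0 subr0 addr0.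
by rewrite addrC subrK; case: z {h}.
Qed.
Lemma tau_in z : rad z <= 1 / 2 -> tau z = (c - (z.1 - c), - z.2).
Proof. by move=> /mm_in h; rewrite /tau h mulr1 cospi sinpi !mulrN1 !mulr0 subr0 addr0. Qed.

(** The holonomy of the arc along which the clockwise rotation carries z: upper points descend on
    the right of both punctures, lower points rise on their left. In the inner disk an axis point
    and its image both count as above, although nearby upper points are sent below; the first case
    corrects this. *)
Definition psi (z : plane) : fg :=
  if (rad z < 1 / 2) && (z.2 == 0) then (K i.+2 * (K i.+1)^-1)%g else
  if above z then if above (tau z) then 1%g else K i.+2 else if above (tau z) then ((K i)^-1)%g else 1%g.
(** The twist carries the step cocycle to its image under [sigma i], up to the coboundary of
    [psi]. *)
Definition twist_ok z w := cross (tau z) (tau w) = ((psi z)^-1 * sigma i (cross z w) * psi w)%g.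

Lemma rad_cts : continuous rad.
Proof.
have c1 : continuous (fun z : plane => z.1 - c).
  by move=> z; apply: cvgB; [exact: cvg_fst|exact: cvg_cst].
have c2 : continuous (fun z : plane => z.2) by move=> z; exact: cvg_snd.
move=> z; apply: (@continuous_comp _ _ _ (fun z : plane => (z.1 - c) ^+ 2 + z.2 ^+ 2) Num.sqrt); last exact: sqrt_continuous.
exact: (cvgD (cvgM (c1 z) (c1 z)) (cvgM (c2 z) (c2 z))).
Qed.
Lemma tau_cts : continuous tau.
Proof.
have c1 : continuous (fun z : plane => z.1 - c).
  by move=> z; apply: cvgB; [exact: cvg_fst|exact: cvg_cst].
have c2 : continuous (fun z : plane => z.2) by move=> z; exact: cvg_snd.
have cr := rad_cts.
have cm : continuous mm.
  move=> z; apply: (continuous_max (f := cst 0) (g := cst 1 \min (fun w => 2 - 2 * rad w))); first exact: cst_continuous.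
  apply: (continuous_min (f := cst 1) (g := fun w => 2 - 2 * rad w)); first exact: cst_continuous.
  exact: (cvgB (cvg_cst (2 : R)) (cvgM (cvg_cst (2 : R)) (cr z))).
have ct : continuous (fun z => pi * mm z) by move=> z; exact: (cvgM (cvg_cst (pi : R)) (cm z)).
have cc : continuous (fun z => cos (pi * mm z)) by move=> z; apply: (continuous_comp (ct z)); exact: continuous_cos.
have cs : continuous (fun z => sin (pi * mm z)) by move=> z; apply: (continuous_comp (ct z)); exact: continuous_sin.
move=> z.
exact: (cvg_pair (cvgD (cvgD (cvg_cst c) (cvgM (c1 z) (cc z))) (cvgM (c2 z) (cs z)))
  (cvgB (cvgM (c2 z) (cc z)) (cvgM (c1 z) (cs z)))).
Qed.

Lemma near_pred z (A : plane -> Prop) : (\forall w \near z, A w) -> exists2 r, 0 < r & forall w, ball z r w -> A w.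
Proof. by move=> /nbhs_ballP[r r0 H]; exists r. Qed.
Lemma near_fst_lt (g : plane -> R) z b : continuous g -> g z < b -> \forall w \near z, g w < b.
Proof. by move=> cg h; apply: (cg z (fun y => y < b)); exact: lt_nbhsl. Qed.
Lemma near_fst_gt (g : plane -> R) z b : continuous g -> b < g z -> \forall w \near z, b < g w.
Proof. by move=> cg h; apply: (cg z (fun y => b < y)); exact: lt_nbhsr. Qed.

Let K2 := K i.+2.
Let K1 := K i.+1.
Let K0 := K i.
Lemma sK (k : nat) : (k <= 4)%N -> sigma i (K k) = if k == i.+1 then (K2 * K1^-1 * K0)%g else K k.
Proof. by move=> k4; case: eqVneq => [->|ki]; [exact: sigma_K1|exact: sigma_K]. Qed.
Lemma sK0 : sigma i K0 = K0. Proof. by rewrite sK ?ifF //; move: i3; lia. Qed.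
Lemma sK2 : sigma i K2 = K2. Proof. by rewrite sK ?ifF //; move: i3; lia. Qed.

(** Once [kx] is known where the step and its image cross the axis, the identity depends only on
    four signs, and becomes a finite check in the group. *)
Lemma ok_table z w (kz kt : fg) : ~~ ((rad z < 1 / 2) && (z.2 == 0)) -> ~~ ((rad w < 1 / 2) && (w.2 == 0)) ->
  (above z != above w -> kx (if above z then z.1 else w.1) = kz) ->
  (above (tau z) != above (tau w) -> kx (if above (tau z) then (tau z).1 else (tau w).1) = kt) ->
  let s := above z in let s' := above w in let u := above (tau z) in let u' := above (tau w) in
  let k s u := if s then if u then 1%g else K2 else if u then (K0^-1)%g else 1%g in
  let E h s s' := if s then if s' then 1%g else h else if s' then (h^-1)%g else 1%g in
  E kt u u' = ((k s u)^-1 * E (sigma i kz) s s' * k s' u')%g -> twist_ok z w.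
Proof.
move=> /negbTE nz /negbTE nw hz ht /= E; rewrite /twist_ok /psi nz nw /Holonomy.cross.
move: hz ht E; case: (above z); case: (above w); case: (above (tau z)); case: (above (tau w)) => //= hz ht;
  try (have {}hz := hz isT); try (have {}ht := ht isT); rewrite ?hz ?ht ?sigma1 ?sigmaV // => E; rewrite ?hz ?ht //; exact: E.
Qed.

Lemma near_sign (g : plane -> R) z : continuous g -> g z != 0 -> \forall w \near z, (0 <= g w) = (0 <= g z) /\ g w != 0.
Proof.
move=> cg; rewrite neq_lt => /orP[g0|g0].
  have := near_fst_lt cg g0; apply: filterS => w gw.
  by rewrite !leNgt g0 gw; split=> //; rewrite lt_eqF.
have := near_fst_gt cg g0; apply: filterS => w gw.
by rewrite !ltW //; split=> //; rewrite gt_eqF.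
Qed.
Definition locally_ok z := exists2 r, 0 < r & forall z' w', ball z r z' -> ball z r w' -> twist_ok z' w'.
Lemma from_near z (A : plane -> Prop) : (\forall w \near z, A w) -> (forall z' w', A z' -> A w' -> twist_ok z' w') -> locally_ok z.
Proof. by move=> /near_pred[r r0 H] ok; exists r => // z' w' /H Az /H; apply: ok. Qed.
Let t1 := (fun z => (tau z).1).
Let t2 := (fun z => (tau z).2).
Let t1c : continuous t1. Proof. by move=> z; apply: (@continuous_comp _ _ _ tau fst); [exact: tau_cts|exact: cvg_fst]. Qed.
Let t2c : continuous t2. Proof. by move=> z; apply: (@continuous_comp _ _ _ tau snd); [exact: tau_cts|exact: cvg_snd]. Qed.
Let p1c : continuous (fun z : plane => z.1). Proof. by move=> z; exact: cvg_fst. Qed.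
Let p2c : continuous (fun z : plane => z.2). Proof. by move=> z; exact: cvg_snd. Qed.
Let kx2 x : c + 1 / 2 < x < c + 3 / 2 -> kx x = K2.
Proof.
move=> /andP[h1 h2]; rewrite /kx (@lx_at 2) ?addn2 // ltr_norml; move: h1 h2; rewrite /c => h1 h2.
by apply/andP; split; lra.
Qed.
Let kx0 x : c - 3 / 2 < x < c - 1 / 2 -> kx x = K0.
Proof.
move=> /andP[h1 h2]; rewrite /kx (@lx_at 0) ?addn0 // ltr_norml; move: h1 h2; rewrite /c => h1 h2.
by apply/andP; split; lra.
Qed.
Let kx1 x : c - 1 / 2 < x < c + 1 / 2 -> kx x = K1.
Proof.
move=> /andP[h1 h2]; rewrite /kx (@lx_at 1) ?addn1 // ltr_norml; move: h1 h2; rewrite /c => h1 h2.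
by apply/andP; split; lra.
Qed.
Let midrange z : z.2 != 0 -> t2 z = 0 -> 1 / 2 < rad z < 1.
Proof.
move=> z0 t0; apply/andP; split; rewrite ltNge; apply/negP => h; move: t0; rewrite /t2.
  by rewrite tau_in //= => /eqP; rewrite oppr_eq0 (negPf z0).
by rewrite tau_out // => /eqP; rewrite (negPf z0).
Qed.
Let midrange' z : z.2 = 0 -> t2 z != 0 -> 1 / 2 < rad z < 1.
Proof.
move=> z0 t0; apply/andP; split; rewrite ltNge; apply/negP => h; move: t0; rewrite /t2.
  by rewrite tau_in //= z0 oppr0 eqxx.
by rewrite tau_out // z0 eqxx.
Qed.

Lemma locally_ok_A z : z.2 != 0 -> t2 z != 0 -> locally_ok z.
Proof.
move=> z0 t0; apply: (from_near (filterI (near_sign p2c z0) (near_sign t2c t0))).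
move=> a b [[a1 a2] [a3 a4]] [[b1 b2] [b3 b4]].
apply: (@ok_table a b 1%g 1%g); rewrite ?(negPf a2) ?(negPf b2) ?andbF // /above ?a1 ?b1 -/(t2 a) -/(t2 b) ?a3 ?b3 ?eqxx //=.
by rewrite sigma1; case: (0 <= z.2); case: (0 <= t2 z); grp.
Qed.

(** The image lies on the axis, and since the sine of the angle is positive, the side of the centre
    on which it falls is given by the sign of [z.2]: right for upper points, left for lower ones. *)
Lemma locally_ok_B z : z.2 != 0 -> t2 z = 0 -> locally_ok z.
Proof.
move=> z0 t0; have mid := midrange z0 t0; have S0 := sin_mm_gt0 mid; case/andP: mid => r1 r2.
have rt : `|t1 z - c| = rad z by rewrite -(rad_tau z) (rad_axis (t0 : (tau z).2 = 0)).
have key : sin (pi * mm z) * (t1 z - c) = z.2.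
  move: t0 (cos2Dsin2 (pi * mm z)); rewrite /t1 /t2 /=; move: (cos _) (sin _) => C S t0 E.
  transitivity (z.2 * (C ^+ 2 + S ^+ 2) - C * (z.2 * C - (z.1 - c) * S)); first by ring.
  by rewrite E t0; ring.
move: (z0); rewrite neq_lt => /orP[zn|zp].
  have tn : t1 z - c < 0 by rewrite -(pmulr_rlt0 _ S0) key.
  rewrite ltr0_norm // in rt.
  have n1 : c - 3 / 2 < t1 z by lra. have n2 : t1 z < c - 1 / 2 by lra.
  apply: (from_near (filterI (near_fst_lt p2c zn) (filterI (near_fst_gt t1c n1) (near_fst_lt t1c n2)))).
  move=> a b [a1 [a2 a3]] [b1 [b2 b3]].
  apply: (@ok_table a b 1%g K0); rewrite ?(lt_eqF a1) ?(lt_eqF b1) ?andbF //.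
  - by rewrite /above !leNgt a1 b1.
  - by move=> _; case: ifP => _; apply: kx0; rewrite -?/(t1 _) ?a2 ?a3 ?b2 ?b3.
  rewrite /above (leNgt 0 a.2) (leNgt 0 b.2) a1 b1 /=.
  by do 2!case: ifP => _; grp.
have tp : 0 < t1 z - c by rewrite -(pmulr_rgt0 _ S0) key.
rewrite gtr0_norm // in rt.
have n1 : c + 1 / 2 < t1 z by lra. have n2 : t1 z < c + 3 / 2 by lra.
apply: (from_near (filterI (near_fst_gt p2c zp) (filterI (near_fst_gt t1c n1) (near_fst_lt t1c n2)))).
move=> a b [a1 [a2 a3]] [b1 [b2 b3]].
apply: (@ok_table a b 1%g K2); rewrite ?(gt_eqF a1) ?(gt_eqF b1) ?andbF //.
- by rewrite /above !ltW.
- by move=> _; case: ifP => _; apply: kx2; rewrite -?/(t1 _) ?a2 ?a3 ?b2 ?b3.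
rewrite /above (ltW a1) (ltW b1) /=.
by do 2!case: ifP => _; grp.
Qed.

Lemma locally_ok_C z : z.2 = 0 -> t2 z != 0 -> locally_ok z.
Proof.
move=> z0 t0; have mid := midrange' z0 t0; have S0 := sin_mm_gt0 mid; case/andP: mid => r1 r2.
have rt : `|z.1 - c| = rad z by rewrite rad_axis.
have key : t2 z = - ((z.1 - c) * sin (pi * mm z)) by rewrite /t2 /= z0 mul0r sub0r.
have sp a : 1 / 2 < rad a -> ~~ ((rad a < 1 / 2) && (a.2 == 0)) by move=> h; rewrite ltNge (ltW h).
move: (t0); rewrite neq_lt => /orP[tn|tp].
  have xp : 0 < z.1 - c by rewrite -(pmulr_lgt0 _ S0) -oppr_lt0 -key.
  rewrite gtr0_norm // in rt.
  have n1 : c + 1 / 2 < z.1 by lra. have n2 : z.1 < c + 3 / 2 by lra.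
  apply: (from_near (filterI (near_fst_lt t2c tn) (filterI (near_fst_gt rad_cts r1) (filterI (near_fst_gt p1c n1) (near_fst_lt p1c n2))))).
  move=> a b [a1 [a2 [a3 a4]]] [b1 [b2 [b3 b4]]].
  apply: (@ok_table a b K2 1%g); rewrite ?sp //.
  - by move=> _; case: ifP => _; apply: kx2; rewrite ?a3 ?a4 ?b3 ?b4.
  - by rewrite /above -/(t2 a) -/(t2 b) !leNgt a1 b1.
  rewrite sK2 /above -/(t2 a) -/(t2 b) (leNgt 0 (t2 a)) (leNgt 0 (t2 b)) a1 b1 /=.
  by do 2!case: ifP => _; grp.
have xn : z.1 - c < 0 by rewrite -(pmulr_llt0 _ S0) -oppr_gt0 -key.
rewrite ltr0_norm // in rt.
have n1 : c - 3 / 2 < z.1 by lra. have n2 : z.1 < c - 1 / 2 by lra.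
apply: (from_near (filterI (near_fst_gt t2c tp) (filterI (near_fst_gt rad_cts r1) (filterI (near_fst_gt p1c n1) (near_fst_lt p1c n2))))).
move=> a b [a1 [a2 [a3 a4]]] [b1 [b2 [b3 b4]]].
apply: (@ok_table a b K0 1%g); rewrite ?sp //.
- by move=> _; case: ifP => _; apply: kx0; rewrite ?a3 ?a4 ?b3 ?b4.
- by rewrite /above -/(t2 a) -/(t2 b) !ltW.
rewrite sK0 /above -/(t2 a) -/(t2 b) (ltW a1) (ltW b1) /=.
by do 2!case: ifP => _; grp.
Qed.

Lemma locally_ok_in z : rad z < 1 / 2 -> locally_ok z.
Proof.
move=> r1; apply: (from_near (near_fst_lt rad_cts r1)) => a b ra rb.
have ka w : rad w < 1 / 2 -> kx w.1 = K1 /\ kx (tau w).1 = K1.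
  move=> rw; have := rad_x w; have := rad_x (tau w); rewrite rad_tau => h1 h2.
  have k v : `|v - c| <= rad w -> kx v = K1.
    by move=> hv; apply: kx1; move: (le_lt_trans hv rw); rewrite ltr_norml => /andP[? ?]; apply/andP; split; lra.
  by split; apply: k.
have [a1 a2] := ka a ra; have [b1 b2] := ka b rb.
have e1 : sigma i K1 = (K2 * K1^-1 * K0)%g by apply: sigma_K1.
have tn w : rad w < 1 / 2 -> above (tau w) = (w.2 <= 0).
  by move=> h; rewrite /above tau_in ?(ltW h) //= oppr_ge0.
rewrite /twist_ok /psi ra rb /Holonomy.cross /= a1 a2 b1 b2 !tn // /above -/K2 -/K1 -/K0.
have e0 := sigma1 i; have e2 : sigma i (K1^-1)%g = ((K2 * K1^-1 * K0)^-1)%g by rewrite sigmaV e1.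
move: e0 e1 e2; move: (sigma i) (K2) (K1) (K0) => s k2 k1 k0 e0 e1 e2.
by case: (ltgtP a.2 0) => ha; case: (ltgtP b.2 0) => hb /=; rewrite ?e0 ?e1 ?e2; grp.
Qed.

Lemma locally_ok_out z : z.2 = 0 -> 1 < rad z -> locally_ok z.
Proof.
move=> z0 r1; have rx : `|z.1 - c| = rad z by rewrite rad_axis.
have main (A : plane -> Prop) : (\forall w \near z, A w) -> (forall w, A w -> lx w.1 != i.+1) -> locally_ok z.
  move=> nA HA; apply: (from_near (filterI (near_fst_gt rad_cts r1) nA)) => a b [ra /HA la] [rb /HA lb].
  have ns w : 1 < rad w -> (rad w < 1 / 2) = false by move=> h; apply/negbTE; rewrite -leNgt; lra.
  rewrite /twist_ok /psi !ns // /= !tau_out ?ltW // /Holonomy.cross.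
  have sk (w : plane) : lx w.1 != i.+1 -> sigma i (kx w.1) = kx w.1 by move=> lw; rewrite /kx sigma_K ?lx4.
  move: (sk a la) (sk b lb) (sigma1 i) (@sigmaV i); move: (sigma i) (kx a.1) (kx b.1) (K i) (K i.+2) => s k1 k2 k3 k4 s1 s2 s3 s4.
  by case: (above a); case: (above b); rewrite /= ?s3 ?s4 ?s1 ?s2; grp.
have [h|h] := leP 0 (z.1 - c).
  rewrite ger0_norm // in rx; have n1 : c + 1 / 2 < z.1 by lra.
  by apply: (main _ (near_fst_gt p1c n1)) => w /ltW /lx_right; rewrite neq_ltn orbC => ->.
rewrite ltr0_norm // in rx; have n1 : z.1 < c - 1 / 2 by lra.
by apply: (main _ (near_fst_lt p1c n1)) => w /lx_left; rewrite neq_ltn ltnS => ->.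
Qed.

(** At the edge of the twist both z and its image lie on the axis. Beyond radius 3/4 the angle is
    less than a right angle, so near the right end points can only go down through the axis, and
    near the left end only up. *)
Lemma locally_ok_one z : z.2 = 0 -> rad z = 1 -> locally_ok z.
Proof.
move=> z0 r1; have rx : `|z.1 - c| = 1 by rewrite -r1 rad_axis.
have tz : t1 z = z.1 by rewrite /t1 tau_out // r1.
have r34 : 3 / 4 < rad z by rewrite r1; lra.
have sp a : 3 / 4 < rad a -> ~~ ((rad a < 1 / 2) && (a.2 == 0)) by move=> h; rewrite ltNge (_ : 1 / 2 <= rad a) //; lra.
have [h|h] := leP 0 (z.1 - c).
  rewrite ger0_norm // in rx.
  have n1 : c + 1 / 2 < z.1 by lra. have n2 : z.1 < c + 3 / 2 by lra.
  have m1 : c + 1 / 2 < t1 z by rewrite tz. have m2 : t1 z < c + 3 / 2 by rewrite tz.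
  apply: (from_near (filterI (near_fst_gt rad_cts r34) (filterI (filterI (near_fst_gt p1c n1) (near_fst_lt p1c n2))
    (filterI (near_fst_gt t1c m1) (near_fst_lt t1c m2))))).
  move=> a b [a1 [[a2 a3] [a4 a5]]] [b1 [[b2 b3] [b4 b5]]].
  have side w : 3 / 4 < rad w -> c + 1 / 2 < w.1 -> ~~ above w -> above (tau w) = false.
    rewrite /above -!ltNge => w1 w2 w3; apply/negbTE; rewrite -ltNge /=.
    have C0 := cos_mm_gt0 w1; have S0 := sin_mm w.
    have : w.2 * cos (pi * mm w) < 0 by rewrite pmulr_llt0.
    have : 0 <= (w.1 - c) * sin (pi * mm w) by rewrite mulr_ge0 //; lra.
    lra.
  apply: (@ok_table a b K2 K2); rewrite ?sp //.
  - by move=> _; case: ifP => _; apply: kx2; rewrite ?a2 ?a3 ?b2 ?b3.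
  - by move=> _; case: ifP => _; apply: kx2; rewrite -?/(t1 _) ?a4 ?a5 ?b4 ?b5.
  have := side _ a1 a2; have := side _ b1 b2; rewrite sK2; move: (K2) (K0) => k2 k0.
  case: (above a); case: (above b); case: (above (tau a)); case: (above (tau b)) => //= sb sa;
    try (by have := sa isT); try (by have := sb isT); by grp.
rewrite ltr0_norm // in rx.
have n1 : c - 3 / 2 < z.1 by lra. have n2 : z.1 < c - 1 / 2 by lra.
have m1 : c - 3 / 2 < t1 z by rewrite tz. have m2 : t1 z < c - 1 / 2 by rewrite tz.
apply: (from_near (filterI (near_fst_gt rad_cts r34) (filterI (filterI (near_fst_gt p1c n1) (near_fst_lt p1c n2))
  (filterI (near_fst_gt t1c m1) (near_fst_lt t1c m2))))).
move=> a b [a1 [[a2 a3] [a4 a5]]] [b1 [[b2 b3] [b4 b5]]].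
have side w : 3 / 4 < rad w -> w.1 < c - 1 / 2 -> above w -> above (tau w).
  rewrite /above => w1 w2 w3 /=.
  have C0 := cos_mm_gt0 w1; have S0 := sin_mm w.
  have : 0 <= w.2 * cos (pi * mm w) by rewrite mulr_ge0 // ltW.
  have : (w.1 - c) * sin (pi * mm w) <= 0 by rewrite mulr_le0_ge0 //; lra.
  lra.
apply: (@ok_table a b K0 K0); rewrite ?sp //.
- by move=> _; case: ifP => _; apply: kx0; rewrite ?a2 ?a3 ?b2 ?b3.
- by move=> _; case: ifP => _; apply: kx0; rewrite -?/(t1 _) ?a4 ?a5 ?b4 ?b5.
have := side _ a1 a3; have := side _ b1 b3; rewrite sK0; move: (K2) (K0) => k2 k0.
case: (above a); case: (above b); case: (above (tau a)); case: (above (tau b)) => //= sb sa;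
  try (by have := sa isT); try (by have := sb isT); by grp.
Qed.

(** If z and its image are both on the axis, then outside the inner and outer regions z can only be
    one of the two exchanged punctures: strictly between the radii 1/2 and 1 the rotation moves axis
    points off the axis. *)
Theorem twist_local z : (forall b, badx b -> z <> (b, 0)) -> locally_ok z.
Proof.
move=> nb; have [z0|z0] := eqVneq z.2 0; have [t0|t0] := eqVneq (t2 z) 0.
- have rx : rad z = `|z.1 - c| by rewrite rad_axis.
  case: (ltgtP (rad z) 1) => r1; [|exact: locally_ok_out|exact: locally_ok_one].
  case: (ltgtP (rad z) (1 / 2)) => r2; first exact: locally_ok_in.
    have S0 : 0 < sin (pi * mm z) by apply: sin_mm_gt0; rewrite r1 r2.
    have : (z.1 - c) * sin (pi * mm z) = 0.
      by move: t0; rewrite /t2 /= z0 mul0r sub0r => /eqP; rewrite oppr_eq0 => /eqP.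
    move/eqP; rewrite mulf_eq0 (gt_eqF S0) orbF => /eqP x0; move: r2; rewrite rx x0 normr0; lra.
  exfalso; have [h|h] := leP 0 (z.1 - c).
    rewrite ger0_norm // r2 in rx; apply: (nb (i.+2)%:R); last by case: z z0 rx {h nb t0 r1 r2} => x y /= -> E; congr pair; rewrite -addn2 natrD; move: E; rewrite /c; lra.
    by rewrite /badx /=; case: i i3 => [|[|[|//]]] _; tauto.
  rewrite ltr0_norm // r2 in rx; apply: (nb (i.+1)%:R); last by case: z z0 rx {h nb t0 r1 r2} => x y /= -> E; congr pair; rewrite -addn1 natrD; move: E; rewrite /c; lra.
  by rewrite /badx /=; case: i i3 => [|[|[|//]]] _; tauto.
- exact: locally_ok_C.
- exact: locally_ok_B.
- exact: locally_ok_A.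
Qed.
End Twist.
End Plane.
End HalfTwist.
Import HalfTwist.

(** * Effect of a braid on the holonomy of loops *)

Module BraidHolonomy.
Local Open Scope classical_set_scope.
Local Open Scope ring_scope.
Local Open Scope quotient_scope.

Section Words.
Variable R : realType.
Local Notation plane := (R * R)%type.
Local Notation I := (@unit_I R).
Local Notation HOL := (@HOL R fg (@kx R)).
Local Notation badx := (@badx R).
Local Notation gloop := (@gloop R badx).
Local Notation avoids := (@avoids R badx).
Definition badl : seq R := [:: 1; 2; 3; 4].
Lemma badlP b : badx b -> b \in badl.
Proof. by case=> [->|[->|[->|->]]]; rewrite !inE eqxx ?orbT. Qed.

(** Conjugation by this reflection inverts the half twist, so inverse letters need no separate local
    study. *)
Definition flip (z : plane) : plane := (z.1, - z.2).
Lemma flipK z : flip (flip z) = z. Proof. by case: z => x y; rewrite /flip /= opprK. Qed.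

Section Letter.
Variable i : nat.
Hypothesis i3 : (i < 3)%N.
Local Notation tau := (@tau R i).
Lemma tauK z : tau (flip (tau (flip z))) = z.
Proof.
have rf w : rad i (flip w) = rad i w by rewrite /rad /= sqrrN.
have e1 : mm i (flip z) = mm i z by rewrite /mm rf.
have e2 : mm i (flip (tau (flip z))) = mm i z by rewrite /mm rf rad_tau rf.
rewrite {1}/HalfTwist.tau e2 /HalfTwist.tau e1 /=; have := cos2Dsin2 (pi * mm i z).
case: z {rf e1 e2} => x y /=; move: (cos _) (sin _) (i%:R + 3 / 2) => C S c E.
by congr pair; [transitivity (c + (x - c) * (C ^+ 2 + S ^+ 2))|transitivity (y * (C ^+ 2 + S ^+ 2))];
  first [ring|rewrite E; ring].
Qed.
Lemma tauK' z : flip (tau (flip (tau z))) = z.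
Proof. by have := tauK (flip z); rewrite flipK => /(congr1 flip); rewrite flipK. Qed.

Lemma tau_bad b : badx b -> exists2 b', badx b' & tau (b, 0) = (b', 0).
Proof.
move=> bb; have ri : [\/ i%:R = 0 :> R, i%:R = 1 :> R | i%:R = 2 :> R].
  by case: (i) i3 => [|[|[|//]]] _; [apply: Or31|apply: Or32|apply: Or33].
have rE : rad i (b, 0) = `|b - (i%:R + 3 / 2)| by rewrite rad_axis.
have [h|h] := leP (rad i (b, 0)) (1 / 2).
  exists (i%:R + 3 / 2 - (b - (i%:R + 3 / 2))); last by rewrite tau_in //= oppr0.
  move: h; rewrite rE ler_norml => /andP[h1 h2].
  by case: ri h1 h2 => ->; case: bb => [->|[->|[->|->]]] h1 h2;
    first [left; lra|right; left; lra|right; right; left; lra|right; right; right; lra].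
exists b => //; apply: tau_out; move: h; rewrite rE ltr_normr ler_normr => /orP h; apply/orP.
by case: ri h => ->; case: bb => [->|[->|[->|->]]] [h|h]; first [left; lra|right; lra].
Qed.
Lemma flip_bad b : flip (b, 0) = (b, 0). Proof. by rewrite /flip /= oppr0. Qed.
Lemma tau_avoids z : avoids z -> avoids (tau z).
Proof.
move=> az b bb E; have [b' bb' E'] := tau_bad bb; apply: (az b' bb').
by rewrite -(tauK' z) E flip_bad E' flip_bad.
Qed.
Lemma flip_avoids z : avoids z -> avoids (flip z).
Proof. by move=> az b bb E; apply: (az b bb); rewrite -(flipK z) E flip_bad. Qed.
Lemma flip_cts : continuous flip.
Proof.
have p1 : continuous (fun z : plane => z.1) by move=> z; exact: cvg_fst.
have p2 : continuous (fun z : plane => z.2) by move=> z; exact: cvg_snd.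
by move=> z; exact: (cvg_pair (p1 z) (cvgN (p2 z))).
Qed.

Lemma gloop_map F g : continuous F -> (forall z, avoids z -> avoids (F z)) -> gloop g -> gloop (F \o g).
Proof.
move=> cF aF [cg e ag]; split; [|by rewrite /= e|by move=> t /ag; apply: aF].
by apply: (@pcont_comp _ _ _ _ _ setT) => //; apply: cts_pcont.
Qed.
(** The values of [psi] telescope along a fine subdivision; as the loop is closed, the two that
    remain conjugate the result. *)
Lemma HOL_tau g h h' : gloop g -> HOL g h -> HOL (tau \o g) h' -> exists u, h' = (u * sigma i h * u^-1)%g.
Proof.
move=> [cg e ag] [N1 H1] [N2 H2].
have [|r r0 Hr] := lebesgue_number (@unit_compact R) (Q := fun s t => twist_ok i (g s) (g t)).
  move=> s Is; have [e' e0 He] := twist_local i3 (ag s Is).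
  by have [r r0 Hr] := cg s Is e' e0; exists r => // t t' It It' h1 h2; apply: He; apply: Hr.
have [N0 HN0] := fine_mesh r0; pose N := (N0 + N1 + N2).+1.
have [N0N N1N N2N] : [/\ N0 < N, N1 < N & N2 < N]%N by rewrite /N; split; lia.
pose p := pts g N; have step j : (j < N)%N -> twist_ok i (p j) (p j.+1).
  move=> jN; apply: Hr; [by apply: unitP => //; apply: ltnW|by apply: unitP|].
  rewrite /ball /= -mulrBl -opprB -natrB // subSnn mulNr mul1r normrN ger0_norm ?invr_ge0 //; exact: HN0.
have H m : (m <= N)%N -> hprod (@kx R) (pts (tau \o g) N) m = ((psi i (p 0%N))^-1 * sigma i (hprod (@kx R) p m) * psi i (p m))%g.
  elim: m => [|m IH] mN; first by rewrite /= sigma1 mulg1 mulVg.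
  rewrite /= IH 1?ltnW // sigmaM; have := step m mN; rewrite /twist_ok => E.
  by rewrite -[pts (tau \o g) N m]/(tau (p m)) -[pts _ N m.+1]/(tau (p m.+1)) E; grp.
have pN : p N = p 0%N by rewrite /p /pts divff ?mul0r ?pnatr_eq0.
exists ((psi i (p 0%N))^-1)%g; rewrite -(H2 N N2N) H // pN -(H1 N N1N) invgK //.
Qed.
End Letter.

Lemma half_twistE (i : 'I_3) b (z : plane) :
  half_twist (n := 4) (i, b) z = if b then flip (tau i (flip z)) else tau i z.
Proof.
rewrite /half_twist /eucl_dist /tau /mm /rad /flip /=.
case: b => /=; rewrite ?expr0 ?expr1 ?mul1r ?mulN1r ?mulNr ?cosN ?sinN ?subr0 ?sqrrN;
  move: (cos _) (sin _) => C S; congr pair; ring.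
Qed.
Lemma phi_letter (i : 'I_3) h : phi (\pi_(braid 4) [:: (i, false)]) h = sigma i h.
Proof. by apply: eq_fgext => j; rewrite bact_pi. Qed.
Lemma phi_letterV (i : 'I_3) h : phi (\pi_(braid 4) [:: (i, true)]) (sigma i h) = h.
Proof.
rewrite -phi_letter -phi_mul; have -> : (\pi_(braid 4) [:: (i, false)] * \pi_(braid 4) [:: (i, true)] = 1)%g; last exact: phi1.
rewrite -[LHS]/(braid_mul _ _) pi_braid_mul; apply/braidP; exact: (@braid_rel_inv 4 i false).
Qed.

Lemma HOL_letter l g h : gloop g -> HOL g h -> gloop (half_twist (n := 4) l \o g) /\
  exists2 h', HOL (half_twist (n := 4) l \o g) h' & exists u, h' = (u * phi (\pi_(braid 4) [:: l]) h * u^-1)%g.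
Proof.
case: l => i [] lg hg.
  set g' := _ \o g; have E t : g' t = flip (tau i (flip (g t))) by rewrite /g' /= half_twistE.
  have lg' : gloop g'.
    have L := gloop_map flip_cts flip_avoids (gloop_map (@tau_cts R i) (@tau_avoids i (ltn_ord i)) (gloop_map flip_cts flip_avoids lg)).
    by apply: gloop_ext L => t _; rewrite E.
  split=> //; have [h' hg'] := gloop_HOL (@kx_const R) badlP lg'; exists h' => //.
  (* For an inverse letter the roles are exchanged: g is the half twist of its image g'. *)
  have [|u Eu] := @HOL_tau i (ltn_ord i) g' h' h lg' hg'.
    by apply: HOL_ext hg => t _ /=; rewrite E tauK.
  have := phi_letterV i h'; have Es : sigma i h' = (u^-1 * h * u)%g by rewrite Eu; grp.
  rewrite Es !phiM => <-; exists (phi (\pi_(braid 4) [:: (i, true)]) u^-1)%g.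
  by rewrite (morph_mulV (@phiM _ _)) invgK.
have E t : half_twist (n := 4) (i, false) (g t) = tau i (g t) by rewrite half_twistE.
have L := gloop_map (@tau_cts R i) (@tau_avoids i (ltn_ord i)) lg.
split; first by apply: gloop_ext L => t _ /=; rewrite E.
have [h' hg'] := gloop_HOL (@kx_const R) badlP L; exists h'; first by apply: HOL_ext hg' => t _ /=; rewrite E.
by have [u Eu] := HOL_tau (ltn_ord i) lg hg hg'; exists u; rewrite phi_letter.
Qed.

Lemma HOL_word (w : braid_word 4) g h : gloop g -> HOL g h -> gloop (word_homeo w \o g) /\
  exists2 h', HOL (word_homeo w \o g) h' & exists u, h' = (u * phi (\pi_(braid 4) w) h * u^-1)%g.
Proof.
elim: w g h => [|l w IH] g h lg hg.
  split=> //; exists h => //; exists 1%g; rewrite -[\pi_(braid 4) [::]]/(1%g : braid 4) phi1; by grp.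
have [lg' [h' hg' [u Eu]]] := HOL_letter l lg hg.
have [lg'' [h'' hg'' [u' Eu']]] := IH _ _ lg' hg'.
split=> //; exists h'' => //; exists (u' * phi (\pi_(braid 4) w) u)%g.
have -> : \pi_(braid 4) (l :: w) = (\pi_(braid 4) [:: l] * \pi_(braid 4) w)%g.
  by rewrite -[RHS]/(braid_mul _ _) pi_braid_mul.
by rewrite phi_mul Eu' Eu !phiM (morph_mulV (@phiM _ _)) invgM !mulgA.
Qed.

Lemma disk_avoids (z : plane) : punctured_disk 4 z -> avoids z.
Proof.
case=> _ np b bb E; apply: np; rewrite E.
case: bb => [->|[->|[->|->]]]; [exists (@Ordinal 4 0 isT)|exists (@Ordinal 4 1 isT)|exists (@Ordinal 4 2 isT)|exists (@Ordinal 4 3 isT)] => //.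
Qed.

(** An isotopy moves the loop through loops in the punctured disk, so the word homeomorphism and f
    give conjugate holonomies. *)
Lemma represents_HOL f b (g : R -> plane) h : represents (n := 4) f b ->
  pcont I g -> g 0 = g 1 -> (forall t, I t -> punctured_disk 4 (g t)) -> HOL g h ->
  gloop (f \o g) /\ exists2 h', HOL (f \o g) h' & exists u, h' = (u * phi b h * u^-1)%g.
Proof.
move=> [[/pcontP cf _ [_ [_ ff _ _ _]]] [w wb [H [/pcontP cH dH H0 H1]]]] cg e dg hg.
have I0 : I 0 by rewrite /unit_I /= in_itv /= lexx ler01.
have I1 : I 1 by rewrite /unit_I /= in_itv /= lexx ler01.
have II s : I s -> 0 <= s <= 1 by rewrite /unit_I /= in_itv.
have lg : gloop g by split=> // t It; apply: disk_avoids; apply: dg.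
have lf : gloop (f \o g).
  split=> [||t It]; [exact: pcont_comp cg dg cf|by rewrite /= e|].
  by apply: disk_avoids; apply: ff; apply: dg.
split=> //; have [h' hf] := gloop_HOL (@kx_const R) badlP lf; exists h' => //.
have [lw [h1 hw [u Eu]]] := HOL_word w lg hg.
have [v Ev] : exists v, h' = (v * h1 * v^-1)%g.
  apply: (@free_homotopy R fg (@kx R) badx badl (@kx_const R) badlP (fun s t => H s (g t))).
  - apply: (@pcont_comp _ _ _ _ _ [set tz : R * plane | 0 <= tz.1 <= 1 /\ punctured_disk 4 tz.2] (fun st => (st.1, g st.2)) (fun tz => H tz.1 tz.2)) => //.
      move=> [s t] [/= Is It] e' e0; have [r r0 Hr] := cg t It e' e0; exists (Num.min e' r); first by rewrite lt_min e0.
      move=> [s' t'] [/= Is' It'] [/= b1 b2]; split=> /=; first by apply: le_ball b1; rewrite ge_min lexx.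
      by apply: Hr => //; apply: le_ball b2; rewrite ge_min lexx orbT.
    by move=> [s t] [/= Is It]; split=> /=; [exact: II|exact: dg].
  - move=> s t Is It; have [_ _ [_ [_ fs _ _ _]]] := dH s (II s Is).
    by apply: disk_avoids; apply: fs; apply: dg.
  - by move=> s _; rewrite e.
  - by apply: HOL_ext hw => t It /=; rewrite H0 // inE; apply: dg.
  by apply: HOL_ext hf => t It /=; rewrite H1 // inE; apply: dg.
by exists (v * u)%g; rewrite Ev Eu wb invgM !mulgA.
Qed.
End Words.
End BraidHolonomy.
Import BraidHolonomy.

(** * Loops covering a simple loop *)

Module SimpleLoop.
Local Open Scope classical_set_scope.
Local Open Scope ring_scope.

Section Separation.
Variable R : realType.
Local Notation plane := (R * R)%type.
Local Notation I := (@unit_I R).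
Lemma separated (z w : plane) : z <> w -> exists2 e, 0 < e & ~ ball z e w.
Proof.
move=> zw; exists (Num.max `|z.1 - w.1| `|z.2 - w.2|).
  rewrite lt_max !normr_gt0 !subr_eq0; apply: contra_notT zw.
  by rewrite negb_or !negbK => /andP[/eqP h1 /eqP h2]; case: z h1 h2 => x y /= -> ->; case: w.
by move=> /ballE[h1 h2]; move: h1 h2; rewrite !lt_max !ltxx /= orbF => h1; rewrite ltNge (ltW h1).
Qed.

Lemma pairs_uniform (g1 g2 : R -> plane) (P : R -> R -> Prop) : pcont I g1 -> pcont I g2 ->
  (forall s t, I s -> I t -> g1 s = g2 t -> exists2 r, 0 < r & forall s' t', I s' -> I t' -> `|s - s'| < r -> `|t - t'| < r -> P s' t') ->
  exists2 r, 0 < r & forall s t, I s -> I t -> ball (g1 s) r (g2 t) -> P s t.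
Proof.
move=> c1 c2 H; have cII := compact_setX (@unit_compact R) (@unit_compact R).
have [||r r0 Hr] := @uniform_radius R (R * R)%type _ cII (fun r st => ball (g1 st.1) r (g2 st.2) -> P st.1 st.2); last first.
- by exists r => // s t Is It; apply: (Hr (s, t)).
- move=> [s t] [/= Is It]; have [E|ne] := pselect (g1 s = g2 t).
    have [r r0 Hr] := H s t Is It E; exists r => // -[s' t'] [/= Is' It'] [/= d1 d2] _.
    exact: Hr.
  have [e e0 ne'] := separated ne; have e3 : 0 < e / 3 by rewrite divr_gt0.
  have [r1 r10 H1] := c1 s Is _ e3; have [r2 r20 H2] := c2 t It _ e3.
  exists (Num.min (e / 3) (Num.min r1 r2)); first by rewrite !lt_min e3 r10.
  move=> [s' t'] [/= Is' It'] [/= d1 d2] bb; exfalso; apply: ne'.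
  have b1 : ball (g1 s) (e / 3) (g1 s') by apply: H1 => //; apply: le_ball d1; rewrite !ge_min lexx !orbT.
  have b2 : ball (g2 t) (e / 3) (g2 t') by apply: H2 => //; apply: le_ball d2; rewrite !ge_min lexx !orbT.
  have b3 : ball (g1 s') (e / 3) (g2 t') by apply: le_ball bb; rewrite ge_min lexx.
  have -> : e = e / 3 + (e / 3 + e / 3) by lra.
  by apply: ball_triangle b1 _; apply: ball_triangle b3 _; apply: ball_sym.
by move=> r r' x /andP[_ rr] Hx bb; apply: Hx; apply: le_ball bb.
Qed.

Lemma unit_itv (s : R) : I s <-> 0 <= s <= 1. Proof. by rewrite /unit_I /= in_itv. Qed.
Lemma inj_uniform (g : R -> plane) d : pcont I g -> g 0 = g 1 -> set_inj `[0, 1[ g -> 0 < d ->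
  exists2 r, 0 < r & forall s t, I s -> I t -> ball (g s) r (g t) -> `|s - t| < d \/ 1 - d < `|s - t|.
Proof.
move=> cg e inj d0; apply: (pairs_uniform cg cg) => s t /unit_itv Is /unit_itv It E.
have sub s' t' : `|s - s'| < d / 2 -> `|t - t'| < d / 2 -> `|(s - t) - (s' - t')| < d.
  by rewrite !ltr_norml => /andP[? ?] /andP[? ?]; apply/andP; split; lra.
have ii x : 0 <= x < 1 -> x \in `[0, 1[%classic by rewrite inE /= in_itv.
exists (d / 2) => [|s' t' _ _ h1 h2]; first by rewrite divr_gt0.
have [st|[st|st]] : s = t \/ s - t = 1 \/ s - t = -1.
  case/andP: Is => s0; rewrite le_eqVlt => /orP[/eqP s1|s1]; case/andP: It => t0; rewrite le_eqVlt => /orP[/eqP t1|t1].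
  - by left; rewrite s1.
  - right; left; rewrite s1 in E *; suff -> : t = 0 by rewrite subr0.
    by apply: inj; rewrite ?ii ?t0 ?lexx ?ltr01 // -E.
  - right; right; rewrite t1 in E *; suff -> : s = 0 by rewrite sub0r.
    by apply: inj; rewrite ?ii ?s0 ?lexx ?ltr01 // E.
  - by left; apply: inj; rewrite ?ii ?s0 ?t0.
- by left; have := sub _ _ h1 h2; rewrite st subrr sub0r normrN.
- right; have := sub _ _ h1 h2; rewrite st ltr_norml => /andP[? ?].
  by rewrite ltr_normr; apply/orP; left; lra.
- right; have := sub _ _ h1 h2; rewrite st ltr_norml => /andP[? ?].
  by rewrite ltr_normr; apply/orP; right; lra.
Qed.
End Separation.

Section Potential.
Variables (R : realType) (G : groupType) (kappa : R -> G) (bad : set R) (l : seq R).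
Local Notation plane := (R * R)%type.
Local Notation I := (@unit_I R).
Local Notation cross := (cross kappa).
Local Notation hprod := (hprod kappa).
Hypothesis kappa_const : forall x y, x <= y -> (forall b, bad b -> ~ (x <= b <= y)) -> kappa x = kappa y.
Hypothesis badl : forall b, bad b -> b \in l.

Lemma crossV z w : (cross z w = (cross w z)^-1)%g.
Proof. by rewrite /Holonomy.cross; case: above; case: above; rewrite ?invg1 ?invgK. Qed.

Variables (g : R -> plane) (c : G).
Hypotheses (lg : gloop bad g) (inj : set_inj `[0, 1[ g) (hc : HOL kappa g c).

Let par (z : plane) : R := xget 0 [set t | 0 <= t < 1 /\ g t = z].
Let parP s : I s -> 0 <= par (g s) < 1 /\ g (par (g s)) = g s.
Proof.
move=> /unit_itv/andP[s0]; rewrite le_eqVlt => /orP[/eqP s1|s1]; rewrite /par; case: xgetP => [x _ //|] H.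
  by case: (H 0); split; [rewrite lexx ltr01|rewrite s1; case: lg].
by case: (H s); split; first by rewrite s0 s1.
Qed.

(** The potential of a point is the holonomy along the curve from the base point to it. Nearby
    points of a simple curve have nearby parameters, up to a passage through the base point; in that
    case a full turn c enters. *)
Theorem potential : exists (p : plane -> G) (r : R), 0 < r /\ forall s t, I s -> I t -> ball (g s) r (g t) ->
  exists2 x, [\/ x = 1%g, x = c | x = (c^-1)%g] & cross (g s) (g t) = ((p (g s))^-1 * x * p (g t))%g.
Proof.
have [e e0 cl] := gloop_uclear badl lg; case: (lg) => cg eg _.
have [d2 d20 Hd] := pcont_upath cg e0; pose d := d2 / 2.
have d0 : 0 < d by rewrite divr_gt0.
have [r r0 Hr] := inj_uniform cg eg inj d0.
have [N1 HN1] := fine_mesh d0; case: hc => N2 HN2; pose N := (N1 + N2).+1.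
have fine : N%:R^-1 < d by apply: HN1; rewrite ltnS leq_addr.
have cN : hprod (pts g N) N = c by apply: HN2; rewrite ltnS leq_addl.
have Npos : 0 < N%:R :> R by rewrite ltr0n.
have Nle i j : (i <= j)%N -> i%:R / N%:R <= j%:R / N%:R :> R by move=> ij; rewrite ler_pM2r ?invr_gt0 // ler_nat.
pose ix (s : R) := Num.truncn (N%:R * s).
have ixP s : 0 <= s -> (ix s)%:R / N%:R <= s < (ix s)%:R / N%:R + d.
  move=> s0; have /truncn_itv/andP[h1 h2] : 0 <= N%:R * s by rewrite mulr_ge0 // ltW.
  rewrite ler_pdivrMr // mulrC h1 /=; apply: (@lt_trans _ _ ((ix s)%:R / N%:R + N%:R^-1)); last by rewrite ltrD2l.
  by rewrite -{2}[N%:R^-1]mul1r -mulrDl natr1 ltr_pdivlMr // mulrC.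
have ixN s : 0 <= s < 1 -> (ix s <= N)%N.
  move=> /andP[s0 s1]; have /andP[h _] := ixP s s0; rewrite -(ler_nat R).
  by have := le_trans h (ltW s1); rewrite ler_pdivrMr // mul1r.
have ix_mono s t : 0 <= s -> s <= t -> (ix s <= ix t)%N.
  move=> s0 st; rewrite leqNgt; apply/negP => H; have /andP[h1 _] := ixP s s0.
  have t0 := le_trans s0 st; have /truncn_itv/andP[_ h2] : 0 <= N%:R * t by rewrite mulr_ge0 // ltW.
  have : (ix s)%:R <= N%:R * s by rewrite mulrC -ler_pdivrMr.
  have : N%:R * s <= N%:R * t by rewrite ler_pM2l.
  have h3 : (ix t).+1%:R <= (ix s)%:R :> R by rewrite ler_nat.
  move=> h4 h5; have := lt_le_trans h2 (le_trans h3 (le_trans h5 h4)); by rewrite ltxx.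
have IN j : (j <= N)%N -> I (j%:R / N%:R) by move=> jN; apply: unitP.
have pI x : 0 <= x < 1 -> I x by move=> /andP[h1 /ltW h2]; apply/unit_itv; rewrite h1.
have near s t : I s -> I t -> `|s - t| < d2 -> ball (g s) e (g t) by apply: Hd.
have d2E : d2 = d + d by rewrite /d; lra.
pose P s := (hprod (pts g N) (ix s) * cross (pts g N (ix s)) (g s))%g.
have seg z i j : (i <= j)%N -> (j <= N)%N -> clear bad z e -> (forall k, (i <= k <= j)%N -> ball z e (pts g N k)) ->
    hprod (pts g N) j = (hprod (pts g N) i * cross (pts g N i) (pts g N j))%g.
  move=> ij jN clz H; rewrite -{1}(subnKC ij) hprod_add; congr (_ * _)%g.
  rewrite (hprod_local kappa_const clz) ?addn0 ?subnKC // => k kj; apply: H; lia.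
have main s t : 0 <= s < 1 -> 0 <= t < 1 -> s <= t -> `|s - t| < d -> cross (g s) (g t) = ((P s)^-1 * P t)%g.
  move=> s01 t01 st dst; have Is := pI s s01; have It := pI t t01.
  case/andP: (s01) => s0 s1; case/andP: (t01) => t0 t1.
  have /andP[a1 a2] := ixP s s0; have /andP[b1 b2] := ixP t t0; have ab := ix_mono s t s0 st.
  have bN := ixN t t01; have clz := cl s Is.
  have B k : (ix s <= k <= ix t)%N -> ball (g s) e (pts g N k).
    move=> /andP[h1 h2]; apply: near => //; first by apply: IN; apply: leq_trans h2 bN.
    have := Nle _ _ h1; have := Nle _ _ h2; move: dst; rewrite !ltr_norml => /andP[? ?]; move: (k%:R / N%:R) => x ? ?.
    by apply/andP; split; lra.
  have Bs : ball (g s) e (g s) by apply: ballxx.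
  have Bt : ball (g s) e (g t) by apply: near => //; move: dst; lra.
  rewrite /P (seg _ _ _ ab bN clz B) !invgM -crossV.
  have Ba := B _ (introT andP (conj (leqnn _) ab)); have Bb := B _ (introT andP (conj ab (leqnn _))).
  rewrite -!mulgA mulKg (cocycle kappa_const clz Ba Bb Bt).
  by rewrite (cocycle kappa_const clz Bs Ba Bt).
have wrap s t : 0 <= s < 1 -> 0 <= t < 1 -> 1 - d < s - t -> cross (g s) (g t) = ((P s)^-1 * c * P t)%g.
  move=> s01 t01 st; have Is := pI s s01; have It := pI t t01.
  case/andP: (s01) => s0 s1; case/andP: (t01) => t0 t1.
  have I1 : I 1 by apply/unit_itv; rewrite lexx ler01. have I0 : I 0 by apply/unit_itv; rewrite lexx ler01.
  have /andP[a1 a2] := ixP s s0; have /andP[b1 b2] := ixP t t0.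
  have aN := ixN s s01; have bN := ixN t t01; have clz := cl 1 I1.
  have B k : (ix s <= k <= N)%N -> ball (g 1) e (pts g N k).
    move=> /andP[h1 h2]; apply: near => //; first by apply: IN.
    have := Nle _ _ h1; have := Nle _ _ h2; rewrite divff ?gt_eqF // ltr_norml; move: (k%:R / N%:R) => x ? ?.
    by apply/andP; split; lra.
  have B' k : (0 <= k <= ix t)%N -> ball (g 1) e (pts g N k).
    move=> /andP[_ h2]; rewrite -eg; apply: near => //; first by apply: IN; apply: leq_trans h2 bN.
    have := Nle _ _ h2; have : 0 <= k%:R / N%:R :> R by rewrite divr_ge0 // ler0n.
    rewrite ltr_norml; move: (k%:R / N%:R) => x ? ?.
    by apply/andP; split; lra.
  have Bs : ball (g 1) e (g s) by apply: near => //; rewrite ltr_norml; apply/andP; split; lra.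
  have Bt : ball (g 1) e (g t) by rewrite -eg; apply: near => //; rewrite ltr_norml; apply/andP; split; lra.
  have E1 := seg _ _ _ aN (leqnn _) clz B; have E2 := seg _ _ _ (leq0n _) bN clz B'.
  have pN : pts g N N = pts g N 0 by rewrite /pts divff ?gt_eqF // mul0r eg.
  have Ba := B _ (introT andP (conj (leqnn _) aN)); have BN := B _ (introT andP (conj aN (leqnn _))).
  have Bb := B' _ (introT andP (conj (leq0n _) (leqnn (ix t)))).
  rewrite -cN E1 /P E2 /= !invgM -crossV mul1g -!mulgA mulKg -pN.
  by rewrite (cocycle kappa_const clz BN Bb Bt) (cocycle kappa_const clz Ba BN Bt) (cocycle kappa_const clz Bs Ba Bt).
exists (P \o par), r; split=> // s t Is It bb.
have [ps gs] := parP Is; have [pt gt] := parP It; move: bb; rewrite -gs -gt /= gs gt => bb.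
have [h|h] := Hr _ _ (pI _ ps) (pI _ pt) (eq_ind_r (fun z => ball z r _) (eq_ind_r (ball (g s) r) bb gt) gs).
  exists 1%g; first exact: Or31.
  rewrite mulg1 -{1}gs -{1}gt; have [st|/ltW st] := leP (par (g s)) (par (g t)); first exact: main.
  by rewrite crossV main ?invgM ?invgK // distrC.
move: h; rewrite ltr_normr => /orP[h|h].
  by exists c; [exact: Or32|rewrite -{1}gs -{1}gt; apply: wrap].
exists (c^-1)%g; first exact: Or33.
rewrite opprB in h; rewrite -{1}gs -{1}gt crossV (wrap _ _ pt ps h) /=; by grp.
Qed.

Definition power_of (x : G) := exists k, x = (c ^+ k)%g \/ x = (c ^- k)%g.
Lemma power_ofM x y : power_of x -> [\/ y = 1%g, y = c | y = (c^-1)%g] -> power_of (x * y)%g.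
Proof.
case=> k xk [->|->|->]; first by exists k; rewrite mulg1.
  case: xk => ->; first by exists k.+1; left; rewrite expgSr.
  by case: k => [|k]; [exists 1%N; left; rewrite invg1 mul1g|exists k; right; rewrite expgS invgM mulgVK].
case: xk => ->; last by exists k.+1; right; rewrite expgS invgM.
by case: k => [|k]; [exists 1%N; right; rewrite mul1g|exists k; left; rewrite expgSr mulgK].
Qed.

(** The loop f is not lifted to a map of parameters. Each small step contributes at most one factor
    c or its inverse between two potentials, and the potentials telescope. *)
Theorem covering_loop (f : R -> plane) h : gloop bad f -> (forall t, I t -> exists2 s, I s & f t = g s) ->
  HOL kappa f h -> exists u x, power_of x /\ h = (u * x * u^-1)%g.
Proof.
move=> lf fg [N1 HN1]; have [p [r [r0 Hp]]] := potential; case: (lf) => cf ef _.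
have [d d0 Hd] := pcont_upath cf r0; have [N2 HN2] := fine_mesh d0; pose N := (N1 + N2).+1.
pose q := pts f N; have H m : (m <= N)%N -> exists2 x, power_of x & hprod q m = ((p (q 0%N))^-1 * x * p (q m))%g.
  elim: m => [|m IH] mN; first by exists 1%g; [exists 0%N; left|rewrite mulg1 mulVg].
  have [x Px Ex] := IH (ltnW mN).
  have I1 : I (m%:R / N%:R) by apply: unitP => //; apply: ltnW.
  have I2 : I (m.+1%:R / N%:R) by apply: unitP.
  have bb : ball (q m) r (q m.+1).
    apply: Hd => //; rewrite -mulrBl -opprB -natrB // subSnn mulNr mul1r normrN ger0_norm ?invr_ge0 //.
    by apply: HN2; rewrite ltnS leq_addl.
  have [s Is Es] := fg _ I1; have [t It Et] := fg _ I2.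
  have := Hp s t Is It; rewrite -Es -Et => /(_ bb)[y Py Ey]; exists (x * y)%g; first exact: power_ofM.
  by rewrite /= Ex Ey !mulgA mulgK.
have [x Px Ex] := H N (leqnn _); exists ((p (q 0%N))^-1)%g, x; split=> //.
rewrite -(HN1 N) ?ltnS ?leq_addr // Ex invgK; congr (_ * p _)%g.
by rewrite /q /pts divff ?pnatr_eq0 // mul0r ef.
Qed.
End Potential.
End SimpleLoop.
Import SimpleLoop.

(** * Lattice approximation of simple loops *)

Module LatticeRounding.
Local Open Scope classical_set_scope.
Local Open Scope ring_scope.

Definition adje (u v : vertex) := (u == v) || adjv u v.

Section Cycles.
Variables (lcol : int -> nat) (V : nat -> vertex).
Local Notation wprod := (wprod lcol).
Local Notation stepv := (stepv lcol).
Definition cyc (vs : seq vertex) := path adje (last (0, 0) vs) vs.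
Definition cycprod (vs : seq vertex) := wprod (last (0, 0) vs) vs.
Definition small (J : seq nat) := forall u p, {subset u :: p <= map V J} -> path adje u p -> last u p = u -> wprod u p = 1%g.

Lemma not_uniq_split (J : seq nat) : ~~ uniq (map V J) ->
  exists A a B b C, J = A ++ a :: B ++ b :: C /\ V a = V b.
Proof.
elim: J => //= x J IH; rewrite negb_and negbK => /orP[/mapP[y yJ E]|/IH[A [a [B [b [C [-> E]]]]]]].
  by case/splitPr: yJ => B C; exists [::], x, B, y, C.
by exists (x :: A), a, B, b, C.
Qed.

(** Two visits to the same vertex split the cycle into two loops. By hypothesis the vertices of one
    of them support only closed walks with trivial product, so that loop is deleted. *)
Lemma reduce_cycle (J : seq nat) : sorted ltn J -> cyc (map V J) ->
  (forall a b, a \in J -> b \in J -> (a < b)%N -> V a = V b ->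
     small [seq j <- J | (a <= j <= b)%N] \/ small [seq j <- J | (j <= a)%N || (b <= j)%N]) ->
  exists vs g, [/\ uniq vs, cyc vs, {subset vs <= map V J} & cycprod (map V J) = (g * cycprod vs * g^-1)%g].
Proof.
have [n] := ubnP (size J); elim: n J => // n IH J; rewrite ltnS => Jn sJ cJ HJ.
have [u|/not_uniq_split[A [a [B [b [C [EJ E]]]]]]] := boolP (uniq (map V J)).
  by exists (map V J), 1%g; split=> //; rewrite mul1g invg1 mulg1.
have sJ' : pairwise ltn (A ++ a :: B ++ b :: C) by rewrite -EJ -(sorted_pairwise ltn_trans).
move: sJ'; rewrite pairwise_cat => /and3P[/allrelP rA _ /=].
rewrite pairwise_cat /= all_cat /= => /andP[/and3P[/allP aB ab /allP aC] /and3P[/allrelP rB _ /andP[/allP bC _]]].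
have inJ x : x \in A ++ a :: B ++ b :: C -> x \in J by rewrite EJ.
have aJ : a \in J by apply: inJ; rewrite mem_cat inE eqxx orbT.
have bJ : b \in J by apply: inJ; rewrite mem_cat inE mem_cat inE eqxx !orbT.
have step K : (size K < size J)%N -> {subset K <= J} -> sorted ltn K -> cyc (map V K) ->
    (exists g, cycprod (map V J) = (g * cycprod (map V K) * g^-1)%g) ->
    exists vs g, [/\ uniq vs, cyc vs, {subset vs <= map V J} & cycprod (map V J) = (g * cycprod vs * g^-1)%g].
  move=> Ks sub sK cK [g Eg].
  have mono P : {subset [seq j <- K | P j] <= [seq j <- J | P j]}.
    by move=> x; rewrite !mem_filter => /andP[-> /sub].
  have smono L L' : {subset L' <= L} -> small L -> small L'.
    by move=> s S u p us; apply: S => x /us /mapP[y yL ->]; apply: map_f; apply: s.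
  have [||vs [g' [u cv sv Ev]]] := IH K _ sK cK.
  - exact: leq_trans Ks Jn.
  - move=> a' b' /sub aK /sub bK ab' E'; case: (HJ a' b' aK bK ab' E') => S; [left|right]; exact: smono S.
  exists vs, (g * g')%g; split=> //; last by rewrite Eg Ev invgM !mulgA.
  by move=> x /sv /mapP[y /sub yJ ->]; apply: map_f.
have P0 : path adje (last (V a) (map V C)) (map V A ++ V a :: map V B ++ V a :: map V C).
  by move: cJ; rewrite /cyc EJ !map_cat /= map_cat /= last_cat /= last_cat /= -E.
move: P0; rewrite cat_path /= cat_path /= => /and3P[pA sA /and3P[pB sB pC]].
case: (HJ a b aJ bJ ab E) => S.
  apply: (step (A ++ b :: C)).
  - rewrite EJ !size_cat /= size_cat /=; lia.
  - move=> x xK; apply: inJ; move: xK; rewrite !mem_cat !inE mem_cat inE.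
    by move=> /orP[->//|/orP[->|->]]; rewrite !orbT.
  - apply: (subseq_sorted ltn_trans) sJ; rewrite EJ cat_subseq //.
    by apply: (@subseq_trans _ (B ++ b :: C)); [exact: suffix_subseq|exact: subseq_cons].
  - by rewrite /cyc map_cat /= last_cat /= -E cat_path /= pA sA.
  exists 1%g; rewrite mul1g invg1 mulg1 /cycprod EJ !map_cat /= map_cat /= !last_cat /= last_cat /= -E !wprod_cat /= !wprod_cat /=.
  have E1 : (wprod (V a) (map V B) * stepv (last (V a) (map V B)) (V a) = 1)%g.
    have := S (V a) (map V B ++ [:: V a]); rewrite wprod_cat /= mulg1; apply; last by rewrite last_cat.
      have Sa x : x \in a :: B -> x \in [seq j <- J | (a <= j <= b)%N].
        rewrite inE mem_filter => /orP[/eqP->|xB]; first by rewrite leqnn (ltnW ab) aJ.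
        rewrite (ltnW (aB x xB)) ltnW ?inJ //; last by apply: rB; rewrite // inE eqxx.
        by rewrite mem_cat inE mem_cat xB !orbT.
      move=> x; rewrite inE mem_cat inE => /orP[/eqP->|/orP[/mapP[y yB ->]|/eqP->]]; apply: map_f; apply: Sa;
        rewrite inE ?eqxx ?yB ?orbT //.
    by rewrite cat_path /= pB sB.
  by rewrite -[RHS]mulg1 -!mulgA; do 2!congr (_ * _)%g; rewrite !mulgA E1 mul1g mulg1.
(* Here the deleted loop contains the base point, so the product changes by a conjugation. *)
apply: (step (a :: B)).
- rewrite EJ !size_cat /= size_cat /=; lia.
- move=> x xK; apply: inJ; move: xK; rewrite !mem_cat !inE mem_cat inE.
  by move=> /orP[->|->]; rewrite !orbT.
- apply: (subseq_sorted ltn_trans) sJ; rewrite EJ.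
  by apply: (@subseq_trans _ (a :: B ++ b :: C)); [rewrite /= eqxx prefix_subseq|exact: suffix_subseq].
- by rewrite /cyc /= sB.
set L := last (V a) (map V C) in pA sA.
have E1 : (wprod (V a) (map V C) * (wprod L (map V A) * stepv (last L (map V A)) (V a)) = 1)%g.
  have := S (V a) (map V C ++ map V A ++ [:: V a]); rewrite !wprod_cat /= mulg1; apply; last by rewrite !last_cat.
    have Sa x : x \in A ++ a :: C -> x \in [seq j <- J | (j <= a)%N || (b <= j)%N].
      rewrite mem_cat inE mem_filter => /orP[xA|/orP[/eqP->|xC]].
      - by rewrite (ltnW (rA x a xA _)) ?inE ?eqxx // inJ // mem_cat xA.
      - by rewrite leqnn aJ.
      - by rewrite (ltnW (bC x xC)) orbT inJ // mem_cat inE mem_cat inE xC !orbT.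
    move=> x; rewrite inE !mem_cat inE => /orP[/eqP->|/orP[/mapP[y yB ->]|/orP[/mapP[y yB ->]|/eqP->]]]; apply: map_f; apply: Sa;
      rewrite !mem_cat inE ?eqxx ?yB ?orbT //.
  by rewrite !cat_path /= pC -/L pA sA.
rewrite /cycprod EJ !map_cat /= map_cat /= !last_cat /= !last_cat /= -E !wprod_cat /= !wprod_cat /= -/L.
move: E1; set X := (wprod L _ * _)%g; move: (wprod (V a) (map V C)) (wprod (V a) (map V B)) (stepv (last (V a) _) _) => Z Y s ZX.
have EX : X = (Z^-1)%g by apply: (mulgI Z); rewrite ZX mulgV.
exists (Z^-1 * s^-1)%g; rewrite !mulgA -[(wprod L (map V A) * _)%g]/X EX; by grp.
Qed.

Lemma cyc_trivial vs : (size vs <= 1)%N -> cycprod vs = 1%g.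
Proof. by case: vs => [|v [|//]] _ //; rewrite /cycprod /= /LatticeWalk.stepv; case: (up v); rewrite mulg1. Qed.
Lemma cyc_adjv vs : (1 < size vs)%N -> uniq vs -> cyc vs -> path adjv (last (0, 0) vs) vs.
Proof.
have P x p : uniq (x :: p) -> path adje x p -> path adjv x p.
  elim: p x => //= y p IH x /andP[xp u] /andP[xy yp]; rewrite IH // andbT.
  by move: xy; rewrite /adje; case: eqVneq => // E; move: xp; rewrite E inE eqxx.
case: vs => [|x [|y p]] // _ u; rewrite /cyc /= => /andP[l xp]; have := P _ _ u xp => /= ->; rewrite andbT.
move: l; rewrite /adje; case: eqVneq => // E; move: u => /=.
by rewrite -E mem_last.
Qed.
End Cycles.

Section Columns.
Variable M : nat.
(** There are M columns per unit of length, so the punctures 1, 2, 3, 4 are on boundaries of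
    columns. *)
Definition lcol (c : int) : nat := ((M%:Z * 1 <= c)%R + (M%:Z * 2 <= c)%R + (M%:Z * 3 <= c)%R + (M%:Z * 4 <= c)%R)%N.
Definition loc (k : int) : nat := lcol ((k + 1) %/ 2)%Z.

Lemma locE k c : k = 2 * c \/ k + 1 = 2 * c -> loc k = lcol c.
Proof. by rewrite /loc => H; congr lcol; move: H; lia. Qed.
Lemma lcol_mono x y : x <= y -> (lcol x <= lcol y)%N.
Proof.
move=> xy; have H (a : int) : ((a <= x)%R <= (a <= y)%R)%N.
  by case: (boolP (a <= x)) => // ax; rewrite (le_trans ax xy).
by rewrite /lcol !leq_add ?H.
Qed.
Lemma loc_mono x y : x <= y -> (loc x <= loc y)%N.
Proof. by move=> xy; apply: lcol_mono; move: xy; lia. Qed.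
Lemma loc_top (M_gt0 : (0 < M)%N) k0 : exists2 Q, lt_z k0 Q & loc Q = 4.
Proof.
exists (2 * (M%:Z * 4 + `|k0|)); first by rewrite /lt_z; move: M_gt0; lia.
rewrite (@locE _ (M%:Z * 4 + `|k0|)); last by left.
have H (a : int) : a <= 4 -> (M%:Z * a <= M%:Z * 4 + `|k0|) = true.
  move=> a4; apply: (@le_trans _ _ (M%:Z * 4)); last by rewrite lerDl.
  by rewrite ler_wpM2l.
by rewrite /lcol !H.
Qed.

End Columns.

Section Round.
Variables (R : realType) (M : nat).
Hypothesis M_gt0 : (0 < M)%N.
Local Notation plane := (R * R)%type.
Local Notation I := (@unit_I R).
Let e : R := M%:R^-1.
Let M0 : 0 < M%:R :> R. Proof. by rewrite ltr0n. Qed.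
Let e0 : 0 < e. Proof. by rewrite invr_gt0. Qed.
Local Notation lcol := (lcol M).
Definition rowof (z : plane) : int := Num.floor (M%:R * z.2).
(** The term in [rowof z] shifts each row by half a brick. *)
Definition colof (z : plane) : int := Num.floor (M%:R * z.1 + (rowof z)%:~R / 2).
Definition rnd (z : plane) : vertex := (rowof z, colof z).
Definition ctr (v : vertex) : plane := ((v.2%:~R - v.1%:~R / 2 + 1 / 2) / M%:R, (v.1%:~R + 1 / 2) / M%:R).
Lemma rnd_bounds z : let r := (rnd z).1 in let c := (rnd z).2 in
  r%:~R <= M%:R * z.2 < r%:~R + 1 /\ c%:~R <= M%:R * z.1 + r%:~R / 2 < c%:~R + 1.
Proof.
rewrite /=; have := floor_itv (M%:R * z.2); have := floor_itv (M%:R * z.1 + (rowof z)%:~R / 2).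
by rewrite -/(colof z) -/(rowof z) !intrD.
Qed.
Lemma ctr_near z : ball z e (ctr (rnd z)).
Proof.
have := rnd_bounds z; move: (rnd z) => [r c] /= [/andP[h1 h2] /andP[h3 h4]].
have E (x X : R) : `|M%:R * x - X| < 1 -> `|x - X / M%:R| < e.
  move=> h; have -> : x - X / M%:R = (M%:R * x - X) * e by rewrite /e; field; rewrite gt_eqF.
  by rewrite normrM (gtr0_norm e0) gtr_pMl.
by apply/ballE; split; apply: E; rewrite ltr_norml; apply/andP; split=> /=; lra.
Qed.
Lemma same_cell z w : rnd z = rnd w -> ball z (2 * e) w.
Proof.
move=> E; rewrite mulr2n mulrDl mul1r; apply: ball_triangle (ctr_near z) _; rewrite E.
by apply: ball_sym; exact: ctr_near.
Qed.

(** Passing to the next row adds 1/2 to the sheared abscissa. With less than 1/4 of horizontal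
    motion the total increment lies strictly between 0 and 1, so the column either stays or
    increases by one, which are the two adjacent bricks of that row. *)
Lemma close_cells (r r' c c' : int) (a a' b b' : R) : r%:~R <= b < r%:~R + 1 -> r'%:~R <= b' < r'%:~R + 1 ->
  c%:~R <= a + r%:~R / 2 < c%:~R + 1 -> c'%:~R <= a' + r'%:~R / 2 < c'%:~R + 1 ->
  `|a - a'| < 1 / 4 -> `|b - b'| < 1 / 4 -> adje (r, c) (r', c').
Proof.
move=> /andP[b1 b2] /andP[b3 b4] /andP[a1 a2] /andP[a3 a4]; rewrite !ltr_norml => /andP[d1 d2] /andP[d3 d4].
have L (m n k : int) : m%:~R < n%:~R + k%:~R :> R -> m < n + k by rewrite -intrD ltr_int.
have i1 : r' < r + 2 by apply: L; rewrite (_ : 2%:~R = 2) //; lra.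
have i2 : r < r' + 2 by apply: L; rewrite (_ : 2%:~R = 2) //; lra.
have [E|[E|E]] : r' = r \/ r' = r + 1 \/ r = r' + 1 by move: i1 i2; clear; lia.
- subst r'; have j1 : c' < c + 2 by apply: L; rewrite (_ : 2%:~R = 2) //; lra.
  have j2 : c < c' + 2 by apply: L; rewrite (_ : 2%:~R = 2) //; lra.
  have [->|[->|->]] : c' = c \/ c' = c + 1 \/ c = c' + 1 by move: j1 j2; clear; lia.
  + by rewrite /adje eqxx.
  + by rewrite /adje /adjv /= !eqxx !orbT.
  + by rewrite /adje /adjv /= !eqxx !orbT.
- subst r'; rewrite intrD in b3 b4 a3 a4.
  have j1 : c' < c + 2 by apply: L; rewrite (_ : 2%:~R = 2) //; lra.
  have j2 : c < c' + 1 by apply: L; rewrite (_ : 1%:~R = 1) //; lra.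
  have [->|->] : c' = c \/ c' = c + 1 by move: j1 j2; clear; lia.
  + by rewrite /adje /adjv /= !eqxx !orbT.
  + by rewrite /adje /adjv /= !eqxx !orbT.
- subst r; rewrite intrD in b1 b2 a1 a2.
  have j1 : c < c' + 2 by apply: L; rewrite (_ : 2%:~R = 2) //; lra.
  have j2 : c' < c + 1 by apply: L; rewrite (_ : 1%:~R = 1) //; lra.
  have [->|->] : c = c' \/ c = c' + 1 by move: j1 j2; clear; lia.
  + by rewrite /adje /adjv /= !eqxx !orbT.
  + by rewrite /adje /adjv /= !eqxx !orbT.
Qed.
Definition close (z w : plane) := `|M%:R * z.1 - M%:R * w.1| < 1 / 4 /\ `|M%:R * z.2 - M%:R * w.2| < 1 / 4.
Lemma close_adj z w : close z w -> adje (rnd z) (rnd w).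
Proof.
move=> [h1 h2]; have [z1 z2] := rnd_bounds z; have [w1 w2] := rnd_bounds w.
by rewrite (surjective_pairing (rnd z)) (surjective_pairing (rnd w)); apply: close_cells h1 h2.
Qed.
Lemma up_rnd z : up (rnd z) = above z.
Proof. by rewrite /up /= /rowof floor_ge_int /above pmulr_rge0. Qed.
(** Row 0 is not shifted, so its columns and the punctures are aligned, and rounding preserves the
    number of punctures on the left. *)
Lemma kx_rnd z : (rnd z).1 = 0 -> kx z.1 = kcol lcol (rnd z).2.
Proof.
move=> r0; rewrite /kx /K /kcol; congr (genprod (iota 0 _))^-1%g; rewrite /= /colof.
have -> : rowof z = 0 by [].
have H (j : nat) : (j%:R <= z.1) = (M%:Z * j%:Z <= Num.floor (M%:R * z.1)).
  by rewrite floor_ge_int intrM -!pmulrn ler_pM2l.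
by rewrite mul0r addr0 /lx /lcol (H 1%N) (H 2) (H 3) (H 4).
Qed.
Lemma cross_rnd z w : close z w -> cross (@kx R) z w = stepv lcol (rnd z) (rnd w).
Proof.
have row0 a b : close a b -> above a -> ~~ above b -> (rnd a).1 = 0.
  rewrite -!up_rnd /up => [[_]]; have [/andP[a1 a2] _] := rnd_bounds a; have [/andP[b1 b2] _] := rnd_bounds b.
  move: (rnd a).1 (rnd b).1 a1 a2 b1 b2 => r r' a1 a2 b1 b2; rewrite ltr_norml -ltNge => /andP[d1 d2] ra rb.
  have rb' : r' + 1 <= 0 by move: rb; clear; lia.
  have : r'%:~R + 1 <= 0 :> R by rewrite -(ler_int R) intrD in rb'.
  have : r < 1; last by move: ra; clear; lia.
  by rewrite -(ltr_int R); rewrite -(ler_int R) intrD in rb'; rewrite (_ : 1%:~R = 1) //; move: rb'; rewrite (_ : 0%:~R = 0) // (_ : 1%:~R = 1) //; lra.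
have csym a b : close a b -> close b a by rewrite /close [`|_ - M%:R * b.1|]distrC [`|_ - M%:R * b.2|]distrC.
move=> c; rewrite /cross /stepv !up_rnd; case: ifP => az; case: ifP => aw //.
  by rewrite kx_rnd //; apply: row0 c az _; rewrite aw.
by rewrite kx_rnd //; apply: (row0 _ _ (csym _ _ c) aw); rewrite az.
Qed.
Lemma up_ctr v : above (ctr v) = up v.
Proof.
rewrite /above /up /= pmulr_lge0 ?invr_gt0 //; apply/idP/idP => h; last by rewrite addr_ge0 // ler0z.
rewrite leNgt; apply/negP => vn; have : v.1 + 1 <= 0 by move: vn; clear; lia.
by rewrite -(ler_int R) intrD (_ : 1%:~R = 1) // (_ : 0%:~R = 0) //; move: h; lra.
Qed.
Lemma kx_ctr v : v.1 = 0 -> kx (ctr v).1 = kcol lcol v.2.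
Proof.
move=> r0; rewrite /kx /K /kcol; congr (genprod (iota 0 _))^-1%g; rewrite /= r0 mul0r subr0.
have H (j : nat) : (j%:R <= (v.2%:~R + 1 / 2) / M%:R :> R) = (M%:Z * j%:Z <= v.2).
  rewrite ler_pdivlMr //; have E : (M%:Z * j%:Z)%:~R = j%:R * M%:R :> R by rewrite intrM mulrC.
  apply/idP/idP => h; last by rewrite -(ler_int R) E in h; lra.
  rewrite leNgt; apply/negP => h'; have : v.2 + 1 <= M%:Z * j%:Z by move: h'; clear; lia.
  by rewrite -(ler_int R) intrD E (_ : 1%:~R = 1) //; move: h; lra.
by rewrite /lx /lcol (H 1%N) (H 2) (H 3) (H 4).
Qed.
Lemma cross_ctr u v : adje u v -> cross (@kx R) (ctr u) (ctr v) = stepv lcol u v.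
Proof.
move=> uv; have row0 a b : adje a b || adje b a -> up a -> ~~ up b -> a.1 = 0.
  case: a b => [r c] [r' c']; rewrite /adje /adjv /up /= !xpair_eqE => H h1 h2.
  have : r = r' \/ r' = r + 1 \/ r = r' + 1.
    case: (eqVneq r' r) H => [->|n1]; first by left.
    case: (eqVneq r' (r + 1)) => [->|n2]; first by right; left.
    case: (eqVneq r (r' + 1)) => [->|n3]; first by right; right.
    by [].
  by move: h1 h2; clear; lia.
rewrite /cross /stepv !up_ctr; case: ifP => az; case: ifP => aw //.
  by rewrite kx_ctr //; apply: (row0 u v); rewrite ?uv ?az ?aw.
by rewrite kx_ctr //; apply: (row0 v u); rewrite ?uv ?orbT ?az ?aw.
Qed.
Lemma wprod_small z d u p : clear (@badx R) z d -> (forall v, v \in u :: p -> ball z d (ctr v)) -> path adje u p ->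
  wprod lcol u p = cross (@kx R) (ctr u) (ctr (last u p)).
Proof.
move=> cl; elim: p u => [|v p IH] u H /=; first by rewrite cross_id.
move=> /andP[uv vp]; rewrite IH //; last by move=> x xp; apply: H; rewrite inE xp orbT.
rewrite -cross_ctr //; apply: (cocycle (@kx_const R) cl); apply: H; rewrite ?inE ?eqxx ?orbT //.
by have := mem_last v p; rewrite inE => ->; rewrite orbT.
Qed.
End Round.

Section Curve.
Variables (R : realType) (g : R -> R * R) (h : fg).
Local Notation plane := (R * R)%type.
Local Notation I := (@unit_I R).
Hypotheses (lg : gloop (@badx R) g) (inj : set_inj `[0, 1[ g) (hg : HOL (@kx R) g h).

(** A fine subdivision is rounded to bricks and made simple by [reduce_cycle]. Two visits to one
    brick come from close points of a simple curve, so one of the two arcs between them is short and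
    lies in a ball without punctures. *)
Theorem lattice_curve : exists M0, forall M, (M0 < M)%N -> h = 1%g \/ exists s vs u,
  [/\ uniq vs, traces vs s, forall v, v \in vs -> exists2 t, I t & ball (g t) M%:R^-1 (ctr R M v) &
      h = (u * hol (loc M) s * u^-1)%g].
Proof.
have [e e0 cl] := gloop_uclear (@badlP R) lg; case: (lg) => cg eg _.
have e2 : 0 < e / 2 by rewrite divr_gt0.
have [d d0 Hd] := pcont_upath cg e2; have [r r0 Hr] := inj_uniform cg eg inj d0.
have m0 : 0 < Num.min (r / 2) (e / 2) by rewrite lt_min e2 divr_gt0.
have [M0 HM0] := fine_mesh m0; exists M0 => M HM; have M_gt0 : (0 < M)%N by apply: leq_ltn_trans HM.
have := HM0 M HM; rewrite lt_min => /andP[Mr Me].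
have MR : 0 < M%:R :> R by rewrite ltr0n.
have q0 : 0 < 1 / 4 / M%:R :> R by rewrite !divr_gt0.
have [d' d'0 Hd'] := pcont_upath cg q0; have [N1 HN1] := fine_mesh d'0; case: hg => N2 HN2.
pose n := (N1 + N2)%N; pose N := n.+1; pose V j := rnd M (pts g N j).
have hN : hprod (@kx R) (pts g N) N = h by apply: HN2; rewrite ltnS leq_addl.
have VN : V N = V 0%N by rewrite /V /pts divff ?mul0r ?eg // pnatr_eq0.
have IN j : (j <= N)%N -> I (j%:R / N%:R) by move=> jN; apply: unitP.
have cl_step j : (j < N)%N -> close M (pts g N j) (pts g N j.+1).
  move=> jN; have /ballE[h1 h2] : ball (pts g N j) (1 / 4 / M%:R) (pts g N j.+1).
    apply: Hd'; [by apply: IN; apply: ltnW|exact: IN|].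
    rewrite -mulrBl -opprB -natrB // subSnn mulNr mul1r normrN ger0_norm ?invr_ge0 //.
    by apply: HN1; rewrite ltnS leq_addr.
  by split; rewrite -mulrBr normrM (gtr0_norm MR) mulrC -ltr_pdivlMr.
have H k : (k <= N)%N -> [/\ hprod (@kx R) (pts g N) k = wprod (lcol M) (V 0%N) (map V (iota 1 k)),
    last (V 0%N) (map V (iota 1 k)) = V k & path adje (V 0%N) (map V (iota 1 k))].
  elim: k => [|k IH] kN; first by [].
  have [h1 h2 h3] := IH (ltnW kN); rewrite (_ : iota 1 k.+1 = iota 1 k ++ [:: k.+1]); last by rewrite -(addn1 k) seq.iotaD /= add1n addn1.
  rewrite map_cat wprod_cat last_cat cat_path /= h1 h2 h3 /=.
  have c := cl_step k kN; have := close_adj c; rewrite -/(V k) -/(V k.+1) => ->; split=> //.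
  by rewrite mulg1 (cross_rnd M_gt0 c).
pose J := iota 0 N; have JE : map V J = V 0%N :: map V (iota 1 n) by [].
have [h1 h2 h3] := H n (leqnSn n).
have cJ : cyc (map V J).
  rewrite /cyc JE /= h2 h3 andbT -VN; exact: (close_adj (cl_step n (ltnSn n))).
have Jc : h = ((stepv (lcol M) (V n) (V 0%N))^-1 * cycprod (lcol M) (map V J) * stepv (lcol M) (V n) (V 0%N))%g.
  rewrite /cycprod JE /= h2 mulKg -hN /= h1 (cross_rnd M_gt0 (cl_step n (ltnSn n))).
  by rewrite -/(V n) -/(V N) VN.
have near_ctr z j : ball z (e / 2) (pts g N j) -> ball z e (ctr R M (V j)).
  move=> b; rewrite [e]splitr; apply: ball_triangle b _; apply: le_ball (ctr_near M_gt0 _); exact: ltW.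
have smallI z (P : pred nat) : clear (@badx R) z e -> (forall j, (j < N)%N -> P j -> ball z (e / 2) (pts g N j)) ->
    small (lcol M) V [seq j <- J | P j].
  move=> clz Hz u p up pu lu; rewrite (@wprod_small _ _ M_gt0 z e) // ?lu ?cross_id // => v /up/mapP[j + ->].
  by rewrite mem_filter mem_iota add0n => /andP[Pj /andP[_ jN]]; apply: near_ctr; apply: Hz.
have I0 : I 0 by apply/unit_itv; rewrite lexx ler01.
have I1 : I 1 by apply/unit_itv; rewrite lexx ler01.
have Nle i j : (i <= j)%N -> i%:R / N%:R <= j%:R / N%:R :> R by move=> ij; rewrite ler_pM2r ?invr_gt0 ?ltr0n // ler_nat.
have [|vs [u [uv cv sv Ev]]] := @reduce_cycle (lcol M) V J (iota_ltn_sorted 0 N) cJ.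
  move=> a b; rewrite !mem_iota !add0n => /andP[_ aN] /andP[_ bN] ab E.
  have Ia := IN a (ltnW aN); have Ib := IN b (ltnW bN).
  have bb : ball (pts g N a) r (pts g N b).
    by apply: le_ball (same_cell M_gt0 E); move: Mr; lra.
  have ab' := Nle _ _ (ltnW ab); have a0 : 0 <= a%:R / N%:R :> R by rewrite divr_ge0 ?ler0n.
  have b1 : b%:R / N%:R <= 1 :> R by have := Nle _ _ (ltnW bN); rewrite divff ?pnatr_eq0.
  case: (Hr _ _ Ia Ib bb); rewrite distrC ger0_norm ?subr_ge0 // => dd; [left|right].
    apply: (smallI (pts g N a)); first exact: cl.
    move=> j jN /andP[aj jb]; apply: Hd => //; first by apply: IN; apply: ltnW.
    have := Nle _ _ aj; have := Nle _ _ jb; rewrite ltr_norml; move: (j%:R / N%:R) => x ? ?.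
    by apply/andP; split; lra.
  apply: (smallI (g 0)); first exact: cl.
  move=> j jN /orP[ja|bj].
    apply: Hd => //; first by apply: IN; apply: ltnW.
    have := Nle _ _ ja; have : 0 <= j%:R / N%:R :> R by rewrite divr_ge0 ?ler0n.
    rewrite ltr_norml; move: (j%:R / N%:R) => x ? ?; by apply/andP; split; lra.
  rewrite eg; apply: Hd => //; first by apply: IN; apply: ltnW.
  have := Nle _ _ bj; have : j%:R / N%:R <= 1 :> R by have := Nle _ _ (ltnW jN); rewrite divff ?pnatr_eq0.
  rewrite ltr_norml; move: (j%:R / N%:R) => x ? ?; by apply/andP; split; lra.
move: Jc; rewrite Ev => Jc; have [s1|s1] := leqP (size vs) 1.
  by left; rewrite Jc cyc_trivial //; grp.
have pv := cyc_adjv s1 uv cv; right.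
case: (trace (@locE M) uv pv) => [E|[s [vs' [u' [pvs tr E]]]]].
  exists [::], [::], 1%g; split=> //; last by rewrite Jc /cycprod E /=; grp.
  by exists [::], [::]; split=> //; exists [::].
exists s, vs', ((stepv (lcol M) (V n) (V 0%N))^-1 * u * u')%g; split=> //.
- by rewrite (perm_uniq pvs).
- move=> v; rewrite (perm_mem pvs) => /sv/mapP[j + ->]; rewrite mem_iota add0n => /andP[_ jN].
  by exists (j%:R / N%:R); [apply: IN; apply: ltnW|exact: ctr_near].
by rewrite Jc /cycprod E !invgM invgK !mulgA.
Qed.
End Curve.

(** With bricks small compared with the distance between the curves, the two lattice walks share no
    vertex. *)
Theorem disjoint_curves (R : realType) (g1 g2 : R -> R * R) h1 h2 :
  gloop (@badx R) g1 -> set_inj `[0, 1[ g1 -> HOL (@kx R) g1 h1 -> h1 <> 1%g ->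
  gloop (@badx R) g2 -> set_inj `[0, 1[ g2 -> HOL (@kx R) g2 h2 -> h2 <> 1%g ->
  (forall s t, @unit_I R s -> @unit_I R t -> g1 s <> g2 t) ->
  exists M s1 s2 u1 u2, (0 < M)%N /\ [/\ joint s1 s2, valid s1, valid s2,
    h1 = (u1 * hol (loc M) s1 * u1^-1)%g & h2 = (u2 * hol (loc M) s2 * u2^-1)%g].
Proof.
move=> l1 i1 H1 n1 l2 i2 H2 n2 dis.
have [M1 K1] := lattice_curve l1 i1 H1; have [M2 K2] := lattice_curve l2 i2 H2.
have [||s t Is It E|r r0 Hr] := @pairs_uniform R g1 g2 (fun _ _ => False); [by case: l1|by case: l2|by case: (dis s t)|].
have r2 : 0 < r / 2 by rewrite divr_gt0.
have [M3 K3] := fine_mesh r2; pose M := (M1 + M2 + M3).+1.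
have [L1 L2 L3] : [/\ M1 < M, M2 < M & M3 < M]%N by rewrite /M; split; lia.
case: (K1 M L1) => [//|[s1 [vs1 [u1 [uv1 t1 b1 E1]]]]]; case: (K2 M L2) => [//|[s2 [vs2 [u2 [uv2 t2 b2 E2]]]]].
exists M, s1, s2, u1, u2; split=> //; split=> //; [|exact: traces_perm t1|exact: traces_perm t2].
apply: traces_joint t1 t2; rewrite cat_uniq uv1 uv2 andbT /=; apply/hasPn => v v2; apply/negP => v1.
have [s Is Bs] := b1 v v1; have [t It Bt] := b2 v v2; apply: (Hr s t Is It).
have B1 : ball (g1 s) (r / 2) (ctr R M v) by apply: le_ball Bs; exact: ltW (K3 M L3).
have B2 : ball (g2 t) (r / 2) (ctr R M v) by apply: le_ball Bt; exact: ltW (K3 M L3).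
rewrite [r]splitr; exact: ball_triangle B1 (ball_sym B2).
Qed.
End LatticeRounding.
Import LatticeRounding.

(** * Winding numbers *)

Module Winding.
Local Open Scope classical_set_scope.
Local Open Scope ring_scope.

(** The integers written multiplicatively, so that winding numbers are a case of holonomy. *)
Definition wint : Type := int.
HB.instance Definition _ := Choice.on wint.
HB.instance Definition _ := isGroup.Build wint (@addrA int) (@add0r int) (@addr0 int) (@addNr int) (@addrN int).
Lemma wmulE (x y : wint) : (x * y)%g = (x : int) + (y : int) :> int. Proof. by []. Qed.
Lemma winvE (x : wint) : (x^-1)%g = - (x : int) :> int. Proof. by []. Qed.
Lemma wconj (u x : wint) : (u * x * u^-1)%g = x.
Proof. by rewrite -[LHS]/((u : int) + x - u) addrAC subrr add0r. Qed.

Section Winding.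
Variable R : realType.
Local Notation plane := (R * R)%type.
Local Notation I := (@unit_I R).
Implicit Types (z w P Q : plane) (g : R -> plane).
(** The cut is the half-axis to the right of the origin; crossing it upwards counts for +1. *)
Definition kw (x : R) : wint := if 0 <= x then -1%:Z else 0.
Definition bad0 : set R := [set x | x = 0].
Lemma kw_const x y : x <= y -> (forall b, bad0 b -> ~ (x <= b <= y)) -> kw x = kw y.
Proof.
move=> xy nb; rewrite /kw; case: (leP 0 x) => x0; first by rewrite (le_trans x0 xy).
by case: (leP 0 y) => // y0; case: (nb 0); rewrite // (ltW x0) y0.
Qed.
Lemma bad0l b : bad0 b -> b \in [:: 0]. Proof. by move=> ->; rewrite inE. Qed.
Definition shift P z : plane := (z.1 - P.1, z.2 - P.2).
Definition wd g P n := HOL kw (shift P \o g) n.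
Lemma shift_ball P z w e : ball (shift P z) e (shift P w) <-> ball z e w.
Proof.
have E (a b c : R) : a - c - (b - c) = a - b by lra.
by split=> /ballE /= [h1 h2]; apply/ballE; move: h1 h2; rewrite /= !E.
Qed.
Lemma shift0 P z : shift P z = (0, 0) -> z = P.
Proof. by case: P z => a b [x y] [/subr0_eq -> /subr0_eq ->]. Qed.
Lemma avoid0 z : z <> (0, 0) -> avoids bad0 z. Proof. by move=> z0 b ->. Qed.
Definition closed_path g := pcont I g /\ g 0 = g 1.
Lemma gloop_shift g P : closed_path g -> (forall t, I t -> g t <> P) -> gloop bad0 (shift P \o g).
Proof.
move=> [cg eg] gP; split; [|by rewrite /= eg|by move=> t It; apply: avoid0 => /shift0; apply: gP].
by move=> t It e e0; have [r r0 H] := cg t It e e0; exists r => // t' It' /(H t' It') /shift_ball; apply.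
Qed.
Lemma wd_exists g P : closed_path g -> (forall t, I t -> g t <> P) -> exists n, wd g P n.
Proof. by move=> cg gP; apply: (gloop_HOL kw_const bad0l); apply: gloop_shift. Qed.
Lemma wd_uniq g P n m : wd g P n -> wd g P m -> n = m.
Proof. exact: HOL_uniq. Qed.

Lemma off_path g P : closed_path g -> (forall t, I t -> g t <> P) ->
  exists2 r, 0 < r & forall t, I t -> ~ ball P r (g t).
Proof.
move=> cg gP; have [e e0 H] := gloop_uclear bad0l (gloop_shift cg gP); exists e => // t It /ball_sym b.
apply: (H t It 0) => //; have : ball (shift P (g t)) e (shift P P) by apply/shift_ball.
by rewrite /shift !subrr.
Qed.
Lemma p1c : continuous (fun z : plane => z.1). Proof. by move=> z; exact: cvg_fst. Qed.
Lemma p2c : continuous (fun z : plane => z.2). Proof. by move=> z; exact: cvg_snd. Qed.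

(** Moving P inside a ball that the curve misses is a homotopy of the translated curve. In a
    commutative group conjugate holonomies are equal. *)
Lemma wd_local g P : closed_path g -> (forall t, I t -> g t <> P) ->
  exists2 r, 0 < r & forall Q, ball P r Q -> (forall t, I t -> g t <> Q) /\ forall n, wd g P n -> wd g Q n.
Proof.
move=> cg gP; have [r r0 H] := off_path cg gP; exists r => // Q PQ.
have gQ t : I t -> g t <> Q by move=> It E; apply: (H t It); rewrite E.
split=> // n wn; have [m wm] := wd_exists cg gQ.
pose F (sz : R * plane) : plane := (sz.2.1 - (P.1 + sz.1 * (Q.1 - P.1)), sz.2.2 - (P.2 + sz.1 * (Q.2 - P.2))).
have cF : continuous F.
  have c1 : continuous (fun sz : R * plane => sz.1) by move=> z; exact: cvg_fst.
  have c2 : continuous (fun sz : R * plane => sz.2) by move=> z; exact: cvg_snd.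
  have c21 : continuous (fun sz : R * plane => sz.2.1) by move=> z; apply: (@continuous_comp _ _ _ snd fst); [exact: c2|exact: p1c].
  have c22 : continuous (fun sz : R * plane => sz.2.2) by move=> z; apply: (@continuous_comp _ _ _ snd snd); [exact: c2|exact: p2c].
  move=> z; exact: (cvg_pair (cvgB (c21 z) (cvgD (cvg_cst P.1) (cvgM (c1 z) (cvg_cst (Q.1 - P.1)))))
    (cvgB (c22 z) (cvgD (cvg_cst P.2) (cvgM (c1 z) (cvg_cst (Q.2 - P.2)))))).
have [u E] : exists u, m = (u * n * u^-1)%g; last by rewrite E wconj in wm.
apply: (@free_homotopy R wint kw bad0 [:: 0] kw_const bad0l (fun s t => F (s, g t))).
- apply: (@pcont_comp _ _ _ _ _ setT (fun st => (st.1, g st.2)) F) => //; last exact: cts_pcont.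
  move=> [s t] [/= Is It] e e0; case: cg => cg _; have [d d0 Hd] := cg t It e e0.
  exists (Num.min e d); first by rewrite lt_min e0.
  move=> [s' t'] [/= Is' It'] [/= b1 b2]; split=> /=; first by apply: le_ball b1; rewrite ge_min lexx.
  by apply: Hd => //; apply: le_ball b2; rewrite ge_min lexx orbT.
- move=> s t /unit_itv/andP[s0 s1] It; apply: avoid0 => -[/= /subr0_eq E1 /subr0_eq E2]; apply: (H t It).
  have B (a b : R) : `|a - b| < r -> `|a - (a + s * (b - a))| < r.
    rewrite opprD addrA subrr add0r normrN normrM distrC => h; apply: le_lt_trans h.
    by rewrite ger0_norm // ler_piMl.
  by move: PQ => /ballE[b1 b2]; apply/ballE; rewrite E1 E2; split; apply: B.
- by move=> s _; case: cg => _ ->.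
- by apply: HOL_ext wn => t _; rewrite /F /shift /= !mul0r !addr0.
by apply: HOL_ext wm => t _; rewrite /F /shift /= !mul1r ![_ + (_ - _)]addrC !subrK.
Qed.

Lemma wd_trivial g P (q : plane -> wint) : g 0 = g 1 ->
  (forall s t, I s -> I t -> cross kw (shift P (g s)) (shift P (g t)) = ((q (shift P (g s)))^-1 * q (shift P (g t)))%g) -> wd g P 0.
Proof.
move=> eg H; exists 0%N => N N0; pose p := pts (shift P \o g) N.
have L m : (m <= N)%N -> hprod kw p m = ((q (p 0%N))^-1 * q (p m))%g.
  elim: m => [|m IH] mN; first by rewrite /= mulVg.
  rewrite /= IH 1?ltnW // H ?mulgA ?mulgK //; [apply: unitP => //; exact: ltnW|exact: unitP].
rewrite L // /p /pts divff ?pnatr_eq0 -?lt0n // mul0r /= eg mulVg //.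
Qed.
Lemma wd_far g P : closed_path g -> [\/ forall t, I t -> (g t).1 < P.1, forall t, I t -> P.1 <= (g t).1,
  forall t, I t -> (g t).2 < P.2 | forall t, I t -> P.2 <= (g t).2] -> wd g P 0.
Proof.
move=> [_ eg] [] H.
- apply: (@wd_trivial g P (fun=> 1%g)) => // s t Is It; rewrite /cross /kw /= !leNgt !subr_lt0 !H //=.
  by case: above; case: above.
- apply: (@wd_trivial g P (fun z => if above z then 1%g else (-1%:Z : wint))) => // s t Is It; rewrite /cross /kw /= !subr_ge0 !H //=.
  by case: above; case: above.
- apply: (@wd_trivial g P (fun=> 1%g)) => // s t Is It; rewrite /cross /above /= !leNgt !subr_lt0 !H //=.
- apply: (@wd_trivial g P (fun=> 1%g)) => // s t Is It; rewrite /cross /above /= !subr_ge0 !H //=.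
Qed.

Definition trace_of g : set plane := g @` I.
Lemma path_compact g : closed_path g -> compact (trace_of g).
Proof. by move=> [/pcontP cg _]; apply: continuous_compact => //; exact: unit_compact. Qed.
Lemma off_trace g P : ~ trace_of g P -> forall t, I t -> g t <> P.
Proof. by move=> nP t It E; apply: nP; exists t. Qed.
Lemma trace_closed g : closed_path g -> closed (trace_of g).
Proof.
move=> cg; rewrite -[trace_of g]setCK; apply: open_closedC; rewrite openE => z /= nz.
have [r r0 H] := off_path cg (off_trace nz); apply/nbhs_ballP; exists r => // w zw [t It E].
by apply: (H t It); rewrite E.
Qed.
Lemma bounded_coords (D : set plane) : bounded_set D <-> exists B, forall z, D z -> `|z.1| <= B /\ `|z.2| <= B.
Proof.
split=> [[B [_ H]]|[B H]].
  exists (B + 1) => z Dz; have : `|z| <= B + 1 by apply: (H (B + 1)) => //; rewrite ltrDl.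
  by rewrite prod_normE ge_max => /andP[].
exists B; split; first exact: num_real.
by move=> x Bx z Dz /=; have [h1 h2] := H z Dz; rewrite prod_normE ge_max !(le_trans _ (ltW Bx)).
Qed.

(** Off the curve the winding number is locally constant, so it is nonzero on the whole component of
    P. It vanishes at points far from the curve, so the component is bounded. *)
Theorem winding_encloses g P n : closed_path g -> ~ trace_of g P -> wd g P n -> n <> 0 -> encloses (trace_of g) P.
Proof.
move=> cg nP wn n0; rewrite /encloses; set D := connected_component _ P.
have DP : D P by apply: connected_component_refl.
have Dsub z : D z -> ~ trace_of g z by move=> Dz; apply: (connected_component_sub Dz).
pose A (b : bool) := [set z | ~ trace_of g z /\ exists2 m, wd g z m & ((m : int) == 0) = b].
have Ao b : open (A b).
  rewrite openE => z [nz [m wm mb]]; have [r r0 H] := wd_local cg (off_trace nz); apply/nbhs_ballP; exists r => //= w /H[gw Hw].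
  by split; [move=> [t It E]; apply: (gw t It)|exists m => //; apply: Hw].
have DA : D `&` A false = D.
  apply: (component_connected (A := ~` trace_of g) (x := P)).
  - by exists P; split=> //; split=> //; exists n => //; apply/eqP.
  - by exists (A false).
  exists (~` A true); first by apply: open_closedC.
  apply/seteqP; split=> z [Dz]; last first.
    move=> nA; split=> //; split; first exact: Dsub.
    have [m wm] := wd_exists cg (off_trace (Dsub z Dz)); exists m => //; apply/negbTE/negP => m0.
    by apply: nA; split; [exact: Dsub|exists m].
  move=> [_ [m wm m0]]; split=> // -[_ [m' wm' m0']].
  by rewrite (wd_uniq wm wm') m0' in m0.
have [B HB] : exists B, forall z, trace_of g z -> `|z.1| <= B /\ `|z.2| <= B.
  by apply/bounded_coords; apply: compact_bounded; apply: path_compact.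
have gB t : I t -> [/\ (g t).1 <= B, - B <= (g t).1, (g t).2 <= B & - B <= (g t).2].
  by move=> It; have [] := HB (g t) (ex_intro2 _ _ t It erefl); rewrite !ler_norml => /andP[? ?] /andP[? ?].
apply/bounded_coords; exists B => z Dz; have : (D `&` A false) z by rewrite DA.
move=> [_ [_ [m wm m0]]]; suff : ~ (B < `|z.1| \/ B < `|z.2|).
  by move=> H; split; rewrite leNgt; apply/negP => h; apply: H; [left|right].
move=> far; suff w0 : wd g z 0 by rewrite (wd_uniq wm w0) eqxx in m0.
apply: wd_far => //; case: far; rewrite ltr_normr => /orP[h|h].
- by apply: Or41 => t /gB[h1 _ _ _]; lra.
- by apply: Or42 => t /gB[_ h1 _ _]; lra.
- by apply: Or43 => t /gB[_ _ h1 _]; lra.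
- by apply: Or44 => t /gB[_ _ _ h1]; lra.
Qed.

(** With more than four samples a step is shorter than a quarter turn, so the descent starts on the
    left, where [kw] is 0. Only the last step, back to (1, 0), contributes. *)
Lemma circle_wd : HOL kw (fun t => (cos (2 * pi * t), sin (2 * pi * t)) : plane) (1 : int).
Proof.
have p0 := pi_gt0 R; exists 4%N => N N4; have Npos : 0 < N%:R :> R by rewrite ltr0n; apply: leq_trans N4.
set g := (fun t : R => _); pose p := pts g N.
have up (t : R) : 0 <= t <= 1 / 2 -> 0 <= sin (2 * pi * t).
  by move=> /andP[h1 h2]; apply: sin_ge0_pi; apply/andP; split; nra.
have down (t : R) : 1 / 2 < t < 1 -> (0 <= sin (2 * pi * t)) = false.
  move=> /andP[h1 h2]; have -> : 2 * pi * t = (2 * pi * t - pi) + pi by lra.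
  rewrite sinDpi oppr_ge0; apply/negbTE; rewrite -ltNge; apply: sin_gt0_pi; apply/andP; split; nra.
have left (t : R) : 1 / 4 < t <= 1 / 2 -> (0 <= cos (2 * pi * t)) = false.
  move=> /andP[h1 h2]; have -> : 2 * pi * t = (2 * pi * t - pi) + pi by lra.
  by rewrite cosDpi oppr_ge0; apply/negbTE; rewrite -ltNge; apply: cos_gt0_pihalf; apply/andP; split; nra.
have fr m : (m <= N)%N -> 0 <= (m%:R / N%:R : R) <= 1.
  by move=> mN; rewrite divr_ge0 ?ler0n //= ler_pdivrMr // mul1r ler_nat.
have lt1 m : (m < N)%N -> m%:R / N%:R < 1 :> R by move=> mN; rewrite ltr_pdivrMr // mul1r ltr_nat.
have st m : m.+1%:R / N%:R = m%:R / N%:R + N%:R^-1 :> R by rewrite -natr1 mulrDl mul1r.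
have iN : N%:R^-1 < 1 / 4 :> R by rewrite -[1 / 4]invrK ltf_pV2 ?posrE // ?invr_gt0 ?divr_gt0 // invf_div divr1 ltr_nat.
have iN0 : 0 < N%:R^-1 :> R by rewrite invr_gt0.
have H m : (m < N)%N -> hprod kw p m = 1%g.
  elim: m => // m IH mN; rewrite /= IH 1?ltnW // mul1g /cross /above /kw /p /pts /=.
  have /andP[m0 _] := fr m (ltnW (ltnW mN)); have l1 := lt1 _ mN; have l2 := lt1 _ (ltnW mN); have := st m.
  move: m0 l1 l2; move: (m%:R / N%:R) (m.+1%:R / N%:R) => x y m0 l1 l2 yx.
  have [h1|h1] := leP y (1 / 2); first by rewrite !up //; apply/andP; split; lra.
  have [h2|h2] := leP x (1 / 2); last by rewrite !down //; apply/andP; split; lra.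
  rewrite up ?m0 // down ?h1 // left //; apply/andP; split; lra.
case: N N4 Npos @p fr lt1 st iN iN0 H => // N N4 Npos p fr lt1 st iN iN0 H.
rewrite /= H // mul1g /cross /above /kw /p /pts /g /= divff ?gt_eqF // mulr1.
have E2 : 2 * pi = pi *+ 2 :> R by rewrite mulr2n mulrDl mul1r.
rewrite down; last first.
  have L (x q : R) : 1 = x + q -> q < 1 / 4 -> 1 / 2 < x by lra.
  have e1 : N.+1%:R / N.+1%:R = 1 :> R by rewrite divff // gt_eqF.
  by rewrite lt1 // andbT; apply: L iN; rewrite -st e1.
by rewrite E2 sin2pi cos2pi lexx ler01.
Qed.

Definition nr z : R := Num.sqrt (z.1 ^+ 2 + z.2 ^+ 2).
Lemma nr_gt0 z : z <> (0, 0) -> 0 < nr z.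
Proof.
move=> z0; rewrite sqrtr_gt0 lt_neqAle addr_ge0 ?sqr_ge0 // andbT eq_sym paddr_eq0 ?sqr_ge0 // !sqrf_eq0.
by apply: contra_notN z0 => /andP[/eqP h1 /eqP h2]; case: z h1 h2 => x y /= -> ->.
Qed.
Lemma nr2 z : nr z ^+ 2 = z.1 ^+ 2 + z.2 ^+ 2. Proof. by rewrite sqr_sqrtr // addr_ge0 ?sqr_ge0. Qed.
Lemma nr_cts : continuous nr.
Proof.
move=> z; apply: (@continuous_comp _ _ _ (fun z : plane => z.1 ^+ 2 + z.2 ^+ 2) Num.sqrt); last exact: sqrt_continuous.
exact: (cvgD (cvgM (@p1c z) (@p1c z)) (cvgM (@p2c z) (@p2c z))).
Qed.
Definition unitv z : plane := (z.1 / nr z, z.2 / nr z).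
Lemma unitv1 z : z <> (0, 0) -> (unitv z).1 ^+ 2 + (unitv z).2 ^+ 2 = 1.
Proof.
move=> z0; have n0 := nr_gt0 z0; rewrite /unitv /= !expr_div_n -mulrDl -nr2 divff // expf_eq0 /= gt_eqF //.
Qed.
Lemma unitv_range z : z <> (0, 0) -> -1 <= (unitv z).1 <= 1.
Proof. by move=> /unitv1 h; apply/andP; split; nra. Qed.
Lemma unitv_cts z : z <> (0, 0) -> {for z, continuous unitv}.
Proof.
move=> z0; have n0 : nr z != 0 by rewrite gt_eqF // nr_gt0.
exact: (cvg_pair (cvgM (@p1c z) (cvgV n0 (@nr_cts z))) (cvgM (@p2c z) (cvgV n0 (@nr_cts z)))).
Qed.
Lemma acos_eps (x e : R) : -1 <= x <= 1 -> 0 < e -> exists2 d, 0 < d & forall y, -1 <= y <= 1 -> `|x - y| < d -> `|acos x - acos y| < e.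
Proof.
move=> x1 e0; have [/andP[a0 ap] ax] := acos_def x1; set a := acos x in a0 ap ax *.
have mono (u v : R) : 0 <= u <= pi -> 0 <= v <= pi -> (cos u < cos v) = (v < u).
  by move=> hu hv; apply: ltr_cos; rewrite in_itv.
have [d1 d10 H1] : exists2 d, 0 < d & forall y, -1 <= y <= 1 -> x - y < d -> acos y < a + e.
  have [h|h] := ltP pi (a + e).
    by exists 1 => // y y1 _; apply: le_lt_trans h; have [/andP[_ ->]] := acos_def y1.
  exists (x - cos (a + e)); first by rewrite subr_gt0 -ax mono; [rewrite ltrDl|apply/andP; split; lra|apply/andP; split; lra].
  move=> y y1 h'; have [/andP[b0 bp] by_] := acos_def y1.
  rewrite -mono; [rewrite by_; lra|apply/andP; split; lra|by rewrite b0 bp].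
have [d2 d20 H2] : exists2 d, 0 < d & forall y, -1 <= y <= 1 -> y - x < d -> a - e < acos y.
  have [h|h] := ltP (a - e) 0.
    by exists 1 => // y y1 _; apply: lt_le_trans h _; have [/andP[->]] := acos_def y1.
  exists (cos (a - e) - x); first by rewrite subr_gt0 -ax mono; [rewrite gtrBl|apply/andP; split; lra|apply/andP; split; lra].
  move=> y y1 h'; have [/andP[b0 bp] by_] := acos_def y1.
  rewrite -mono; [rewrite by_; lra|by rewrite b0 bp|apply/andP; split; lra].
exists (Num.min d1 d2); first by rewrite lt_min d10.
move=> y y1; rewrite lt_min !ltr_norml => /andP[/andP[_ h1] /andP[h2 _]].
by have := H1 y y1 h1; have := H2 y y1; rewrite -opprB ltrNl => /(_ h2) ? ?; apply/andP; split; lra.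
Qed.
Definition ac z := acos (unitv z).1.
(** The argument in [0, 2 pi[, whose jump is along the cut of [kw]. *)
Definition ang z := if above z then ac z else 2 * pi - ac z.
Lemma cos_sin_ang z : z <> (0, 0) -> cos (ang z) = (unitv z).1 /\ sin (ang z) = (unitv z).2.
Proof.
move=> z0; have r1 := unitv_range z0; have [/andP[a0 ap] ax] := acos_def r1.
have S : sin (ac z) = `|(unitv z).2|.
  rewrite /ac sin_acos // -sqrtr_sqr; congr Num.sqrt; have := unitv1 z0; lra.
have sg : (0 <= (unitv z).2) = above z by rewrite /= pmulr_lge0 // invr_gt0 nr_gt0.
have E2 : 2 * pi = pi *+ 2 :> R by rewrite mulr2n mulrDl mul1r.
rewrite /ang -sg; case: (leP 0 (unitv z).2) => h; first by rewrite S ger0_norm.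
have -> : 2 * pi - ac z = (pi - ac z) + pi by lra.
have -> : pi - ac z = - ac z + pi by lra.
by rewrite cosDpi sinDpi cosDpi sinDpi cosN sinN !opprK S ltr0_norm ?opprK.
Qed.
Lemma ac_eps z e : z <> (0, 0) -> 0 < e -> exists2 r, 0 < r & forall w, ball z r w -> w <> (0, 0) /\ `|ac z - ac w| < e.
Proof.
move=> z0 e0; have [d d0 Hd] := acos_eps (unitv_range z0) e0.
have /nbhs_ballP[r1 r10 H1] := unitv_cts z0 (nbhsx_ballx _ _ d0).
have /nbhs_ballP[r2 r20 H2] := nr_cts (nbhsx_ballx (nr z) _ (nr_gt0 z0)).
exists (Num.min r1 r2); first by rewrite lt_min r10.
move=> w zw; have w1 : ball z r1 w by apply: le_ball zw; rewrite ge_min lexx.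
have w2 : ball z r2 w by apply: le_ball zw; rewrite ge_min lexx orbT.
have w0 : w <> (0, 0).
  move=> E; have b : `|nr z - nr w| < nr z := H2 w w2; have nw : nr w = 0 by rewrite E /nr /= expr0n addr0 sqrtr0.
  by move: b; rewrite nw subr0 ger0_norm ?ltxx // ltW // nr_gt0.
split=> //; apply: Hd; first exact: unitv_range.
by have /ballE[] := H1 w w1.
Qed.
(** The jump of the argument at the cut is compensated by the winding cocycle; elsewhere the
    argument is continuous. *)
Lemma ang_cocycle z e : z <> (0, 0) -> 0 < e -> exists2 r, 0 < r &
  forall w, ball z r w -> `|ang w - ang z + 2 * pi * ((cross kw z w : int)%:~R)| < e.
Proof.
move=> z0 e0; have [r r0 H] := ac_eps z0 e0; have p0 := pi_gt0 R.
have flipd w : `|ac z - ac w| < e -> `|ac w - ac z| < e by rewrite distrC.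
have [y0|y0] := eqVneq z.2 0; last first.
  exists (Num.min r `|z.2|); first by rewrite lt_min r0 normr_gt0.
  move=> w zw; have [w0 aw] : w <> (0, 0) /\ `|ac z - ac w| < e by apply: H; apply: le_ball zw; rewrite ge_min lexx.
  have same : above w = above z.
    have /ballE[_] : ball z `|z.2| w by apply: le_ball zw; rewrite ge_min lexx orbT.
    rewrite /above; case: (ltgtP z.2 0) y0 => // h _.
      by rewrite (ltr0_norm h) ltr_norml => /andP[? ?]; apply/negbTE; rewrite -ltNge; lra.
    by rewrite (gtr0_norm h) ltr_norml => /andP[? ?]; lra.
  rewrite /ang /cross same; case: ifP => _; rewrite /= (_ : (1%g : wint) = 0 :> int) // mulr0 addr0; first exact: flipd.
  by rewrite (_ : _ - _ = ac z - ac w) //; lra.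
have x0 : z.1 != 0 by apply: contra_notN z0 => /eqP x0; case: z x0 y0 {H flipd} => x y /= -> ->.
have nrx : nr z = `|z.1| by rewrite /nr y0 expr0n addr0 sqrtr_sqr.
have az : above z by rewrite /above y0.
exists r => // w /H[w0 aw]; rewrite /ang /cross az; case: ifP => bw.
  by rewrite (_ : (1%g : wint) = 0 :> int) // mulr0 addr0; exact: flipd.
move: aw; rewrite /kw {1 4}/ac /unitv /= nrx; move: x0; case: (ltgtP z.1 0) => // h _.
  rewrite (ltr0_norm h) invrN mulrN divff ?lt_eqF // acosN1 => aw; rewrite mulr0 addr0.
  by rewrite (_ : _ - _ = pi - ac w) //; lra.
rewrite (gtr0_norm h) divff ?gt_eqF // acos1 => aw; rewrite (_ : (-1%:Z)%:~R = -1) //.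
by rewrite (_ : _ + _ = 0 - ac w) //; lra.
Qed.
End Winding.
End Winding.
Import Winding.

(** * A curve does not enclose a point around which it has winding number zero *)

Module TrivialWinding.
Local Open Scope classical_set_scope.
Local Open Scope ring_scope.

Section Borsuk.
Variable R : realType.
Local Notation plane := (R * R)%type.
Local Notation I := (@unit_I R).
Implicit Types z w P : plane.

Lemma trig_nat (x : R) n : cos (x + 2 * pi * n%:R) = cos x /\ sin (x + 2 * pi * n%:R) = sin x.
Proof.
elim: n => [|n [IHc IHs]]; first by rewrite mulr0 addr0.
have -> : x + 2 * pi * n.+1%:R = (x + 2 * pi * n%:R) + pi + pi by rewrite -natr1; ring.
by rewrite !cosDpi !sinDpi !opprK.
Qed.
Lemma trig_int (x : R) (k : int) : cos (x + 2 * pi * k%:~R) = cos x /\ sin (x + 2 * pi * k%:~R) = sin x.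
Proof.
case: k => n; first exact: trig_nat.
have [c s] := trig_nat (x + 2 * pi * (Negz n)%:~R) n.+1; move: c s.
have -> : x + 2 * pi * (Negz n)%:~R + 2 * pi * n.+1%:R = x by rewrite NegzE mulrNz -pmulrn; ring.
by move=> -> ->.
Qed.

Lemma segment_component (A : set plane) z r w : (forall v, ball z r v -> A v) -> ball z r w -> connected_component A z w.
Proof.
move=> BA zw; pose F (s : R) : plane := (z.1 + s * (w.1 - z.1), z.2 + s * (w.2 - z.2)).
have cF : continuous F.
  have ci : continuous (fun s : R => s) by move=> s; exact: cvg_id.
  move=> s; exact: (cvg_pair (cvgD (cvg_cst z.1) (cvgM (ci s) (cvg_cst (w.1 - z.1)))) (cvgD (cvg_cst z.2) (cvgM (ci s) (cvg_cst (w.2 - z.2))))).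
have I0 : I 0 by apply/unit_itv; rewrite lexx ler01.
have I1 : I 1 by apply/unit_itv; rewrite lexx ler01.
apply: (@connected_component_max _ _ (F @` I)); last by exists 1 => //; rewrite /F !mul1r ![_ + (_ - _)]addrC !subrK -surjective_pairing.
- by exists 0 => //; rewrite /F !mul0r !addr0 -surjective_pairing.
- move=> v [s /unit_itv/andP[s0 s1] <-]; apply: BA.
  have B (a b : R) : `|a - b| < r -> `|a - (a + s * (b - a))| < r.
    rewrite opprD addrA subrr add0r normrN normrM distrC => h; apply: le_lt_trans h.
    by rewrite ger0_norm // ler_piMl.
  by move: zw => /ballE[b1 b2]; apply/ballE; split; apply: B.
by apply: connected_continuous_connected; [exact: segment_connected|apply: continuous_subspaceT].
Qed.

Lemma sqrt_circle (B c s : R) : 0 < B -> c ^+ 2 + s ^+ 2 = 1 -> Num.sqrt ((B * c) ^+ 2 + (B * s) ^+ 2) = B.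
Proof. by move=> B0 cs1; rewrite !exprMn -mulrDr cs1 mulr1 sqrtr_sqr gtr0_norm. Qed.
Lemma shift_inj P z w : shift P z = shift P w -> z = w.
Proof. by case: P z w => a b [x y] [x' y'] [/addIr -> /addIr ->]. Qed.

(** The potential corrects the argument into a continuous angle along the curve. If the component D
    of P were bounded, the direction given by the extended angle on D and the direction from P
    outside D would glue to a map of the plane avoiding the origin. A large circle around P is
    contractible in the plane, yet its image winds once. *)
Theorem trivial_winding (g : R -> plane) P : closed_path g -> set_inj `[0, 1[ g -> ~ trace_of g P -> wd g P 0 ->
  ~ encloses (trace_of g) P.
Proof.
move=> cg inj nP w0; rewrite /encloses; set C := trace_of g; set D := connected_component _ P => bD.
have lg := gloop_shift cg (off_trace nP).
have inj' : set_inj `[0, 1[ (shift P \o g) by move=> x y hx hy /= E; apply: inj => //; apply: shift_inj E.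
have [p [r [r0 Hp]]] := potential (@kw_const R) (@bad0l R) lg inj' w0.
have Hc s t : I s -> I t -> ball (g s) r (g t) -> (cross (@kw R) (shift P (g s)) (shift P (g t)) : int) = (p (shift P (g t)) : int) - p (shift P (g s)).
  move=> Is It /shift_ball b; have [x x0 ->] := Hp s t Is It (b P).
  have -> : x = 1%g by case: x0 => ->.
  by rewrite mulg1 wmulE winvE addrC.
have gP t : I t -> shift P (g t) <> (0, 0) by move=> It /shift0; exact: (off_trace nP It).
pose th z : R := ang (shift P z) + 2 * pi * ((p (shift P z) : int)%:~R).
have cth : pcont C th.
  move=> z [s Is <-] e e0; have [r1 r10 H1] := ang_cocycle (gP s Is) e0.
  exists (Num.min r r1); first by rewrite lt_min r0.
  move=> w [t It <-] b; have b1 : ball (g s) r (g t) by apply: le_ball b; rewrite ge_min lexx.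
  have /shift_ball b2 : ball (g s) r1 (g t) by apply: le_ball b; rewrite ge_min lexx orbT.
  have := H1 _ (b2 P); rewrite Hc // intrB => b3; rewrite /ball /= distrC.
  rewrite (_ : th (g t) - th (g s) = ang (shift P (g t)) - ang (shift P (g s)) + 2 * pi * ((p (shift P (g t)) : int)%:~R - (p (shift P (g s)) : int)%:~R)) //.
  by rewrite /th; ring.
have /pcontP wth := cth.
have [M1 [_ HM1]] : bounded_set (th @` C : set R) by apply: compact_bounded; apply: continuous_compact => //; apply: path_compact.
have M0 : 0 < `|M1| + 1 by rewrite ltr_wpDl.
have bth z : C z -> `|th z| <= `|M1| + 1.
  by move=> Cz; apply: (HM1 (`|M1| + 1)); [rewrite (le_lt_trans (ler_norm _)) // ltrDl|exists z].
have [Th [ThE cTh _]] := continuous_bounded_extension (@pseudometric_normal R plane) (trace_closed cg) M0 (wth : {within C, continuous (th : plane -> R^o)}) bth.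
pose F1 z : plane := (cos (Th z : R), sin (Th z : R)); pose F2 z := unitv (shift P z).
have n1 z e : 0 < e -> exists2 d, 0 < d & forall w, ball z d w -> ball (F1 z) e (F1 w).
  move=> e0; have cF1 : continuous F1.
    have c1 : continuous (fun w => cos (Th w : R)) by move=> w; apply: (@continuous_comp _ _ _ (Th : plane -> R) cos); [exact: cTh|exact: continuous_cos].
    have c2 : continuous (fun w => sin (Th w : R)) by move=> w; apply: (@continuous_comp _ _ _ (Th : plane -> R) sin); [exact: cTh|exact: continuous_sin].
    by move=> w; exact: (cvg_pair (c1 w) (c2 w)).
  by have /nbhs_ballP[d d0 Hd] := cF1 z _ (nbhsx_ballx (F1 z) _ e0); exists d.
have n2 z e : z <> P -> 0 < e -> exists2 d, 0 < d & forall w, ball z d w -> ball (F2 z) e (F2 w).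
  move=> zP e0; have nz : shift P z <> (0, 0) by move=> /shift0.
  have /nbhs_ballP[d d0 Hd] := unitv_cts nz (nbhsx_ballx _ _ e0); exists d => // w zw.
  by apply: Hd; apply/shift_ball.
have agree z : C z -> F1 z = F2 z.
  move=> [s Is E]; rewrite /F1 -(ThE z) ?inE; last by exists s.
  rewrite /th; have [-> ->] := trig_int (ang (shift P z)) (p (shift P z)).
  have nz : shift P z <> (0, 0) by rewrite -E; apply: gP.
  by have [-> ->] := cos_sin_ang nz; rewrite /F2 -surjective_pairing.
pose F z := if `[< D z >] then F1 z else F2 z.
have DP : D P by apply: connected_component_refl.
have off z : ~ C z -> exists2 d, 0 < d & forall w, ball z d w -> ~ C w.
  move=> nz; have [d d0 Hd] := off_path cg (off_trace nz); exists d => // w zw [t It E].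
  by apply: (Hd t It); rewrite E.
have same z d w : (forall w, ball z d w -> ~ C w) -> ball z d w -> D z <-> D w.
  move=> nC zw; have cc := segment_component nC zw; split=> h; first exact: connected_component_trans h cc.
  by apply: connected_component_trans h _; apply: connected_component_sym.
have cF z e : 0 < e -> exists2 d, 0 < d & forall w, ball z d w -> ball (F z) e (F w).
  move=> e0; have [Cz|/off[d d0 Hd]] := pselect (C z).
    have zP : z <> P by move=> E; apply: nP; rewrite -E.
    have [d1 d10 H1] := n1 z e e0; have [d2 d20 H2] := n2 z e zP e0.
    exists (Num.min d1 d2); first by rewrite lt_min d10.
    have FE : F z = F1 z by rewrite /F; case: ifP => // _; rewrite agree.
    move=> w zw; rewrite {2}/F; case: ifP => _.
      by rewrite FE; apply: H1; apply: le_ball zw; rewrite ge_min lexx.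
    by rewrite FE agree //; apply: H2; apply: le_ball zw; rewrite ge_min lexx orbT.
  have [Dz|nDz] := pselect (D z).
    have [d1 d10 H1] := n1 z e e0; exists (Num.min d d1); first by rewrite lt_min d0.
    move=> w zw; have zd : ball z d w by apply: le_ball zw; rewrite ge_min lexx.
    have Dw : D w by apply/(same z d w).
    by rewrite /F !asboolT //; apply: H1; apply: le_ball zw; rewrite ge_min lexx orbT.
  have zP : z <> P by move=> E; apply: nDz; rewrite E.
  have [d2 d20 H2] := n2 z e zP e0; exists (Num.min d d2); first by rewrite lt_min d0.
  move=> w zw; have zd : ball z d w by apply: le_ball zw; rewrite ge_min lexx.
  have nDw : ~ D w by move=> Dw; apply: nDz; apply/(same z d w).
  by rewrite /F !asboolF //; apply: H2; apply: le_ball zw; rewrite ge_min lexx orbT.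
have F0 z : avoids (@bad0 R) (F z).
  apply: avoid0; rewrite /F; case: asboolP => Dz.
    by move=> [c0 s0]; have := cos2Dsin2 (Th z : R); rewrite c0 s0 expr0n addr0 => /eqP; rewrite eq_sym oner_eq0.
  have nz : shift P z <> (0, 0) by move=> /shift0 E; apply: Dz; rewrite E.
  by move=> E; have := unitv1 nz; rewrite -/(F2 z) E /= expr0n addr0 => /eqP; rewrite eq_sym oner_eq0.
have [B0 HB] := (bounded_coords D).1 bD.
(* Every point of the circle of radius B around P has a coordinate differing from that of P by more
   than B / 2, hence lies outside the bounds of D. *)
pose B := 2 * (`|B0| + `|P.1| + `|P.2| + 1).
have B_gt0 : 0 < B.
  by have := normr_ge0 B0; have := normr_ge0 P.1; have := normr_ge0 P.2; rewrite /B; lra.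
pose cp (st : R * R) : plane := (P.1 + st.1 * (B * cos (2 * pi * st.2)), P.2 + st.1 * (B * sin (2 * pi * st.2))).
have ccp : continuous cp.
  have c1 : continuous (fun st : R * R => st.1) by move=> st; exact: cvg_fst.
  have c2 : continuous (fun st : R * R => 2 * pi * st.2) by move=> st; apply: cvgM; [exact: cvg_cst|exact: cvg_snd].
  have cc : continuous (fun st : R * R => cos (2 * pi * st.2)).
    by move=> st; apply: (@continuous_comp _ _ _ (fun st : R * R => 2 * pi * st.2) cos); [exact: c2|exact: continuous_cos].
  have cs : continuous (fun st : R * R => sin (2 * pi * st.2)).
    by move=> st; apply: (@continuous_comp _ _ _ (fun st : R * R => 2 * pi * st.2) sin); [exact: c2|exact: continuous_sin].
  move=> st; exact: (cvg_pair (cvgD (cvg_cst P.1) (cvgM (c1 st) (cvgM (cvg_cst B) (cc st))))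
    (cvgD (cvg_cst P.2) (cvgM (c1 st) (cvgM (cvg_cst B) (cs st))))).
have E2 : 2 * pi = pi *+ 2 :> R by rewrite mulr2n mulrDl mul1r.
have [u E] : exists u, (1%:Z : wint) = (u * 1 * u^-1)%g; last by rewrite wconj in E.
apply: (@free_homotopy R wint (@kw R) (@bad0 R) [:: 0] (@kw_const R) (@bad0l R) (fun s t => F (cp (s, t)))).
- apply: (@pcont_comp _ _ _ _ _ setT cp F) => //; first exact: cts_pcont.
  by move=> z _ e e0; have [d d0 Hd] := cF z e e0; exists d => // w _; apply: Hd.
- by move=> s t _ _; apply: F0.
- by move=> s _; congr F; rewrite /cp /= mulr0 mulr1 cos0 sin0 E2 cos2pi sin2pi.
- apply: (@HOL_ext _ _ _ (fun=> F P)) => [t _|]; first by congr F; rewrite /cp /= !mul0r !addr0 -surjective_pairing.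
  by exists 0%N => N _; elim: {2}N => //= n ->; rewrite cross_id mulg1.
apply: HOL_ext (@circle_wd R) => t _; have := cos2Dsin2 (2 * pi * t).
move=> cs1; have nD : ~ D (cp (1, t)).
  move=> /HB[]; rewrite /cp /= !mul1r; move: (cos _) (sin _) cs1 => c s cs1; rewrite !ler_norml => /andP[h1 h2] /andP[h3 h4].
  have := ler_norm B0; have := ler_norm P.1; have := ler_norm P.2; have := ler_norm (- P.1); have := ler_norm (- P.2).
  rewrite !normrN => k1 k2 k3 k4 k5.
  have hc : `|B * c| <= B / 2 by rewrite ler_norml; apply/andP; split; rewrite /B in h1 h2 h3 h4 *; lra.
  have hs : `|B * s| <= B / 2 by rewrite ler_norml; apply/andP; split; rewrite /B in h1 h2 h3 h4 *; lra.
  have sq (x : R) : `|x| <= B / 2 -> x ^+ 2 <= (B / 2) ^+ 2 by move=> h; rewrite -real_normK ?num_real // lerXn2r ?nnegrE ?divr_ge0 // ltW.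
  have := sq _ hc; have := sq _ hs; have B2 : 0 < B ^+ 2 by rewrite exprn_gt0.
  have : B ^+ 2 = (B * c) ^+ 2 + (B * s) ^+ 2 by rewrite !exprMn -mulrDr cs1 mulr1.
  have -> : (B / 2) ^+ 2 = B ^+ 2 / 4 by rewrite expr_div_n; congr (_ / _); rewrite -natrX.
  lra.
rewrite /F asboolF // /F2; move: cs1; rewrite /unitv /shift /cp /nr /= !mul1r.
move: (cos _) (sin _) => c s cs1; have e1 (x y : R) : x + y - x = y by rewrite addrAC subrr add0r.
have e2 : Num.sqrt ((B * c) ^+ 2 + (B * s) ^+ 2) = B by apply: sqrt_circle.
rewrite !e1 e2.
by congr pair; rewrite mulrAC divff ?mul1r // gt_eqF.
Qed.
End Borsuk.
End TrivialWinding.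
Import TrivialWinding.

(** * Reduction curves *)

Module ReductionCurve.
Local Open Scope classical_set_scope.
Local Open Scope ring_scope.
Local Open Scope quotient_scope.

Section Exponents.
(** The exponent sum of the letter i. *)
Definition expo (i : nat) : fg -> wint := fgext (fun j => ((j == i)%:Z : wint)).
Lemma expoM i : {morph expo i : x y / (x * y)%g}. Proof. exact: fgextM. Qed.
Lemma expoV i : {morph expo i : x / (x^-1)%g}. Proof. exact: (morph_mulV (@expoM i)). Qed.
Lemma expo1 i : expo i 1%g = 0. Proof. exact: (morph_mul1 (@expoM i)). Qed.
Lemma expoJ i u x : expo i (u * x * u^-1)%g = expo i x.
Proof. by rewrite !expoM expoV wconj. Qed.
Lemma expo_cprod i (S : seq (fg * nat)) : uniq (map snd S) -> expo i (cprod S) = ((i \in map snd S)%:Z : wint).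
Proof.
elim: S => [|[u j] S IH] /=; first by rewrite expo1.
move=> /andP[jS uS]; rewrite expoM IH // /cval expoJ /expo fgextX inE eq_sym; case: eqVneq => [->|_] //=.
by rewrite (negPf jS).
Qed.
Lemma hact_fixed (G : groupType) w (y : nat -> G) j : all (fun l => l.1.+1 < 4)%N w -> (4 <= j)%N -> hact w y j = y j.
Proof.
move=> + j4; elim: w => //= -[i e] w IH /andP[/= i4 aw]; rewrite -[RHS]IH // /mv /=.
have [n1 n2] : j != i /\ j != i.+1 by split; move: i4 j4; clear; lia.
by rewrite ?[i == j]eq_sym ?[i.+1 == j]eq_sym ?(negPf n1) ?(negPf n2); case: e => /=; rewrite ?(negPf n1) ?(negPf n2).
Qed.
Lemma hact_eq_below (G : groupType) w (y y' : nat -> G) : all (fun l => l.1.+1 < 4)%N w -> (forall j, (j < 4)%N -> y j = y' j) ->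
  forall j, (j < 4)%N -> hact w y j = hact w y' j.
Proof.
move=> + E; elim: w => //= -[i e] w IH /andP[/= i4 aw] j j4; have H := IH aw.
by rewrite /mv /= !H // ltnW.
Qed.
Lemma expo_phi i (b : braid 4) g : (i < 4)%N -> (forall j, (j < 4)%N -> pb b j = j) -> expo i (phi b g) = expo i g.
Proof.
move=> i4 pure; rewrite /phi (fgext_comp _ (@expoM i)); apply: eq_fgext => j /=.
have [j4|j4] := ltnP j 4.
  by have [h ->] := bact_gen_conj pure j4; rewrite /cval expoJ /expo fgextX.
rewrite /bact hact_fixed //; last by rewrite all_map; apply/allP => l _ /=; rewrite ltnS ltn_ord.
by rewrite /expo fgextX.
Qed.
End Exponents.

Section PowerConj.
Variable G : groupType.
Definition power_conj (x y : G) := exists g d, x = (g * y ^+ d * g^-1)%g \/ x = (g * y ^- d * g^-1)%g.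
Lemma power_conjJ u x y : power_conj x y -> power_conj (u * x * u^-1)%g y.
Proof. by case=> g [d [->|->]]; exists (u * g)%g, d; [left|right]; rewrite invgM !mulgA. Qed.
Lemma power_conjV x y : power_conj x y -> power_conj (x^-1)%g y.
Proof. by case=> g [d [->|->]]; exists g, d; [right|left]; rewrite !invgM ?invgK !mulgA. Qed.
Lemma power_conjJr u x y : power_conj x (u * y * u^-1)%g -> power_conj x y.
Proof.
have X d : ((u * y * u^-1) ^+ d = u * y ^+ d * u^-1)%g.
  by elim: d => [|d IH]; rewrite ?mulg1 ?mulgV // !expgS IH; grp; reflexivity.
by case=> g [d [->|->]]; exists (g * u)%g, d; [left|right]; rewrite X !invgM ?invgK !mulgA.
Qed.
Lemma power_conjVr x y : power_conj x (y^-1)%g -> power_conj x y.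
Proof.
have X d : ((y^-1) ^+ d = y ^- d)%g.
  by elim: d => [|d IH]; rewrite ?expg0 ?invg1 // expgS expgSr invgM IH.
by case=> g [d [->|->]]; exists g, d; [right|left]; rewrite X ?invgK.
Qed.
End PowerConj.

Section Reduction.
Variable R : realType.
Local Notation plane := (R * R)%type.
Local Notation I := (@unit_I R).
Local Notation puncture := (@puncture R 4).

Lemma lx_mono (x : R) i : (i < 4)%N -> (i < lx x)%N = ((i.+1)%:R <= x).
Proof.
rewrite /lx; case: (leP 1 x) => h1; case: (leP 2 x) => h2; case: (leP 3 x) => h3; case: (leP 4 x) => h4; try (exfalso; lra);
  case: i => [|[|[|[|//]]]] _ /=; apply/esym; apply/idP; rewrite ?h1 ?h2 ?h3 ?h4 // leNgt; apply/negP/negPn; rewrite ?h1 ?h2 ?h3 ?h4 //.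
Qed.
Lemma expo_kx i (x : R) : (i < 4)%N -> expo i (kx x) = kw (x - (i.+1)%:R).
Proof.
move=> i4; rewrite /kx /K expoV /kw subr_ge0 -lx_mono //; have := @lx4 R x; move: (lx x) => k k4.
case: k k4 => [|[|[|[|[|//]]]]] _; case: i i4 => [|[|[|[|//]]]] _;
  rewrite /genprod /= ?expoM ?expo1 /expo ?fgextX //.
Qed.
(** The exponent sum of the letter i turns [kx] into the step function of the winding number around
    the corresponding puncture. *)
Lemma expo_winding (g : R -> plane) h (i : 'I_4) : HOL (@kx R) g h -> wd g (puncture i) (expo i h).
Proof.
move=> /(HOL_morph (@expoM i))[N0 H]; exists N0 => N HN; rewrite -(H N HN).
have L n : hprod (@kw R) (pts (shift (puncture i) \o g) N) n = hprod (expo i \o @kx R) (pts g N) n.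
  by elim: n => //= n ->; congr (_ * _)%g; rewrite /cross /above /= !subr0 !expo_kx.
exact: L.
Qed.

Lemma lam_high M s i : (4 <= i)%N -> lam (loc M) i s = false.
Proof.
move=> i4; have L k : (loc M k <= i)%N.
  by apply: leq_trans i4; rewrite /loc /lcol; do 4!case: (_ <= _)%R.
by elim: s => //= c s ->; rewrite !L.
Qed.
(** The holonomy or its inverse is a product of conjugates of distinct letters, so each exponent sum
    is 0, 1 or -1, and it is nonzero exactly for the enclosed punctures. *)
Lemma lam_expo M s i : valid s -> lam (loc M) i s = (expo i (hol (loc M) s) != 0).
Proof.
move=> vs; have [S [H [uS SE]]] := loop_form (@loc_mono M) vs; rewrite -SE.
by case: H => ->; rewrite ?expoV expo_cprod //; case: (_ \in _).
Qed.

Record curve (C : set plane) (g : R -> plane) (h : fg) : Prop := Curve {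
  curve_disk : C `<=` punctured_disk 4; curve_path : pcont I g; curve_closed : g 0 = g 1; curve_inj : set_inj `[0, 1[ g;
  curve_image : C = g @` I; curve_essential : essential 4 C; curve_HOL : HOL (@kx R) g h }.
Section Curve.
Variables (C : set plane) (g : R -> plane) (h : fg).
Hypothesis Cgh : curve C g h.
Let CD := curve_disk Cgh.
Let cg := curve_path Cgh.
Let eg := curve_closed Cgh.
Let inj := curve_inj Cgh.
Let CE := curve_image Cgh.
Let ess := curve_essential Cgh.
Let hg := curve_HOL Cgh.

Lemma gD t : I t -> punctured_disk 4 (g t).
Proof. by move=> It; apply: CD; rewrite CE; exists t. Qed.
Lemma g_loop : gloop (@badx R) g.
Proof. by split; [exact: cg|exact: eg|move=> t It; apply: disk_avoids; apply: gD]. Qed.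
Lemma enclosed_expo (i : 'I_4) : `[< encloses C (puncture i) >] = (expo i h != 0).
Proof.
have cp : closed_path g by split; [exact: cg|exact: eg].
have nP : ~ trace_of g (puncture i).
  move=> [t It E]; have [_] := gD It; apply; rewrite E; exists i => //.
have wE := expo_winding i hg; rewrite (_ : C = trace_of g); last exact: CE.
apply/asboolP/idP => [|/eqP n0]; last exact: winding_encloses wE n0.
by apply: contraPN => /eqP w0; apply: trivial_winding; rewrite // -w0.
Qed.
Lemma card_expo : (1 < #|[set i : 'I_4 | expo i h != 0]%SET| < 4)%N.
Proof.
move: ess; rewrite /essential; congr (1 < _ < 4)%N; apply: eq_card => i; rewrite !inE; exact: enclosed_expo.
Qed.

Lemma exists_expo : exists i : 'I_4, expo i h != 0.
Proof.
have /card_gt0P[i] : (0 < #|[set i : 'I_4 | expo i h != 0]%SET|)%N by apply: leq_trans (ltnW (proj1 (andP card_expo))).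
by rewrite inE; exists i.
Qed.

(** Hurwitz transitivity needs a factorisation of the product of all four letters. The conjugates
    obtained from the curve are therefore completed by those of [positive_complement]. They come
    first, so they correspond to an initial block of standard letters, of size 2 or 3 because the
    curve is essential. *)
Lemma standard_loop : exists (v : braid 4) (u : fg) (k : nat), (k = 2%N \/ k = 3%N) /\
  let c := phi v (genprod (iota 0 k)) in h = (u * c * u^-1)%g \/ h = (u * c^-1 * u^-1)%g.
Proof.
have card := card_expo; have h1 : h <> 1%g.
  by move=> E; have [i] := exists_expo; rewrite E expo1.
have [M0 H] := lattice_curve g_loop inj hg; case: (H M0.+1 (ltnSn _)) => [//|[s [vs [u [uv tr _ E]]]]].
move: E; set l := loc _ => E; have vls := traces_perm uv tr.
have [s' [ps' E']] : exists s', positive s' /\ (hol l s = hol l s' \/ hol l s = (hol l s')^-1)%g.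
  by case: (positive_or vls) => p; [exists s; split; [|left]|exists (rs s); split; [|right; rewrite hol_rs invgK]].
have ne : s' != [::].
  by apply: contra_notN h1 => /eqP s0; move: E'; rewrite s0 E /= invg1 => -[->|->]; rewrite mulg1 mulgV.
have [u' [S [S' [hS cS pS lS]]]] := positive_complement (@loc_mono M0.+1) ps' ne (loc_top (ltn0Sn M0)).
have uSS : uniq (map snd (S ++ S')) by rewrite (perm_uniq pS) iota_uniq.
have uS : uniq (map snd S) by move: uSS; rewrite map_cat cat_uniq => /and3P[].
have [v0 hv] : exists v0, h = (v0 * cprod S * v0^-1)%g \/ h = (v0 * (cprod S)^-1 * v0^-1)%g.
  have hS' : hol l s' = (u' * (cprod S)^-1 * u'^-1)%g by rewrite -[LHS]invgK hS !invgM invgK mulgA.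
  exists (u * u')%g; rewrite E; case: E' => ->; [right|left]; rewrite ?hS ?hS' !invgM !mulgA //.
have eS (i : nat) : (expo i h != 0) = (i \in map snd S).
  by case: hv => ->; rewrite expoJ ?expoV expo_cprod //; case: (_ \in _).
have sz4 : size (S ++ S') = 4 by rewrite -(size_map snd) (perm_size pS) size_iota.
have ksz : size S = #|[set i : 'I_4 | expo i h != 0]%SET|.
  have lt4 i : i \in map snd S -> (i < 4)%N.
    by move=> iS; have := perm_mem pS i; rewrite map_cat mem_cat iS orTb mem_iota add0n => /esym.
  rewrite cardE -(size_map snd S) -(size_map val (enum _)).
  apply/perm_size/uniq_perm => //; first by rewrite map_inj_uniq ?enum_uniq //; exact: val_inj.
  move=> i; apply/idP/mapP => [iS|[j + ->]]; last by rewrite mem_enum inE eS.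
  by exists (Ordinal (lt4 i iS)) => //; rewrite mem_enum inE eS.
have [w aw wE] := hurwitz_transitive (s := S ++ S') (c := iota 0 4) sz4 cS.
pose v : braid 4 := bw 2 (winv w).
have aw' : all (fun l => l.1 < 3)%N w by apply: sub_all aw => -[a b] /=; rewrite sz4.
have vE j : (j < 4)%N -> phi v (gen j) = nth 1%g (map cval (S ++ S')) j.
  move=> j4; rewrite /phi fgextX /v bact_bw; last exact: (@all_winv (fun i => i < 3)%N).
  rewrite -[RHS](hact_winv w) -[RHS](eq_hact _ (fun k => esym (wE k))).
  apply: hact_eq_below => //; first exact: (@all_winv (fun i => i.+1 < 4)%N).
  by case=> [|[|[|[|//]]]].
exists v, v0, (size S); split.
  by move: card; rewrite -ksz; case: (size S) => [|[|[|[|]]]] //; [left|right].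
have -> : phi v (genprod (iota 0 (size S))) = cprod S; last exact: hv.
have sS : (size S <= 4)%N by have := leq_addr (size S') (size S); rewrite -size_cat sz4.
have P (m k : nat) : (m + k = size S)%N -> phi v (genprod (iota m k)) = cprod (drop m S).
  elim: k m => [|k IH] m mk; first by rewrite /= (morph_mul1 (@phiM _ v)) drop_oversize // -mk addn0.
  have mS : (m < size S)%N by rewrite -mk addnS ltnS leq_addr.
  rewrite /= phiM IH ?addSnnS // (drop_nth (1%g, 0%N) mS) /= vE ?(leq_trans mS) //.
  by rewrite map_cat nth_cat size_map mS (nth_map (1%g, 0%N)).
by rewrite P // drop0.
Qed.
End Curve.

Lemma reducible_kernel p (b : braid 4) : (1 < p)%N -> burau4_mod p b = 1%:M -> reducible_braid R b -> b = 1%g.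
Proof.
move=> p1 rb [f [L [rep [C LC] HL dis fL]]]; have pure := rho_pure p1 rb.
have [CD [g [/pcontP cg eg inj CE]] ess] := HL C LC.
have lg : gloop (@badx R) g.
  by split=> // t It; apply: disk_avoids; apply: CD; rewrite CE; exists t.
have [h hg] := gloop_HOL (@kx_const R) (@badlP R) lg.
have K := Curve CD cg eg inj CE ess hg; have gPD := gD K.
have [lf [h' hf [u Eu]]] := represents_HOL rep cg eg gPD hg.
have [v [w [k [k23 hc]]]] := standard_loop K.
suff pc : power_conj h' h.
  have pb1 : power_conj (phi b h) h.
    by have := power_conjJ (u^-1)%g pc; rewrite Eu invgK !mulgA mulVg mul1g mulgVK.
  have pb2 : power_conj (phi b (phi v (genprod (iota 0 k)))) (phi v (genprod (iota 0 k))).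
    move: pb1 hc; rewrite /=; set c := phi v _ => pb1 [] E; rewrite E !phiM !(morph_mulV (@phiM _ b)) in pb1.
      have := power_conjJ (phi b w)^-1%g (power_conjJr pb1).
      by rewrite invgK !mulgA mulVg mul1g mulgVK.
    have := power_conjV (power_conjJ (phi b w)^-1%g (power_conjVr (power_conjJr pb1))).
    by rewrite invgK !mulgA mulVg mul1g mulgVK invgK.
  by have [g' [d H]] := pb2; apply: (reduction_kernel p1 k23 rb H).
have fC : L (f @` C) by rewrite -fL; exists C.
(* If the curve is mapped to itself, its image loop only covers it, and a power of the class is all
   that can be concluded. Otherwise the image is disjoint from the curve, since both belong to the
   reduction system. *)
have [E|ne] := pselect (f @` C = C).
  have [||v' [x [[d Hx] ->]]] := covering_loop (@kx_const R) (@badlP R) lg inj hg (f := f \o g) (h := h') lf.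
  - move=> t It; have : C (f (g t)) by rewrite -E; exists (g t) => //; rewrite CE; exists t.
    by rewrite CE => -[s Is Es]; exists s.
  - exact: hf.
  by exists v', d; case: Hx => ->; [left|right].
have dj := dis _ _ fC LC ne.
have h1 : h <> 1%g.
  by move=> E; have [i] := exists_expo K; rewrite E expo1.
have h1' : h' <> 1%g.
  move=> E; apply: h1; rewrite -(phi1 4 h) -(mulgV b) phi_mul (_ : phi b h = 1%g) ?(morph_mul1 (@phiM _ _)) //.
  by apply: (mulgI u); apply: (mulIg u^-1%g); rewrite -Eu E mulg1 mulgV.
have finj : set_inj `[0, 1[ (f \o g).
  move=> x y hx hy /= E; apply: inj => //; case: rep => [[_ _ [f' [_ _ _ ff' _]]] _].
  have I' z : z \in `[0, 1[%classic -> I z by rewrite inE /= in_itv /= => /andP[z0 /ltW z1]; apply/unit_itv; rewrite z0.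
  by rewrite -(ff' (g x)) ?inE ?E ?ff' ?inE //; apply: gPD; apply: I'.
have [|M [s1 [s2 [u1 [u2 [M0 [js v1 v2 E1 E2]]]]]]] := disjoint_curves lg inj hg h1 lf finj hf h1'.
  move=> s t Is It E; have : (f @` C `&` C) (g s) by split; [exists (g t); rewrite ?CE; [exists t|]|rewrite CE; exists s].
  by rewrite dj.
(* A pure braid preserves the exponent sums, so the curve and its image enclose the same
   punctures. *)
have lam12 i : lam (loc M) i s1 = lam (loc M) i s2.
  have [i4|i4] := ltnP i 4; last by rewrite !lam_high.
  rewrite !lam_expo // -(expoJ i u1) -E1 -(expoJ i u2 (hol (loc M) s2)) -E2 Eu expoJ expo_phi //.
have [i0 Hi0] := exists_expo K.
have [|g' H] := parallel_loops (@loc_mono M) js lam12 (i0 := i0).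
  by rewrite lam_expo // -(expoJ i0 u1) -E1.
have e1 : hol (loc M) s1 = (u1^-1 * h * u1)%g by rewrite E1; grp.
rewrite E2; apply: power_conjJ; case: H => ->; apply: power_conjJ.
  by exists (u1^-1)%g, 1%N; left; rewrite expg1 invgK.
by apply: power_conjV; exists (u1^-1)%g, 1%N; left; rewrite expg1 invgK.
Qed.
End Reduction.
End ReductionCurve.
Import ReductionCurve.

Theorem theorem1 (R : realType) (p : nat) (hp : (1 < p)%N) :
  (forall b : braid 4, burau4_mod_ker p b ->
     periodic_braid b \/ reducible_braid R b -> b = 1%g) /\
  (~ injective (burau4_mod p) ->
     normal_subgroup (burau4_mod_ker p) /\
     all_pseudo_Anosov R (burau4_mod_ker p)).
Proof.
have main (b : braid 4) : burau4_mod_ker p b -> periodic_braid b \/ reducible_braid R b -> b = 1%g.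
  by move=> kb []; [exact: (periodic_kernel hp kb)|exact: (reducible_kernel hp kb)].
have k1 : burau4_mod p 1%g = (1%:M)%R by exact: burau4_mod_pi.
have kV (x : braid 4) : burau4_mod_ker p x -> burau4_mod_ker p x^-1%g.
  rewrite /burau4_mod_ker /= => kx; have := burau4_modM p x x^-1%g; by rewrite mulgV k1 kx mul1mx => <-.
split=> // _; split; last by move=> b kb b1; split=> H; apply: b1; apply: main => //; [left|right].
split=> [//|x y kx ky|x y kx]; rewrite /burau4_mod_ker /=.
  by rewrite burau4_modM kx (kV y ky) mul1mx.
by rewrite conjgE !burau4_modM kx mul1mx -burau4_modM mulVg.
Qed.
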